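(* Let $r$ be a classical dynamical $r$-matrix with spectral parameter, with associated operator $R$. Let $L:T^*\mathfrak h^*\times\mathfrak g^*\to L\mathfrak g$, $L(q,p,\xi)=p+r_-^{\#}(q)\xi$; $\tau(q,p,\xi)=(q,-i^*\xi)\in T\mathfrak h^*$; $m(q,p,\xi)=q$. (1) For all smooth functions $f,g$ on $L\mathfrak g$ and all $x=(q,p,\xi)\in T^*\mathfrak h^*\times\mathfrak g^*$, $$\{L^*f,L^*g\}(x)=\big\langle L(x),\,-ad^*_{R_{m(x)}(df(L(x)))}dg(L(x))+ad^*_{R_{m(x)}(dg(L(x)))}df(L(x))\big\rangle+\big\langle(\mathcal X_{\tau(x)}R)(df(L(x))),\,dg(L(x))\big\rangle .$$ (2) If $\mathcal H=L^*f$ with $f\in I(L\mathfrak g)$, then under the flow $\phi_t$ generated by the Hamiltonian $\mathcal H$, $$\frac{dL(\phi_t)}{dt}=[R_{m(\phi_t)}(df(L(\phi_t))),\,L(\phi_t)]-(\mathcal X_{\tau(\phi_t)}R)(df(L(\phi_t))).$$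
   Context: $\mathfrak g$ is a (finite-dimensional) complex Lie algebra with a nondegenerate ad-invariant symmetric bilinear form $(\cdot,\cdot)$; $\mathfrak h\subset\mathfrak g$ is an abelian Lie subalgebra on which the form is nondegenerate; $i:\mathfrak h\to\mathfrak g$ is the inclusion and $i^*:\mathfrak g^*\to\mathfrak h^*$ its dual. Convention: $\langle ad_X^*\xi,Y\rangle=\langle\xi,[X,Y]\rangle$. A classical dynamical $r$-matrix with spectral parameter is a meromorphic map $r:\mathfrak h^*\times\mathbb C\to\mathfrak g\otimes\mathfrak g$ with a simple pole at $z=0$ such that (away from poles): (i) $[h\otimes1+1\otimes h,r(q,z)]=0$ for $h\in\mathfrak h$; (ii) $r^{12}(q,z)+r^{21}(q,-z)=0$; (iii) $\mathrm{Res}_{z=0}r(q,z)=\Omega$, where $\Omega\in(S^2\mathfrak g)^{\mathfrak g}$ is the Casimir element of $(\cdot,\cdot)$; (iv) the classical dynamical Yang-Baxter equation, with $z_{i,j}=z_i-z_j$, $$\mathrm{Alt}(d_{\mathfrak h}r)+[r^{12}(q,z_{1,2}),r^{13}(q,z_{1,3})]+[r^{12}(q,z_{1,2}),r^{23}(q,z_{2,3})]+[r^{13}(q,z_{1,3}),r^{23}(q,z_{2,3})]=0,$$ where $\mathrm{Alt}(d_{\mathfrak h}r)=\sum_ih_i^{(1)}\frac{\partial r^{23}}{\partial q_i}(q,z_{2,3})+\sum_ih_i^{(2)}\frac{\partial r^{31}}{\partial q_i}(q,z_{3,1})+\sum_ih_i^{(3)}\frac{\partial r^{12}}{\partial q_i}(q,z_{1,2})$,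 $(h_i)$ is a basis of $\mathfrak h$ and $(q_i)$ the corresponding coordinates on $\mathfrak h^*$; (v) in the Laurent expansion $r(q,z)=\frac{\Omega}{z}+\sum_{k\ge0}t_k(q)z^k$ about $z=0$ the radius of convergence $c(r)$ is independent of $q$. Throughout, $q\in\mathfrak h^*$ ranges over the open set of points that are not poles of $r$. Notation: $L\mathfrak g$ (resp. $L\mathfrak g^*$) is the space of Laurent series $\sum_{n\ge-T}X_nz^n$ ($T$ finite) with coefficients in $\mathfrak g$ (resp. $\mathfrak g^*$) convergent in some $\{0<|z|<c\}$, with pointwise bracket on $L\mathfrak g$ and pairing $\langle\xi,X\rangle=\mathrm{Res}_{z=0}\langle\xi(z),X(z)\rangle$. $I:L\mathfrak g^*\to L\mathfrak g$ is the isomorphism $((I\xi)(z),Y)=\langle\xi(z),Y\rangle$. $r_-^{\#}(q):\mathfrak g^*\to L\mathfrak g$ is defined by $\langle(r_-^{\#}(q)\xi)(z),\eta\rangle=\langle r(q,z),\eta\otimes\xi\rangle$, and $p\in\mathfrak h$ is viewed as a constant series. The operator $R_q:L\mathfrak g^*\to L\mathfrak g$ is $$(R_q\xi)(z)=\tfrac12(I\xi)(z)+\sum_{k\ge0}\frac1{k!}\Big\langle\frac{\partial^kr}{\partial z^k}(q,-z),\xi_{-(k+1)}\otimes1\Big\rangle,$$ where $\langle s,\eta\otimes1\rangle$ is contraction of the first factor. For $v\in T_q\mathfrak h^*\cong\mathfrak h^*$, $\mathcal X_vR$ is the derivative of $q\mapsto R_q$ at $q$ in the direction $v$. A function $f$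 on $L\mathfrak g$ is smooth if for each $X\in L\mathfrak g$ the derivative $df(X)$, $df(X)(Y)=\frac d{dt}|_{t=0}f(X+tY)$, belongs to $L\mathfrak g^*$. $I(L\mathfrak g)$ is the set of smooth ad-invariant functions: $ad_X^*df(X)=0$ for all $X$. The Poisson bracket on $T^*\mathfrak h^*\times\mathfrak g^*$ ($T^*\mathfrak h^*=\mathfrak h^*\times\mathfrak h\ni(q,p)$) is the product of the canonical one and the (plus) Lie-Poisson one, normalized as the Lie-Poisson structure dual to the product Lie algebroid $T\mathfrak h^*\times\mathfrak g$: $\{p_i,q_k\}=\delta_{ik}$ in dual coordinates, $\{l_X,l_Y\}=l_{[X,Y]}$ for linear functions $l_X(\xi)=\langle\xi,X\rangle$ on $\mathfrak g^*$, and functions on $T^*\mathfrak h^*$ commute with functions on $\mathfrak g^*$. The flow generated by $\mathcal H$ is the one for which $\frac{dF}{dt}=\{F,\mathcal H\}$. *)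

(* Defs.v *)
From HB Require Import structures.
From mathcomp Require Import all_boot all_order all_algebra.
From mathcomp Require Import sesquilinear.
From mathcomp Require Import all_classical all_reals all_analysis.
From mathcomp.real_closed Require Import complex.

Set Implicit Arguments.
Unset Strict Implicit.
Unset Printing Implicit Defensive.

Import Order.TTheory GRing.Theory Num.Theory.
Import numFieldNormedType.Exports.

Local Open Scope classical_set_scope.
Local Open Scope ring_scope.

(* The topology of a finite-dimensional space is the one of 'rV, transported  *)
(* along the coordinates in the basis vbasis {:V}.                            *)
Section FiniteDimensionalCalculus.
Context {K : numFieldType}.
Implicit Types (V W : vectType K).

Definition crd V : V -> 'rV[K]_(\dim {:V}) := passmx.rVof (vbasis {:V}).

Definition uncrd V : 'rV[K]_(\dim {:V}) -> V := passmx.vecof (vbasis {:V}).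

Definition vcvg V (u : nat -> V) (l : V) : Prop :=
  (fun N => crd (u N)) @ \oo --> crd l.

Definition vlim V (u : nat -> V) : V :=
  uncrd (lim ((fun N => crd (u N)) @ \oo)).

Definition vnear V (x : V) (P : V -> Prop) : Prop :=
  \forall c \near crd x, P (uncrd c).

Definition holo_at V W (F : V -> W) (x : V) : Prop :=
  \forall c \near crd x, differentiable (fun c' => crd (F (uncrd c'))) c.

(* Near each point a quotient of holomorphic germs; the values of F on the    *)
(* zero set of the denominator are unconstrained.                             *)
Definition meromorphic V W (F : V -> W) : Prop :=
  forall x : V, exists (num : V -> W) (den : V -> K^o),
    [/\ holo_at num x, holo_at den x,
        ~ vnear x (fun y => den y = 0) &
        vnear x (fun y => den y != 0 -> F y = (den y)^-1 *: num y)].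

Definition vderiven V (k : nat) (F : K -> V) (t : K) : V :=
  uncrd (derive1n k (fun s : K => crd (F s)) t).

Definition dirder V W (F : V -> W) (x v : V) : W :=
  vderiven 1 (fun s : K => F (x + s *: v)) 0.

(* Derivative at t of a curve whose parameter is restricted to D: an open D   *)
(* gives the complex derivative, a real interval the real one.                *)
Definition is_deriv_in V (D : set K) (F : K -> V) (t : K) (v : V) : Prop :=
  (fun s : K => (s - t)^-1 *: crd (F s - F t)) @ within D (dnbhs t)
    --> crd v.

End FiniteDimensionalCalculus.

(* A series sum_n X_n z^n is the function X : int -> V of its coefficients.   *)
Section LaurentSeries.
Context {K : numFieldType}.
Implicit Types (V W : vectType K).

(* the terms with -N <= n < N *)
Definition lpartial V (X : int -> V) (z : K) (N : nat) : V :=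
  \sum_(k < N) (z ^+ k *: X k%:Z + z ^- k.+1 *: X (- k.+1%:Z)).

Definition lsum V (X : int -> V) (z : K) : V := vlim (lpartial X z).

Definition Laurent V : set (int -> V) := [set X |
  (exists T : int, forall n, n < T -> X n = 0) /\
  (exists2 c : K, 0 < c & forall z, 0 < `|z| < c ->
     exists l, vcvg (lpartial X z) l)].

(* the Laurent expansion at 0 of a function *)
Definition laurent_of V (F : K -> V) : int -> V :=
  xget (fun=> 0) [set X | Laurent X /\
    exists2 c : K, 0 < c & forall z, 0 < `|z| < c -> lsum X z = F z].

Definition residue V (F : K -> V) : V := laurent_of F (- 1).

(* Y is the derivative at t of the curve X of Laurent series. *)
Definition is_lderiv_in V (D : set K) (X : K -> int -> V) (t : K)
    (Y : int -> V) : Prop :=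
  exists2 c : K, 0 < c & forall z, 0 < `|z| < c ->
    is_deriv_in D (fun s => lsum (X s) z) t (lsum Y z).

End LaurentSeries.

(* An element of g (x) g (resp. g (x) g (x) g) is given by its coefficients   *)
(* in the basis of the e_i (x) e_j (resp. e_i (x) e_j (x) e_k), where e is    *)
(* vbasis {:g}.                                                               *)
Section Tensors.
Context {K : numFieldType} (g : vectType K).
Local Notation n := (\dim {:g}).
Local Notation e i := (vbasis {:g})`_i.
Local Notation coo i x := (coord (vbasis {:g}) i x).

Definition tensor2 : vectType K := 'M[K]_n.
Definition tensor3 : vectType K := {ffun 'I_n -> 'M[K]_n}.

Definition tens (x y : g) : tensor2 := \matrix_(i, j) (coo i x * coo j y).
Definition tens3 (x y w : g) : tensor3 := [ffun i => coo i x *: tens y w].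

(* the linear map on g (x) g induced by a bilinear map F *)
Definition lift2 (V : lmodType K) (F : g -> g -> V) (T : tensor2) : V :=
  \sum_(i < n) \sum_(j < n) (T : 'M[K]_n) i j *: F (e i) (e j).

Definition flip (T : tensor2) : tensor2 := lift2 (fun a b => tens b a) T.

Definition contr1 (T : tensor2) (eta : 'Hom(g, K^o)) : g :=
  lift2 (fun a b => eta a *: b) T.

Definition contr2 (T : tensor2) (xi : 'Hom(g, K^o)) : g :=
  lift2 (fun a b => xi b *: a) T.

End Tensors.

Section LieAlgebra.
Context {K : numFieldType} {g : vectType K}.
Local Notation "g ^*" := 'Hom(g, K^o) : type_scope.

Definition is_lie_bracket (br : g -> g -> g) : Prop :=
  [/\ forall x, linear (br x), forall y, linear (br^~ y),
      forall x, br x x = 0 &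
      forall x y z, br x (br y z) + br y (br z x) + br z (br x y) = 0].

Definition is_invariant_form (br : g -> g -> g) (form : g -> g -> K^o) : Prop :=
  [/\ forall x, linear (form x), forall x y, form x y = form y x &
      forall x y z, form (br x y) z + form y (br x z) = 0].

Definition nondegenerate_on (U : {vspace g}) (form : g -> g -> K^o) : Prop :=
  forall x, x \in U -> (forall y, y \in U -> form x y = 0) -> x = 0.

Definition abelian_subalgebra (br : g -> g -> g) (h : {vspace g}) : Prop :=
  forall x y, x \in h -> y \in h -> br x y = 0.

Definition casimir (form : g -> g -> K^o) : tensor2 g :=
  invmx (\matrix_(i, j) form (vbasis {:g})`_i (vbasis {:g})`_j).

(* g^* -> g induced by the form *)
Definition raise (form : g -> g -> K^o) (xi : g^*) : g :=
  xget 0 [set x | forall y, form x y = xi y].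

Definition adstar (br : g -> g -> g) (x : g) (xi : g^*) : g^* :=
  linfun (fun y => xi (br x y)).

(* the residue pairing of Lg^* and Lg *)
Definition lpair (xi : int -> g^*) (X : int -> g) : K :=
  residue (fun z => lsum xi z (lsum X z) : K^o).

Definition lbr (br : g -> g -> g) (X Y : int -> g) : int -> g :=
  laurent_of (fun z => br (lsum X z) (lsum Y z)).

Definition ladstar (br : g -> g -> g) (X : int -> g) (xi : int -> g^*) :
    int -> g^* :=
  laurent_of (fun z => adstar br (lsum X z) (lsum xi z)).

Definition is_ldiff (f : (int -> g) -> K) (X : int -> g) (xi : int -> g^*) :
    Prop :=
  Laurent xi /\ forall Y, Laurent Y ->
    is_derive (0 : K) 1 (fun t : K => f (fun n => X n + t *: Y n)) (lpair xi Y).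

Definition ldiff (f : (int -> g) -> K) (X : int -> g) : int -> g^* :=
  xget (fun=> 0) [set xi | is_ldiff f X xi].

(* A function on Lg is represented by a function of arbitrary coefficient     *)
(* sequences of which only the values on Laurent series matter.               *)
Definition lsmooth (f : (int -> g) -> K) : Prop :=
  forall X, Laurent X -> exists xi, is_ldiff f X xi.

Definition ad_invariant (br : g -> g -> g) (f : (int -> g) -> K) : Prop :=
  lsmooth f /\
  forall X, Laurent X -> ladstar br X (ldiff f X) = fun=> 0.

End LieAlgebra.

Section Dynamical.
Context {K : numFieldType} {g : vectType K}.
Variables (br : g -> g -> g) (form : g -> g -> K^o) (h : {vspace g}).
Local Notation "g ^*" := 'Hom(g, K^o) : type_scope.
Local Notation hstar := 'Hom(subvs_of h, K^o).

(* the basis (h_i) of h and its dual basis, so that q_i is q |-> q (hbas i) *)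
Definition hbas (i : 'I_(\dim h)) : subvs_of h := vsproj h (vbasis h)`_i.

Definition hdual (i : 'I_(\dim h)) : hstar :=
  linfun (fun x : subvs_of h => coord (vbasis h) i (vsval x)).

Definition gdual (i : 'I_(\dim {:g})) : g^* :=
  linfun (fun x : g => coord (vbasis {:g}) i x).

Definition istar (xi : g^*) : hstar := (xi \o linfun (@vsval _ _ h))%VF.

Section RMatrix.
Variable r : hstar -> K -> tensor2 g.

Definition runc (y : hstar * K^o) : tensor2 g := r y.1 y.2.

Definition regular (q : hstar) (z : K) : Prop := holo_at runc (q, z : K^o).

(* q is not a pole of r: near (q, 0), the only singularity of r is a pole of  *)
(* order at most 1 along z = 0.                                               *)
Definition nonpole : set hstar := [set q | exists G : hstar * K^o -> tensor2 g,
  holo_at G (q, 0) /\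
  vnear (q, 0 : K^o) (fun y => y.2 != 0 -> runc y = y.2^-1 *: G y)].

(* [h (x) 1 + 1 (x) h, T] *)
Definition ad2 (x : g) (T : tensor2 g) : tensor2 g :=
  lift2 (fun a b => tens (br x a) b + tens a (br x b)) T.

Definition br12_13 (S T : tensor2 g) : tensor3 g :=
  lift2 (fun a b => lift2 (fun c d => tens3 (br a c) b d) T) S.
Definition br12_23 (S T : tensor2 g) : tensor3 g :=
  lift2 (fun a b => lift2 (fun c d => tens3 a (br b c) d) T) S.
Definition br13_23 (S T : tensor2 g) : tensor3 g :=
  lift2 (fun a b => lift2 (fun c d => tens3 a c (br b d)) T) S.

Definition dr (i : 'I_(\dim h)) (q : hstar) (z : K) : tensor2 g :=
  dirder (r^~ z) q (hdual i).

Definition alt_dr (q : hstar) (z1 z2 z3 : K) : tensor3 g :=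
  \sum_(i < \dim h)
    (lift2 (fun a b => tens3 (vsval (hbas i)) a b) (dr i q (z2 - z3)) +
     lift2 (fun a b => tens3 b (vsval (hbas i)) a) (dr i q (z3 - z1)) +
     lift2 (fun a b => tens3 a b (vsval (hbas i))) (dr i q (z1 - z2))).

Definition CDYBE (q : hstar) (z1 z2 z3 : K) : Prop :=
  alt_dr q z1 z2 z3
  + br12_13 (r q (z1 - z2)) (r q (z1 - z3))
  + br12_23 (r q (z1 - z2)) (r q (z2 - z3))
  + br13_23 (r q (z1 - z3)) (r q (z2 - z3)) = 0.

Definition Rop (q : hstar) (xi : int -> g^*) : int -> g :=
  laurent_of (fun z => 2^-1 *: raise form (lsum xi z) +
    vlim (fun N => \sum_(k < N) (k`!%:R : K)^-1 *:
      contr1 (vderiven k (r q) (- z)) (xi (- k.+1%:Z)))).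

(* the derivative of q |-> Rop q at the tangent vector (q, v) *)
Definition dRop (qv : hstar * hstar) (xi : int -> g^*) : int -> g :=
  xget (fun=> 0) [set Y | Laurent Y /\
    is_lderiv_in setT (fun s => Rop (qv.1 + s *: qv.2) xi) 0 Y].

(* x.1.1 = q, x.1.2 = p, x.2 = xi *)
Definition phase : vectType K := (hstar * subvs_of h * g^*)%type.

Definition nonpole_phase : set phase := [set x | nonpole x.1.1].

Definition Lmap (x : phase) : int -> g :=
  laurent_of (fun z => vsval x.1.2 + contr2 (r x.1.1 z) x.2).

End RMatrix.

Definition mproj (x : phase) : hstar := x.1.1.

Definition tau (x : phase) : hstar * hstar := (x.1.1, - istar x.2).

Definition pbracket (F G : phase -> K^o) (x : phase) : K :=
  \sum_(i < \dim h)
    (dirder F x (0, hbas i, 0) * dirder G x (hdual i, 0, 0) -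
     dirder F x (hdual i, 0, 0) * dirder G x (0, hbas i, 0)) +
  \sum_(i < \dim {:g}) \sum_(j < \dim {:g})
    dirder F x (0, 0, gdual i) * dirder G x (0, 0, gdual j) *
      x.2 (br (vbasis {:g})`_i (vbasis {:g})`_j).

(* phi : D -> phase is an integral curve of the Hamiltonian H; both real and  *)
(* complex times are covered, see is_deriv_in.                                *)
Definition hamiltonian_flow (P : set phase) (H : phase -> K^o)
    (D : set K) (phi : K -> phase) : Prop :=
  forall t, D t -> P (phi t) /\
    forall F : phase -> K^o, (forall x, P x -> holo_at F x) ->
      is_deriv_in D (fun s => F (phi s)) t (pbracket F H (phi t) : K^o).

End Dynamical.

Section ClassicalDynamicalRMatrix.
Context {R : realType} {g : vectType R[i]}.
Variables (br : g -> g -> g) (form : g -> g -> (R[i])^o) (h : {vspace g}).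

Definition radius (V : vectType R[i]) (X : int -> V) : \bar R :=
  ereal_sup [set (Normc.normc z)%:E | z in [set z : R[i] |
    exists l, vcvg (fun N => \sum_(k < N) z ^+ k *: X k%:Z) l]].

Record classical_dynamical_r_matrix
    (r : 'Hom(subvs_of h, (R[i])^o) -> R[i] -> tensor2 g) : Prop := {
  cdr_meromorphic : meromorphic (runc r);
  cdr_simple_pole : nonpole r !=set0;
  cdr_weight_zero : forall q z x, nonpole r q -> regular r q z -> x \in h ->
    ad2 br x (r q z) = 0;
  cdr_unitary : forall q z, nonpole r q -> regular r q z -> regular r q (- z) ->
    r q z + flip (r q (- z)) = 0;
  cdr_residue : forall q, nonpole r q -> residue (r q) = casimir form;
  cdr_CDYBE : forall q z1 z2 z3, nonpole r q ->
    regular r q (z1 - z2) -> regular r q (z1 - z3) ->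
    regular r q (z2 - z3) -> regular r q (z3 - z1) ->
    CDYBE br r q z1 z2 z3;
  cdr_radius : forall q q', nonpole r q -> nonpole r q' ->
    radius (laurent_of (r q)) = radius (laurent_of (r q'))
}.

End ClassicalDynamicalRMatrix.

(* Main.v *)
Require Import Defs.
From HB Require Import structures.
From mathcomp Require Import all_boot all_order all_algebra.
From mathcomp Require Import all_classical all_reals all_analysis.
From mathcomp.real_closed Require Import complex.
From mathcomp Require Import ring lra zify.
Set Implicit Arguments.
Unset Strict Implicit.
Unset Printing Implicit Defensive.
Import Order.TTheory GRing.Theory Num.Theory.
Import numFieldNormedType.Exports.
Local Open Scope classical_set_scope.
Local Open Scope ring_scope.


Notation cRe := (@complex.Re _).
Notation cIm := (@complex.Im _).

Section ComplexModulus.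
Context {R : realType}.
Implicit Types (x y z : R[i]) (r : R).
Local Open Scope complex_scope.

Definition nc x : R := Normc.normc x.

Lemma ncE x : `|x| = (nc x)%:C. Proof. by []. Qed.
Lemma nc_ge0 x : 0 <= nc x.
Proof. by rewrite -ler0c -ncE. Qed.
Lemma ncD x y : nc (x + y) <= nc x + nc y. Proof. exact: le_normcD. Qed.
Lemma ncN x : nc (- x) = nc x. Proof. exact: normcN. Qed.
Lemma ncBC x y : nc (x - y) = nc (y - x). Proof. by rewrite -ncN opprB. Qed.
Lemma ncM x y : nc (x * y) = nc x * nc y. Proof. exact: Normc.normcM. Qed.
Lemma nc0 : nc 0 = 0. Proof. exact: Normc.normc0. Qed.
Lemma nc1 : nc 1 = 1. Proof. exact: Normc.normc1. Qed.
Lemma ncV x : nc x^-1 = (nc x)^-1. Proof. exact: Normc.normcV. Qed.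
Lemma ncX x n : nc (x ^+ n) = nc x ^+ n.
Proof. by elim: n => [|n IH]; rewrite ?expr0 ?nc1 // !exprS ncM IH. Qed.
Lemma nc_eq0 x : (nc x == 0) = (x == 0).
Proof. by apply/eqP/eqP => [/Normc.eq0_normc//|->]; exact: nc0. Qed.
Lemma nc_gt0 x : (0 < nc x) = (x != 0).
Proof. by rewrite lt_def nc_ge0 nc_eq0 andbT. Qed.
Lemma ncR r : nc r%:C = `|r|.
Proof. by rewrite /nc /= expr0n /= addr0 sqrtr_sqr. Qed.
Lemma nc_nat n : nc n%:R = n%:R.
Proof. by rewrite -(rmorph_nat (real_complex R)) ncR ger0_norm. Qed.
Lemma nc_i : nc 'i = 1.
Proof. by rewrite /nc /= expr0n /= add0r expr1n sqrtr1. Qed.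
Lemma ncB x y : nc (x - y) <= nc x + nc y.
Proof. by rewrite -(ncN y) ncD. Qed.
Lemma nc_sub_ge x y : nc x - nc y <= nc (x - y).
Proof. by rewrite lerBlDr (le_trans _ (ncD _ _)) // subrK. Qed.
Lemma nc_sum (I : Type) (s : seq I) (P : pred I) (F : I -> R[i]) :
  nc (\sum_(i <- s | P i) F i) <= \sum_(i <- s | P i) nc (F i).
Proof.
elim/big_ind2: _ => [|a b c d h1 h2|//]; first by rewrite nc0.
by rewrite (le_trans (ncD _ _)) // lerD.
Qed.
Lemma Re_le_nc x : `|cRe x| <= nc x.
Proof.
case: x => a b /=; rewrite /nc /= -sqrtr_sqr ler_sqrt; last first.
  by rewrite addr_ge0 ?sqr_ge0.
by rewrite lerDl sqr_ge0.
Qed.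
Lemma Im_le_nc x : `|cIm x| <= nc x.
Proof.
case: x => a b /=; rewrite /nc /= -sqrtr_sqr ler_sqrt; last first.
  by rewrite addr_ge0 ?sqr_ge0.
by rewrite lerDr sqr_ge0.
Qed.
Lemma nc_le_ReIm x : nc x <= `|cRe x| + `|cIm x|.
Proof.
case: x => a b /=; rewrite /nc /= -(@ler_pXn2r _ 2) ?nnegrE ?sqrtr_ge0 ?addr_ge0 //.
rewrite sqr_sqrtr ?addr_ge0 ?sqr_ge0 // sqrrD !real_normK ?num_real //.
by rewrite -addrA lerD2l lerDr mulrn_wge0 // mulr_ge0.
Qed.

Lemma ncP x : (forall e, 0 < e -> nc x <= e) -> x = 0.
Proof.
move=> h; apply/eqP; rewrite -nc_eq0 eq_le nc_ge0 andbT.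
by rewrite leNgt; apply/negP => h0; have := h (nc x / 2); lra.
Qed.

Lemma eqC_ReIm x y : cRe x = cRe y -> cIm x = cIm y -> x = y.
Proof. by case: x y => a b [c d] /= -> ->. Qed.
End ComplexModulus.

Lemma small2 (R : realType) (d d' : R) : 0 < d -> 0 < d' ->
  exists t : R, [/\ 0 < t, t < d & t < d'].
Proof.
move=> d0 d0'; have [h|h] := leP d d'.
  by exists (d / 2); split; lra.
by exists (d' / 2); split; lra.
Qed.

Section EpsilonDerivative.
Context {R : realType}.
Implicit Types (F G : R[i] -> R[i]) (z l : R[i]).

(** Complex differentiability with the real-valued modulus: real
    inequalities are decidable by linear arithmetic, those between complex
    numbers are not. *)
Definition hd F z l := forall e : R, 0 < e -> exists2 d : R, 0 < d &
  forall h, nc h < d -> nc (F (z + h) - F z - l * h) <= e * nc h.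

Definition ccont F z := forall e : R, 0 < e -> exists2 d : R, 0 < d &
  forall h, nc h < d -> nc (F (z + h) - F z) <= e.

Lemma hd_cont F z l : hd F z l -> ccont F z.
Proof.
move=> h e e0; have [d d0 hd1] := h 1 ltr01.
pose c := nc l + 1; have c0 : 0 < c by rewrite /c; have := nc_ge0 l; lra.
exists (Num.min d (e / c)); first by rewrite lt_min d0 divr_gt0.
move=> k; rewrite lt_min => /andP[/hd1 hk]; rewrite ltr_pdivlMr // => ke.
have -> : F (z + k) - F z = (F (z + k) - F z - l * k) + l * k by rewrite subrK.
apply: (le_trans (ncD _ _)); rewrite ncM.
by move: hk ke; rewrite /c; lra.
Qed.

Lemma hd_unique F z l l' : hd F z l -> hd F z l' -> l = l'.
Proof.
move=> h h'; apply/eqP; rewrite -subr_eq0; apply/eqP; apply: ncP => e e0.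
have e2 : 0 < e / 2 by lra.
have [d d0 H] := h _ e2; have [d' d0' H'] := h' _ e2.
have [t [t0 t1 t2]] := small2 d0 d0'.
have nt : nc (real_complex R t) = t by rewrite ncR ger0_norm // ltW.
have := H (real_complex R t); rewrite nt => /(_ t1) H1.
have := H' (real_complex R t); rewrite nt => /(_ t2) H2.
have : nc ((l - l') * real_complex R t) <= e * t.
  have -> : (l - l') * real_complex R t =
     (F (z + real_complex R t) - F z - l' * real_complex R t) -
     (F (z + real_complex R t) - F z - l * real_complex R t) by ring.
  by rewrite (le_trans (ncB _ _)) //; lra.
by rewrite ncM nt ler_pM2r.
Qed.

Lemma hd_ext F G z l : (forall w, F w = G w) -> hd F z l -> hd G z l.
Proof. by move=> e H ? /H [d d0 K]; exists d => // h /K; rewrite !e. Qed.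

(** Derivatives only depend on germs. *)
Lemma hd_near F G z l (r : R) : 0 < r ->
  (forall w, nc (w - z) < r -> F w = G w) -> hd F z l -> hd G z l.
Proof.
move=> r0 e H ? /H [d d0 K]; exists (Num.min d r) => [|h].
  by rewrite lt_min d0.
rewrite lt_min => /andP[/K Kh hr]; rewrite -!e ?subrr ?nc0 //.
by rewrite addrC addKr.
Qed.

Lemma hd_cst c z : hd (fun=> c) z 0.
Proof.
by move=> e e0; exists 1 => // h _; rewrite subrr mul0r subr0 nc0 mulr_ge0 ?nc_ge0 // ltW.
Qed.

Lemma hd_id z : hd id z 1.
Proof.
move=> e e0; exists 1 => // h _.
by rewrite mul1r [z + h]addrC addrK subrr nc0 mulr_ge0 ?nc_ge0 // ltW.
Qed.

Lemma hdD F G z l m : hd F z l -> hd G z m -> hd (fun w => F w + G w) z (l + m).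
Proof.
move=> h h' e e0; have e2 : 0 < e / 2 by lra.
have [d d0 H] := h _ e2; have [d' d0' H'] := h' _ e2.
exists (Num.min d d') => [|k]; first by rewrite lt_min d0.
rewrite lt_min => /andP[/H Hk /H' Hk'].
have -> : F (z + k) + G (z + k) - (F z + G z) - (l + m) * k =
  (F (z + k) - F z - l * k) + (G (z + k) - G z - m * k) by ring.
by rewrite (le_trans (ncD _ _)) //; lra.
Qed.

Lemma hdM F G z l m : hd F z l -> hd G z m ->
  hd (fun w => F w * G w) z (l * G z + F z * m).
Proof.
move=> h h' e e0.
pose A := nc l + nc (F z) + nc (G z) + 2.
have A0 : 0 < A by rewrite /A; have := nc_ge0 l; have := nc_ge0 (F z); have := nc_ge0 (G z); lra.
pose e' := e / (2 * A) ; have e'0 : 0 < e' by rewrite divr_gt0 // mulr_gt0.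
have [d d0 H] := h _ e'0.
have [d1 d10 H1] := h 1 ltr01.
have [d' d0' H'] := h' _ e'0.
have [d'' d0'' H''] := hd_cont h' e'0.
exists (Num.min (Num.min d d1) (Num.min d' d'')) => [|k].
  by rewrite !lt_min d0 d10 d0'.
rewrite !lt_min => /andP[/andP[/H Hk /H1 H1k] /andP[/H' Hk' /H'' Hk'']].
have -> : F (z + k) * G (z + k) - F z * G z - (l * G z + F z * m) * k =
  (F (z + k) - F z - l * k) * G z + F z * (G (z + k) - G z - m * k) +
  ((F (z + k) - F z - l * k) + l * k) * (G (z + k) - G z) by ring.
apply: (le_trans (ncD _ _)); apply: (le_trans (lerD (ncD _ _) (lexx _))).
rewrite !ncM.
have Q : nc (F (z + k) - F z - l * k + l * k) <= (1 + nc l) * nc k.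
  by apply: (le_trans (ncD _ _)); rewrite ncM; lra.
have {Q}Q := ler_pM (nc_ge0 _) (nc_ge0 _) Q Hk''.
have P1 := ler_wpM2r (nc_ge0 (G z)) Hk.
have P2 := ler_wpM2l (nc_ge0 (F z)) Hk'.
have Ee : e' * (A * 2) = e by rewrite /e' -mulrA [A * 2]mulrC mulVf ?mulr1 // gt_eqF // mulr_gt0.
have : e' * nc k * A <= e * nc k.
  rewrite -Ee; have := mulr_ge0 (ltW e'0) (nc_ge0 k) => T.
  have := mulr_ge0 T (ltW A0); lra.
have := mulr_ge0 (ltW e'0) (nc_ge0 k); rewrite /A; nra.
Qed.

Lemma hdZ F z l c : hd F z l -> hd (fun w => c * F w) z (c * l).
Proof.
move=> h; have := hdM (hd_cst c z) h; rewrite mul0r add0r; exact: hd_ext.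
Qed.

Lemma hdN F z l : hd F z l -> hd (fun w => - F w) z (- l).
Proof.
move=> /(hdZ (-1)); rewrite mulN1r; apply: hd_ext => w; exact: mulN1r.
Qed.

Lemma hdB F G z l m : hd F z l -> hd G z m -> hd (fun w => F w - G w) z (l - m).
Proof. by move=> hF /hdN hG; exact: hdD. Qed.

Lemma hd_sum (I : Type) (s : seq I) (P : pred I) (F : I -> R[i] -> R[i]) z (l : I -> R[i]) :
  (forall i, P i -> hd (F i) z (l i)) ->
  hd (fun w => \sum_(i <- s | P i) F i w) z (\sum_(i <- s | P i) l i).
Proof.
move=> H; elim: s => [|i s IH].
  by rewrite big_nil; apply: hd_ext (hd_cst 0 z) => w; rewrite big_nil.
rewrite big_cons; case Pi : (P i); last first.
  by apply: hd_ext IH => w; rewrite big_cons Pi.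
by apply: hd_ext (hdD (H _ Pi) IH) => w; rewrite big_cons Pi.
Qed.

Lemma hd_aff F z l a b : hd F (a + b * z) l -> hd (fun w => F (a + b * w)) z (b * l).
Proof.
move=> h e e0; have b0 : 0 < nc b + 1 by have := nc_ge0 b; lra.
have e'0 : 0 < e / (nc b + 1) by rewrite divr_gt0.
have [d d0 H] := h _ e'0; exists (d / (nc b + 1)) => [|k]; first by rewrite divr_gt0.
rewrite ltr_pdivlMr // => kd.
have bk : nc (b * k) <= nc k * (nc b + 1) by rewrite ncM mulrC ler_wpM2l ?nc_ge0 // lerDl.
have -> : a + b * (z + k) = a + b * z + b * k by ring.
have -> : b * l * k = l * (b * k) by ring.
apply: (le_trans (H _ (le_lt_trans bk kd))).
by rewrite mulrAC ler_pdivrMr // -mulrA ler_wpM2l // ltW.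
Qed.

Lemma hdX z n : hd (fun w => w ^+ n) z (n%:R * z ^+ n.-1).
Proof.
elim: n => [|n IH]; first by rewrite mul0r; exact: hd_cst.
have := hdM (hd_id z) IH; rewrite mul1r.
have -> : z ^+ n + z * (n%:R * z ^+ n.-1) = n.+1%:R * z ^+ n.
  case: n {IH} => [|n]; first by rewrite mul0r mulr0 addr0 mul1r.
  by rewrite /= mulrCA -exprS -[n.+2]addn1 natrD mulrDl mul1r addrC.
by apply: hd_ext => w; rewrite exprS.
Qed.

Lemma hdV z : z != 0 -> hd (fun w => w^-1) z (- (z^-1 * z^-1)).
Proof.
move=> z0 e e0; have nz : 0 < nc z by rewrite nc_gt0.
pose c := nc z; exists (Num.min (c / 2) (e * c ^+ 3 / 2)) => [|k].
  by rewrite lt_min !divr_gt0 // mulr_gt0 // exprn_gt0.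
rewrite lt_min => /andP[k1 k2].
have ck : c / 2 <= nc (z + k).
  by have := nc_sub_ge z (- k); rewrite opprK ncN -/c => ck; lra.
have zk0 : z + k != 0 by rewrite -nc_gt0; apply: lt_le_trans ck; rewrite divr_gt0.
have -> : (z + k)^-1 - z^-1 - - (z^-1 * z^-1) * k = k * k / (z * z * (z + k)).
  by field; rewrite z0 zk0.
rewrite !(ncM, ncV) -/c -mulrA [X in _ <= X]mulrC ler_wpM2l ?nc_ge0 //.
rewrite ler_pdivrMr ?mulr_gt0 ?nc_gt0 //.
apply: (le_trans (ltW k2)); rewrite -mulrA ler_wpM2l ?(ltW e0) //.
by rewrite exprSr expr2 -mulrA ler_wpM2l // mulr_ge0 // nc_ge0.
Qed.

Lemma hd_comp F G z l m : hd G z m -> hd F (G z) l -> hd (F \o G) z (l * m).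
Proof.
move=> hG hF e e0.
have c0 : 0 < nc m + 1 by have := nc_ge0 m; lra.
have m1 : 0 < nc l + 1 by have := nc_ge0 l; lra.
have e1 : 0 < e / 2 / (nc m + 1) by rewrite !divr_gt0.
have e2 : 0 < e / 2 / (nc l + 1) by rewrite !divr_gt0.
have [d1 d10 H1] := hF _ e1.
have [d2 d20 H2] := hG _ e2.
have [d3 d30 H3] := hG _ ltr01.
exists (Num.min (Num.min d2 d3) (d1 / (nc m + 1))) => [|k].
  by rewrite !lt_min d20 d30 divr_gt0.
rewrite !lt_min ltr_pdivlMr // => /andP[/andP[/H2 K2 /H3 K3] k1].
pose g := G (z + k) - G z.
have gE : nc g <= (nc m + 1) * nc k.
  rewrite /g -(subrK (m * k) (G (z + k) - G z)).
  by rewrite (le_trans (ncD _ _)) // ncM; lra.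
have /H1 : nc g < d1 by rewrite (le_lt_trans gE) // mulrC.
have -> : G z + g = G (z + k) by rewrite /g addrC subrK.
move=> K1.
have -> : (F \o G) (z + k) - (F \o G) z - l * m * k =
  (F (G (z + k)) - F (G z) - l * g) + l * (G (z + k) - G z - m * k).
  by rewrite /g /=; ring.
apply: (le_trans (ncD _ _)); rewrite ncM.
have Q1 : nc (F (G (z + k)) - F (G z) - l * g) <= e / 2 * nc k.
  apply: (le_trans K1); rewrite mulrAC ler_pdivrMr // -[X in _ <= X]mulrA ler_wpM2l //; first lra.
  by rewrite [nc k * _]mulrC.
have Q2 : nc l * nc (G (z + k) - G z - m * k) <= e / 2 * nc k.
  apply: (le_trans (ler_wpM2l (nc_ge0 _) K2)).
  rewrite mulrA ler_wpM2r ?nc_ge0 // mulrA ler_pdivrMr // mulrC ler_wpM2l //; lra.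
by lra.
Qed.

End EpsilonDerivative.


Lemma is_derive_epsP (K : numFieldType) (f : K -> K) (x l : K) :
  is_derive x (1 : K) f l <-> forall e : K, 0 < e -> exists2 d : K, 0 < d &
    forall h, `|h| < d -> `|f (x + h) - f x - l * h| <= e * `|h|.
Proof.
have E : forall e h : K, h != 0 ->
    (`|l - h^-1 *: (f (h *: 1 + x) - f x)| <= e) = (`|f (x + h) - f x - l * h| <= e * `|h|).
  move=> e h h0; rewrite distrC -[in RHS]ler_pdivrMr ?normr_gt0 // -normf_div.
  by rewrite mulrBl mulfK // [h%:A]mulr1 [h + x]addrC [(_ - f x) / h]mulrC.
split.
  case=> df dv e e0.
  have : (fun h => h^-1 *: ((f \o shift x) (h *: 1) - f x)) @ 0^' --> l.
    by rewrite -dv; exact: df.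
  move=> /cvgrPdist_le /(_ e e0).
  rewrite near_withinE => /nbhs_ballP [d /= d0 H].
  exists d => // h hd.
  have [->|h0] := eqVneq h 0; first by rewrite addr0 subrr mulr0 subr0 !normr0 mulr0.
  rewrite -E //; apply: H => //.
  by rewrite /ball /= sub0r normrN.
move=> H.
have C : (fun h => h^-1 *: ((f \o shift x) (h *: 1) - f x)) @ 0^' --> l.
  apply/cvgrPdist_le => e e0; have [d d0 Hd] := H e e0.
  rewrite near_withinE; apply/nbhs_ballP; exists d => //= h.
  rewrite /ball /= sub0r normrN => hd h0; rewrite E //; exact: Hd.
split; first by apply/cvg_ex; exists l.
by rewrite /derive; apply/cvg_lim.
Qed.

Section ComplexBridge.
Context {R : realType}.
Local Open Scope complex_scope.

Local Notation C := (Num.NumField.sort (R[i] : numFieldType)).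

Lemma hdP (F : C -> C) (z l : C) : hd F z l <-> is_derive z (1 : C) F l.
Proof.
split=> [H|/is_derive_epsP H].
  apply/is_derive_epsP => e e0; have e0' : 0 < cRe e by move: e0; rewrite ltcE => /andP[].
  have [d d0 Hd] := H _ e0'; exists d%:C; first by rewrite ltcR.
  move=> h; rewrite !ncE ltcR => /Hd.
  have -> : e = (cRe e)%:C by rewrite RRe_real // gtr0_real.
  by rewrite -rmorphM lecR.
move=> e e0; have [|d d0 Hd] := H e%:C; first by rewrite (ltcR 0 e).
have dE : d = (cRe d)%:C by rewrite RRe_real // gtr0_real.
exists (cRe d) => [|h]; first by move: d0; rewrite {1}dE ltcR.
by move=> hd; have := Hd h; rewrite dE !ncE ltcR -rmorphM lecR => ->.
Qed.

End ComplexBridge.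

Section Primitives.
Context {R : realType}.
Local Open Scope complex_scope.
Implicit Types (u U : R -> R[i]).

Definition hdR U x (l : R[i]) := forall e : R, 0 < e -> exists2 d : R, 0 < d &
  forall h : R, `|h| < d -> nc (U (x + h) - U x - l * h%:C) <= e * `|h|.

Definition ctsR u := forall x (e : R), 0 < e -> exists2 d : R, 0 < d &
  forall y, `|y - x| < d -> nc (u y - u x) <= e.

Lemma hdRP (f : R -> R) (x l : R) : is_derive x (1 : R) f l <-> hdR (fun t => (f t)%:C) x l%:C.
Proof.
have E h : nc ((f (x + h))%:C - (f x)%:C - l%:C * h%:C) = `|f (x + h) - f x - l * h|.
  by rewrite -rmorphM -!rmorphB ncR.
split=> [/is_derive_epsP H e /H[d d0 Hd]|H].
  by exists d => // h /Hd; rewrite E.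
by apply/is_derive_epsP => e /H [d d0 Hd]; exists d => // h /Hd; rewrite E.
Qed.

Lemma hdR_unique U x l l' : hdR U x l -> hdR U x l' -> l = l'.
Proof.
move=> h h'; apply/eqP; rewrite -subr_eq0; apply/eqP; apply: ncP => e e0.
have e2 : 0 < e / 2 by lra.
have [d d0 H] := h _ e2; have [d' d0' H'] := h' _ e2.
have [t [t0 t1 t2]] := small2 d0 d0'.
have nt : `|t| = t by rewrite ger0_norm // ltW.
have := H t; rewrite nt => /(_ t1) H1.
have := H' t; rewrite nt => /(_ t2) H2.
have : nc ((l - l') * t%:C) <= e * t.
  have -> : (l - l') * t%:C = (U (x + t) - U x - l' * t%:C) - (U (x + t) - U x - l * t%:C) by ring.
  by rewrite (le_trans (ncB _ _)) //; lra.
by rewrite ncM ncR nt ler_pM2r.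
Qed.

Lemma hdR_ext U V x l : (forall t, U t = V t) -> hdR U x l -> hdR V x l.
Proof. by move=> e H ? /H [d d0 K]; exists d => // h /K; rewrite !e. Qed.

Lemma hdR_eq U x l l' : l = l' -> hdR U x l -> hdR U x l'.
Proof. by move=> ->. Qed.

Lemma hdRD U V x l m : hdR U x l -> hdR V x m -> hdR (fun w => U w + V w) x (l + m).
Proof.
move=> h h' e e0; have e2 : 0 < e / 2 by lra.
have [d d0 H] := h _ e2; have [d' d0' H'] := h' _ e2.
exists (Num.min d d') => [|k]; first by rewrite lt_min d0.
rewrite lt_min => /andP[/H Hk /H' Hk'].
have -> : U (x + k) + V (x + k) - (U x + V x) - (l + m) * k%:C =
  (U (x + k) - U x - l * k%:C) + (V (x + k) - V x - m * k%:C) by ring.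
by rewrite (le_trans (ncD _ _)) //; lra.
Qed.

Lemma hdRZ U x l c : hdR U x l -> hdR (fun w => c * U w) x (c * l).
Proof.
move=> H e e0; have c0 : 0 < nc c + 1 by have := nc_ge0 c; lra.
have [d d0 Hd] := H (e / (nc c + 1)) (divr_gt0 e0 c0).
exists d => // h /Hd K.
have -> : c * U (x + h) - c * U x - c * l * h%:C = c * (U (x + h) - U x - l * h%:C) by ring.
rewrite ncM; apply: (le_trans (ler_wpM2l (nc_ge0 c) K)).
by rewrite mulrA ler_wpM2r // mulrA ler_pdivrMr // mulrC ler_wpM2l // ?ltW //; lra.
Qed.

(** Chain rule for a holomorphic function along a real curve. *)
Lemma hd_hdR F U x l m : hdR U x m -> hd F (U x) l -> hdR (fun t => F (U t)) x (l * m).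
Proof.
move=> hU hF e e0.
have c0 : 0 < nc m + 1 by have := nc_ge0 m; lra.
have m1 : 0 < nc l + 1 by have := nc_ge0 l; lra.
have e1 : 0 < e / 2 / (nc m + 1) by rewrite !divr_gt0.
have e2 : 0 < e / 2 / (nc l + 1) by rewrite !divr_gt0.
have [d1 d10 H1] := hF _ e1.
have [d2 d20 H2] := hU _ e2.
have [d3 d30 H3] := hU _ ltr01.
exists (Num.min (Num.min d2 d3) (d1 / (nc m + 1))) => [|k].
  by rewrite !lt_min d20 d30 divr_gt0.
rewrite !lt_min ltr_pdivlMr // => /andP[/andP[/H2 K2 /H3 K3] k1].
pose g := U (x + k) - U x.
have gE : nc g <= (nc m + 1) * `|k|.
  rewrite /g -(subrK (m * k%:C) (U (x + k) - U x)).
  by rewrite (le_trans (ncD _ _)) // ncM ncR; lra.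
have /H1 : nc g < d1 by rewrite (le_lt_trans gE) // mulrC.
have -> : U x + g = U (x + k) by rewrite /g addrC subrK.
move=> K1.
have -> : F (U (x + k)) - F (U x) - l * m * k%:C =
  (F (U (x + k)) - F (U x) - l * g) + l * (U (x + k) - U x - m * k%:C).
  by rewrite /g /=; ring.
apply: (le_trans (ncD _ _)); rewrite ncM.
have Q1 : nc (F (U (x + k)) - F (U x) - l * g) <= e / 2 * `|k|.
  apply: (le_trans K1); rewrite mulrAC ler_pdivrMr // -[X in _ <= X]mulrA ler_wpM2l //; first lra.
  by rewrite [`|k| * _]mulrC.
have Q2 : nc l * nc (U (x + k) - U x - m * k%:C) <= e / 2 * `|k|.
  apply: (le_trans (ler_wpM2l (nc_ge0 _) K2)).
  rewrite mulrA ler_wpM2r // mulrA ler_pdivrMr // mulrC ler_wpM2l //; lra.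
by lra.
Qed.

Lemma hdR_ctsR U (l : R -> R[i]) : (forall x, hdR U x (l x)) -> ctsR U.
Proof.
move=> H x e e0; have [d d0 Hd] := H x 1 ltr01.
have c0 : 0 < nc (l x) + 1 by have := nc_ge0 (l x); lra.
exists (Num.min d (e / (nc (l x) + 1))) => [|y]; first by rewrite lt_min d0 divr_gt0.
rewrite lt_min ltr_pdivlMr // => /andP[/Hd]; rewrite [x + _]addrC subrK => K ye.
rewrite -(subrK (l x * (y - x)%:C) (U y - U x)) (le_trans (ncD _ _)) // ncM ncR; lra.
Qed.

Lemma ctsRM u v : ctsR u -> ctsR v -> ctsR (fun t => u t * v t).
Proof.
move=> Hu Hv x e e0.
pose A := nc (u x) + nc (v x) + 2.
have A0 : 0 < A by rewrite /A; have := nc_ge0 (u x); have := nc_ge0 (v x); lra.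
have e'0 : 0 < e / A by rewrite divr_gt0.
have [d d0 H] := Hu x _ e'0.
have [d1 d10 H1] := Hv x _ e'0.
have [d2 d20 H2] := Hu x _ ltr01.
exists (Num.min (Num.min d d1) d2) => [|y]; first by rewrite !lt_min d0 d10.
rewrite !lt_min => /andP[/andP[/H K /H1 K1] /H2 K2].
have -> : u y * v y - u x * v x = (u y - u x) * v x + ((u y - u x) + u x) * (v y - v x) by ring.
apply: (le_trans (ncD _ _)); rewrite !ncM.
have Q1 := ler_wpM2r (nc_ge0 (v x)) K.
have Q2 : nc (u y - u x + u x) <= 1 + nc (u x) by rewrite (le_trans (ncD _ _)) // lerD2r.
have Q3 := ler_pM (nc_ge0 _) (nc_ge0 _) Q2 K1.
have : e / A * A = e by rewrite divfK // gt_eqF.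
rewrite {2}/A; nra.
Qed.

Lemma ctsR_cst c : ctsR (fun=> c).
Proof. by move=> x e e0; exists 1 => // y _; rewrite subrr nc0 ltW. Qed.

(** Every continuous function has a primitive on the half line x > -1; the
    integrals below are differences of values of such primitives. *)
Lemma prim_ex u : ctsR u -> exists U, forall x, 0 <= x -> hdR U x (u x).
Proof.
move=> Hu.
have cts (f : R[i] -> R) : (forall x y, `|f x - f y| <= nc (x - y)) ->
    continuous (f \o u).
  move=> Hf x; apply/cvgrPdist_le => e e0; have [d d0 Hd] := Hu x e e0.
  apply/nbhs_ballP; exists d => //= y; rewrite /ball /= => yd.
  by rewrite (le_trans (Hf _ _)) // ncBC Hd // distrC.
have prim (f : R -> R) : continuous f -> exists F, forall x, 0 <= x -> is_derive (x:R) (1:R) F (f x).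
  move=> cf; exists (fun x => \int[lebesgue_measure]_(t in [set` Interval (BLeft (-1)) (BRight x)]) (f t))%R.
  move=> x x0.
  have [] := @continuous_FTC1 R f (BLeft (-1)) x (x + 1).
  - by rewrite ltrDl.
  - apply: continuous_compact_integrable; first exact: segment_compact.
    by apply: continuous_subspaceT.
  - have h : (-1 < x)%R by lra.
    exact: h.
  - exact: cf.
  - move=> d1 d2; apply: DeriveDef; first exact: d1.
    by rewrite -derive1E; exact: d2.
have [|FR HR] := prim ((fun z : R[i] => cRe z) \o u).
  by apply: cts => x y; case: x y => a b [c d]; exact: (Re_le_nc ((a +i* b) - (c +i* d))).
have [|FI HI] := prim ((fun z : R[i] => cIm z) \o u).
  by apply: cts => x y; case: x y => a b [c d]; exact: (Im_le_nc ((a +i* b) - (c +i* d))).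
exists (fun x => (FR x)%:C + 'i * (FI x)%:C) => x x0.
rewrite [u x]complexE; apply: hdRD.
  by apply/hdRP; exact: HR.
by apply: hdRZ; apply/hdRP; exact: HI.
Qed.

Lemma hdR_Re U x l : hdR U x l -> is_derive x (1:R) (fun t => cRe (U t)) (cRe l).
Proof.
move=> H; apply/is_derive_epsP => e e0; have [d d0 Hd] := H e e0.
exists d => // h /Hd K; apply: le_trans K.
apply: le_trans (Re_le_nc _).
by case: (U (x + h)) (U x) l {H Hd} => a b [a' b'] [c c'] /=; rewrite mulr0 subr0.
Qed.

Lemma hdR_Im U x l : hdR U x l -> is_derive x (1:R) (fun t => cIm (U t)) (cIm l).
Proof.
move=> H; apply/is_derive_epsP => e e0; have [d d0 Hd] := H e e0.
exists d => // h /Hd K; apply: le_trans K.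
apply: le_trans (Im_le_nc _).
by case: (U (x + h)) (U x) l {H Hd} => a b [a' b'] [c c'] /=; rewrite mulr0 add0r.
Qed.

Lemma real_increment (f g : R -> R) (a b M : R) : a <= b ->
  (forall x : R, a <= x <= b -> is_derive x (1:R) f (g x)) ->
  (forall x, a <= x <= b -> `|g x| <= M) -> `|f b - f a| <= M * (b - a).
Proof.
move=> ab df gM.
have [| |c cab ->] := @MVT_segment R f g a b ab.
- move=> x; rewrite in_itv /= => /andP[ax xb]; apply: df; by rewrite !ltW.
- apply: derivable_within_continuous => x; rewrite in_itv /= => /df; by case.
rewrite normrM [`|b - a|]ger0_norm ?subr_ge0 // ler_wpM2r ?subr_ge0 // gM //.
Qed.

(** Mean value inequality; the constant 2 comes from treating the real and
    imaginary parts separately and is harmless below. *)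
Lemma increment U u a b M : a <= b ->
  (forall x, a <= x <= b -> hdR U x (u x)) ->
  (forall x, a <= x <= b -> nc (u x) <= M) -> nc (U b - U a) <= 2 * M * (b - a).
Proof.
move=> ab dU uM; apply: (le_trans (nc_le_ReIm _)).
have -> : cRe (U b - U a) = cRe (U b) - cRe (U a) by case: (U b) (U a) => ? ? [? ?].
have -> : cIm (U b - U a) = cIm (U b) - cIm (U a) by case: (U b) (U a) => ? ? [? ?].
have H1 : `|cRe (U b) - cRe (U a)| <= M * (b - a).
  apply: (@real_increment (fun x => cRe (U x)) (fun x => cRe (u x))) => // x xab.
    exact: hdR_Re (dU _ _).
  by rewrite (le_trans (Re_le_nc _)) // uM.
have H2 : `|cIm (U b) - cIm (U a)| <= M * (b - a).
  apply: (@real_increment (fun x => cIm (U x)) (fun x => cIm (u x))) => // x xab.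
    exact: hdR_Im (dU _ _).
  by rewrite (le_trans (Im_le_nc _)) // uM.
by lra.
Qed.

Lemma hdR_const U a b : a <= b -> (forall x, a <= x <= b -> hdR U x 0) -> U b = U a.
Proof.
move=> ab H; apply/eqP; rewrite -subr_eq0; apply/eqP; apply: ncP => e e0.
rewrite (le_trans (@increment U (fun=> 0) a b 0 ab H _)) //.
  by move=> x _; rewrite nc0.
by rewrite mulr0 mul0r ltW.
Qed.

Definition prim u : R -> R[i] := xget (fun=> 0) [set U | forall x, 0 <= x -> hdR U x (u x)].

Lemma primP u x : ctsR u -> 0 <= x -> hdR (prim u) x (u x).
Proof.
move=> /prim_ex [U HU]; rewrite /prim; case: xgetP => [V -> HV|]; first exact: HV.
by move=> /(_ U).
Qed.

(** the integral of u over [a, b], for 0 <= a <= b *)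
Definition cint u a b : R[i] := prim u b - prim u a.

Lemma cint_chain u a b c : cint u a b + cint u b c = cint u a c.
Proof. by rewrite /cint; ring. Qed.

Lemma cintE u U a b : ctsR u -> 0 <= a -> a <= b ->
  (forall x, a <= x <= b -> hdR U x (u x)) -> cint u a b = U b - U a.
Proof.
move=> cu a0 ab H.
have := @hdR_const (fun x => prim u x + (-1) * U x) a b ab.
have K x : a <= x <= b -> hdR (fun x => prim u x + (-1) * U x) x 0.
  move=> xab; apply: (@hdR_eq _ _ (u x + (-1) * u x)); first by ring.
  apply: hdRD; last by apply: hdRZ; exact: H.
  by apply: primP => //; move/andP: xab => [+ _]; exact: le_trans.
move=> /(_ K) E; rewrite /cint -[prim u b](addrK ((-1) * U b)) E; ring.
Qed.

Lemma cint_bound u a b M : ctsR u -> 0 <= a -> a <= b ->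
  (forall x, a <= x <= b -> nc (u x) <= M) -> nc (cint u a b) <= 2 * M * (b - a).
Proof.
move=> cu a0 ab H; apply: increment H => // x /andP[ax _].
by apply: primP => //; exact: le_trans ax.
Qed.

Lemma cintD u v a b : ctsR u -> ctsR v -> 0 <= a -> a <= b ->
  ctsR (fun t => u t + v t) ->
  cint (fun t => u t + v t) a b = cint u a b + cint v a b.
Proof.
move=> cu cv a0 ab cw.
rewrite (@cintE _ (fun t => prim u t + prim v t)) //; first by rewrite /cint; ring.
move=> x /andP[ax _]; apply: hdRD; by apply: primP => //; exact: le_trans ax.
Qed.

Lemma cintZ u c a b : ctsR u -> 0 <= a -> a <= b ->
  cint (fun t => c * u t) a b = c * cint u a b.
Proof.
move=> cu a0 ab.
rewrite (@cintE _ (fun t => c * prim u t)) //; first by rewrite /cint; ring.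
  by apply: ctsRM => //; exact: ctsR_cst.
move=> x /andP[ax _]; apply: hdRZ; by apply: primP => //; exact: le_trans ax.
Qed.

Lemma ctsRD u v : ctsR u -> ctsR v -> ctsR (fun t => u t + v t).
Proof.
move=> Hu Hv x e e0; have e2 : 0 < e / 2 by lra.
have [d d0 H] := Hu x _ e2; have [d1 d10 H1] := Hv x _ e2.
exists (Num.min d d1) => [|y]; first by rewrite !lt_min d0 d10.
rewrite !lt_min => /andP[/H K /H1 K1].
have -> : u y + v y - (u x + v x) = (u y - u x) + (v y - v x) by ring.
by rewrite (le_trans (ncD _ _)) //; lra.
Qed.

End Primitives.


Section RectangleLemma.
Context {R : realType}.
Local Open Scope complex_scope.

Lemma exp_small (q e : R) : 0 <= q -> q < 1 -> 0 < e ->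
  exists N, forall n, (N <= n)%N -> q ^+ n <= e.
Proof.
move=> q0 q1 e0.
have : (fun n => q ^+ n) @ \oo --> 0 by apply: cvg_expr; rewrite ger0_norm.
move=> /cvgrPdist_le /(_ e e0) [N _ H]; exists N => n Nn.
by have := H n Nn; rewrite /= sub0r normrN ger0_norm // exprn_ge0.
Qed.

Lemma half_pow_small (e X : R) : 0 < e -> 0 <= X -> exists n, X * (2^-1) ^+ n < e.
Proof.
move=> e0 X0.
have [|||N /(_ N (leqnn N)) H] := @exp_small 2^-1 (e / (X + 1)); [lra|lra| |].
  by rewrite divr_gt0 //; lra.
exists N; have := ler_wpM2l X0 H.
have : X * (e / (X + 1)) < e by rewrite mulrA ltr_pdivrMr; nra.
lra.
Qed.

(** Goursat's bisection argument, for an arbitrary additive function of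
    rectangles that is small compared to the square of the size. *)
Lemma goursat (I : R -> R -> R -> R -> R[i]) (a0 c0 w h : R) :
  0 <= w -> 0 <= h ->
  (forall a m b c d, I a b c d = I a m c d + I m b c d) ->
  (forall a b c m d, I a b c d = I a b c m + I a b m d) ->
  (forall x0 y0 e, a0 <= x0 <= a0 + w -> c0 <= y0 <= c0 + h -> 0 < e ->
     exists2 dl, 0 < dl & forall a b c d, a0 <= a -> a <= x0 <= b -> b <= a0 + w ->
       c0 <= c -> c <= y0 <= d -> d <= c0 + h -> b - a < dl -> d - c < dl ->
       nc (I a b c d) <= e * ((b - a) + (d - c)) ^+ 2) ->
  I a0 (a0 + w) c0 (c0 + h) = 0.
Proof.
move=> w0 h0 Ix Iy loc.
apply/eqP; rewrite -nc_eq0; apply/negPn/negP => mu0.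
pose mu := nc (I a0 (a0 + w) c0 (c0 + h)).
have {mu0}mu0 : 0 < mu by rewrite lt_def mu0 nc_ge0.
pose u n : R := (2^-1) ^+ n.
have u0 n : 0 < u n by rewrite exprn_gt0.
have uS n : u n = 2 * u n.+1 by rewrite /u exprS mulrA divff ?mul1r.
pose good n (p : R * R) := [/\ a0 <= p.1, p.1 + w * u n <= a0 + w, c0 <= p.2,
  p.2 + h * u n <= c0 + h &
  mu * u n ^+ 2 <= nc (I p.1 (p.1 + w * u n) p.2 (p.2 + h * u n))].
pose nested n (p p' : R * R) := [/\ p.1 <= p'.1, p'.1 + w * u n.+1 <= p.1 + w * u n,
  p.2 <= p'.2 & p'.2 + h * u n.+1 <= p.2 + h * u n].
have step n p : good n p -> exists p', good n.+1 p' /\ nested n p p'.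
  case: p => a c [/= g1 g2 g3 g4 g5].
  pose m := a + w * u n.+1; pose k := c + h * u n.+1.
  have wu := mulr_ge0 w0 (ltW (u0 n.+1)); have hu := mulr_ge0 h0 (ltW (u0 n.+1)).
  have mE : a + w * u n = m + w * u n.+1 by rewrite /m uS; ring.
  have kE : c + h * u n = k + h * u n.+1 by rewrite /k uS; ring.
  move: g5; rewrite mE kE => g5.
  have [] : [\/ mu * u n.+1 ^+ 2 <= nc (I a m c k),
     mu * u n.+1 ^+ 2 <= nc (I m (m + w * u n.+1) c k),
     mu * u n.+1 ^+ 2 <= nc (I a m k (k + h * u n.+1)) |
     mu * u n.+1 ^+ 2 <= nc (I m (m + w * u n.+1) k (k + h * u n.+1))].
    have [?|L1] := leP (mu * u n.+1 ^+ 2) (nc (I a m c k)); first exact: Or41.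
    have [?|L2] := leP (mu * u n.+1 ^+ 2) (nc (I m (m + w * u n.+1) c k)); first exact: Or42.
    have [?|L3] := leP (mu * u n.+1 ^+ 2) (nc (I a m k (k + h * u n.+1))); first exact: Or43.
    have [?|L4] := leP (mu * u n.+1 ^+ 2) (nc (I m (m + w * u n.+1) k (k + h * u n.+1))); first exact: Or44.
    exfalso; move: g5; rewrite (Ix a m) (Iy a m c k) (Iy m _ c k) (uS n) exprMn.
    set A := I a m c k in L1 *; set B := I m _ c k in L2 *.
    set C := I a m k _ in L3 *; set D := I m _ k _ in L4 *.
    have := ncD (A + C) (B + D); have := ncD A C; have := ncD B D; lra.
  - by exists (a, c); split; split => //=; rewrite ?(uS n) in g2 g4 *; lra.
  - by exists (m, c); split; split => //=; rewrite ?(uS n) in g2 g4 *; rewrite /m; lra.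
  - by exists (a, k); split; split => //=; rewrite ?(uS n) in g2 g4 *; rewrite /k; lra.
  - by exists (m, k); split; split => //=; rewrite ?(uS n) in g2 g4 *; rewrite /m /k; lra.
pose nxt n p := xget p [set p' | good n.+1 p' /\ nested n p p'].
pose p := fix p n := if n is n'.+1 then nxt n' (p n') else (a0, c0).
have gp n : good n (p n).
  elim: n => [|n IH]; first by rewrite /good /= /u expr0 !mulr1 expr1n mulr1.
  by rewrite /= /nxt; case: xgetP => [p' -> [] //|]; have [p' H] := step _ _ IH => /(_ p').
have np n : nested n (p n) (p n.+1).
  rewrite /= /nxt; case: xgetP => [p' -> [] //|].
  by have [p' H] := step _ _ (gp n) => /(_ p').
have lim (f : nat -> R) (v : R) : 0 <= v ->
  (forall n, f n <= f n.+1) -> (forall n, f n.+1 + v * u n.+1 <= f n + v * u n) ->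
  exists x, forall n, f n <= x <= f n + v * u n.
  move=> v0 f1 f2.
  have mono m n : (m <= n)%N -> f m <= f n.
    by move=> /subnK <-; elim: (n - m)%N => // j IH; rewrite addSn (le_trans IH).
  have anti m n : (m <= n)%N -> f n + v * u n <= f m + v * u m.
    by move=> /subnK <-; elim: (n - m)%N => // j IH; rewrite addSn (le_trans _ IH).
  have fb m n : f m <= f n + v * u n.
    have vu k : 0 <= v * u k by rewrite mulr_ge0 // ltW.
    case: (leqP m n) => [mn|/ltnW nm].
      by rewrite (le_trans (mono _ _ mn)) // lerDl.
    by rewrite (le_trans _ (anti _ _ nm)) // lerDl.
  exists (sup (range f)) => n; apply/andP; split.
    apply: ub_le_sup; last by exists n.
    by exists (f 0%N + v * u 0%N) => _ [m _ <-].
  by apply: ge_sup; [exists (f 0%N); exists 0%N|move=> _ [m _ <-]].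
have [||x0 Hx] := lim (fun n => (p n).1) w w0; [by move=> n; case: (np n)|by move=> n; case: (np n)|].
have [||y0 Hy] := lim (fun n => (p n).2) h h0; [by move=> n; case: (np n)|by move=> n; case: (np n)|].
have X0 : 0 <= w + h by rewrite addr_ge0.
pose e := mu / (2 * ((w + h) ^+ 2 + 1)).
have D0 : 0 < 2 * ((w + h) ^+ 2 + 1) by have := sqr_ge0 (w + h); lra.
have e0 : 0 < e by rewrite divr_gt0.
have := Hx 0%N; have := Hy 0%N; rewrite /= /u expr0 !mulr1 => y0b x0b.
have [dl dl0 H] := loc x0 y0 e x0b y0b e0.
have [n nsmall] := half_pow_small dl0 X0.
have wu : w * u n < dl by rewrite (le_lt_trans _ nsmall) // ler_wpM2r ?(ltW (u0 n)) // lerDl.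
have hu : h * u n < dl by rewrite (le_lt_trans _ nsmall) // ler_wpM2r ?(ltW (u0 n)) // lerDr.
case: (gp n) => g1 g2 g3 g4 g5.
have {H} := H _ _ _ _ g1 (Hx n) g2 g3 (Hy n) g4.
have -> : (p n).1 + w * u n - (p n).1 = w * u n by ring.
have -> : (p n).2 + h * u n - (p n).2 = h * u n by ring.
move=> /(_ wu hu) /(le_trans g5).
have -> : (w * u n + h * u n) ^+ 2 = (w + h) ^+ 2 * u n ^+ 2 by ring.
rewrite [e * _]mulrA ler_pM2r ?exprn_gt0 // leNgt => /negP; apply.
rewrite /e mulrAC ltr_pdivrMr // ltr_pM2l //; have := sqr_ge0 (w + h); lra.
Qed.

End RectangleLemma.


Section CauchyFormula.
Context {R : realType}.
Local Open Scope complex_scope.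
Implicit Types (F : R[i] -> R[i]) (t : R).

Lemma ctsR_comp F (U : R -> R[i]) : ctsR U -> (forall t, ccont F (U t)) ->
  ctsR (fun t => F (U t)).
Proof.
move=> cU cF x e e0; have [d d0 Hd] := cF x e e0.
have [d' d0' Hd'] := cU x (d / 2) (divr_gt0 d0 (ltr0n _ 2)).
exists d' => // y /Hd' K; have := Hd (U y - U x).
by rewrite [U x + _]addrC subrK; apply; lra.
Qed.

Lemma cint_near (u V v : R -> R[i]) a b M : ctsR u -> 0 <= a -> a <= b ->
  (forall x, a <= x <= b -> hdR V x (v x)) ->
  (forall x, a <= x <= b -> nc (u x - v x) <= M) ->
  nc (cint u a b - (V b - V a)) <= 2 * M * (b - a).
Proof.
move=> cu a0 ab dV uv.
have -> : cint u a b - (V b - V a) = (prim u b + (-1) * V b) - (prim u a + (-1) * V a).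
  by rewrite /cint; ring.
apply: (@increment _ (fun x => prim u x + (-1) * V x) (fun x => u x + (-1) * v x)) => //.
  move=> x xab; apply: hdRD; last by apply: hdRZ; exact: dV.
  by apply: primP => //; move/andP: xab => [+ _]; exact: le_trans.
by move=> x /uv; rewrite mulN1r.
Qed.

Definition expi t : R[i] := (cos t)%:C + 'i * (sin t)%:C.

Lemma hdR_expi t : hdR expi t ('i * expi t).
Proof.
apply: (@hdR_eq _ _ _ ((- sin t)%:C + 'i * (cos t)%:C)).
  rewrite /expi rmorphN /= mulrDr mulrA -expr2 sqr_i; ring.
apply: hdRD; first by apply/hdRP; exact: is_derive_cos.
by apply: hdRZ; apply/hdRP; exact: is_derive_sin.
Qed.

Lemma nc_expi t : nc (expi t) = 1.
Proof.
rewrite /expi /nc /=; set A := (X in Num.sqrt X).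
have -> : A = 1; last by rewrite sqrtr1.
by rewrite /A -[RHS](cos2Dsin2 t); ring.
Qed.

Lemma expi_neq0 t : expi t != 0.
Proof. by rewrite -nc_gt0 nc_expi. Qed.

Lemma expi_2pi : expi (2 * pi) = expi 0.
Proof. by rewrite /expi mulr_natl cos2pi sin2pi cos0 sin0. Qed.

Lemma hdR_embed t : hdR (fun x => x%:C) t 1.
Proof.
move=> e e0; exists 1 => // h _.
have -> : (t + h)%:C - t%:C - 1 * h%:C = 0 by rewrite rmorphD /=; ring.
by rewrite nc0 mulr_ge0 // ltW.
Qed.

Lemma hdR_scaled_expi (s : R) t : hdR (fun x => s%:C * expi x) t ('i * (s%:C * expi t)).
Proof. by apply: (@hdR_eq _ _ _ (s%:C * ('i * expi t))); [ring|apply: hdRZ; exact: hdR_expi]. Qed.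

(** A circle is contracted to a centre by the factor lambda, which takes its
    values in ]0, 1] and is smooth on the whole line. *)
Definition lambda t : R := (1 + t ^+ 2)^-1.

Lemma lambda_den_gt0 t : 0 < 1 + t ^+ 2.
Proof. by have := sqr_ge0 t; lra. Qed.

Lemma lambda_gt0 t : 0 < lambda t.
Proof. by rewrite invr_gt0 lambda_den_gt0. Qed.

Lemma lambda_le1 t : lambda t <= 1.
Proof. by rewrite invf_le1 ?lambda_den_gt0 // lerDl sqr_ge0. Qed.

Definition dlog_lambda t : R := - (2 * t) * lambda t.

Lemma dlog_lambda_le1 t : `|dlog_lambda t| <= 1.
Proof.
rewrite normrM normrN [`|lambda t|]gtr0_norm ?lambda_gt0 // /lambda.
rewrite ler_pdivrMr ?lambda_den_gt0 // mul1r ler_norml; apply/andP.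
by have := sqr_ge0 (t - 1); have := sqr_ge0 (t + 1); rewrite !expr2; split; lra.
Qed.

Lemma hdR_lambda t : hdR (fun x => (lambda x)%:C) t (dlog_lambda t * lambda t)%:C.
Proof.
have E x : (lambda x)%:C = (1 + x%:C * x%:C)^-1.
  by rewrite /lambda fmorphV rmorphD rmorph1 rmorphXn expr2.
have n0 : 1 + t%:C * t%:C != 0.
  by rewrite -invr_eq0 -E fmorph_eq0 gt_eqF ?lambda_gt0.
have := hd_hdR (hdR_embed t) (hd_comp (hdD (hd_cst 1 t%:C) (hdM (hd_id t%:C) (hd_id t%:C))) (hdV n0)).
move=> H; apply: (@hdR_eq _ _ _ (- ((1 + id t%:C * id t%:C)^-1 * (1 + id t%:C * id t%:C)^-1) *
   (0 + (1 * id t%:C + id t%:C * 1)) * 1)).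
  by rewrite /dlog_lambda !rmorphM rmorphN rmorphM rmorph_nat /= E; ring.
by apply: hdR_ext H => x /=; rewrite E.
Qed.

Lemma lambda_lip t t' : `|lambda t - lambda t'| <= `|t - t'|.
Proof.
have h := lambda_den_gt0 t; have h' := lambda_den_gt0 t'.
have -> : lambda t - lambda t' = (t - t') * (- (t + t') / ((1 + t ^+ 2) * (1 + t' ^+ 2))).
  by rewrite /lambda; field; rewrite !gt_eqF.
rewrite normrM ler_piMr // normrM normfV [`|_ * (1 + t' ^+ 2)|]gtr0_norm ?mulr_gt0 //.
rewrite ler_pdivrMr ?mulr_gt0 // mul1r normrN ler_norml !expr2; apply/andP.
by split; have := sqr_ge0 (t - 1); have := sqr_ge0 (t + 1); have := sqr_ge0 (t' - 1);
  have := sqr_ge0 (t' + 1); have := sqr_ge0 (t * t'); have := sqr_ge0 t; have := sqr_ge0 t';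
  rewrite !expr2; lra.
Qed.

Section Circle.
Variables (F : R[i] -> R[i]) (s r : R) (a : R[i]).
Hypotheses (s0 : 0 < s) (sr : s < r) (hF : forall z, nc z < r -> exists l, hd F z l)
  (as_ : nc a < s).

Let zc t := s%:C * expi t.
Let nzc t : nc (zc t) = s.
Proof. by rewrite ncM ncR nc_expi mulr1 gtr0_norm. Qed.
Let zca t : s - nc a <= nc (zc t - a).
Proof. by have := nc_sub_ge (zc t) a; rewrite nzc. Qed.
Let zca0 t : zc t - a != 0.
Proof. by rewrite -nc_gt0; apply: lt_le_trans (zca t); rewrite subr_gt0. Qed.
Let zeta x t := a + (lambda x)%:C * (zc t - a).
Let kap t := 'i * zc t / (zc t - a).
Let Kk := s / (s - nc a).
Let Kk0 : 0 < Kk. Proof. by rewrite divr_gt0 // subr_gt0. Qed.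

Let nkap t : nc (kap t) <= Kk.
Proof.
rewrite /kap ncM [nc ('i * _)]ncM ncV nc_i mul1r nzc /Kk ler_pM2l // lef_pV2 ?posrE ?nc_gt0 ?subr_gt0 //.
Qed.

Let nzeta x t : nc (zeta x t) <= s.
Proof.
have -> : zeta x t = (1 - lambda x)%:C * a + (lambda x)%:C * zc t.
  by rewrite /zeta rmorphB rmorph1; ring.
apply: (le_trans (ncD _ _)); rewrite 2!ncM [X in _ + _ * X]nzc !ncR.
have l0 := lambda_gt0 x; have l1 := lambda_le1 x.
have l2 : 0 <= 1 - lambda x by rewrite subr_ge0.
have l3 : 0 <= s - nc a by rewrite subr_ge0 ltW.
by rewrite [`|1 - _|]ger0_norm // gtr0_norm //; have := mulr_ge0 l2 l3; lra.
Qed.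

Let cF x t : ccont F (zeta x t).
Proof. by have [l /hd_cont] := hF (le_lt_trans (nzeta x t) sr). Qed.

Let dzc t : hdR zc t ('i * zc t). Proof. exact: hdR_scaled_expi. Qed.

Let dzeta1 x t : hdR (zeta^~ t) x ((dlog_lambda x * lambda x)%:C * (zc t - a)).
Proof.
have := hdRZ (zc t - a) (hdR_lambda x); rewrite mulrC => /(hd_hdR) H.
have := H (fun w => a + w) 1; rewrite mul1r.
move=> K; apply: hdR_ext (K _); first by move=> y; rewrite /zeta; ring.
have := hdD (hd_cst a ((zc t - a) * (lambda x)%:C)) (hd_id ((zc t - a) * (lambda x)%:C)).
by rewrite add0r.
Qed.

Let dzeta2 x t : hdR (zeta x) t ((lambda x)%:C * ('i * zc t)).
Proof.
have H := hdRD (hdRZ (lambda x)%:C (dzc t)) (hdRZ (a - (lambda x)%:C * a) (hdRZ 0 (hdR_embed t))).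
have : hdR (fun y => (lambda x)%:C * zc y + (a - (lambda x)%:C * a)) t ((lambda x)%:C * ('i * zc t)).
  move=> e e0; have [d d0 Hd] := hdRZ (lambda x)%:C (dzc t) e0.
  exists d => // h /Hd; congr (nc (_ - _) <= _); ring.
by apply: hdR_ext => y; rewrite /zeta; ring.
Qed.

Let dkap t : exists l, hd (fun w => 'i * w / (w - a)) (zc t) l.
Proof.
eexists; apply: hdM; first by apply: hdZ; exact: hd_id.
apply: (@hd_comp _ (fun w => w^-1) (fun w => w - a)).
  by apply: hdB; [exact: hd_id|exact: hd_cst].
exact: hdV.
Qed.

Let czc : ctsR zc.
Proof. exact: (hdR_ctsR dzc). Qed.

Let ckap : ctsR kap.
Proof.
apply: (@ctsR_comp (fun w => 'i * w / (w - a)) zc czc) => t.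
by have [l /hd_cont] := dkap t.
Qed.

Let cdlog : ctsR (fun t => (dlog_lambda t)%:C).
Proof.
have -> : (fun t => (dlog_lambda t)%:C) = (fun t => ((-2)%:C * t%:C) * (lambda t)%:C).
  by apply/funext => t; rewrite /dlog_lambda -!rmorphM; congr (_%:C); ring.
apply: ctsRM; last exact: (hdR_ctsR hdR_lambda).
apply: ctsRM; first exact: ctsR_cst.
exact: (hdR_ctsR hdR_embed).
Qed.

Let P t x := F (zeta x t) * (dlog_lambda x)%:C.
Let Q x t := F (zeta x t) * kap t.

Let cP t : ctsR (P t).
Proof.
apply: ctsRM => //; apply: (@ctsR_comp F (zeta^~ t)) => [|x]; last exact: cF.
exact: (hdR_ctsR (fun x => dzeta1 x t)).
Qed.

Let cQ x : ctsR (Q x).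
Proof.
apply: ctsRM => //; apply: (@ctsR_comp F (zeta x)) => [|t]; last exact: cF.
exact: (hdR_ctsR (fun t => dzeta2 x t)).
Qed.

Let I x x' t t' := cint (P t) x x' + cint (Q x') t t' - cint (P t') x x' - cint (Q x) t t'.

Let zlip x t x' t' : nc (zeta x t - zeta x' t') <= 4 * s * (`|x - x'| + `|t - t'|).
Proof.
have -> : zeta x t - zeta x' t' = (lambda x - lambda x')%:C * (zc t - a) +
   (lambda x')%:C * (zc t - zc t') by rewrite /zeta rmorphB; ring.
apply: (le_trans (ncD _ _)); rewrite 2!ncM 2!ncR.
have H1 := lambda_lip x x'.
have H2 : nc (zc t - a) <= 2 * s by by apply: (le_trans (ncB _ _)); rewrite nzc; have := as_; lra.
have H3 : nc (zc t - zc t') <= 2 * s * `|t - t'|.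
  wlog tt : t t' {H2} / t' <= t => [H|].
    have [/H//|/ltW/H] := leP t' t; by rewrite ncBC distrC.
  rewrite [`|_|]ger0_norm ?subr_ge0 //.
  by apply: (@increment _ zc (fun t => 'i * zc t)) => // y _; rewrite ncM nc_i mul1r nzc.
have H4 : `|lambda x'| <= 1 by rewrite gtr0_norm ?lambda_gt0 // lambda_le1.
have P1 := ler_pM (normr_ge0 _) (nc_ge0 _) H1 H2.
have P2 := ler_pM (normr_ge0 _) (nc_ge0 _) H4 H3.
have : 0 <= s * `|x - x'| by rewrite mulr_ge0 // ltW.
have : 0 <= s * `|t - t'| by rewrite mulr_ge0 // ltW.
lra.
Qed.

(** The form F(zeta) dzeta / (zeta - a), pulled back to the (x, t) plane, is
    closed: near each point it differs from an exact one by an error of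
    second order. *)
Let I0 X T : 0 <= X -> 0 <= T -> I 0 X 0 T = 0.
Proof.
move=> X0 T0; rewrite -[X]add0r -[T]add0r; apply: goursat => //.
- by move=> x m x' t t'; rewrite /I -!(cint_chain _ x m x'); ring.
- by move=> x x' t m t'; rewrite /I -!(cint_chain _ t m t'); ring.
move=> x0 t0 e; rewrite !add0r => x0b t0b e0.
have [l hl] := hF (le_lt_trans (nzeta x0 t0) sr).
pose K := 16 * s * (1 + Kk).
have K0 : 0 < K by rewrite /K !mulr_gt0 // addr_gt0.
have [d d0 Hd] := hl (e / K) (divr_gt0 e0 K0).
exists (d / (8 * s)) => [|x x' t t' x1 /andP[x2 x3] x4 t1 /andP[t2 t3] t4].
  by rewrite divr_gt0 // mulr_gt0.
have s8 : 0 < 8 * s by rewrite mulr_gt0.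
rewrite !ltr_pdivlMr // => xd td.
pose D := (x' - x) + (t' - t).
have D0 : 0 <= D by rewrite /D; lra.
pose Fl w := F (zeta x0 t0) + l * (w - zeta x0 t0).
have near y u : x <= y <= x' -> t <= u <= t' ->
    nc (F (zeta y u) - Fl (zeta y u)) <= e / K * (4 * s * D).
  move=> /andP[y1 y2] /andP[u1 u2].
  have Z : nc (zeta y u - zeta x0 t0) <= 4 * s * D.
    apply: (le_trans (zlip _ _ _ _)); rewrite ler_pM2l ?mulr_gt0 //.
    by rewrite lerD // ler_norml; apply/andP; split; lra.
  have /Hd : nc (zeta y u - zeta x0 t0) < d by apply: (le_lt_trans Z); rewrite /D; lra.
  rewrite [zeta x0 t0 + _]addrC subrK => H.
  have -> : F (zeta y u) - Fl (zeta y u) = F (zeta y u) - F (zeta x0 t0) - l * (zeta y u - zeta x0 t0).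
    by rewrite /Fl; ring.
  apply: (le_trans H); rewrite ler_pM2l // divr_gt0 //.
pose M := e / K * (4 * s * D).
have M0 : 0 <= M by rewrite /M !mulr_ge0 // ?invr_ge0 ltW.
pose A := F (zeta x0 t0) - l * (zeta x0 t0 - a).
have sideP u : t <= u <= t' ->
   nc (cint (P u) x x' - ((A * prim (fun y => (dlog_lambda y)%:C) x' + l * zeta x' u) -
      (A * prim (fun y => (dlog_lambda y)%:C) x + l * zeta x u))) <= 2 * M * (x' - x).
  move=> ut; apply: (@cint_near (P u) (fun y => A * prim (fun y => (dlog_lambda y)%:C) y + l * zeta y u)
     (fun y => Fl (zeta y u) * (dlog_lambda y)%:C)) => //; first lra.
  - move=> y /andP[y1 _].
    apply: (@hdR_eq _ _ _ (A * (dlog_lambda y)%:C + l * ((dlog_lambda y * lambda y)%:C * (zc u - a)))).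
      by rewrite [(_ * lambda y)%:C]rmorphM /A /Fl /zeta /=; ring.
    apply: hdRD; apply: hdRZ => //; apply: primP => //; lra.
  - move=> y yx; rewrite /P -mulrBl ncM ncR -[M]mulr1.
    by apply: ler_pM; rewrite ?nc_ge0 // ?dlog_lambda_le1 //; exact: near.
have sideQ y : x <= y <= x' ->
   nc (cint (Q y) t t' - ((A * prim kap t' + l * zeta y t') -
      (A * prim kap t + l * zeta y t))) <= 2 * (M * Kk) * (t' - t).
  move=> yx; apply: (@cint_near (Q y) (fun u => A * prim kap u + l * zeta y u)
     (fun u => Fl (zeta y u) * kap u)) => //; first lra.
  - move=> u /andP[u1 _].
    apply: (@hdR_eq _ _ _ (A * kap u + l * ((lambda y)%:C * ('i * zc u)))).
      rewrite /A /Fl /zeta /kap; field; exact: zca0.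
    apply: hdRD; apply: hdRZ => //; apply: primP => //; lra.
  - move=> u ut; rewrite /Q -mulrBl ncM.
    by apply: ler_pM; rewrite ?nc_ge0 //; exact: near.
have xx : x <= x <= x' by rewrite lexx; lra.
have xx' : x <= x' <= x' by rewrite lexx andbT; lra.
have tt : t <= t <= t' by rewrite lexx; lra.
have tt' : t <= t' <= t' by rewrite lexx andbT; lra.
have := sideP _ tt; have := sideP _ tt'; have := sideQ _ xx; have := sideQ _ xx'.
set q1 := cint (Q x') t t' - _; set q2 := cint (Q x) t t' - _.
set p1 := cint (P t') x x' - _; set p2 := cint (P t) x x' - _.
have -> : I x x' t t' = p2 + q1 - p1 - q2 by rewrite /I /p1 /p2 /q1 /q2; ring.
move=> h1 h2 h3 h4.
apply: (le_trans (ncB _ _)); apply: (le_trans (lerD (ncB _ _) (lexx _))).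
apply: (le_trans (lerD (lerD (ncD _ _) (lexx _)) (lexx _))).
have S1 : 0 <= M * (x' - x) by rewrite mulr_ge0 //; lra.
have S2 : 0 <= M * (t' - t) by rewrite mulr_ge0 //; lra.
have S3 : 0 <= M * Kk * (x' - x) by apply: mulr_ge0; [exact: mulr_ge0 M0 (ltW Kk0)|lra].
have S4 : 0 <= M * Kk * (t' - t) by apply: mulr_ge0; [exact: mulr_ge0 M0 (ltW Kk0)|lra].
have E : e * D ^+ 2 = 4 * M * (1 + Kk) * D.
  by rewrite /M /K; field; rewrite !gt_eqF // ?addr_gt0.
rewrite E (_ : D = (x' - x) + (t' - t)) //; lra.
Qed.

Let Qcst X : 0 <= X -> cint (Q X) 0 (2 * pi) = cint (Q 0) 0 (2 * pi).
Proof.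
move=> X0; have p0 : 0 <= 2 * pi :> R by rewrite mulr_ge0 ?pi_ge0.
have := I0 X0 p0; rewrite /I.
have -> : P (2 * pi) = P 0 by apply/funext => x; rewrite /P /zeta /zc expi_2pi.
set A := cint (P 0) 0 X => E; apply/eqP; rewrite -subr_eq0 -E; apply/eqP; ring.
Qed.

(** Cauchy's formula: letting X tend to infinity shrinks the circle to a. *)
Lemma cauchy_formula :
  cint (fun t => F (zc t) * kap t) 0 (2 * pi) = F a * cint kap 0 (2 * pi).
Proof.
have p0 : 0 <= 2 * pi :> R by rewrite mulr_ge0 ?pi_ge0.
have pp : 0 < 2 * pi :> R by rewrite mulr_gt0 ?pi_gt0.
have -> : (fun t => F (zc t) * kap t) = Q 0.
  apply/funext => t; rewrite /Q /zeta /lambda expr0n addr0 invr1 rmorph1 mul1r.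
  by rewrite [a + _]addrC subrK.
apply/eqP; rewrite -subr_eq0; apply/eqP; apply: ncP => e e0.
have ra : nc a < r by apply: lt_trans sr.
have [l /hd_cont cFa] := hF ra.
pose B := 2 * Kk * (2 * pi).
have B0 : 0 < B by apply: mulr_gt0 pp; apply: mulr_gt0 Kk0.
have [d d0 Hd] := cFa (e / B) (divr_gt0 e0 B0).
pose X := 2 * s / d + 1.
have X1 : 1 <= X by rewrite /X lerDr divr_ge0 ?mulr_ge0 ?ltW.
have X0 : 0 <= X by apply: le_trans X1.
have lX : lambda X * (2 * s) < d.
  rewrite /lambda mulrC ltr_pdivrMr ?lambda_den_gt0 // [d * _]mulrC -ltr_pdivrMr //.
  have -> : 2 * s / d = X - 1 by rewrite /X; ring.
  rewrite expr2; nra.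
rewrite -(Qcst X0) -cintZ //.
have -> : cint (fun t => F a * kap t) 0 (2 * pi) = F a * prim kap (2 * pi) - F a * prim kap 0.
  by rewrite cintZ // /cint; ring.
apply: (@le_trans _ _ (2 * (e / B * Kk) * (2 * pi - 0))).
  apply: (@cint_near (Q X) (fun t => F a * prim kap t) (fun t => F a * kap t)) => //.
    by move=> t /andP[t1 _]; apply: hdRZ; exact: primP.
  move=> t _; rewrite /Q -mulrBl ncM; apply: ler_pM; rewrite ?nc_ge0 //.
  apply: Hd; rewrite ncM ncR gtr0_norm ?lambda_gt0 //; apply: le_lt_trans lX.
  rewrite ler_pM2l ?lambda_gt0 //; by apply: (le_trans (ncB _ _)); rewrite nzc; have := as_; lra.
have -> : 2 * (e / B * Kk) * (2 * pi - 0) = e / B * (2 * Kk * (2 * pi)) by ring.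
by rewrite -/B divfK // gt_eqF.
Qed.

End Circle.

End CauchyFormula.


Section PowerSeries.
Context {R : realType}.
Local Open Scope complex_scope.
Implicit Types (F : R[i] -> R[i]) (a : nat -> R[i]).

Definition clim (u : nat -> R[i]) l := forall e : R, 0 < e ->
  exists N, forall n, (N <= n)%N -> nc (u n - l) <= e.

Definition psum a z l := clim (fun n => \sum_(k < n) a k * z ^+ k) l.

Definition hol F c (r : R) := forall z, nc (z - c) < r -> exists l, hd F z l.

Lemma clim_unique u l l' : clim u l -> clim u l' -> l = l'.
Proof.
move=> h h'; apply/eqP; rewrite -subr_eq0; apply/eqP; apply: ncP => e e0.
have e2 : 0 < e / 2 by lra.
have [N H] := h _ e2; have [N' H'] := h' _ e2.
have := H _ (leq_maxl N N'); have := H' _ (leq_maxr N N').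
set n := maxn _ _ => H1 H2.
have -> : l - l' = (u n - l') - (u n - l) by ring.
by rewrite (le_trans (ncB _ _)) //; lra.
Qed.

Lemma psum_unique a z l l' : psum a z l -> psum a z l' -> l = l'.
Proof. exact: clim_unique. Qed.

Lemma climD u v l m : clim u l -> clim v m -> clim (fun n => u n + v n) (l + m).
Proof.
move=> hu hv e e0; have e2 : 0 < e / 2 by lra.
have [N H] := hu _ e2; have [N' H'] := hv _ e2.
exists (maxn N N') => n; rewrite geq_max => /andP[/H Hn /H' Hn'].
have -> : u n + v n - (l + m) = (u n - l) + (v n - m) by ring.
by rewrite (le_trans (ncD _ _)) //; lra.
Qed.

Lemma climZ c u l : clim u l -> clim (fun n => c * u n) (c * l).
Proof.
move=> hu e e0; have c0 : 0 < nc c + 1 by have := nc_ge0 c; lra.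
have [N H] := hu _ (divr_gt0 e0 c0); exists N => n /H Hn.
rewrite -mulrBr ncM; apply: (le_trans (ler_wpM2l (nc_ge0 c) Hn)).
rewrite mulrA ler_pdivrMr // mulrC ler_wpM2l ?ltW //; lra.
Qed.

Lemma clim_ext u v l : (forall n, u n = v n) -> clim u l -> clim v l.
Proof. by move=> E H ? /H [N HN]; exists N => n /HN; rewrite E. Qed.

Lemma clim_cst c : clim (fun=> c) c.
Proof. by move=> e e0; exists 0%N => n _; rewrite subrr nc0 ltW. Qed.

Lemma clim_bound u l : clim u l -> exists M, forall n, nc (u n) <= M.
Proof.
move=> /(_ 1 ltr01) [N H].
exists (\sum_(i < N) nc (u i) + (nc l + 1)) => n.
have S0 : 0 <= \sum_(i < N) nc (u i) by apply: sumr_ge0 => i _; exact: nc_ge0.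
have [nN|Nn] := ltnP n N.
  have : nc (u n) <= \sum_(i < N) nc (u i).
    rewrite (bigD1 (Ordinal nN)) //= lerDl; apply: sumr_ge0 => i _; exact: nc_ge0.
  by have := nc_ge0 l; lra.
have := H _ Nn; rewrite -{2}(subrK l (u n)) => K.
by have := ncD (u n - l) l; lra.
Qed.

Lemma clim_le u l (M : R) : clim u l -> (forall n, nc (u n) <= M) -> nc l <= M.
Proof.
move=> hu H; apply/ler_addgt0Pr => e e0; have [N /(_ _ (leqnn N)) K] := hu e e0.
have -> : l = u N - (u N - l) by ring.
by apply: (le_trans (ncB _ _)); have := H N; lra.
Qed.

Lemma R_complete_eps (f : nat -> R) : (forall e : R, 0 < e -> exists N, forall m n,
    (N <= m)%N -> (N <= n)%N -> `|f m - f n| <= e) -> exists l : R, f @ \oo --> l.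
Proof.
move=> H; suff /cauchy_cvgP /cvg_ex [l Hl] : cauchy (f @ \oo) by exists l.
apply/cauchy_ballP => e e0; have [N HN] := H (e / 2) (divr_gt0 e0 (ltr0n _ 2)).
rewrite near_map2; near=> m n => /=.
rewrite /ball /=; apply: (@le_lt_trans _ _ (e / 2)); last lra.
by apply: HN; [near: m|near: n]; exists N.
Unshelve. all: by end_near.
Qed.

Lemma C_complete u : (forall e : R, 0 < e -> exists N, forall m n, (N <= m)%N -> (N <= n)%N ->
   nc (u m - u n) <= e) -> exists l, clim u l.
Proof.
move=> H.
have [|lr Hr] := @R_complete_eps (fun n => cRe (u n)).
  move=> e /H [N HN]; exists N => m n Nm Nn; apply: le_trans (HN m n Nm Nn).
  by case: (u m) (u n) => a b [c d]; exact: (Re_le_nc ((a +i* b) - (c +i* d))).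
have [|li Hi] := @R_complete_eps (fun n => cIm (u n)).
  move=> e /H [N HN]; exists N => m n Nm Nn; apply: le_trans (HN m n Nm Nn).
  by case: (u m) (u n) => a b [c d]; exact: (Im_le_nc ((a +i* b) - (c +i* d))).
exists (lr +i* li) => e e0; have e2 : 0 < e / 2 by lra.
move/cvgrPdist_le : Hr => /(_ _ e2) [N _ HN].
move/cvgrPdist_le : Hi => /(_ _ e2) [N' _ HN'].
exists (maxn N N') => n; rewrite geq_max => /andP[/HN /= K /HN' /= K'].
apply: (le_trans (nc_le_ReIm _)); move: K K'; case: (u n) => x y /=.
by rewrite [`|lr - _|]distrC [`|li - _|]distrC; lra.
Qed.

Lemma geo_sum (q : R) n m : 0 <= q -> q < 1 ->
  \sum_(n <= k < m) q ^+ k <= q ^+ n / (1 - q).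
Proof.
move=> q0 q1; have q10 : 0 < 1 - q by lra.
have [nm|mn] := leqP n m; last first.
  by rewrite big_geq ?(ltnW mn) // divr_ge0 ?exprn_ge0 // ltW.
rewrite ler_pdivlMr //.
have -> : (\sum_(n <= k < m) q ^+ k) * (1 - q) = q ^+ n - q ^+ m.
  elim: m nm => [|m IH]; first by rewrite leqn0 => /eqP ->; rewrite big_geq // mul0r subrr.
  rewrite leq_eqVlt => /predU1P[->|]; first by rewrite big_geq // mul0r subrr.
  by rewrite ltnS => nm; rewrite big_nat_recr //= mulrDl IH // exprS; ring.
by rewrite gerDl oppr_le0 exprn_ge0.
Qed.

(** Linear growth is absorbed by a slightly larger ratio (Bernoulli). *)
Lemma lin_geo (q q1 : R) : 0 < q -> q < q1 ->
  exists2 C : R, 0 < C & forall k, k%:R * q ^+ k <= C * q1 ^+ k.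
Proof.
move=> q0 qq; pose d := q1 / q - 1.
have d0 : 0 < d by rewrite /d subr_gt0 ltr_pdivlMr // mul1r.
exists d^-1 => [|k]; first by rewrite invr_gt0.
have q1E : q1 = q * (1 + d) by rewrite /d addrC subrK mulrC divfK // gt_eqF.
have bern : k%:R * d <= (1 + d) ^+ k.
  suff : 1 + k%:R * d <= (1 + d) ^+ k by lra.
  elim: k => [|k IH]; first by rewrite mul0r addr0 expr0.
  rewrite exprS; apply: (@le_trans _ _ ((1 + d) * (1 + k%:R * d))); last first.
    by rewrite ler_wpM2l //; lra.
  rewrite -natr1; have : 0 <= k%:R * (d * d) by rewrite !mulr_ge0 // ltW.
  lra.
rewrite q1E exprMn mulrCA mulrC ler_wpM2l ?exprn_ge0 ?(ltW q0) // mulrC ler_pdivlMr //.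
Qed.

Lemma clim_abs (b : nat -> R[i]) (M q : R) : 0 <= q -> q < 1 -> 0 <= M ->
  (forall k, nc (b k) <= M * q ^+ k) ->
  exists2 l, clim (fun n => \sum_(k < n) b k) l &
    forall n, nc (l - \sum_(k < n) b k) <= M * (q ^+ n / (1 - q)).
Proof.
move=> q0 q1 M0 H; pose S n := \sum_(k < n) b k.
have D m n : (n <= m)%N -> nc (S m - S n) <= M * (q ^+ n / (1 - q)).
  move=> nm; rewrite /S -!(big_mkord xpredT) (big_cat_nat _ nm) //= addrAC subrr add0r.
  apply: (le_trans (nc_sum _ _ _)); apply: (@le_trans _ _ (\sum_(n <= k < m) M * q ^+ k)).
    by apply: ler_sum => k _.
  by rewrite -mulr_sumr ler_wpM2l // geo_sum.
have [l Hl] : exists l, clim S l.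
  apply: C_complete => e e0.
  have q10 : 0 < 1 - q by lra.
  have [|N HN] := @exp_small _ q (e * (1 - q) / (M + 1)) q0 q1.
    by rewrite divr_gt0 ?mulr_gt0 //; lra.
  have K : forall n, (N <= n)%N -> M * (q ^+ n / (1 - q)) <= e.
    move=> n /HN h; rewrite mulrA ler_pdivrMr //.
    have M10 : 0 < M + 1 by lra.
    move: h; rewrite ler_pdivlMr //; have := exprn_ge0 n q0; lra.
  exists N => m n Nm Nn; wlog mn : m n Nm Nn / (n <= m)%N => [W|].
    have [/W|/ltnW /W] := leqP n m; first by apply.
    by rewrite ncBC; apply.
  by apply: (le_trans (D _ _ mn)); exact: K.
exists l => // n; apply/ler_addgt0Pr => e e0; have [N HN] := Hl e e0.
have := HN _ (leq_maxl N n); have := D _ _ (leq_maxr N n).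
set m := maxn _ _; have -> : l - S n = (S m - S n) - (S m - l) by ring.
by move=> *; apply: (le_trans (ncB _ _)); lra.
Qed.

Lemma psum_coef_bound a z l : psum a z l -> exists2 M : R, 0 <= M & forall k, nc (a k) * nc z ^+ k <= M.
Proof.
move=> /clim_bound [M HM]; exists (M + M) => [|k].
  by have := HM 0%N; rewrite big_ord0 nc0; lra.
rewrite -ncX -ncM.
have -> : a k * z ^+ k = \sum_(i < k.+1) a i * z ^+ i - \sum_(i < k) a i * z ^+ i.
  by rewrite big_ord_recr /= addrAC subrr add0r.
by apply: (le_trans (ncB _ _)); rewrite lerD.
Qed.

Lemma geo_of_bound (x M s rho : R) k : 0 < s -> 0 <= rho -> x * s ^+ k <= M ->
  x * rho ^+ k <= M * (rho / s) ^+ k.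
Proof.
move=> s0 r0 H; rewrite expr_div_n mulrA ler_pdivlMr ?exprn_gt0 // mulrAC.
by rewrite ler_wpM2r // exprn_ge0.
Qed.

Lemma powdiff (z w : R[i]) (rho : R) k : nc z <= rho -> nc w <= rho ->
  nc (z ^+ k - w ^+ k) <= nc (z - w) * (k%:R * rho ^+ k.-1).
Proof.
move=> zr wr; rewrite subrXX ncM ler_wpM2l ?nc_ge0 //.
apply: (le_trans (nc_sum _ _ _)).
have -> : k%:R * rho ^+ k.-1 = \sum_(i < k) rho ^+ k.-1.
  by rewrite sumr_const card_ord mulr_natl.
apply: ler_sum => i _; rewrite ncM !ncX.
have ik : (i <= k.-1)%N by have := ltn_ord i; lia.
rewrite -{2}(subnK ik) exprD.
have r0 : 0 <= rho by apply: le_trans (nc_ge0 _) zr.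
by apply: ler_pM; rewrite ?exprn_ge0 ?nc_ge0 // lerXn2r ?nnegrE ?nc_ge0.
Qed.

(** A convergent power series may be differentiated term by term. *)
Lemma psum_hd a F (s : R) : (forall w, nc w < s -> psum a w (F w)) ->
  forall z, nc z < s -> exists2 l, hd F z l & psum (fun k => k.+1%:R * a k.+1) z l.
Proof.
move=> HF z zs.
pose rho1 := (2 * nc z + s) / 3; pose s1 := (nc z + 2 * s) / 3.
have z0 := nc_ge0 z.
have [r1 r2 r3 s0] : [/\ nc z < rho1, rho1 < s1, s1 < s & 0 < rho1].
  by rewrite /rho1 /s1; split; lra.
have s10 : 0 < s1 by lra.
have [M M0 HM] : exists2 M : R, 0 <= M & forall k, nc (a k) * s1 ^+ k <= M.
  have : nc s1%:C < s by rewrite ncR gtr0_norm.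
  by move=> /HF/psum_coef_bound; rewrite ncR gtr0_norm.
pose q := rho1 / s1; have q0 : 0 < q by rewrite divr_gt0.
have q1 : q < 1 by rewrite ltr_pdivrMr // mul1r.
pose q' := (q + 1) / 2; have [q0' qq' q1'] : [/\ 0 < q', q < q' & q' < 1] by rewrite /q'; split; lra.
have [C C0 HC] := lin_geo q0 qq'.
pose K := M * C / rho1; have K0 : 0 <= K by apply: divr_ge0 (ltW s0); exact: mulr_ge0 M0 (ltW C0).
have akb k : nc (a k) * (k%:R * rho1 ^+ k.-1) <= K * q' ^+ k.
  case: k => [|k]; first by rewrite mul0r mulr0 mulr_ge0 // expr0.
  have -> : K * q' ^+ k.+1 = M * (C * q' ^+ k.+1) / rho1 by rewrite /K -!mulrA [rho1^-1 * _]mulrC mulrA.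
  have E : nc (a k.+1) * (k.+1%:R * rho1 ^+ k) * rho1 = k.+1%:R * (nc (a k.+1) * rho1 ^+ k.+1).
    by rewrite exprSr; ring.
  rewrite ler_pdivlMr //= E.
  have := geo_of_bound s10 (ltW s0) (HM k.+1).
  rewrite -/q => /(ler_wpM2l (ler0n R k.+1)) H; apply: (le_trans H).
  by rewrite mulrCA ler_wpM2l.
have [l Hl1 Hl2] : exists2 l, psum (fun k => k.+1%:R * a k.+1) z l &
   forall n, nc (l - \sum_(k < n) k.+1%:R * a k.+1 * z ^+ k) <= K * q' * (q' ^+ n / (1 - q')).
  apply: (@clim_abs (fun k => k.+1%:R * a k.+1 * z ^+ k) (K * q') q' (ltW q0') q1' (mulr_ge0 K0 (ltW q0'))) => k.
  rewrite !ncM nc_nat ncX -[K * _ * _]mulrA -exprS; apply: le_trans (akb k.+1).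
  rewrite [k.+1%:R * _]mulrC -mulrA ler_wpM2l ?nc_ge0 // ler_wpM2l //=.
  by rewrite lerXn2r ?nnegrE ?nc_ge0 ?(ltW s0) // ltW.
exists l => //.
pose p n w := \sum_(k < n) a k * w ^+ k.
pose T n := K * (q' ^+ n / (1 - q')).
have Rn n h : nc (z + h) <= rho1 -> nc (F (z + h) - F z - (p n (z + h) - p n z)) <= nc h * T n.
  move=> zh.
  have L : clim (fun m => p m (z + h) + (-1) * p m z) (F (z + h) + (-1) * F z).
    apply: climD; first by apply: HF; lra.
    by apply: climZ; apply: HF.
  apply/ler_addgt0Pr => e e0; have [N HN] := L e e0.
  have := HN _ (leq_maxl N n); have := leq_maxr N n; set m := maxn _ _ => nm Hm.
  have E : p m (z + h) - p m z - (p n (z + h) - p n z) = \sum_(n <= k < m) a k * ((z + h) ^+ k - z ^+ k).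
    have cat w : p m w = p n w + \sum_(n <= k < m) a k * w ^+ k.
      by rewrite /p -!(big_mkord xpredT (fun k => a k * w ^+ k)) (big_cat_nat _ nm).
    rewrite (cat (z + h)) (cat z).
    have -> : \sum_(n <= k < m) a k * ((z + h) ^+ k - z ^+ k) =
      \sum_(n <= k < m) a k * (z + h) ^+ k - \sum_(n <= k < m) a k * z ^+ k.
      by rewrite -sumrB; apply: eq_bigr => k _; rewrite mulrBr.
    ring.
  have : nc (p m (z + h) - p m z - (p n (z + h) - p n z)) <= nc h * T n.
    rewrite E; apply: (le_trans (nc_sum _ _ _)).
    apply: (@le_trans _ _ (\sum_(n <= k < m) nc h * (K * q' ^+ k))); last first.
      by rewrite -mulr_sumr ler_wpM2l ?nc_ge0 // -mulr_sumr ler_wpM2l // geo_sum // ltW.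
    apply: ler_sum => k _; rewrite ncM.
    have := @powdiff (z + h) z rho1 k zh (ltW r1).
    have -> : z + h - z = h by ring.
    move=> /(ler_wpM2l (nc_ge0 (a k))) H; apply: (le_trans H).
    by rewrite mulrCA ler_wpM2l ?nc_ge0.
  move=> H.
  have -> : F (z + h) - F z - (p n (z + h) - p n z) =
    (p m (z + h) - p m z - (p n (z + h) - p n z)) -
    (p m (z + h) + (-1) * p m z - (F (z + h) + (-1) * F z)) by ring.
  by apply: (le_trans (ncB _ _)); lra.
have small (e : R) : 0 < e -> exists n, T n <= e /\ K * q' * (q' ^+ n / (1 - q')) <= e.
  move=> e0; have q10 : 0 < 1 - q' by lra.
  have [|N HN] := @exp_small _ q' (e * (1 - q') / (K + 1)) (ltW q0') q1'.
    by rewrite divr_gt0 ?mulr_gt0 //; lra.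
  exists N; have := HN _ (leqnn N).
  have K10 : 0 < K + 1 by lra.
  rewrite ler_pdivlMr // => H.
  have P := exprn_ge0 N (ltW q0').
  have H1 : T N <= e by rewrite /T mulrA ler_pdivrMr //; lra.
  split => //; apply: le_trans H1; rewrite /T ler_wpM2r ?divr_ge0 ?(ltW q10) //.
  by rewrite ler_piMr // ltW.
have dp n : hd (p n) z (\sum_(k < n) a k * (k%:R * z ^+ k.-1)).
  by apply: hd_sum => k _; apply: hdZ; exact: hdX.
move=> e e0; have e4 : 0 < e / 4 by lra.
have [n [Tn Dn]] := small _ e4.
have [d d0 Hd] := dp n.+1 _ e4.
exists (Num.min d (rho1 - nc z)) => [|h]; first by rewrite lt_min d0 subr_gt0.
rewrite lt_min => /andP[/Hd H1 H2].
have zh : nc (z + h) <= rho1 by apply: (le_trans (ncD _ _)); lra.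
have H3 := Rn n.+1 h zh.
have Tn1 : T n.+1 <= e / 4.
  apply: le_trans Tn; rewrite /T ler_wpM2l // ler_wpM2r ?invr_ge0 ?subr_ge0 ?(ltW q1') //.
  by rewrite exprS ler_piMl ?exprn_ge0 // ltW.
move: H1; rewrite big_ord_recl /= mul0r mulr0 add0r.
have -> : \sum_(i < n) a (bump 0 i) * ((bump 0 i)%:R * z ^+ (bump 0 i).-1) =
   \sum_(k < n) k.+1%:R * a k.+1 * z ^+ k.
  by apply: eq_bigr => i _; rewrite /bump /= mulrCA mulrA.
set S := \sum_(k < n) _ in Dn *; move=> H1.
have -> : F (z + h) - F z - l * h =
  (F (z + h) - F z - (p n.+1 (z + h) - p n.+1 z)) +
  (p n.+1 (z + h) - p n.+1 z - S * h) - (l - S) * h by ring.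
apply: (le_trans (ncB _ _)); apply: (le_trans (lerD (ncD _ _) (lexx _))).
have h0 := nc_ge0 h.
have E1 : nc h * T n.+1 <= e / 4 * nc h by rewrite mulrC ler_wpM2r.
have E2 : nc ((l - S) * h) <= e / 4 * nc h.
  by rewrite ncM ler_wpM2r // (le_trans (Hl2 n)).
have := mulr_ge0 (ltW e0) h0; lra.
Qed.

End PowerSeries.


Section Taylor.
Context {R : realType}.
Local Open Scope complex_scope.
Implicit Types (F G : R[i] -> R[i]) (a : nat -> R[i]).

Lemma circle_bound (u : R -> R[i]) (b : R) : 0 <= b -> ctsR u ->
  exists2 M : R, 0 <= M & forall t, 0 <= t <= b -> nc (u t) <= M.
Proof.
move=> b0 cu.
have cn : continuous (fun t => nc (u t)).
  move=> x; apply/cvgrPdist_le => e e0; have [d d0 Hd] := cu x e e0.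
  apply/nbhs_ballP; exists d => //= y; rewrite /ball /= => yd.
  have H : nc (u y - u x) <= e by apply: Hd; rewrite distrC.
  by rewrite ler_norml; have := nc_sub_ge (u y) (u x); have := nc_sub_ge (u x) (u y);
     rewrite (ncBC (u x)) => *; apply/andP; split; lra.
have [|c cb Hc] := @EVT_max R (fun t => nc (u t)) 0 b b0; first exact: continuous_subspaceT.
exists (nc (u c)) => [|t tb]; first exact: nc_ge0.
by apply: Hc; rewrite in_itv.
Qed.

Lemma cint_ext (u v : R -> R[i]) (x y : R) : (forall t, u t = v t) -> cint u x y = cint v x y.
Proof. by move=> /funext ->. Qed.

Lemma taylor0 F (r s : R) : hol F 0 r -> 0 < s -> s < r -> exists a,
  (forall w, nc w < s -> psum a w (F w)) /\
  (forall M, (forall w, nc w = s -> nc (F w) <= M) -> forall k, nc (a k) * s ^+ k <= 2 * M).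
Proof.
move=> hF' s0 sr.
have hF : forall z, nc z < r -> exists l, hd F z l by move=> z zr; apply: hF'; rewrite subr0.
pose zc t := s%:C * expi t.
have nzc t : nc (zc t) = s by rewrite /zc ncM ncR nc_expi mulr1 gtr0_norm.
have zc0 t : zc t != 0 by rewrite -nc_gt0 nzc.
have dzc t : hdR zc t ('i * zc t) by exact: hdR_scaled_expi.
have czc : ctsR zc by exact: hdR_ctsR dzc.
have pp : 0 < 2 * pi :> R by rewrite mulr_gt0 ?pi_gt0.
have p0 := ltW pp.
pose pw k t := ((zc t)^-1) ^+ k.
have dpw k t : hdR (pw k) t (- (k%:R * 'i) * pw k t).
  have := hd_hdR (dzc t) (hd_comp (hdV (zc0 t)) (hdX ((zc t)^-1) k)).
  apply: hdR_eq; case: k => [|k]; first by rewrite /pw !mul0r oppr0 mul0r.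
  by rewrite /pw /= exprS; field; exact: zc0.
have cpw k : ctsR (pw k) by exact: hdR_ctsR (dpw k).
have main G : (forall z, nc z < r -> exists l, hd G z l) ->
   [/\ forall k, ctsR (fun t => G (zc t) * pw k t),
       exists2 M : R, 0 <= M & forall t, 0 <= t <= 2 * pi -> nc (G (zc t)) <= M &
    forall b, nc b < s -> clim (fun n => 'i * \sum_(k < n) b ^+ k * cint (fun t => G (zc t) * pw k t) 0 (2 * pi))
       (G b * cint (fun t => 'i * zc t / (zc t - b)) 0 (2 * pi))].
  move=> hG.
  have cG : ctsR (fun t => G (zc t)).
    apply: ctsR_comp => // t; have [|l /hd_cont//] := hG (zc t); by rewrite nzc.
  have cGp k : ctsR (fun t => G (zc t) * pw k t) by exact: ctsRM.
  have [M M0 HM] := circle_bound p0 cG.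
  split => //; first by exists M.
  move=> b bs.
  have zb0 t : zc t - b != 0.
    rewrite -nc_gt0; have := nc_sub_ge (zc t) b; rewrite nzc; lra.
  rewrite -(cauchy_formula s0 sr hG bs) -/zc.
  pose q := nc b / s; have q0 : 0 <= q by rewrite divr_ge0 ?nc_ge0 ?ltW.
  have q1 : q < 1 by rewrite ltr_pdivrMr // mul1r.
  have sb0 : 0 < s - nc b by rewrite subr_gt0.
  pose Kk := s / (s - nc b); have Kk0 : 0 < Kk by rewrite divr_gt0.
  have ckap : ctsR (fun t => 'i * zc t / (zc t - b)).
    apply: (@ctsR_comp _ (fun w => 'i * w / (w - b)) zc czc) => t.
    suff [l /hd_cont//] : exists l, hd (fun w => 'i * w / (w - b)) (zc t) l.
    eexists; apply: hdM; first by apply: hdZ; exact: hd_id.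
    apply: (@hd_comp _ (fun w => w^-1) (fun w => w - b)).
      by apply: hdB; [exact: hd_id|exact: hd_cst].
    exact: hdV.
  have exp n t : 'i * zc t / (zc t - b) = \sum_(k < n) 'i * b ^+ k * pw k t +
      b ^+ n * pw n t * ('i * zc t / (zc t - b)).
    elim: n => [|n IH]; first by rewrite big_ord0 add0r /pw !expr0 !mul1r.
    rewrite {1}IH big_ord_recr /= -!addrA; congr (_ + _).
    by rewrite /pw !exprS; field; rewrite zc0 zb0.
  have K1 : 0 < M * Kk + 1 by have := mulr_ge0 M0 (ltW Kk0); lra.
  move=> e e0.
  have [|N HN] := @exp_small _ q (e / (2 * (M * Kk + 1) * (2 * pi))) q0 q1.
    by apply: divr_gt0 => //; apply: mulr_gt0 => //; apply: mulr_gt0.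
  exists N => n Nn.
  pose V x := \sum_(k < n) 'i * b ^+ k * prim (fun t => G (zc t) * pw k t) x.
  have -> : 'i * (\sum_(k < n) b ^+ k * cint (fun t => G (zc t) * pw k t) 0 (2 * pi)) = V (2 * pi) - V 0.
    rewrite /V -sumrB mulr_sumr; apply: eq_bigr => k _; rewrite /cint; ring.
  rewrite ncBC.
  apply: (@le_trans _ _ (2 * (M * Kk * q ^+ n) * (2 * pi - 0))).
    apply: (@cint_near _ _ V (fun x => \sum_(k < n) 'i * b ^+ k * (G (zc x) * pw k x))) => //.
    - exact: ctsRM.
    - move=> x /andP[x0 _]; rewrite /V.
      elim: (n) => [|m IH].
        rewrite big_ord0; apply: (@hdR_ext _ (fun y => 0 * y%:C)) => [y|].
          by rewrite big_ord0 mul0r.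
        by apply: (@hdR_eq _ _ _ (0 * 1)); [rewrite mul0r|apply: hdRZ; exact: hdR_embed].
      rewrite big_ord_recr /=; apply: (@hdR_ext _ (fun y => \sum_(k < m) 'i * b ^+ k * prim (fun t => G (zc t) * pw k t) y + 'i * b ^+ m * prim (fun t => G (zc t) * pw m t) y)).
        by move=> y; rewrite big_ord_recr.
      by apply: hdRD => //; apply: hdRZ; exact: primP.
    - move=> x xb; rewrite (exp n x).
      have -> : G (zc x) * (\sum_(k < n) 'i * b ^+ k * pw k x + b ^+ n * pw n x * ('i * zc x / (zc x - b))) -
         \sum_(k < n) 'i * b ^+ k * (G (zc x) * pw k x) = G (zc x) * (('i * zc x / (zc x - b)) * (b ^+ n * pw n x)).
        rewrite mulrDr mulr_sumr.
        have -> : \sum_(i < n) G (zc x) * ('i * b ^+ i * pw i x) = \sum_(k < n) 'i * b ^+ k * (G (zc x) * pw k x).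
          by apply: eq_bigr => k _; ring.
        ring.
      rewrite ncM [nc (_ * (b ^+ n * _))]ncM -[X in _ <= X]mulrA.
      have E : nc (b ^+ n * pw n x) = q ^+ n.
        by rewrite ncM /pw !ncX ncV nzc /q expr_div_n exprVn.
      rewrite E; apply: ler_pM; [exact: nc_ge0|by rewrite mulr_ge0 ?nc_ge0 ?exprn_ge0|exact: HM|].
      rewrite ler_wpM2r ?exprn_ge0 // ncM [nc ('i * _)]ncM ncV nc_i mul1r nzc ler_pM2l //.
      rewrite lef_pV2 ?posrE // ?nc_gt0 //.
      by have := nc_sub_ge (zc x) b; rewrite nzc.
  have D0 : 0 < 2 * (M * Kk + 1) * (2 * pi) by apply: mulr_gt0 => //; apply: mulr_gt0.
  have := HN _ Nn; rewrite ler_pdivlMr // subr0.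
  have P : 0 <= q ^+ n * (2 * pi) by rewrite mulr_ge0 ?exprn_ge0.
  by move=> H; apply: le_trans H; lra.
have kap1 b : nc b < s -> cint (fun t => 'i * zc t / (zc t - b)) 0 (2 * pi) = 'i * (2 * pi)%:C.
  move=> bs; have [_ _ /(_ b bs)] := main (fun=> 1) (fun z _ => ex_intro _ 0 (hd_cst 1 z)).
  rewrite mul1r => H; apply: (clim_unique H).
  suff E n : 'i * \sum_(k < n.+1) b ^+ k * cint (fun t => 1 * pw k t) 0 (2 * pi) = 'i * (2 * pi)%:C.
    move=> e e0; exists 1%N => [[//|n]] _; by rewrite E subrr nc0 ltW.
  congr (_ * _).
  rewrite big_ord_recl big1 ?addr0.
    rewrite expr0 mul1r (@cintE _ _ (fun x => x%:C)) ?rmorph0 ?subr0 //.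
      by apply: ctsRM; [exact: ctsR_cst|exact: cpw].
    by move=> x _; rewrite /pw expr0 mulr1; exact: hdR_embed.
  move=> k _; rewrite (@cint_ext _ (pw (lift ord0 k))); last by move=> t; rewrite mul1r.
  set j := nat_of_ord (lift ord0 k).
  have j0 : j%:R * 'i != 0 :> R[i].
    rewrite mulf_neq0 // ?pnatr_eq0 // -nc_gt0 nc_i; exact: ltr01.
  rewrite (@cintE _ _ (fun x => - (j%:R * 'i)^-1 * pw j x)) //.
    by rewrite /pw /zc expi_2pi subrr mulr0.
  move=> x _; apply: (@hdR_eq _ _ _ (- (j%:R * 'i)^-1 * (- (j%:R * 'i) * pw j x))).
    by rewrite mulrA mulrNN mulVf // mul1r.
  by apply: hdRZ.
have [cFp [M M0 HM] HF] := main F hF.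
have pC : (2 * pi)%:C != 0 :> R[i] by rewrite fmorph_eq0 gt_eqF.
have i0 : 'i != 0 :> R[i] by rewrite -nc_gt0 nc_i; exact: ltr01.
exists (fun k => ((2 * pi)%:C)^-1 * cint (fun t => F (zc t) * pw k t) 0 (2 * pi)); split.
  move=> w ws; have := HF w ws; rewrite kap1 // => H.
  have := climZ ('i * (2 * pi)%:C)^-1 H.
  rewrite mulrCA mulVf ?mulf_neq0 // mulr1; apply: clim_ext => n.
  rewrite invfM mulrACA mulVf // mul1r mulr_sumr; apply: eq_bigr => k _; ring.
move=> M' HM' k; rewrite ncM ncV ncR gtr0_norm //.
have sk : 0 < s ^+ k by rewrite exprn_gt0.
have B : nc (cint (fun t => F (zc t) * pw k t) 0 (2 * pi)) <= 2 * (M' / s ^+ k) * (2 * pi - 0).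
  apply: cint_bound => // t _; rewrite ncM /pw ncX ncV nzc exprVn ler_wpM2r ?invr_ge0 ?(ltW sk) //.
  by apply: HM'.
apply: (@le_trans _ _ ((2 * pi)^-1 * (2 * (M' / s ^+ k) * (2 * pi - 0)) * s ^+ k)).
  by rewrite ler_wpM2r ?(ltW sk) // ler_wpM2l // invr_ge0.
rewrite subr0 mulrC [_ * (2 * pi)]mulrC mulKf ?gt_eqF //.
by rewrite mulrCA [s ^+ k * _]mulrC divfK ?gt_eqF.
Qed.

End Taylor.


Section TaylorCoefficients.
Context {R : realType}.
Local Open Scope complex_scope.
Implicit Types (F G : R[i] -> R[i]) (a : nat -> R[i]).

Definition dC F z : R[i] := xget 0 [set l | hd F z l].

Lemma dCP F z l : hd F z l -> hd F z (dC F z).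
Proof. by move=> h; rewrite /dC; case: xgetP => [?-> //|/(_ l)]. Qed.

Lemma dC_eq F z l : hd F z l -> dC F z = l.
Proof. by move=> h; apply: (hd_unique (dCP h) h). Qed.

Lemma hol_dC F c (r : R) z : hol F c r -> nc (z - c) < r -> hd F z (dC F z).
Proof. by move=> h /h [l /dCP]. Qed.

(** A convergent power series that vanishes on a real interval around 0 is
    zero: differentiate it along that interval. *)
Lemma psum_real0 a F (s t : R) : 0 < t -> t <= s ->
  (forall w, nc w < s -> psum a w (F w)) ->
  (forall x : R, `|x| < t -> F x%:C = 0) -> forall k, a k = 0.
Proof.
move=> t0 ts HF F0 k; elim: k a F HF F0 => [|k IH] a F HF F0.
  have h0 : psum a 0 0.
    by have := HF 0; rewrite nc0 -[X in F X](rmorph0 (real_complex R)) F0 ?normr0 //;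
      apply; apply: lt_le_trans ts.
  apply: (psum_unique (z := 0) (a := a)) h0.
  move=> e e0; exists 1%N => [[//|n]] _; rewrite big_ord_recl big1 ?addr0 => [|i _].
    by rewrite expr0 mulr1 subrr nc0 ltW.
  by rewrite expr0n mulr0.
have dF w : nc w < s -> exists2 l, hd F w l & psum (fun k => k.+1%:R * a k.+1) w l.
  exact: psum_hd.
have := IH (fun k => k.+1%:R * a k.+1) (dC F).
have H1 w : nc w < s -> psum (fun k => k.+1%:R * a k.+1) w (dC F w).
  by move=> /dF [l hl hp]; rewrite (dC_eq hl).
have H2 (x : R) : `|x| < t -> dC F x%:C = 0.
  move=> xt.
  have [|l hl _] := dF x%:C; first by rewrite ncR; apply: lt_le_trans ts.
  rewrite (dC_eq hl); have := hd_hdR (hdR_embed x) hl; rewrite mulr1 => H.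
  apply: (hdR_unique H) => e e0; exists (t - `|x|) => [|h hx]; first by rewrite subr_gt0.
  rewrite !F0 //; first by rewrite mul0r !subr0 nc0 mulr_ge0 // ltW.
  by apply: (le_lt_trans (ler_normD _ _)); lra.
move=> /(_ H1 H2) /eqP; rewrite mulf_eq0 pnatr_eq0 /=; exact: eqP.
Qed.

Lemma psumB a b z l m : psum a z l -> psum b z m -> psum (fun k => a k - b k) z (l - m).
Proof.
move=> ha hb; have := climD ha (climZ (-1) hb); rewrite mulN1r; apply: clim_ext => n.
rewrite mulN1r -sumrB; apply: eq_bigr => k _; ring.
Qed.

Lemma psum_inj a b F (s : R) : 0 < s -> (forall w, nc w < s -> psum a w (F w)) ->
  (forall w, nc w < s -> psum b w (F w)) -> a = b.
Proof.
move=> s0 ha hb; apply/funext => k; apply/eqP; rewrite -subr_eq0; apply/eqP.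
move: k; apply: (@psum_real0 (fun k => a k - b k) (fun=> 0) s s) => // w ws.
by rewrite -(subrr (F w)); apply: psumB; [exact: ha|exact: hb].
Qed.

(** the coefficients of the Taylor expansion of F at c *)
Definition tc F c : nat -> R[i] := xget (fun=> 0) [set a |
  exists2 s : R, 0 < s & forall w, nc w < s -> psum a w (F (c + w))].

Lemma tc_eq F c a (s : R) : 0 < s -> (forall w, nc w < s -> psum a w (F (c + w))) ->
  tc F c = a.
Proof.
move=> s0 H; rewrite /tc; case: xgetP => [b -> [s' s0' H']|]; last by move=> /(_ a) []; exists s.
have [t [t0 t1 t2]] := small2 s0 s0'.
apply: (@psum_inj _ _ (fun w => F (c + w)) t) => // w wt; [apply: H'|apply: H]; exact: lt_trans wt _.
Qed.

Lemma hol_shift F c (r : R) : hol F c r -> hol (fun w => F (c + w)) 0 r.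
Proof.
move=> h z; rewrite subr0 => zr; have [|l hl] := h (c + z).
  by rewrite addrAC subrr add0r.
exists l; have := @hd_aff R F z l c 1; rewrite !mul1r => /(_ hl).
by apply: hd_ext => w; rewrite mul1r.
Qed.

Lemma tcP F c (r : R) : hol F c r -> forall w, nc w < r -> psum (tc F c) w (F (c + w)).
Proof.
move=> /hol_shift hF w wr.
have w0 := nc_ge0 w.
pose s := (nc w + r) / 2; have [s0 ws sr] : [/\ 0 < s, nc w < s & s < r] by rewrite /s; split; lra.
have [a [Ha _]] := taylor0 hF s0 sr.
by rewrite (tc_eq s0 Ha); exact: Ha.
Qed.

Lemma tc_bound F c (r s M : R) : hol F c r -> 0 < s -> s < r ->
  (forall w, nc w = s -> nc (F (c + w)) <= M) -> forall k, nc (tc F c k) * s ^+ k <= 2 * M.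
Proof.
move=> /hol_shift hF s0 sr HM; have [a [Ha Hb]] := taylor0 hF s0 sr.
by rewrite (tc_eq s0 Ha); exact: Hb.
Qed.

Lemma tc_ext F G c (r : R) : 0 < r -> hol F c r -> (forall w, nc (w - c) < r -> F w = G w) ->
  tc F c = tc G c.
Proof.
move=> r0 hF FG; apply/esym; apply: (tc_eq r0) => w wr.
have E : nc (c + w - c) < r by rewrite [c + w]addrC addrK.
by rewrite -(FG _ E); exact: tcP hF _ wr.
Qed.

Lemma hol_dC_hol F c (r : R) : hol F c r -> hol (dC F) c r.
Proof.
move=> hF z zr.
have P := tcP hF.
have dP w : nc w < r -> psum (fun k => k.+1%:R * tc F c k.+1) w (dC F (c + w)).
  move=> wr; have [l hl hp] := psum_hd P wr.
  suff -> : dC F (c + w) = l by [].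
  have := @hd_aff R (fun v => F (c + v)) (c + w) l (- c) 1.
  rewrite mul1r addKr mul1r => /(_ hl) H; apply: dC_eq.
  by apply: hd_ext H => v; rewrite mul1r addNKr.
have [l hl _] := psum_hd dP zr.
exists l; have := @hd_aff R (fun v => dC F (c + v)) z l (- c) 1.
rewrite mul1r [- c + z]addrC mul1r => /(_ hl) H.
by apply: hd_ext H => v; rewrite mul1r addNKr.
Qed.

Lemma tc_dC F c (r : R) k : 0 < r -> hol F c r -> tc (dC F) c k = k.+1%:R * tc F c k.+1.
Proof.
move=> r0 hF; have P := tcP hF.
rewrite (@tc_eq (dC F) c (fun k => k.+1%:R * tc F c k.+1) r r0) // => w wr.
have [l hl hp] := psum_hd P wr.
suff -> : dC F (c + w) = l by [].
have := @hd_aff R (fun v => F (c + v)) (c + w) l (- c) 1.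
rewrite mul1r addKr mul1r => /(_ hl) H; apply: dC_eq.
by apply: hd_ext H => v; rewrite mul1r addNKr.
Qed.

Lemma psum_at0 a : psum a 0 (a 0%N).
Proof.
move=> e e0; exists 1%N => [[//|n]] _; rewrite big_ord_recl big1 ?addr0 => [|i _].
  by rewrite expr0 mulr1 subrr nc0 ltW.
by rewrite expr0n mulr0.
Qed.

Lemma tc0 F c (r : R) : 0 < r -> hol F c r -> tc F c 0 = F c.
Proof.
move=> r0 hF; have := tcP hF; move=> /(_ 0); rewrite nc0 addr0 => /(_ r0).
exact: psum_unique (psum_at0 _).
Qed.

Lemma tc1 F c (r : R) : 0 < r -> hol F c r -> tc F c 1 = dC F c.
Proof. by move=> r0 hF; rewrite -(tc0 r0 (hol_dC_hol hF)) (tc_dC _ r0 hF) mul1r. Qed.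

Lemma psum_tail a z l (M s : R) n : psum a z l -> 0 < s -> nc z < s -> 0 <= M ->
  (forall k, nc (a k) * s ^+ k <= M) ->
  nc (l - \sum_(k < n) a k * z ^+ k) <= M * ((nc z / s) ^+ n / (1 - nc z / s)).
Proof.
move=> hl s0 zs M0 HM.
have q0 : 0 <= nc z / s by rewrite divr_ge0 ?nc_ge0 ?ltW.
have q1 : nc z / s < 1 by rewrite ltr_pdivrMr // mul1r.
have [|l' hl' H] := @clim_abs R (fun k => a k * z ^+ k) M (nc z / s) q0 q1 M0.
  by move=> k; rewrite ncM ncX; apply: geo_of_bound; rewrite ?nc_ge0.
by rewrite (clim_unique hl hl').
Qed.

(** Holomorphic functions are bounded on smaller discs. *)
Lemma hol_bounded F c (r s : R) : hol F c r -> 0 < s -> s < r ->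
  exists2 M : R, 0 <= M & forall w, nc w <= s -> nc (F (c + w)) <= M.
Proof.
move=> hF s0 sr; pose s1 := (s + r) / 2.
have [s10 ss1 s1r] : [/\ 0 < s1, s < s1 & s1 < r] by rewrite /s1; split; lra.
have : nc s1%:C < r by rewrite ncR gtr0_norm.
move=> /(tcP hF)/psum_coef_bound [M M0 HM]; rewrite ncR gtr0_norm // in HM.
have q1 : s / s1 < 1 by rewrite ltr_pdivrMr // mul1r.
exists (M / (1 - s / s1)) => [|w ws]; first by rewrite divr_ge0 // subr_ge0 ltW.
have wr : nc w < r by lra.
have ws1 : nc w < s1 by lra.
have := psum_tail 0 (tcP hF wr) s10 ws1 M0 HM.
rewrite big_ord0 subr0 expr0 mul1r => H; apply: (le_trans H).
have w1 : nc w / s1 < 1 by rewrite ltr_pdivrMr // mul1r.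
by rewrite ler_wpM2l // lef_pV2 ?posrE ?subr_gt0 // lerD2l lerN2 ler_pM2r // invr_gt0.
Qed.

Lemma hol_sub F c (r s : R) d : hol F c r -> nc (d - c) + s <= r -> hol F d s.
Proof.
move=> hF h z zs; apply: hF.
have -> : z - c = (z - d) + (d - c) by ring.
by apply: (le_lt_trans (ncD _ _)); lra.
Qed.

Lemma tcD F G c (r : R) k : 0 < r -> hol F c r -> hol G c r ->
  tc (fun z => F z + G z) c k = tc F c k + tc G c k.
Proof.
move=> r0 hF hG; rewrite (@tc_eq _ c (fun k => tc F c k + tc G c k) r r0) // => w wr.
have := climD (tcP hF wr) (tcP hG wr); apply: clim_ext => n.
by rewrite -big_split; apply: eq_bigr => i _; rewrite mulrDl.
Qed.

Lemma tcZ F c (r : R) b k : 0 < r -> hol F c r -> tc (fun z => b * F z) c k = b * tc F c k.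
Proof.
move=> r0 hF; rewrite (@tc_eq _ c (fun k => b * tc F c k) r r0) // => w wr.
have := climZ b (tcP hF wr); apply: clim_ext => n.
by rewrite mulr_sumr; apply: eq_bigr => i _; rewrite mulrA.
Qed.

Lemma holD F G c (r : R) : hol F c r -> hol G c r -> hol (fun z => F z + G z) c r.
Proof. by move=> hF hG z zr; have [l hl] := hF z zr; have [m hm] := hG z zr; exists (l + m); exact: hdD. Qed.
Lemma holZ F b c (r : R) : hol F c r -> hol (fun z => b * F z) c r.
Proof. by move=> hF z zr; have [l hl] := hF z zr; exists (b * l); exact: hdZ. Qed.
Lemma holM F G c (r : R) : hol F c r -> hol G c r -> hol (fun z => F z * G z) c r.
Proof. by move=> hF hG z zr; have [l hl] := hF z zr; have [m hm] := hG z zr; eexists; exact: hdM hl hm. Qed.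

(** Taylor's formula with an explicit quadratic remainder. *)
Lemma hol_quad F c (r s M : R) : hol F c r -> 0 < s -> s < r -> 0 <= M ->
  (forall w, nc w = s -> nc (F (c + w)) <= M) ->
  forall h, nc h <= s / 2 -> nc (F (c + h) - F c - dC F c * h) <= 4 * M / s ^+ 2 * nc h ^+ 2.
Proof.
move=> hF s0 sr M0 HM h hs.
have r0 : 0 < r by lra.
have hr : nc h < r by lra.
have hs' : nc h < s by lra.
have M20 : 0 <= 2 * M by lra.
have := psum_tail 2 (tcP hF hr) s0 hs' M20 (tc_bound hF s0 sr HM).
rewrite !big_ord_recl big_ord0 /= expr0 mulr1 (tc0 r0 hF) addr0 (tc1 r0 hF) expr1 opprD addrA.
move=> H; apply: (le_trans H).
rewrite expr_div_n; set X := nc h ^+ 2 / s ^+ 2.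
have X0 : 0 <= X by rewrite divr_ge0 ?exprn_ge0 ?nc_ge0 ?ltW.
have E : 4 * M / s ^+ 2 * nc h ^+ 2 = 4 * M * X by rewrite /X mulrAC mulrA.
rewrite E; have q2 : nc h / s <= 2^-1 by rewrite ler_pdivrMr // mulrC.
have q20 : 0 < 1 - nc h / s by lra.
rewrite mulrA ler_pdivrMr //; have := mulr_ge0 M0 X0 => MX.
have := mulr_ge0 MX (ltW q20).
have : 0 <= M * X * (2^-1 - nc h / s) by rewrite mulr_ge0 // subr_ge0.
lra.
Qed.

(** Taylor coefficients in z of a bounded function of (s, z) that is
    holomorphic in each variable are holomorphic in s. *)
Lemma tc_param (F : R[i] -> R[i] -> R[i]) (sg rho M : R) : 0 < sg -> 0 < rho -> 0 <= M ->
  (forall z, nc z < rho -> hol (F^~ z) 0 sg) -> (forall s, nc s < sg -> hol (F s) 0 rho) ->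
  (forall s z, nc s < sg -> nc z < rho -> nc (F s z) <= M) ->
  hol (fun z => dC (F^~ z) 0) 0 rho /\
  forall k, hd (fun s => tc (F s) 0 k) 0 (tc (fun z => dC (F^~ z) 0) 0 k).
Proof.
move=> sg0 rho0 M0 h1 h2 HM; pose D z := dC (F^~ z) 0.
pose sg' := sg / 2; have [sg'0 sg'1] : 0 < sg' /\ sg' < sg by rewrite /sg'; split; lra.
pose K := 4 * M / sg' ^+ 2; have K0 : 0 <= K by rewrite divr_ge0 ?exprn_ge0 ?mulr_ge0 // ltW.
have quad s z : nc s <= sg' / 2 -> nc z < rho -> nc (F s z - F 0 z - s * D z) <= K * nc s ^+ 2.
  move=> hs hz; have := @hol_quad (F^~ z) 0 sg sg' M (h1 z hz) sg'0 sg'1 M0 _ s hs.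
  rewrite add0r [s * _]mulrC; apply=> w ws; rewrite add0r; apply: HM => //; lra.
pose Q s z := s^-1 * (F s z + (-1) * F 0 z).
have hQ s : nc s < sg -> hol (Q s) 0 rho.
  move=> hs; apply: holZ; apply: holD; first exact: h2.
  by apply: holZ; apply: h2; rewrite nc0.
have QD s z : s != 0 -> nc s <= sg' / 2 -> nc z < rho -> nc (Q s z - D z) <= K * nc s.
  move=> s0 hs hz; have ns0 : 0 < nc s by rewrite nc_gt0.
  have -> : Q s z - D z = s^-1 * (F s z - F 0 z - s * D z) by rewrite /Q; field.
  by rewrite ncM ncV mulrC ler_pdivrMr // -mulrA -expr2; exact: quad.
have main rho' : 0 < rho' -> rho' < rho -> exists b : nat -> R[i],
    (forall k, hd (fun s => tc (F s) 0 k) 0 (b k)) /\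
    (forall z, nc z < rho' -> psum b z (D z)).
  move=> r0' r1'.
  have tcQ s k : nc s < sg -> tc (Q s) 0 k = s^-1 * (tc (F s) 0 k - tc (F 0) 0 k).
    move=> hs; have h0 : hol (F 0) 0 rho by apply: h2; rewrite nc0.
    rewrite /Q (tcZ _ _ rho0); last by apply: holD; [exact: h2|exact: holZ].
    rewrite (tcD _ rho0); [|exact: h2|exact: holZ].
    by rewrite (tcZ _ _ rho0) // mulN1r.
  have Qd s t k : s != 0 -> t != 0 -> nc s <= sg' / 2 -> nc t <= sg' / 2 ->
      nc (tc (Q s) 0 k - tc (Q t) 0 k) <= 2 * K * (nc s + nc t) / rho' ^+ k.
    move=> s0 t0 hs ht.
    have sS : nc s < sg by lra. have tS : nc t < sg by lra.
    have -> : tc (Q s) 0 k - tc (Q t) 0 k = tc (fun z => Q s z + (-1) * Q t z) 0 k.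
      rewrite (tcD _ rho0); [|exact: (hQ s sS)|by apply: holZ; exact: (hQ t tS)].
      by rewrite (tcZ _ _ rho0 (hQ t tS)) mulN1r.
    rewrite ler_pdivlMr ?exprn_gt0 // -mulrA.
    apply: (@tc_bound _ 0 rho rho') => //.
      by apply: holD; [exact: (hQ s sS)|apply: holZ; exact: (hQ t tS)].
    move=> w wr; rewrite add0r mulN1r.
    have wr' : nc w < rho by rewrite wr.
    have -> : Q s w - Q t w = (Q s w - D w) - (Q t w - D w) by ring.
    by apply: (le_trans (ncB _ _)); rewrite mulrDr lerD // QD.
  pose sn n : R[i] := (sg' / 2 * (2^-1) ^+ n)%:C.
  have nsn n : nc (sn n) = sg' / 2 * (2^-1) ^+ n.
    by rewrite ncR ger0_norm // mulr_ge0 ?exprn_ge0 //; lra.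
  have sn0 n : sn n != 0 by rewrite -nc_gt0 nsn mulr_gt0 ?exprn_gt0 //; lra.
  have snle n : nc (sn n) <= sg' / 2.
    by rewrite nsn ler_piMr //; [lra|rewrite exprn_ile1 //; lra].
  have snsmall (e : R) : 0 < e -> exists N, forall n, (N <= n)%N -> nc (sn n) <= e.
    move=> e0; have [|||N HN] := @exp_small _ (2^-1 : R) (e / sg'); [lra|lra|exact: divr_gt0|].
    exists N => n /HN; rewrite nsn ler_pdivlMr // => H.
    have : 0 <= 2^-1 ^+ n :> R by rewrite exprn_ge0.
    by nra.
  have ex k : exists l, clim (fun n => tc (Q (sn n)) 0 k) l.
    apply: C_complete => e e0.
    have rk : 0 < rho' ^+ k by rewrite exprn_gt0.
    have [|N HN] := snsmall (e * rho' ^+ k / (4 * K + 1)).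
      by rewrite divr_gt0 ?mulr_gt0 //; lra.
    exists N => m n /HN Hm /HN Hn; apply: (le_trans (Qd _ _ _ (sn0 m) (sn0 n) (snle m) (snle n))).
    rewrite ler_pdivrMr //.
    have K1 : 0 < 4 * K + 1 by lra.
    move: Hm Hn; rewrite !ler_pdivlMr //.
    by have := nc_ge0 (sn m); have := nc_ge0 (sn n); lra.
  have [b Hb] := choice ex.
  have Qb s k : s != 0 -> nc s <= sg' / 2 -> nc (tc (Q s) 0 k - b k) <= 2 * K * nc s / rho' ^+ k.
    move=> s0 hs; apply/ler_addgt0Pr => e e0; have e2 : 0 < e / 2 by lra.
    have rk : 0 < rho' ^+ k by rewrite exprn_gt0.
    have [N HN] := Hb k _ e2.
    have [|N' HN'] := snsmall (e / 2 * rho' ^+ k / (2 * K + 1)).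
      by rewrite divr_gt0 ?mulr_gt0 //; lra.
    have := HN _ (leq_maxl N N'); have := HN' _ (leq_maxr N N'); set n := maxn _ _ => A B.
    have C := Qd s (sn n) k s0 (sn0 n) hs (snle n).
    have -> : tc (Q s) 0 k - b k = (tc (Q s) 0 k - tc (Q (sn n)) 0 k) + (tc (Q (sn n)) 0 k - b k) by ring.
    apply: (le_trans (ncD _ _)).
    have K1 : 0 < 2 * K + 1 by lra.
    have : 2 * K * nc (sn n) / rho' ^+ k <= e / 2.
      rewrite ler_pdivrMr //; move: A; rewrite ler_pdivlMr //; have := nc_ge0 (sn n); lra.
    by move: C; rewrite mulrDr mulrDl; lra.
  exists b; split.
    move=> k e e0; have rk : 0 < rho' ^+ k by rewrite exprn_gt0.
    pose c := 2 * K / rho' ^+ k; have c0 : 0 <= c by apply: divr_ge0 (ltW rk); exact: mulr_ge0.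
    have [t [t0 t1 t2]] := small2 (divr_gt0 e0 (ltr_wpDl c0 ltr01)) (divr_gt0 sg'0 (ltr0n _ 2)).
    exists t => // h ht; rewrite add0r.
    have [->|h0] := eqVneq h 0; first by rewrite subrr mulr0 subr0 nc0 mulr0.
    have hs : nc h <= sg' / 2 by lra.
    have -> : tc (F h) 0 k - tc (F 0) 0 k - b k * h = h * (tc (Q h) 0 k - b k).
      rewrite tcQ; last lra.
      by field.
    rewrite ncM mulrC ler_wpM2r ?nc_ge0 //; apply: (le_trans (Qb _ _ h0 hs)).
    have -> : 2 * K * nc h / rho' ^+ k = c * nc h by rewrite /c mulrAC.
    move: t1; rewrite ltr_pdivlMr ?ltr_wpDl // => t1.
    by have := nc_ge0 h; nra.
  move=> z zr e e0.
  have q0 : 0 <= nc z / rho' by rewrite divr_ge0 ?nc_ge0 ?ltW.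
  have q1 : nc z / rho' < 1 by rewrite ltr_pdivrMr // mul1r.
  have q10 : 0 < 1 - nc z / rho' by lra.
  pose A := 2 * K / (1 - nc z / rho'); have A0 : 0 <= A by apply: divr_ge0 (ltW q10); exact: mulr_ge0.
  have [|N HN] := snsmall (e / 3 / (A + K + 1)).
    by rewrite !divr_gt0 //; lra.
  have := HN _ (leqnn N); set s := sn N => sE.
  have AK : 0 < A + K + 1 by lra.
  move: sE; rewrite ler_pdivlMr // => sE.
  have zr' : nc z < rho by lra.
  have sS : nc s < sg by have := snle N; rewrite -/s; lra.
  have e3 : 0 < e / 3 by lra.
  have := tcP (hQ s sS) zr'; rewrite add0r => /(_ _ e3) [N1 HN1].
  exists N1 => n /HN1 Hn.
  have D1 := QD s z (sn0 N) (snle N) zr'.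
  have D2 : nc (\sum_(k < n) tc (Q s) 0 k * z ^+ k - \sum_(k < n) b k * z ^+ k) <= A * nc s.
    rewrite -sumrB; apply: (le_trans (nc_sum _ _ _)).
    apply: (@le_trans _ _ (\sum_(k < n) 2 * K * nc s * (nc z / rho') ^+ k)).
      apply: ler_sum => k _; rewrite -mulrBl ncM ncX expr_div_n mulrA mulrAC.
      by rewrite ler_wpM2r ?exprn_ge0 ?nc_ge0 //; exact: Qb (sn0 N) (snle N).
    rewrite -mulr_sumr -(big_mkord xpredT (fun k => (nc z / rho') ^+ k)).
    have := geo_sum 0 n q0 q1; rewrite expr0 mul1r => G.
    have -> : A * nc s = 2 * K * nc s * (1 - nc z / rho')^-1 by rewrite /A mulrAC.
    by rewrite ler_wpM2l // mulr_ge0 ?nc_ge0 // mulr_ge0.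
  have -> : \sum_(k < n) b k * z ^+ k - D z =
     (Q s z - D z) + (\sum_(k < n) tc (Q s) 0 k * z ^+ k - Q s z) -
     (\sum_(k < n) tc (Q s) 0 k * z ^+ k - \sum_(k < n) b k * z ^+ k) by ring.
  apply: (le_trans (ncB _ _)); apply: (le_trans (lerD (ncD _ _) (lexx _))).
  by have := nc_ge0 s; lra.
split.
  move=> z; rewrite subr0 => zr; have z0 := nc_ge0 z.
  pose rho' := (nc z + rho) / 2.
  have [p1 p2 p3] : [/\ 0 < rho', rho' < rho & nc z < rho'] by rewrite /rho'; split; lra.
  have [b [_ Hb]] := main _ p1 p2.
  by have [l hl _] := psum_hd Hb p3; exists l.
move=> k; have [|| b [Hb1 Hb2]] := main (rho / 2); [lra|lra|].
rewrite (@tc_eq _ 0 b (rho / 2)) => [//||w wr]; first by lra.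
by rewrite add0r; exact: Hb2.
Qed.

End TaylorCoefficients.


Section BaireLeja.
Context {R : realType}.
Local Open Scope complex_scope.

(** Baire's theorem in a disc. *)
Lemma baireC (A : nat -> R[i] -> Prop) (c : R[i]) (r : R) : 0 < r ->
  (forall N w, ~ A N w -> exists2 d : R, 0 < d & forall h, nc h < d -> ~ A N (w + h)) ->
  (forall w, nc (w - c) < r -> exists N, A N w) ->
  exists N w, exists2 d : R, 0 < d & nc (w - c) < r /\ forall h, nc h < d -> A N (w + h).
Proof.
move=> r0 oA cA; apply: contrapT => noball.
pose inside (p q : R[i] * R) := nc (q.1 - p.1) + q.2 <= p.2 /\ q.2 <= p.2 / 2.
pose ok (p : R[i] * R) := 0 < p.2 /\ nc (p.1 - c) + p.2 <= r / 2.
have step N p : ok p -> exists q, [/\ ok q, inside p q & forall w, nc (w - q.1) <= q.2 -> ~ A N w].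
  case: p => w d [/= d0 wd].
  have w0 := nc_ge0 (w - c).
  have [h [hd hA]] : exists h, nc h < d / 2 /\ ~ A N (w + h).
    apply: contrapT => H; apply: noball; exists N, w, (d / 2); first lra.
    split=> [|h hd]; first by lra.
    by apply: contrapT => nA; apply: H; exists h.
  have [d' d0' Hd'] := oA _ _ hA.
  have [t [t0 t1 t2]] := small2 d0' (divr_gt0 d0 (ltr0n _ 2)).
  exists (w + h, t); split; rewrite /ok /inside /=.
  - split=> //; have -> : w + h - c = (w - c) + h by ring.
    by have := ncD (w - c) h; lra.
  - have -> : w + h - w = h by ring.
    by split; lra.
  - move=> v vt; have -> : v = w + h + (v - (w + h)) by ring.
    by apply: Hd'; lra.
pose nxt N p := xget p [set q | [/\ ok q, inside p q & forall w, nc (w - q.1) <= q.2 -> ~ A N w]].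
pose p := fix p n := if n is n'.+1 then nxt n' (p n') else (c, r / 2).
have okp n : ok (p n).
  elim: n => [|n IH]; first by rewrite /ok /= subrr nc0 add0r lexx divr_gt0.
  rewrite /= /nxt; case: xgetP => [q -> [] //|]; have [q H] := step n _ IH.
  by move=> /(_ q).
have pP n : inside (p n) (p n.+1) /\ forall w, nc (w - (p n.+1).1) <= (p n.+1).2 -> ~ A n w.
  rewrite /= /nxt; case: xgetP => [q -> [] //|]; have [q H] := step n _ (okp n).
  by move=> /(_ q).
have nest m n : (n <= m)%N -> nc ((p m).1 - (p n).1) + (p m).2 <= (p n).2.
  move=> /subnK <-; elim: (m - n)%N => [|k IH]; first by rewrite add0n subrr nc0 add0r.
  rewrite addSn; have [[H1 _] _] := pP (k + n)%N.
  have -> : (p (k + n).+1).1 - (p n).1 = ((p (k + n).+1).1 - (p (k + n)%N).1) + ((p (k + n)%N).1 - (p n).1) by ring.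
  by apply: (le_trans (lerD (ncD _ _) (lexx _))); lra.
have rad n : (p n).2 <= r / 2 * 2^-1 ^+ n.
  elim: n => [|n IH]; first by rewrite expr0 mulr1.
  by have [[_ H] _] := pP n; rewrite exprS; lra.
have [l Hl] : exists l, clim (fun n => (p n).1) l.
  apply: C_complete => e e0.
  have [|||N HN] := @exp_small _ (2^-1 : R) (e / r); [lra|lra|exact: divr_gt0|].
  exists N => m n Nm Nn.
  have B : (p N).2 <= e / 2.
    apply: (le_trans (rad N)); have := HN _ (leqnn N); rewrite ler_pdivlMr //; lra.
  have := nest _ _ Nm; have := nest _ _ Nn.
  have -> : (p m).1 - (p n).1 = ((p m).1 - (p N).1) - ((p n).1 - (p N).1) by ring.
  have [a0 _] := okp m; have [b0 _] := okp n.
  by move=> *; apply: (le_trans (ncB _ _)); lra.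
have inl n : nc (l - (p n).1) <= (p n).2.
  apply: (@clim_le _ (fun m => (p (m + n)%N).1 - (p n).1)).
    move=> e /Hl [N HN]; exists N => m Nm.
    have -> : (p (m + n)%N).1 - (p n).1 - (l - (p n).1) = (p (m + n)%N).1 - l by ring.
    by apply: HN; apply: leq_trans Nm (leq_addr _ _).
  by move=> m; have := nest _ _ (leq_addl m n); have [a0 _] := okp (m + n)%N; lra.
have [|N AN] := cA l.
  by have := inl 0%N; rewrite /=; lra.
by have [_ /(_ _ (inl N.+1))] := pP N.
Qed.

(** Liouville: polynomial growth kills the high Taylor coefficients. *)
Lemma liouville (G : R[i] -> R[i]) (A : R) n : 0 <= A -> (forall r, hol G 0 r) ->
  (forall s, nc (G s) <= A * (1 + nc s) ^+ n) ->
  forall k, (n < k)%N -> tc G 0 k = 0.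
Proof.
move=> A0 hG HG k nk; apply: ncP => e e0.
pose B := 2 * (A * 2 ^+ n); have B0 : 0 <= B by rewrite /B !mulr_ge0 // exprn_ge0.
pose S := B / e + 1; have S1 : 1 <= S by rewrite /S lerDr divr_ge0 // ltW.
have S0 : 0 < S by lra.
have K : nc (tc G 0 k) * S ^+ k <= 2 * (A * (2 * S) ^+ n).
  apply: (@tc_bound _ G 0 (S + 1) S); [exact: hG|by []|lra|] => w wS.
  rewrite add0r; apply: (le_trans (HG w)); rewrite ler_wpM2l //.
  by rewrite wS; apply: lerXn2r; rewrite ?nnegrE; lra.
have Sk : S ^+ k = S ^+ (k - n).-1 * S * S ^+ n.
  by rewrite -exprSr -exprD; congr (_ ^+ _); lia.
have Sn : 0 < S ^+ n by rewrite exprn_gt0.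
have P : 1 <= S ^+ (k - n).-1 by rewrite exprn_ege1.
move: K; rewrite Sk exprMn.
have -> : 2 * (A * (2 ^+ n * S ^+ n)) = B * S ^+ n by rewrite /B; ring.
rewrite mulrA ler_pM2r // => K.
have T0 := nc_ge0 (tc G 0 k).
have K2 : nc (tc G 0 k) * S <= B.
  by apply: le_trans K; rewrite ler_wpM2l // ler_peMl // ltW.
have : nc (tc G 0 k) * (B / e + 1) <= B by [].
rewrite mulrDr mulr1 => K3.
rewrite leNgt; apply/negP => lt.
have : B <= nc (tc G 0 k) * (B / e) by rewrite mulrA ler_pdivlMr // mulrC ler_wpM2r // ltW.
lra.
Qed.

Lemma prod_dist n i : (i <= n)%N ->
  (\prod_(0 <= j < n.+1 | j != i) (maxn i j - minn i j) = i`! * (n - i)`!)%N.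
Proof.
move=> ni; rewrite (@big_cat_nat _ _ _ i) //=; last by rewrite (leq_trans ni).
rewrite [X in (_ * X)%N]big_ltn_cond ?ltnS // eqxx /=; congr (_ * _)%N.
  rewrite big_nat_cond (eq_big (fun j => (0 <= j < i)%N && true) (fun j => (i - j)%N)); first last.
  - by move=> j /andP[/andP[_ ji] _]; rewrite (maxn_idPl (ltnW ji)) (minn_idPr (ltnW ji)).
  - by move=> j; case: ltngtP.
  rewrite -big_nat_cond big_nat_rev /= add0n fact_prod big_add1 /= big_nat_cond [RHS]big_nat_cond.
  by apply: eq_bigr => j /andP[/andP[_ ji] _]; lia.
rewrite big_nat_cond (eq_big (fun j => (i.+1 <= j < n.+1)%N && true) (fun j => (j - i)%N)); first last.
- by move=> j /andP[/andP[ij _] _]; rewrite (maxn_idPr (ltnW ij)) (minn_idPl (ltnW ij)).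
- by move=> j; case: ltngtP.
rewrite -big_nat_cond -[i.+1]addn1 addnC big_addn fact_prod.
rewrite subSn // big_nat_cond [RHS]big_nat_cond; apply: eq_bigr => j _; lia.
Qed.

Lemma pow_fact_le n : (n.+1)%:R ^+ n <= expR 1 ^+ n * (n`!)%:R :> R.
Proof.
elim: n => [|n IH]; first by rewrite !expr0 mul1r.
have m0 : 0 < n.+1%:R :> R by rewrite ltr0n.
have H : (n.+2%:R / n.+1%:R) ^+ n.+1 <= expR 1 :> R.
  have -> : expR 1 = expR (n.+1%:R^-1) ^+ n.+1 :> R by rewrite -expRM_natl divff // gt_eqF.
  apply: lerXn2r; rewrite ?nnegrE ?divr_ge0 ?expR_ge0 //.
  have -> : n.+2%:R / n.+1%:R = 1 + n.+1%:R^-1 :> R.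
    by rewrite -[n.+2]addn1 natrD mulrDl divff ?gt_eqF // mul1r.
  exact: expR_ge1Dx.
move: H; rewrite expr_div_n ler_pdivrMr ?exprn_gt0 // => H; apply: (le_trans H).
rewrite factS natrM [n.+1%:R ^+ _]exprSr exprS -!mulrA ler_pM2l ?expR_gt0 //.
by rewrite [X in _ <= X]mulrCA mulrC ler_pM2l.
Qed.

Lemma lagrange_interp n (p : {poly R[i]}) (x : 'I_n.+1 -> R[i]) : injective x ->
  (size p <= n.+1)%N -> forall s,
  p.[s] = \sum_(i < n.+1) p.[x i] * \prod_(j < n.+1 | j != i) ((s - x j) / (x i - x j)).
Proof.
move=> xinj sp s.
pose q : {poly R[i]} := \sum_(i < n.+1) (p.[x i] * \prod_(j < n.+1 | j != i) (x i - x j)^-1) *: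
   \prod_(j < n.+1 | j != i) ('X - (x j)%:P).
have qE t : q.[t] = \sum_(i < n.+1) p.[x i] * \prod_(j < n.+1 | j != i) ((t - x j) / (x i - x j)).
  rewrite horner_sum; apply: eq_bigr => i _.
  rewrite hornerZ horner_prod -mulrA; congr (_ * _).
  rewrite -big_split /=; apply: eq_bigr => j _.
  by rewrite hornerXsubC mulrC.
rewrite -qE; apply/eqP; rewrite -subr_eq0 -hornerN -hornerD; apply/eqP.
suff -> : p - q = 0 by rewrite horner0.
apply: (@roots_geq_poly_eq0 _ _ [seq x i | i <- enum 'I_n.+1]).
- apply/allP => _ /mapP[i _ ->]; rewrite /root hornerD hornerN qE (bigD1 i) //=.
  rewrite [X in _ * X]big1 ?mulr1 => [|j ji]; last first.
    by rewrite divff // subr_eq0; apply: contra ji => /eqP/xinj ->.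
  rewrite big1 ?addr0 ?subrr // => k ki.
  by rewrite (bigD1 i) 1?eq_sym //= subrr !mul0r mulr0.
- by rewrite map_inj_uniq // enum_uniq.
- rewrite size_map size_enum_ord; apply: (leq_trans (size_polyD _ _)).
  rewrite geq_max sp size_polyN; apply: (leq_trans (size_sum _ _ _)).
  apply/bigmax_leqP => i _; apply: (leq_trans (size_scale_leq _ _)).
  apply: (leq_trans (size_poly_prod_leq _ _)).
  under eq_bigr do rewrite size_XsubC.
  by rewrite sum_nat_const cardC1 card_ord; lia.
Qed.

Definition above (E : set R) (a : R) : set R := E `&` `[a, 1].

(** A subset of [0, 1] of large measure contains many well spaced points. *)
Lemma spaced_points (E : set R) (eta : R) : 0 < eta -> measurable E ->
  forall k (a : R), a <= 1 -> ((k%:R * 2 * eta)%:E < lebesgue_measure (above E a))%E ->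
  exists x : nat -> R, (forall i, (i <= k)%N -> (above E a) (x i)) /\
    (forall i, (i < k)%N -> x i + eta <= x i.+1).
Proof.
move=> eta0 mE k; elim: k => [|k IH] a a1 mu.
  have [x Hx] : (above E a) !=set0.
    apply/set0P/negP => /eqP E0; by move: mu; rewrite E0 measure0 !mul0r ltxx.
  by exists (fun=> x); split.
pose S := above E a.
have mS b : measurable (above E b) by exact: measurableI.
have S0 : S !=set0.
  apply/set0P/negP => /eqP E0; move: mu; rewrite -/S E0 measure0 lte_fin.
  by rewrite ltNge !mulr_ge0 // ltW.
have lS : has_lbound S by exists a => x [_]; rewrite /= in_itv /= => /andP[].
have [x0 Sx0 x0u] := inf_adherent eta0 (conj S0 lS).
pose b0 := x0 + eta.
pose J : set R := [set` `[inf S, b0]].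
have Sub : S `<=` J `|` above E b0.
  move=> y Sy; have iy : inf S <= y by apply: ge_inf.
  have [yx|xy] := leP y b0; [left|right]; first by rewrite /J /= in_itv /= iy.
  case: Sy => Ey; rewrite /= in_itv /= => /andP[_ y1]; split => //=.
  by rewrite in_itv /= (ltW xy).
have ix0 : inf S <= x0 by apply: ge_inf.
have ix : inf S < b0 by rewrite /b0; lra.
have mJ : measurable J by rewrite /J; exact: measurable_itv.
have M1 : (lebesgue_measure S <= (2 * eta)%:E + lebesgue_measure (above E b0))%E.
  apply: (@le_trans _ _ (lebesgue_measure (J `|` above E b0))).
    apply: le_measure => //; rewrite inE; first exact: (mS a).
    by apply: measurableU; [exact: mJ|exact: (mS b0)].
  have U2 : (lebesgue_measure (J `|` above E b0) <= lebesgue_measure J + lebesgue_measure (above E b0))%E.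
    by apply: measureU2; [exact: mJ|exact: (mS b0)].
  apply: (le_trans U2); apply: leeD2r.
  by rewrite lebesgue_measure_itv /= lte_fin ix -EFinB lee_fin /b0; lra.
have {mu} := lt_le_trans mu M1.
have x01 : x0 <= 1 by case: Sx0 => _; rewrite /= in_itv /= => /andP[].
have ax0 : a <= x0 by case: Sx0 => _; rewrite /= in_itv /= => /andP[].
have [xe|xe] := leP (x0 + eta) 1; last first.
  rewrite /above set_itv_ge ?bnd_simp -?ltNge // setI0 measure0 adde0 lte_fin ltNge.
  by rewrite -mulrA ler_peMl ?mulr_ge0 ?(ltW eta0) // ler1n.
have -> : (k.+1%:R * 2 * eta)%:E = ((2 * eta)%:E + (k%:R * 2 * eta)%:E)%E.
  by rewrite -EFinD; congr (_%:E); rewrite -natr1; ring.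
rewrite lteD2lE // => mu'.
have [x [H1 H2]] := IH (x0 + eta) xe mu'.
exists (fun i => if i is j.+1 then x j else x0); split.
  case=> [//|i] ik; have [? ] := H1 i ik; rewrite /= in_itv /= => /andP[p1 p2]; split => //=.
  by rewrite in_itv /= p2 andbT (le_trans _ p1) // (le_trans ax0) // lerDl ltW.
case=> [_|i ik]; last exact: H2.
by have [_ /=] := H1 0%N (leq0n _); rewrite in_itv /= => /andP[].
Qed.

(** Leja's polynomial lemma: a polynomial of degree n that is bounded by B on
    a set of measure 1/2 is bounded by B times a fixed n-th power on the disc. *)
Definition leja_const : R := 16 * expR 1.

Lemma leja_const_gt0 : 0 < leja_const.
Proof. by rewrite mulr_gt0 // expR_gt0. Qed.

Lemma leja (c : nat -> R[i]) n (E : set R) (B : R) : measurable E -> E `<=` `[0, 1] ->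
  ((2^-1)%:E <= lebesgue_measure E)%E -> 0 <= B ->
  (forall t, E t -> nc (\sum_(k < n.+1) c k * t%:C ^+ k) <= B) ->
  forall s, nc s <= 1 -> nc (\sum_(k < n.+1) c k * s ^+ k) <= B * leja_const ^+ n.
Proof.
move=> mE E1 muE B0 HB s s1.
pose eta : R := (4 * n.+1%:R)^-1.
have n0 : 0 < n.+1%:R :> R by rewrite ltr0n.
have eta0 : 0 < eta by rewrite invr_gt0 mulr_gt0.
have [x [Ex gap]] : exists x : nat -> R, (forall i, (i <= n)%N -> (above E 0) (x i)) /\
    (forall i, (i < n)%N -> x i + eta <= x i.+1).
  apply: spaced_points => //; rewrite /above setIidl //; apply: lt_le_trans muE; rewrite lte_fin.
  rewrite /eta ltr_pdivrMr ?mulr_gt0 //.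
  have : n%:R < n.+1%:R :> R by rewrite ltr_nat.
  lra.
have gaps i j : (i <= j)%N -> (j <= n)%N -> (j - i)%:R * eta <= x j - x i.
  move=> /subnK <-; elim: (j - i)%N => [|k IH]; first by rewrite add0n subnn mul0r subrr.
  rewrite addSn => kn; have := gap _ kn; have := IH (ltnW kn).
  rewrite !addnK subSn ?leq_addl // addnK -natr1; lra.
pose p : {poly R[i]} := \poly_(k < n.+1) c k.
have pE t : p.[t] = \sum_(k < n.+1) c k * t ^+ k by rewrite horner_poly.
have dist (i j : 'I_n.+1) : (maxn i j - minn i j)%:R * eta <= nc ((x i)%:C - (x j)%:C).
  have L (k : 'I_n.+1) : (k <= n)%N by rewrite -ltnS.
  rewrite -rmorphB ncR; case: (leqP i j) => [ij|/ltnW ji].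
    by rewrite (le_trans (gaps i j ij (L j))) // -normrN opprB ler_norm.
  by rewrite (le_trans (gaps j i ji (L i))) // ler_norm.
have xinj : injective (fun i : 'I_n.+1 => (x i)%:C).
  move=> i j /= xij; apply/val_inj/eqP; apply: contraT => nij.
  have := dist i j; rewrite xij subrr nc0 leNgt mulr_gt0 // ltr0n.
  by move: nij; rewrite /= ; case: ltngtP => //; lia.
rewrite -pE (lagrange_interp xinj (size_poly _ _)).
apply: (le_trans (nc_sum _ _ _)).
have term (i : 'I_n.+1) : nc (p.[(x i)%:C] * \prod_(j < n.+1 | j != i) ((s - (x j)%:C) / ((x i)%:C - (x j)%:C)))
   <= B * ((2 / eta) ^+ n / (i`! * (n - i)`!)%:R).
  rewrite ncM; apply: ler_pM; rewrite ?nc_ge0 //.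
    by rewrite pE; apply: HB; case: (Ex i) => //; rewrite -ltnS.
  rewrite /nc (big_morph (@Normc.normc R) (@Normc.normcM R) (@Normc.normc1 R)) -/nc.
  apply: (@le_trans _ _ (\prod_(j < n.+1 | j != i) (2 / ((maxn i j - minn i j)%:R * eta)))).
    apply: ler_prod => j ji; rewrite nc_ge0 /= -/(nc _) ncM ncV.
    have d0 : 0 < (maxn i j - minn i j)%:R * eta.
      by rewrite mulr_gt0 // ltr0n; move: ji; rewrite -val_eqE /=; case: ltngtP => //; lia.
    apply: ler_pM; rewrite ?invr_ge0 ?nc_ge0 //.
      apply: (le_trans (ncB _ _)); rewrite ncR.
      have [_] : (above E 0) (x j) by apply: Ex; rewrite -ltnS.
      by rewrite /= in_itv /= => /andP[x0 x1]; rewrite ger0_norm //; lra.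
    by rewrite lef_pV2 ?posrE // (lt_le_trans d0).
  have -> : \prod_(j < n.+1 | j != i) (2 / ((maxn i j - minn i j)%:R * eta)) =
     \prod_(j < n.+1 | j != i) (2 / eta) * (\prod_(j < n.+1 | j != i) (maxn i j - minn i j)%:R)^-1.
    rewrite -prodfV -big_split /=; apply: eq_bigr => j _.
    by rewrite invfM mulrA mulrAC.
  rewrite prodr_const cardC1 card_ord /= -natr_prod.
  have -> : (\prod_(j < n.+1 | j != i) (maxn i j - minn i j) = i`! * (n - i)`!)%N.
    have iL : (i <= n)%N by rewrite -ltnS.
    by rewrite -(prod_dist iL) big_mkord.
  by [].
apply: (@le_trans _ _ (\sum_(i < n.+1) B * ((2 / eta) ^+ n / (i`! * (n - i)`!)%:R))).
  by apply: ler_sum => i _; exact: term.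
rewrite -mulr_sumr ler_wpM2l // -mulr_sumr.
have f0 k : 0 < (k`!)%:R :> R by rewrite ltr0n fact_gt0.
have -> : \sum_(i < n.+1) ((i`! * (n - i)`!)%:R)^-1 = 2 ^+ n / (n`!)%:R :> R.
  have -> : 2 ^+ n = \sum_(i < n.+1) ('C(n, i))%:R :> R.
    rewrite -natr_sum -[2]/(1 + 1)%N%:R -natrX expnDn; congr (_%:R).
    by apply: eq_bigr => i _; rewrite !exp1n !muln1.
  rewrite mulr_suml; apply: eq_bigr => i _.
  have /bin_fact <- : (i <= n)%N by rewrite -ltnS.
  rewrite [('C(n, i) * _)%:R]natrM invfM mulrA divff ?mul1r //.
  by rewrite pnatr_eq0 -lt0n bin_gt0 -ltnS.
rewrite mulrA ler_pdivrMr // -exprMn.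
have -> : 2 / eta * 2 = 16 * n.+1%:R by rewrite /eta invrK; ring.
rewrite /leja_const !exprMn -mulrA ler_wpM2l ?exprn_ge0 //.
exact: pow_fact_le.
Qed.

End BaireLeja.


Section Hartogs.
Context {R : realType}.
Local Open Scope complex_scope.
Variable W : lmodType R[i].
Implicit Types (F : W -> R[i]) (a y : W).

(** F is entire on every complex line *)
Definition gentire F := forall a b z, exists l, hd (fun t => F (a + t *: b)) z l.

Lemma gentire_hol F a b c (r : R) : gentire F -> hol (fun t => F (a + t *: b)) c r.
Proof. by move=> h z _; exact: h. Qed.

(** the homogeneous terms of the expansion of F at a *)
Definition hterm F a n y : R[i] := tc (fun t => F (a + t *: y)) 0 n.

Lemma hterm_hom F a n y c : gentire F -> hterm F a n (c *: y) = c ^+ n * hterm F a n y.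
Proof.
move=> gF; rewrite /hterm (@tc_eq _ _ _ (fun k => c ^+ k * tc (fun t => F (a + t *: y)) 0 k) 1 ltr01) //.
move=> w _.
have := tcP (@gentire_hol F a y 0 (nc (w * c) + 1) gF); move=> /(_ (w * c)).
rewrite ltrDl ltr01 !add0r scalerA => /(_ isT); apply: clim_ext => n'.
by apply: eq_bigr => k _; rewrite exprMn; ring.
Qed.

Lemma hterm_sum F a y : gentire F -> psum (fun n => hterm F a n y) 1 (F (a + y)).
Proof.
move=> gF; have := tcP (@gentire_hol F a y 0 2 gF); move=> /(_ 1).
by rewrite nc1 add0r scale1r; apply; lra.
Qed.

Lemma hterm_pointwise F a y (r : R) : gentire F -> 0 < r ->
  exists2 M : R, 0 <= M & forall n, r ^+ n * nc (hterm F a n y) <= M.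
Proof.
move=> gF r0.
have h : hol (fun t => F (a + t *: y)) 0 (r + 1) by exact: gentire_hol.
have rr : r < r + 1 by lra.
have [M M0 HM] := hol_bounded h r0 rr.
exists (2 * M) => [|n]; first by rewrite mulr_ge0.
rewrite mulrC; apply: (tc_bound h) => // w wr; by apply: HM; rewrite wr.
Qed.

Lemma hterm_bound F a y (M : R) n : gentire F ->
  (forall t, nc t = 1 -> nc (F (a + t *: y)) <= M) -> nc (hterm F a n y) <= 2 * M.
Proof.
move=> gF HM; have := @tc_bound _ (fun t => F (a + t *: y)) 0 2 1 M (@gentire_hol F a y 0 2 gF) ltr01.
have l2 : 1 < 2 :> R by lra.
move=> /(_ l2) H; have := H _ n; rewrite expr1n mulr1; apply=> w w1.
by rewrite add0r; exact: HM.
Qed.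

Section Polydisc.
Variables (F : W -> R[i]) (gF : gentire F) (b : nat -> W) (m : nat).
Local Notation Y x := (\sum_(k < m) x k *: b k).
Let scaleY (c : R[i]) (x : nat -> R[i]) : c *: Y x = Y (fun k => c * x k).
Proof. by rewrite scaler_sumr; apply: eq_bigr => k _; rewrite scalerA. Qed.
Let addY (x x' : nat -> R[i]) c : Y x + c *: Y x' = Y (fun k => x k + c * x' k).
Proof. by rewrite scaleY -big_split; apply: eq_bigr => k _; rewrite /= -scalerDl. Qed.

Variables (a : W) (de N : R).
Hypotheses (de0 : 0 < de) (N0 : 0 <= N)
  (FN : forall x, (forall k, (k < m)%N -> nc (x k) <= de) -> nc (F (a + Y x)) <= N).

Let P n (x : nat -> R[i]) := hterm F a n (Y x).

Let P_le n x (X : R) : 0 < X -> (forall k, (k < m)%N -> nc (x k) <= X) ->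
  nc (P n x) <= 2 * N * (X / de) ^+ n.
Proof.
move=> X0 HX; pose c := (X / de)%:C.
have c0 : c != 0 by rewrite fmorph_eq0 mulf_neq0 ?invr_eq0 // gt_eqF.
have -> : P n x = c ^+ n * P n (fun k => c^-1 * x k).
  rewrite /P -hterm_hom // (scaleY c (fun k => c^-1 * x k)); congr (hterm _ _ _ _); apply: eq_bigr => k _.
  by rewrite mulVKf.
have nc_c : nc c = X / de by rewrite ncR gtr0_norm // divr_gt0.
rewrite ncM ncX nc_c mulrC ler_wpM2r ?exprn_ge0 ?divr_ge0 ?(ltW X0) ?(ltW de0) //.
rewrite /P; apply: hterm_bound => // t t1; rewrite (scaleY t (fun k => c^-1 * x k)).
apply: (@FN (fun k => t * (c^-1 * x k))) => k km.
rewrite !ncM t1 mul1r ncV nc_c invf_div mulrAC ler_pdivrMr // ler_wpM2l ?(ltW de0) //.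
exact: HX.
Qed.

Let maxnc (x : nat -> R[i]) : exists2 X : R, 0 < X & forall k, (k < m)%N -> nc (x k) <= X.
Proof.
exists (\sum_(k < m) nc (x k) + 1) => [|k km].
  by rewrite ltr_wpDl // sumr_ge0 // => k _; exact: nc_ge0.
rewrite (bigD1 (Ordinal km)) //= -addrA lerDl addr_ge0 // sumr_ge0 // => i _; exact: nc_ge0.
Qed.

Let P_entire n x x' z : exists l, hd (fun s => P n (fun k => x k + s * x' k)) z l.
Proof.
have [X X0 HX] := maxnc x; have [X' X0' HX'] := maxnc x'.
pose T := X + (nc z + 1) * X'.
have z0 := nc_ge0 z.
have T0 : 0 < T by rewrite /T addr_gt0 // mulr_gt0 //; lra.
pose tau : R[i] := (de / T)%:C.
have nct : nc tau = de / T by rewrite ncR gtr0_norm // divr_gt0.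
have tau0 : tau != 0 by rewrite -nc_gt0 nct divr_gt0.
pose G s t := F (a + t *: (tau *: Y (fun k => x k + (z + s) * x' k))).
have h1 t : nc t < 1 -> hol (G^~ t) 0 1.
  move=> _ s _; have -> : (fun s => G s t) = (fun s => F ((a + t *: (tau *: Y (fun k => x k + z * x' k))) + s *: (t *: (tau *: Y x')))).
    apply/funext => u; rewrite /G -addrA; congr (F (a + _)).
    rewrite [u *: _]scalerA [u * _]mulrC -scalerA -scalerDr; congr (_ *: _).
    rewrite [u *: _]scalerA [u * _]mulrC -scalerA -scalerDr; congr (_ *: _).
    rewrite (addY (fun k => x k + z * x' k)).
    by apply: eq_bigr => k _; congr (_ *: _); ring.
  exact: gF.
have h2 s : nc s < 1 -> hol (G s) 0 1 by move=> _; exact: gentire_hol.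
have h3 s t : nc s < 1 -> nc t < 1 -> nc (G s t) <= N.
  move=> s1 t1; rewrite /G scalerA (scaleY _ (fun k => x k + (z + s) * x' k)).
  apply: (@FN (fun k => t * tau * (x k + (z + s) * x' k))) => k km.
  rewrite !ncM nct.
  have B : nc (x k + (z + s) * x' k) <= T.
    apply: (le_trans (ncD _ _)); rewrite ncM /T lerD ?HX //.
    apply: ler_pM; rewrite ?nc_ge0 ?HX' //.
    by apply: (le_trans (ncD _ _)); rewrite lerD2l ltW.
  have := ler_pM (nc_ge0 t) (nc_ge0 _) (ltW t1) B; rewrite mul1r => C.
  move: C; set v := nc (_ + _) => C.
  have -> : nc t * (de / T) * v = de * (nc t * v) / T by ring.
  by rewrite ler_pdivrMr // ler_wpM2l ?(ltW de0).
have [_ /(_ n) H] := tc_param ltr01 ltr01 N0 h1 h2 h3.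
have tcG s : tc (G s) 0 n = tau ^+ n * P n (fun k => x k + (z + s) * x' k).
  by rewrite -hterm_hom.
eexists.
have K : hd (fun s => tau ^- n * tc (G s) 0 n) 0 (tau ^- n * tc (fun t => dC (G^~ t) 0) 0 n).
  exact: hdZ.
have := @hd_aff _ (fun s => tau ^- n * tc (G s) 0 n) z _ (- z) 1.
rewrite mul1r addNr => /(_ _ K); rewrite mul1r; apply: hd_ext => s.
by rewrite tcG mul1r addrA subrr add0r mulKf // expf_neq0.
Qed.


Let P_poly n (x x' : nat -> R[i]) : exists c : nat -> R[i],
  forall s, P n (fun k => x k + s * x' k) = \sum_(k < n.+1) c k * s ^+ k.
Proof.
have [X X0 HX] := maxnc x; have [X' X0' HX'] := maxnc x'.
pose T := X + X'; have T0 : 0 < T by rewrite /T addr_gt0.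
pose G s := P n (fun k => x k + s * x' k).
have hG r : hol G 0 r by move=> z _; exact: P_entire.
exists (tc G 0) => s; have s0 := nc_ge0 s.
have G0 : 0 <= 2 * N * (T / de) ^+ n.
  by rewrite !mulr_ge0 // exprn_ge0 // divr_ge0 ?ltW.
have high := @liouville _ G (2 * N * (T / de) ^+ n) n G0 hG.
have {}high k : (n < k)%N -> tc G 0 k = 0.
  apply: high => u; have u0 := nc_ge0 u.
  apply: (le_trans (@P_le n _ (T * (1 + nc u)) _ _)).
  - by rewrite mulr_gt0 //; lra.
  - move=> j jm; apply: (le_trans (ncD _ _)); rewrite ncM.
    have := HX j jm; have := ler_wpM2l u0 (HX' j jm); rewrite /T; nra.
  - by rewrite [T * _ / de]mulrAC exprMn mulrA.
have := tcP (hG (nc s + 1)); move=> /(_ s); rewrite ltrDl ltr01 add0r => /(_ isT) H.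
apply: (clim_unique H) => e e0; exists n.+1 => n' nn'.
have -> : \sum_(k < n') tc G 0 k * s ^+ k = \sum_(k < n.+1) tc G 0 k * s ^+ k.
  rewrite -(subnKC nn') big_split_ord /= [X in _ + X]big1 ?addr0 // => i _.
  by rewrite high ?mul0r // leq_addr.
by rewrite subrr nc0 ltW.
Qed.

Let upd (x : nat -> R[i]) k t i := if i == k then t else x i.

Let P_upd n x k t0 : exists c : nat -> R[i],
  forall s, P n (upd x k (t0 + s)) = \sum_(j < n.+1) c j * s ^+ j.
Proof.
have [c Hc] := P_poly n (upd x k t0) (upd (fun=> 0) k 1).
exists c => s; rewrite -Hc; congr (P n _); apply/funext => i; rewrite /upd.
by case: eqP => _; rewrite ?mulr1 ?mulr0 ?addr0.
Qed.

Let good (x : nat -> R[i]) k (r : R) (B : R) : set R := [set t : R | forall n x',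
  (forall i, (i < k)%N -> nc (x' i) <= 1) -> (forall i, (k < i)%N -> x' i = x i) ->
  r ^+ n * nc (P n (upd x' k t%:C)) <= B].

Let good_closed x k r B : 0 < r -> closed (good x k r B).
Proof.
move=> r0; rewrite -openC openE => t nt.
have [n [x' [h1 h2 h3]]] : exists n x', [/\ forall i, (i < k)%N -> nc (x' i) <= 1,
   forall i, (k < i)%N -> x' i = x i & B < r ^+ n * nc (P n (upd x' k t%:C))].
  apply: contrapT => H; apply: nt => n x' h1 h2; rewrite leNgt; apply/negP => h3.
  by apply: H; exists n, x'.
have [c Hc] := P_upd n x' k t%:C.
pose p s := \sum_(j < n.+1) c j * s ^+ j.
have : hd p 0 (\sum_(j < n.+1) c j * (j%:R * 0 ^+ j.-1)).
  by apply: hd_sum => j _; apply: hdZ; exact: hdX.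
move=> /hd_cont cp.
have rn : 0 < r ^+ n by rewrite exprn_gt0.
pose e := (r ^+ n * nc (P n (upd x' k t%:C)) - B) / 2 / r ^+ n.
have e0 : 0 < e by rewrite !divr_gt0 // subr_gt0.
have [d d0 Hd] := cp e e0.
apply/nbhs_ballP; exists d => //= u; rewrite /ball /= => tu gu.
have := gu n x' h1 h2.
have -> : u%:C = t%:C + (u - t)%:C by rewrite rmorphB /=; ring.
rewrite Hc -/(p _).
have : nc (p (0 + (u - t)%:C) - p 0) <= e by apply: Hd; rewrite ncR distrC.
rewrite add0r.
have -> : p 0 = P n (upd x' k t%:C) by rewrite -[t%:C]addr0 Hc.
have := nc_sub_ge (P n (upd x' k t%:C)) (p (u - t)%:C); rewrite ncBC => A1 A2 A3.
have A4 : nc (P n (upd x' k t%:C)) - nc (p (u - t)%:C) <= e by lra.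
have := ler_wpM2l (ltW rn) A4.
have -> : r ^+ n * e = (r ^+ n * nc (P n (upd x' k t%:C)) - B) / 2.
  by rewrite /e mulrC divfK // gt_eqF.
rewrite mulrBr; lra.
Qed.

Let P_uniform k : (k <= m)%N -> forall (r : R) x, 0 < r -> exists2 M : R, 0 <= M & forall n x',
  (forall i, (i < k)%N -> nc (x' i) <= 1) -> (forall i, (k <= i)%N -> x' i = x i) ->
  r ^+ n * nc (P n x') <= M.
Proof.
elim: k => [|k IH] km r x r0.
  have [M M0 HM] := @hterm_pointwise F a (Y x) r gF r0.
  exists M => // n x' _ E; have -> : x' = x by apply/funext => i; exact: E.
  exact: HM.
pose r' := r * leja_const; have r0' : 0 < r' by rewrite mulr_gt0 // leja_const_gt0.
pose E N : set R := [set` `[0, 1]] `&` good x k r' N%:R.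
have mE N' : measurable (E N').
  apply: measurableI => //; apply: measurable_realfun.closed_measurable; exact: good_closed.
have homE : {homo E : i j / (i <= j)%N >-> (i <= j)%O}.
  move=> i j ij; apply/subsetPset => t [t01 gt]; split => // n x' h1 h2.
  by apply: (le_trans (gt n x' h1 h2)); rewrite ler_nat.
have covE : \bigcup_n E n = [set` `[0, 1]].
  apply/seteqP; split=> [t [n _ []]//|t t01].
  have [M M0 HM] := IH (ltnW km) r' (upd x k t%:C) r0'.
  have [j Hj] : exists j, M <= j%:R.
    by exists (Num.bound M); rewrite ltW // archi_boundP.
  exists j => //; split=> // n x' h1 h2; apply: le_trans Hj; apply: HM.
    by move=> i ik; rewrite /upd ltn_eqF // h1.
  move=> i ki; rewrite /upd; case: eqP => // /eqP ik; apply: h2.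
  by rewrite ltn_neqAle eq_sym ik.
have cvE := @nondecreasing_cvg_mu _ _ _ (@lebesgue_measure R) E mE (bigcup_measurable (fun k _ => mE k)) homE.
have [j muj] : exists j, ((2^-1)%:E <= lebesgue_measure (E j))%E.
  apply: contrapT => H.
  have : (lim ((lebesgue_measure \o E) @ \oo) <= (2^-1 : R)%:E)%E.
    apply: lime_le; first by apply/cvg_ex; eexists; exact: cvE.
    apply: nearW => j /=; rewrite leNgt; apply/negP => L; apply: H; exists j; exact: ltW.
  have -> : lim ((lebesgue_measure \o E) @ \oo) = lebesgue_measure (\bigcup_n E n) by apply/cvg_lim.
  rewrite covE lebesgue_measure_itv /= lte_fin ltr01 sube0 lee_fin; lra.
exists j%:R => // n x' h1 h2.
have h1' i : (i < k)%N -> nc (x' i) <= 1 by move=> ik; apply: h1; exact: ltnW.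
have [c Hc] := P_upd n x' k 0.
have xE : x' = upd x' k (0 + x' k).
  by apply/funext => i; rewrite /upd add0r; case: eqP => [->|].
have rn : 0 < r' ^+ n by rewrite exprn_gt0.
have L := @leja R c n (E j) (j%:R / r' ^+ n) (mE j).
have {}L : nc (\sum_(k0 < n.+1) c k0 * x' k ^+ k0) <= j%:R / r' ^+ n * leja_const ^+ n.
  apply: L => //.
  - by move=> t [].
  - by apply: divr_ge0 => //; exact: ltW.
  - move=> t [_ gt]; rewrite -Hc add0r ler_pdivlMr // mulrC; apply: gt => //.
  - exact: h1.
rewrite xE Hc; apply: (le_trans (ler_wpM2l (exprn_ge0 n (ltW r0)) L)).
rewrite /r' exprMn; have l0 : leja_const ^+ n != 0 :> R by rewrite gt_eqF // exprn_gt0 // leja_const_gt0.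
have r1 : r ^+ n != 0 by rewrite gt_eqF // exprn_gt0.
suff -> : r ^+ n * (j%:R / (r ^+ n * leja_const ^+ n) * leja_const ^+ n) = j%:R by [].
by field; rewrite r1 l0.
Qed.

(** Once F is bounded on some polydisc, it is bounded on every larger one. *)
Lemma polydisc_bound (X : R) : 0 < X -> exists2 M : R, 0 <= M & forall x,
  (forall k, (k < m)%N -> nc (x k) <= X) -> nc (F (a + Y x)) <= M.
Proof.
move=> X0; have X20 : 0 < 2 * X by rewrite mulr_gt0.
have [M M0 HM] := P_uniform (leqnn m) (fun=> 0) X20.
exists (M * 2) => [|x Hx]; first by rewrite mulr_ge0.
have tail := @psum_tail R (fun n => hterm F a n (Y x)) 1 _ M 2 0 (hterm_sum a (Y x) gF).
have := tail _ _ M0 _; rewrite nc1 big_ord0 subr0 expr0 mul1r => H.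
have -> : M * 2 = M * (1 - 1 / 2)^-1 by congr (_ * _); field.
apply: H; [lra|lra|] => n.
pose x' k := if (k < m)%N then X%:C^-1 * x k else 0.
have XC : X%:C != 0 :> R[i] by rewrite fmorph_eq0 gt_eqF.
have -> : hterm F a n (Y x) = X%:C ^+ n * P n x'.
  rewrite /P -hterm_hom // (scaleY X%:C x'); congr (hterm _ _ _ _); apply: eq_bigr => k _.
  by rewrite /x' ltn_ord mulVKf.
have nX : nc X%:C = X by rewrite ncR gtr0_norm.
rewrite ncM ncX nX mulrC mulrA -exprMn; apply: HM => i im.
  by rewrite /x' im ncM ncV nX mulrC ler_pdivrMr // mul1r Hx.
by rewrite /x' ltnNge im.
Qed.

End Polydisc.

(** Hartogs' theorem: a function that is entire on every complex line is
    bounded on polydiscs. Baire's theorem provides a first polydisc, and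
    Leja's lemma enlarges it. *)
Lemma hartogs F (b : nat -> W) m a (X : R) : gentire F -> 0 < X ->
  exists2 M : R, 0 <= M & forall x : nat -> R[i],
    (forall k, (k < m)%N -> nc (x k) <= X) -> nc (F (a + \sum_(k < m) x k *: b k)) <= M.
Proof.
move=> gF; elim: m a X => [|m IH] a X X0.
  by exists (nc (F a)); rewrite ?nc_ge0 // => x _; rewrite big_ord0 addr0.
pose A N w := forall x : nat -> R[i], (forall k, (k < m)%N -> nc (x k) <= X) ->
  nc (F (a + w *: b m + \sum_(k < m) x k *: b k)) <= N%:R.
have [N [w0 [d d0 [_ Hd]]]] : exists N w0, exists2 d : R, 0 < d &
    nc (w0 - 0) < 1 /\ forall h, nc h < d -> A N (w0 + h).
  apply: baireC; first exact: ltr01.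
    move=> N w nA.
    have [x [h1 h2]] : exists x : nat -> R[i], (forall k, (k < m)%N -> nc (x k) <= X) /\
       N%:R < nc (F (a + w *: b m + \sum_(k < m) x k *: b k)).
      apply: contrapT => H; apply: nA => x h1; rewrite leNgt; apply/negP => h2; by apply: H; exists x.
    pose g t := F (a + t *: b m + \sum_(k < m) x k *: b k).
    have [l /hd_cont cg] : exists l, hd g w l.
      have [l hl] := gF (a + \sum_(k < m) x k *: b k) (b m) w; exists l.
      by apply: hd_ext hl => t; rewrite /g addrAC.
    pose e := (nc (g w) - N%:R) / 2.
    have e0 : 0 < e by rewrite divr_gt0 // subr_gt0.
    have [d d0 Hd] := cg e e0; exists d => // h hd Ah.
    have U : nc (g (w + h)) <= N%:R := Ah x h1.
    have V := Hd h hd.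
    have := nc_sub_ge (g w) (g (w + h)); rewrite ncBC => Z.
    have := h2; rewrite -/(g w) => h2'.
    by move: V; rewrite /e; lra.
  move=> w _; have [M M0 HM] := IH (a + w *: b m) X X0.
  exists (Num.bound M) => x /HM H; apply: (le_trans H).
  by rewrite ltW // archi_boundP.
have [de [de0 de1 de2]] := small2 d0 X0.
pose a' := a + w0 *: b m.
have FN x : (forall k, (k < m.+1)%N -> nc (x k) <= de) ->
   nc (F (a' + \sum_(k < m.+1) x k *: b k)) <= N%:R.
  move=> Hx; rewrite big_ord_recr /=.
  have -> : a' + (\sum_(k < m) x k *: b k + x m *: b m) = a + (w0 + x m) *: b m + \sum_(k < m) x k *: b k.
    by rewrite /a' scalerDl [_ + x m *: _]addrC -!addrA.
  apply: Hd; first by apply: le_lt_trans de1; exact: Hx.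
  by move=> k km; apply: le_trans (ltW de2); apply: Hx; exact: ltnW.
have X10 : 0 < X + nc w0 by have := nc_ge0 w0; lra.
have [M M0 HM] := polydisc_bound gF de0 (ler0n _ N) FN X10.
exists M => // x Hx.
pose x' k := if k == m then x m - w0 else x k.
have -> : a + \sum_(k < m.+1) x k *: b k = a' + \sum_(k < m.+1) x' k *: b k.
  rewrite !big_ord_recr /= /a' /x' eqxx scalerBl.
  have -> : \sum_(i < m) (if i == m :> nat then x m - w0 else x i) *: b i = \sum_(i < m) x i *: b i.
    by apply: eq_bigr => i _; rewrite ltn_eqF.
  by rewrite -!addrA; congr (_ + _); rewrite [in RHS]addrCA; congr (_ + _); rewrite [in RHS]addrC subrK.
apply: HM => k km; rewrite /x'; have [_|_] := eqVneq k m.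
  by apply: (le_trans (ncB _ _)); rewrite lerD2r Hx.
by apply: (le_trans (Hx k km)); rewrite lerDl nc_ge0.
Qed.

End Hartogs.


Section Sequences.
Context {R : realType}.
Local Open Scope complex_scope.
Local Notation C := R[i].
Implicit Types (a b x : nat -> C) (F P : (nat -> C) -> C).

Definition lc a (t : C) b : nat -> C := fun k => a k + t * b k.

Definition unitseq (j : nat) : nat -> C := fun k => (k == j)%:R.

Lemma lc0 a b : lc a 0 b = a.
Proof. by apply/funext => k; rewrite /lc mul0r addr0. Qed.

Lemma lc_lc a b z t : lc (lc a z b) t b = lc a (z + t) b.
Proof. by apply/funext => k; rewrite /lc mulrDl addrA. Qed.

(** Countably many non-zero entire functions have a common non-zero. *)
Lemma avoid_zeros (u : nat -> C -> C) : (forall j z, exists l, hd (u j) z l) ->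
  (forall j, exists z, u j z != 0) -> exists2 s, nc s <= 1 & forall j, u j s != 0.
Proof.
move=> hu nz; apply: contrapT => H.
have [||N [w [d d0 [_ Hd]]]] := @baireC R (fun j s => u j s = 0) 0 1 ltr01.
- move=> j w /eqP nw; have [l /hd_cont] := hu j w.
  have e0 : 0 < nc (u j w) / 2 by rewrite divr_gt0 // nc_gt0.
  move=> /(_ _ e0) [d d0 Hd]; exists d => // h /Hd K E; move: K.
  by rewrite E sub0r ncN leNgt ltr_pdivrMr // mulr_natr mulr2n ltrDl nc_gt0 nw.
- move=> w; rewrite subr0 => w1; apply: contrapT => K; apply: H; exists w; first exact: ltW.
  by move=> j; apply/eqP => E; apply: K; exists j.
have [z] := nz N; rewrite -[z](subrK w) addrC => /eqP; apply.
have hol_u r : hol (u N) w r by move=> v _; exact: hu.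
have tc0 : tc (u N) w = fun=> 0.
  apply: (tc_eq d0) => v /Hd ->; apply: clim_ext (@clim_cst R 0) => n.
  by rewrite big1 // => k _; rewrite mul0r.
have := tcP (hol_u (nc (z - w) + 1)); move=> /(_ (z - w)); rewrite ltrDl ltr01 tc0 => /(_ isT) K.
apply: (clim_unique K); apply: clim_ext (@clim_cst R 0) => n.
by rewrite big1 // => k _; rewrite mul0r.
Qed.

(** An entire function with zero derivative is constant. *)
Lemma entire_const (u : C -> C) : (forall z, hd u z 0) -> forall z, u z = u 0.
Proof.
move=> hu z; have hol_u r : hol u 0 r by move=> v _; exists 0.
have tcu k : tc u 0 k.+1 = 0.
  have := @tc_dC R u 0 1 k ltr01 (hol_u 1).
  have -> : dC u = fun=> 0 by apply/funext => v; exact: dC_eq.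
  have -> : tc (fun=> 0 : C) 0 k = 0.
    rewrite (@tc_eq R (fun=> 0) 0 (fun=> 0) 1 ltr01) // => w _.
    by apply: clim_ext (@clim_cst R 0) => n; rewrite big1 // => i _; rewrite mul0r.
  by move=> /esym/eqP; rewrite mulf_eq0 pnatr_eq0 /= => /eqP.
have := tcP (hol_u (nc z + 1)); move=> /(_ z); rewrite ltrDl ltr01 add0r => /(_ isT) K.
apply: (clim_unique K); rewrite -(tc0 ltr01 (hol_u 1)).
move=> e e0; exists 1%N => [[//|n]] _; rewrite big_ord_recl big1 => [|i _].
  by rewrite expr0 mulr1 addr0 subrr nc0 ltW.
by rewrite tcu mul0r.
Qed.

Lemma tc_mulX (u : C -> C) (r : R) n : 0 < r -> hol u 0 r ->
  tc (fun t => t * u t) 0 n = if n is n'.+1 then tc u 0 n' else 0.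
Proof.
move=> r0 hu; rewrite (@tc_eq R _ 0 (fun n => if n is n'.+1 then tc u 0 n' else 0) r r0) // => w wr.
have := climZ w (tcP hu wr); rewrite !add0r => K e /K [N HN]; exists N.+1 => [[//|m]] Nm.
rewrite big_ord_recl mul0r add0r.
have -> : \sum_(i < m) tc u 0 i * w ^+ i.+1 = w * \sum_(i < m) tc u 0 i * w ^+ i.
  by rewrite mulr_sumr; apply: eq_bigr => i _; rewrite exprS mulrCA.
exact: HN.
Qed.

Lemma hol_sum n (G : nat -> C -> C) c (r : R) : (forall k, hol (G k) c r) ->
  hol (fun z => \sum_(k < n) G k z) c r.
Proof.
move=> h; elim: n => [|n IH] z zr.
  by exists 0; apply: hd_ext (hd_cst 0 z) => w; rewrite big_ord0.
have [l hl] := IH z zr; have [m hm] := h n z zr; exists (l + m).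
by apply: hd_ext (hdD hl hm) => w; rewrite big_ord_recr.
Qed.

Lemma tc_sum n (G : nat -> C -> C) c (r : R) k : 0 < r -> (forall i, hol (G i) c r) ->
  tc (fun z => \sum_(i < n) G i z) c k = \sum_(i < n) tc (G i) c k.
Proof.
move=> r0 h; elim: n => [|n IH].
  rewrite big_ord0 (@tc_eq R _ c (fun=> 0) 1 ltr01) // => w _.
  by apply: clim_ext (@clim_cst R _) => m; rewrite big_ord0 big1 // => i _; rewrite mul0r.
rewrite big_ord_recr /= -IH -(tcD k r0) //; last exact: hol_sum.
by congr (tc _ c k); apply/funext => z; rewrite big_ord_recr.
Qed.

Variable V : (nat -> C) -> Prop.
Hypotheses (Vlc : forall a t b, V a -> V b -> V (lc a t b))
  (Vbd : forall a, (forall k, nc (a k) <= 1) -> V a).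

Let Ve j : V (unitseq j).
Proof. by apply: Vbd => k; rewrite /unitseq; case: eqP => _; rewrite ?nc1 ?nc0. Qed.
Let V0 : V (fun=> 0).
Proof. by apply: Vbd => k; rewrite nc0. Qed.

Lemma Vsum a (b : nat -> nat -> C) (x : nat -> C) m : V a -> (forall k, V (b k)) ->
  V (fun j => a j + \sum_(k < m) x k * b k j).
Proof.
move=> Va Vb; elim: m => [|m IH].
  by congr (V _) : Va; apply/funext => j; rewrite big_ord0 addr0.
have := Vlc (x m) IH (Vb m); congr (V _); apply/funext => j.
by rewrite /lc big_ord_recr /= addrA.
Qed.

(** F is differentiable along lines, and each differential only involves
    finitely many coordinates. *)
Definition Cl F := forall a, V a -> exists K (xi : nat -> C), forall b, V b ->
  hd (fun t => F (lc a t b)) 0 (\sum_(k < K) xi k * b k).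

Definition pj F j a : C := dC (fun t => F (lc a t (unitseq j))) 0.

Definition lineentire F := forall a b, V a -> V b -> forall z, exists l, hd (fun t => F (lc a t b)) z l.

Lemma hd_line F a b z l : hd (fun t => F (lc (lc a z b) t b)) 0 l -> hd (fun t => F (lc a t b)) z l.
Proof.
move=> h; have := @hd_aff R (fun t => F (lc (lc a z b) t b)) z l (- z) 1.
rewrite mul1r addNr mul1r => /(_ h); apply: hd_ext => t.
by rewrite lc_lc mul1r addrA subrr add0r.
Qed.

Lemma Cl_line F : Cl F -> lineentire F.
Proof.
move=> hF a b Va Vb z; have [K [xi H]] := hF _ (Vlc z Va Vb).
by exists (\sum_(k < K) xi k * b k); apply: hd_line; exact: H.
Qed.

Lemma Cl_pj F a : Cl F -> V a -> exists K, (forall j, (K <= j)%N -> pj F j a = 0) /\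
  forall b, V b -> forall K', (K <= K')%N -> hd (fun t => F (lc a t b)) 0 (\sum_(k < K') pj F k a * b k).
Proof.
move=> hF Va; have [K [xi H]] := hF a Va.
have pE j : pj F j a = \sum_(k < K) xi k * unitseq j k by apply: dC_eq; exact: H.
have big j : (K <= j)%N -> pj F j a = 0.
  move=> Kj; rewrite pE big1 // => k _; rewrite /unitseq ltn_eqF ?mulr0 //.
  exact: leq_trans (ltn_ord k) Kj.
exists K; split => // b Vb K' KK'.
have -> : \sum_(k < K') pj F k a * b k = \sum_(k < K) xi k * b k.
  rewrite -(subnKC KK') big_split_ord /= [X in _ + X]big1 ?addr0 => [|i _].
    apply: eq_bigr => i _; rewrite pE (bigD1 i) //= big1 ?addr0 => [|k ki].
      by rewrite /unitseq eqxx mulr1.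
    by rewrite /unitseq; have -> : (k == i :> nat) = false by [apply/negbTE]; rewrite mulr0.
  by rewrite big ?mul0r // leq_addr.
exact: H.
Qed.

Lemma hartogs_seq F a (b : nat -> nat -> C) m (X : R) : lineentire F -> V a -> (forall k, V (b k)) -> 0 < X ->
  exists2 M : R, 0 <= M & forall x : nat -> C, (forall k, (k < m)%N -> nc (x k) <= X) ->
    nc (F (fun j => a j + \sum_(k < m) x k * b k j)) <= M.
Proof.
move=> hF Va Vb X0.
pose x' (v : 'rV[C]_m) : nat -> C := fun k => if insub k is Some i then v 0 i else 0.
pose Phi (v : 'rV[C]_m) := F (fun j => a j + \sum_(k < m) v 0 k * b k j).
have gPhi : gentire Phi.
  move=> u v z.
  have [l hl] := hF _ _ (Vsum (x' u) m Va Vb) (Vsum (x' v) m V0 Vb) z.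
  exists l; apply: hd_ext hl => t; congr F; apply/funext => j; rewrite /lc add0r -addrA; congr (_ + _).
  rewrite mulr_sumr -big_split; apply: eq_bigr => k _ /=.
  by rewrite /x' !valK !mxE; ring.
have [M M0 HM] := hartogs (fun k => if insub k is Some i then delta_mx 0 i else 0) m 0 gPhi X0.
exists M => // x /HM; congr (nc _ <= _); congr F; apply/funext => j; congr (_ + _).
apply: eq_bigr => k _; congr (_ * _); rewrite add0r summxE (bigD1 k) //= big1 ?addr0 => [|i ik].
  by rewrite valK !mxE !eqxx mulr1.
by rewrite valK !mxE eqxx eq_sym (negbTE ik) mulr0.
Qed.

Let bounded2 F a b c : lineentire F -> V a -> V b -> V c -> exists2 M : R, 0 <= M &
  forall s t, nc s <= 1 -> nc t <= 1 -> nc (F (lc (lc a s b) t c)) <= M.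
Proof.
move=> hF Va Vb Vc.
have [|M M0 HM] := @hartogs_seq F a (fun k => if k == 0%N then b else c) 2 1 hF Va _ ltr01.
  by move=> k; case: eqP.
exists M => // s t s1 t1; have := HM (fun k => if k == 0%N then s else t).
have -> : lc (lc a s b) t c = fun j => a j + \sum_(k < 2) (if k == 0%N :> nat then s else t) *
    (if k == 0%N :> nat then b else c) j.
  by apply/funext => j; rewrite /lc !big_ord_recl big_ord0 /= addr0 addrA.
by apply; case=> [|[|//]].
Qed.

(** Partial derivatives are entire on lines. The differential of F at
    a + t e_j in the direction b, as a function of t, has the mixed second
    derivative as its own derivative. *)
Let pj_line0 F j a b : Cl F -> V a -> V b ->
  hol (fun t => dC (fun s => F (lc (lc a t (unitseq j)) s b)) 0) 0 1 /\
  hd (fun s => pj F j (lc a s b)) 0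
     (dC (fun t => dC (fun s => F (lc (lc a t (unitseq j)) s b)) 0) 0).
Proof.
move=> hF Va Vb; have lF := Cl_line hF; have Vj := Ve j.
pose G s t := F (lc (lc a s b) t (unitseq j)).
have [M M0 HM] := bounded2 lF Va Vb Vj.
have swap s t : G s t = F (lc (lc a t (unitseq j)) s b).
  by congr F; apply/funext => k; rewrite /lc; ring.
have h1 t : nc t < 1 -> hol (G^~ t) 0 1.
  move=> _ z _; have [l hl] := lF _ _ (Vlc t Va Vj) Vb z.
  by exists l; apply: hd_ext hl => s; rewrite swap.
have h2 s : nc s < 1 -> hol (G s) 0 1.
  by move=> _ z _; exact: lF (Vlc s Va Vb) Vj z.
have [|hD /(_ 1%N) H1] := tc_param ltr01 ltr01 M0 h1 h2.
  by move=> s t s1 t1; apply: HM; exact: ltW.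
have DE : (fun z => dC (G^~ z) 0) = (fun t => dC (fun s => F (lc (lc a t (unitseq j)) s b)) 0).
  by apply/funext => t; congr (dC _ 0); apply/funext => s; exact: swap.
rewrite DE in hD H1; split => //; rewrite -(tc1 ltr01 hD).
apply: (hd_near ltr01 _ H1) => s; rewrite subr0 => s1.
by rewrite (tc1 ltr01 (h2 s s1)).
Qed.

Lemma pj_line F j : Cl F -> lineentire (pj F j).
Proof.
move=> hF a b Va Vb z; have [_ H] := pj_line0 j hF (Vlc z Va Vb) Vb.
by eexists; apply: hd_line; exact: H.
Qed.

(** On a complex line the supports of the differentials are uniformly
    bounded: otherwise a common non-zero of the partial derivatives would have
    a differential of infinite support. *)
Lemma pj_uniform F a c : Cl F -> V a -> V c ->
  exists K, forall s j, (K <= j)%N -> pj F j (lc a s c) = 0.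
Proof.
move=> hF Va Vc; apply: contrapT => H.
have /choice [J HJ] : forall K, exists j, (K <= j)%N /\ exists s, pj F j (lc a s c) != 0.
  move=> K; apply: contrapT => H'; apply: H; exists K => s j Kj.
  by apply/eqP/negPn/negP => nz; apply: H'; exists j; split => //; exists s.
have [||s _ Hs] := @avoid_zeros (fun K s => pj F (J K) (lc a s c)).
- by move=> K z; exact: pj_line.
- by move=> K; case: (HJ K).
have [K [HK _]] := Cl_pj hF (Vlc s Va Vc).
have [KJ _] := HJ K; have /eqP := Hs K; apply; exact: HK.
Qed.

(** The class is closed under partial derivatives. *)
Lemma Cl_pjF F j : Cl F -> Cl (pj F j).
Proof.
move=> hF a Va; have Vj := Ve j.
have [K HK] := pj_uniform hF Va Vj.
exists K, (fun k => dC (fun t => pj F k (lc a t (unitseq j))) 0) => b Vb.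
have [_] := pj_line0 j hF Va Vb.
have -> : (fun t => dC (fun s => F (lc (lc a t (unitseq j)) s b)) 0) =
    (fun t => \sum_(k < K) pj F k (lc a t (unitseq j)) * b k).
  apply/funext => t; apply: dC_eq.
  have [K' [HK' H]] := Cl_pj hF (Vlc t Va Vj).
  have := H b Vb (maxn K K') (leq_maxr _ _).
  rewrite -(subnKC (leq_maxl K K')) big_split_ord /= [X in _ + X]big1 ?addr0 // => i _.
  by rewrite HK ?mul0r // leq_addr.
suff -> : dC (fun t => \sum_(k < K) pj F k (lc a t (unitseq j)) * b k) 0 =
    \sum_(k < K) dC (fun t => pj F k (lc a t (unitseq j))) 0 * b k by [].
apply: dC_eq; apply: hd_sum => k _; rewrite mulrC.
have [l hl] := pj_line k hF Va Vj 0.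
by apply: hd_ext (hdZ (b k) (dCP hl)) => t; rewrite mulrC.
Qed.

(** F only involves the first N coordinates. *)
Definition fdep F N := forall a a', V a -> V a' -> (forall k, (k < N)%N -> a k = a' k) -> F a = F a'.

Lemma fdep_of_pj F N : Cl F -> (forall j a, (N <= j)%N -> V a -> pj F j a = 0) -> fdep F N.
Proof.
move=> hF HN a a' Va Va' aa'.
pose b : nat -> C := lc a' (-1) a; have Vb : V b by exact: Vlc.
have := @entire_const (fun t => F (lc a t b)).
have -> : F a = F (lc a 0 b) by rewrite lc0.
have -> : F a' = F (lc a 1 b) by congr F; apply/funext => k; rewrite /b /lc; ring.
move=> H; apply/esym; apply: H => z; apply: hd_line.
have Vz := Vlc z Va Vb.
have [K [_ HK]] := Cl_pj hF Vz.
have := HK b Vb K (leqnn K); rewrite big1 // => k _.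
have [kN|Nk] := ltnP k N; last by rewrite HN ?mul0r.
by rewrite /b /lc aa' // mulN1r subrr mulr0.
Qed.

(** Coordinates are chosen one at a time, so that each function of the family
    keeps a chance not to vanish. *)
Lemma generic_point (h : nat -> (nat -> C) -> C) (N : nat -> nat) :
  (forall j, lineentire (h j)) -> (forall j, fdep (h j) (N j)) ->
  (forall j, exists2 a, V a & h j a != 0) -> exists2 a, V a & forall j, h j a != 0.
Proof.
move=> hl hd hnz.
pose Inv m (a : nat -> C) := forall j, exists x, [/\ V x, forall k, (k < m)%N -> x k = a k & h j x != 0].
pose upd (a : nat -> C) m c : nat -> C := fun k => if k == m then c else a k.
have step m a : Inv m a -> exists c, nc c <= 1 /\ Inv m.+1 (upd a m c).
  move=> /choice [x Hx].
  have [||c c1 Hc] := @avoid_zeros (fun j s => h j (lc (x j) (s - x j m) (unitseq m))).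
  - move=> j z; have [Vx _ _] := Hx j.
    have [l hlz] := hl j _ _ Vx (Ve m) (z - x j m).
    exists (1 * l); have := @hd_aff R (fun t => h j (lc (x j) t (unitseq m))) z l (- x j m) 1.
    rewrite mul1r [- _ + z]addrC => /(_ hlz); rewrite mul1r; apply: hd_ext => s.
    by rewrite mul1r addrC.
  - by move=> j; exists (x j m); rewrite subrr lc0; case: (Hx j).
  exists c; split => // j; exists (lc (x j) (c - x j m) (unitseq m)).
  have [Vx xa _] := Hx j; split; [exact: Vlc| |exact: Hc].
  move=> k; rewrite ltnS leq_eqVlt /lc /upd /unitseq => /predU1P[->|km].
    by rewrite eqxx mulr1 addrC subrK.
  by rewrite ltn_eqF // mulr0 addr0 xa.
pose nxt m a := xget 0 [set c | nc c <= 1 /\ Inv m.+1 (upd a m c)].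
pose A := fix A m : nat -> C := if m is m'.+1 then upd (A m') m' (nxt m' (A m')) else fun=> 0.
have invA m : Inv m (A m).
  elim: m => [|m IH]; first by move=> j; have [a Va na] := hnz j; exists a.
  rewrite /= /nxt; case: xgetP => [c -> [] //|]; have [c Hc] := step _ _ IH.
  by move=> /(_ c).
have nA m : nc (nxt m (A m)) <= 1.
  rewrite /nxt; case: xgetP => [c -> [] //|]; have [c Hc] := step _ _ (invA m).
  by move=> /(_ c).
pose a : nat -> C := fun k => nxt k (A k).
have Aa m k : (k < m)%N -> A m k = a k.
  elim: m => // m IH; rewrite ltnS leq_eqVlt /= /upd => /predU1P[->|km].
    by rewrite eqxx.
  by rewrite ltn_eqF // IH.
have Va : V a by apply: Vbd => k; exact: nA.
exists a => // j; have [x [Vx xA nx]] := invA (N j) j.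
by rewrite (hd j a x Va Vx) // => k kN; rewrite xA // Aa.
Qed.

Definition homog n P := forall a t, V a -> t != 0 -> P (lc (fun=> 0) t a) = t ^+ n * P a.

Lemma pj_homog n P j : Cl P -> homog n.+1 P -> homog n (pj P j).
Proof.
move=> hP hom a t Va t0; apply: dC_eq.
have [l hl] := Cl_line hP Va (Ve j) 0.
have := @hd_aff R (fun s => P (lc a s (unitseq j))) 0 (pj P j a) 0 t^-1.
rewrite mulr0 addr0 => /(_ (dCP hl)) /(hdZ (t ^+ n.+1)).
have -> : t ^+ n.+1 * (t^-1 * pj P j a) = t ^+ n * pj P j a.
  by rewrite exprSr mulrA mulfK.
apply: hd_ext => s; rewrite -(hom _ t (Vlc _ Va (Ve j)) t0).
congr P; apply/funext => k; rewrite /lc !add0r; field.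
exact: t0.
Qed.

(** A homogeneous function of the class involves finitely many coordinates:
    otherwise its partial derivatives, which do by induction on the degree,
    would have a common non-zero. *)
Lemma homog_fdep n P : Cl P -> homog n P -> exists N, fdep P N.
Proof.
elim: n P => [|n IH] P hP hom.
  exists 0%N => a a' Va Va' _.
  suff E b : V b -> P b = P (fun=> 0) by rewrite (E a) // (E a').
  move=> Vb; apply/eqP; rewrite -subr_eq0; apply/eqP; apply: ncP => e e0.
  have [l /hd_cont] := Cl_line hP V0 Vb 0.
  move=> /(_ e e0) [d d0 Hd]; pose t : R := d / 2.
  have t0 : 0 < t by rewrite divr_gt0.
  have := Hd t%:C; rewrite ncR gtr0_norm // add0r lc0 (hom b) ?fmorph_eq0 ?gt_eqF //.
  by rewrite expr0 mul1r; apply; rewrite /t; lra.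
have /choice [N HN] : forall j, exists N, fdep (pj P j) N.
  by move=> j; apply: IH; [exact: Cl_pjF|exact: pj_homog].
suff [K HK] : exists K, forall j a, (K <= j)%N -> V a -> pj P j a = 0.
  by exists K; exact: fdep_of_pj.
apply: contrapT => H.
have /choice [J HJ] : forall K, exists j, (K <= j)%N /\ exists2 a, V a & pj P j a != 0.
  move=> K; apply: contrapT => H'; apply: H; exists K => j a Kj Va.
  by apply/eqP/negPn/negP => nz; apply: H'; exists j; split => //; exists a.
have [|||a Va Ha] := @generic_point (fun K => pj P (J K)) (fun K => N (J K)).
- by move=> K; exact: pj_line.
- by move=> K; exact: HN.
- by move=> K; case: (HJ K).
have [K [HK _]] := Cl_pj hP Va; have [KJ _] := HJ K.
by have /eqP := Ha K; apply; exact: HK.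
Qed.

(** the homogeneous terms of the Taylor expansion of F at 0 *)
Definition hpart F n a := tc (fun t => F (lc (fun=> 0) t a)) 0 n.

Let hpart_hd F n a : Cl F -> V a -> exists K,
  (forall j, (K <= j)%N -> tc (fun t => t * pj F j (lc (fun=> 0) t a)) 0 n = 0) /\ forall b, V b ->
  hd (fun s => hpart F n (lc a s b)) 0
    (\sum_(k < K) tc (fun t => t * pj F k (lc (fun=> 0) t a)) 0 n * b k).
Proof.
move=> hF Va; have lF := Cl_line hF.
have [K HK] := pj_uniform hF V0 Va; exists K; split=> [j Kj|b Vb].
  rewrite (@tc_eq R _ 0 (fun=> 0) 1 ltr01) // => w _; rewrite HK // mulr0.
  by apply: clim_ext (@clim_cst R _) => m; rewrite big1 // => i _; rewrite mul0r.
have V1 : V (fun k => (fun=> 0 : C) k) := V0.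
pose G s t := F (lc (fun=> 0) t (lc a s b)).
have GE s t : G s t = F (lc (lc (fun=> 0) t a) (t * s) b).
  by congr F; apply/funext => k; rewrite /lc; ring.
have [M M0 HM] := bounded2 lF V0 Va Vb.
have h1 t : nc t < 1 -> hol (G^~ t) 0 1.
  move=> _ z _; have [l hl] := lF _ _ (Vlc t V0 Va) Vb (0 + t * z).
  have := hd_aff hl => H; exists (t * l); apply: hd_ext H => s.
  by rewrite GE add0r.
have h2 s : nc s < 1 -> hol (G s) 0 1.
  by move=> _ z _; exact: lF V0 (Vlc s Va Vb) z.
have [|hD /(_ n) H1] := tc_param ltr01 ltr01 M0 h1 h2.
  move=> s t s1 t1; rewrite GE; apply: HM; first exact: ltW.
  by rewrite ncM -[1]mulr1 ler_pM ?nc_ge0 // ltW.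
have DE t : dC (G^~ t) 0 = \sum_(k < K) b k * (t * pj F k (lc (fun=> 0) t a)).
  apply: dC_eq; have Vt := Vlc t V0 Va.
  have [K' [_ H]] := Cl_pj hF Vt.
  have := H b Vb (maxn K K') (leq_maxr _ _).
  rewrite -(subnKC (leq_maxl K K')) big_split_ord /= [X in _ + X]big1 ?addr0 => [|i _]; last first.
    by rewrite HK ?mul0r // leq_addr.
  have -> : \sum_(k < K) b k * (t * pj F k (lc (fun=> 0) t a)) = t * \sum_(k < K) pj F k (lc (fun=> 0) t a) * b k.
    by rewrite mulr_sumr; apply: eq_bigr => k _; ring.
  move=> H2; have := @hd_aff R (fun s => F (lc (lc (fun=> 0) t a) s b)) 0 (\sum_(k < K) pj F k (lc (fun=> 0) t a) * b k) 0 t.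
  rewrite mulr0 addr0 => /(_ H2); apply: hd_ext => s.
  by rewrite GE add0r.
have hk k r : hol (fun t => t * pj F k (lc (fun=> 0) t a)) 0 r.
  move=> z _; have [l hl] := pj_line k hF V0 Va z.
  by eexists; apply: hdM (hd_id z) hl.
have -> : \sum_(k < K) tc (fun t => t * pj F k (lc (fun=> 0) t a)) 0 n * b k = tc (fun z => dC (G^~ z) 0) 0 n.
  have -> : (fun z => dC (G^~ z) 0) = (fun t => \sum_(k < K) b k * (t * pj F k (lc (fun=> 0) t a))).
    by apply/funext.
  rewrite (@tc_sum K (fun k t => b k * (t * pj F k (lc (fun=> 0) t a))) 0 1 n ltr01); last first.
    by move=> k; exact: holZ.
  by apply: eq_bigr => k _; rewrite (@tcZ R _ 0 1 (b k) n ltr01) // mulrC.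
exact: H1.
Qed.

Let Cl_hpart F n : Cl F -> Cl (hpart F n).
Proof.
move=> hF a Va; have [K [_ HK]] := hpart_hd n hF Va.
by exists K, (fun k => tc (fun t => t * pj F k (lc (fun=> 0) t a)) 0 n).
Qed.

Let pj_hpart F n a j : Cl F -> V a ->
  pj (hpart F n) j a = tc (fun t => t * pj F j (lc (fun=> 0) t a)) 0 n.
Proof.
move=> hF Va; apply: dC_eq.
have [K [HK HK']] := hpart_hd n hF Va.
have := HK' _ (Ve j).
have [jK|Kj] := ltnP j K.
  rewrite (bigD1 (Ordinal jK)) //= big1 ?addr0 => [|k kj].
    by rewrite /unitseq eqxx mulr1.
  by rewrite /unitseq; have -> : (k == j :> nat) = false by [apply/negbTE]; rewrite mulr0.
by rewrite HK // big1 => [|k _] //; rewrite /unitseq ltn_eqF ?mulr0 // (leq_trans (ltn_ord k)).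
Qed.

Let homog_hpart F n : Cl F -> homog n (hpart F n).
Proof.
move=> hF a t Va t0; have lF := Cl_line hF.
have h r : hol (fun s => F (lc (fun=> 0) s a)) 0 r by move=> z _; exact: lF.
rewrite /hpart (@tc_eq R _ 0 (fun k => t ^+ k * tc (fun s => F (lc (fun=> 0) s a)) 0 k) 1 ltr01) // => w _.
have := tcP (h (nc (w * t) + 1)); move=> /(_ (w * t)).
rewrite ltrDl ltr01 !add0r => /(_ isT).
have -> : lc (fun=> 0) (w * t) a = lc (fun=> 0) w (lc (fun=> 0) t a).
  by apply/funext => k; rewrite /lc; ring.
by apply: clim_ext => n'; apply: eq_bigr => k _; rewrite exprMn; ring.
Qed.

Lemma Cl_support F : Cl F -> exists N, forall j a, (N <= j)%N -> V a -> pj F j a = 0.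
Proof.
move=> hF; apply: contrapT => H.
have /choice [J HJ] : forall K, exists jn : nat * nat, (K <= jn.1)%N /\ exists2 a, V a & pj (hpart F jn.2) jn.1 a != 0.
  move=> K; apply: contrapT => H'; apply: H; exists K => j a Kj Va.
  apply/eqP/negPn/negP => nz.
  have h : hol (fun t => pj F j (lc (fun=> 0) t a)) 0 2 by move=> z _; exact: pj_line.
  have tc0 n : tc (fun t => pj F j (lc (fun=> 0) t a)) 0 n = 0.
    have := tc_mulX n.+1 (ltr0Sn R 1) h; rewrite -(pj_hpart n.+1 j hF Va) => <-.
    by apply/eqP/negPn/negP => nz'; apply: H'; exists (j, n.+1); split => //; exists a.
  have := tcP h; move=> /(_ 1); rewrite nc1 add0r => /(_ _) K1.
  move: nz; have -> : a = lc (fun=> 0) 1 a by apply/funext => k; rewrite /lc add0r mul1r.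
  move=> /eqP; apply; apply: (clim_unique (K1 _)); first lra.
  by apply: clim_ext (@clim_cst R _) => m; rewrite big1 // => i _; rewrite tc0 mul0r.
have /choice [N HN] : forall K, exists N, fdep (pj (hpart F (J K).2) (J K).1) N.
  move=> K; case: (J K) => j [|n] /=.
    exists 0%N => a a' Va Va' _; rewrite !pj_hpart //.
    have h b : V b -> hol (fun t => pj F j (lc (fun=> 0) t b)) 0 2 by move=> Vb z _; exact: pj_line.
    by rewrite !(tc_mulX 0 (ltr0Sn R 1) (h _ _)).
  apply: (@homog_fdep n); first by apply: Cl_pjF; exact: Cl_hpart.
  by apply: pj_homog; [exact: Cl_hpart|exact: homog_hpart].
have [|||a Va Ha] := @generic_point (fun K => pj (hpart F (J K).2) (J K).1) N.
- by move=> K; apply: pj_line; exact: Cl_hpart.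
- by [].
- by move=> K; case: (HJ K).
have [K HK] := pj_uniform hF V0 Va; have [KJ _] := HJ K.
have /eqP := Ha K; apply; rewrite pj_hpart //.
rewrite (@tc_eq R _ 0 (fun=> 0) 1 ltr01) // => w _; rewrite HK // mulr0.
by apply: clim_ext (@clim_cst R _) => m; rewrite big1 // => i _; rewrite mul0r.
Qed.

(** Chain rule along a coordinatewise differentiable curve. *)
Lemma Cl_chain F (gam : C -> nat -> C) (bet : nat -> C) (r : R) : Cl F -> 0 < r ->
  (forall s, nc s < r -> V (gam s)) -> V bet ->
  (forall k, hd (fun s => gam s k) 0 (bet k)) ->
  exists2 l, hd (fun t => F (lc (gam 0) t bet)) 0 l & hd (fun s => F (gam s)) 0 l.
Proof.
move=> hF r0 Vg Vb hg; pose a := gam 0.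
have Va : V a by apply: Vg; rewrite nc0.
have [N HN] := Cl_support hF.
have dep := fdep_of_pj hF HN.
have [K0 [_ HK]] := Cl_pj hF Va; pose K := maxn N K0.
have dF b : V b -> hd (fun t => F (lc a t b)) 0 (\sum_(k < N) pj F k a * b k).
  move=> Vb'; have := HK b Vb' K (leq_maxr _ _).
  rewrite -(subnKC (leq_maxl N K0 : (N <= K)%N)) big_split_ord /= [X in _ + X]big1 ?addr0 // => i _.
  by rewrite HN ?mul0r // leq_addr.
exists (\sum_(k < N) pj F k a * bet k); first exact: dF.
pose y (x : nat -> C) : nat -> C := fun j => (fun=> 0 : C) j + \sum_(k < N) x k * unitseq k j.
have Vy x : V (y x) by apply: Vsum => //; exact: Ve.
have yk x k : (k < N)%N -> y x k = x k.
  move=> kN; rewrite /y add0r (bigD1 (Ordinal kN)) //= big1 ?addr0 => [|i ik].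
    by rewrite /unitseq eqxx mulr1.
  by rewrite /unitseq eq_sym; have -> : (i == k :> nat) = false by [apply/negbTE]; rewrite mulr0.
have [M M0 HM] := hartogs_seq (b := unitseq) N (Cl_line hF) Va Ve ltr01.
have quad x (X : R) : 0 < X -> X <= 2^-1 -> (forall k, (k < N)%N -> nc (x k) <= X) ->
   nc (F (lc a 1 (y x)) - F a - \sum_(k < N) pj F k a * x k) <= 16 * M * X ^+ 2.
  move=> X0 X2 Hx; pose x' k := (X^-1)%:C * x k.
  have h : hol (fun t => F (lc a t (y x'))) 0 2 by move=> z _; exact: Cl_line.
  have l12 : 1 < 2 :> R by lra.
  have nX : nc X%:C <= 1 / 2 by rewrite ncR gtr0_norm //; lra.
  have XC : X%:C != 0 :> C by rewrite fmorph_eq0 gt_eqF.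
  have := hol_quad h ltr01 l12 M0 _ nX.
  rewrite !add0r lc0 (dC_eq (dF _ (Vy x'))).
  have -> : lc a X%:C (y x') = lc a 1 (y x).
    apply/funext => j; rewrite /lc /y !add0r mul1r mulr_sumr; congr (_ + _); apply: eq_bigr => k _.
    by rewrite /x' !mulrA -rmorphM divff ?gt_eqF // rmorph1 mul1r.
  have -> : (\sum_(k < N) pj F k a * y x' k) * X%:C = \sum_(k < N) pj F k a * x k.
    rewrite mulr_suml; apply: eq_bigr => k _; rewrite yk // /x' -mulrA; congr (_ * _).
    by rewrite mulrAC -rmorphM mulVf ?gt_eqF // rmorph1 mul1r.
  rewrite ncR gtr0_norm // expr1n divr1 => H.
  have {}H : nc (F (lc a 1 (y x)) - F a - \sum_(k < N) pj F k a * x k) <= 4 * M * X ^+ 2.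
    apply: H => w w1; rewrite add0r.
    have -> : lc a w (y x') = fun j => a j + \sum_(k < N) (w * x' k) * unitseq k j.
      by apply/funext => j; rewrite /lc /y add0r mulr_sumr; congr (_ + _); apply: eq_bigr => k _; rewrite mulrA.
    apply: (HM (fun k => w * x' k)) => k kN; rewrite ncM w1 mul1r /x' ncM ncR gtr0_norm ?invr_gt0 //.
    by rewrite mulrC ler_pdivrMr // mul1r Hx.
  apply: (le_trans H); have := mulr_ge0 M0 (sqr_ge0 X); lra.
pose B := \sum_(k < N) (nc (bet k) + 1) + 1.
have bB k : (k < N)%N -> nc (bet k) + 1 <= B.
  move=> kN; rewrite /B (bigD1 (Ordinal kN)) //= -addrA lerDl addr_ge0 // sumr_ge0 // => i _.
  by rewrite addr_ge0 // nc_ge0.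
have B0 : 0 < B.
  by rewrite /B ltr_wpDl // sumr_ge0 // => i _; rewrite addr_ge0 // nc_ge0.
pose Q := \sum_(k < N) nc (pj F k a) + 1.
have Q0 : 0 < Q by rewrite /Q ltr_wpDl // sumr_ge0 // => i _; exact: nc_ge0.
(* common radius for the N coordinates *)
have unif (e : R) : 0 < e -> exists2 d : R, 0 < d & forall h k, nc h < d -> (k < N)%N ->
    nc (gam h k - a k - bet k * h) <= e * nc h.
  move=> e0; elim: (N) => [|n [d d0 Hd]]; first by exists 1.
  have [d' d0' Hd'] := hg n e e0; exists (Num.min d d') => [|h k]; first by rewrite lt_min d0.
  rewrite lt_min ltnS leq_eqVlt => /andP[h1 h2] /predU1P[->|kn]; last exact: Hd.
  by have := Hd' h h2; rewrite add0r.
move=> e e0.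
have [d1 d10 H1] := unif 1 ltr01.
have e1 : 0 < e / 2 / Q by rewrite !divr_gt0.
have [d2 d20 H2] := unif _ e1.
pose c := 16 * M * B ^+ 2 + 1.
have c0 : 0 < c by rewrite /c; have := mulr_ge0 M0 (sqr_ge0 B); lra.
have d30 : 0 < e / 2 / c by rewrite !divr_gt0.
have d40 : 0 < 2^-1 / B by rewrite divr_gt0.
exists (Num.min (Num.min d1 d2) (Num.min r (Num.min (e / 2 / c) (2^-1 / B)))) => [|h].
  by rewrite !lt_min d10 d20 r0 d30 d40.
rewrite !lt_min => /andP[/andP[h1 h2] /and3P[h3 h4 h5]]; rewrite add0r -/a.
have [->|hn0] := eqVneq h 0; first by rewrite subrr mulr0 subr0 nc0 mulr0.
have nh : 0 < nc h by rewrite nc_gt0.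
pose x k := gam h k - a k.
have -> : F (gam h) = F (lc a 1 (y x)).
  apply: dep => [||k kN]; [exact: Vg|exact: Vlc|].
  by rewrite /lc mul1r yk // /x addrC subrK.
have xB k : (k < N)%N -> nc (x k) <= B * nc h.
  move=> kN; have := H1 h k h1 kN; rewrite mul1r => K1.
  rewrite /x -(subrK (bet k * h) (gam h k - a k)); apply: (le_trans (ncD _ _)); rewrite ncM.
  have := ler_wpM2r (ltW nh) (bB k kN); lra.
have X1 : B * nc h <= 2^-1 by rewrite mulrC -ler_pdivlMr // ltW.
have X0 : 0 < B * nc h by rewrite mulr_gt0.
have K1 := quad x _ X0 X1 xB.
have -> : F (lc a 1 (y x)) - F a - (\sum_(k < N) pj F k a * bet k) * h =
  (F (lc a 1 (y x)) - F a - \sum_(k < N) pj F k a * x k) + \sum_(k < N) pj F k a * (x k - bet k * h).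
  have -> : \sum_(k < N) pj F k a * (x k - bet k * h) = \sum_(k < N) pj F k a * x k - (\sum_(k < N) pj F k a * bet k) * h.
    by rewrite mulr_suml -sumrB; apply: eq_bigr => k _; ring.
  ring.
apply: (le_trans (ncD _ _)).
have K2 : nc (\sum_(k < N) pj F k a * (x k - bet k * h)) <= e / 2 * nc h.
  apply: (le_trans (nc_sum _ _ _)).
  apply: (@le_trans _ _ (\sum_(k < N) nc (pj F k a) * (e / 2 / Q * nc h))).
    by apply: ler_sum => k _; rewrite ncM ler_wpM2l ?nc_ge0 //; exact: H2.
  rewrite -mulr_suml mulrA mulrCA mulrA ler_wpM2r ?(ltW nh) // ler_pdivrMr //.
  by rewrite ler_wpM2l //; [lra|rewrite /Q lerDl].
have K3 : 16 * M * (B * nc h) ^+ 2 <= e / 2 * nc h.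
  move: h4; rewrite ltr_pdivlMr // => h4.
  have : nc h * (16 * M * B ^+ 2) <= e / 2.
    by apply: le_trans (ltW h4); rewrite ler_wpM2l ?(ltW nh) // /c lerDl.
  move=> /(ler_wpM2r (ltW nh)); apply: le_trans; rewrite exprMn.
  by have -> : 16 * M * (B ^+ 2 * nc h ^+ 2) = nc h * (16 * M * B ^+ 2) * nc h by ring.
lra.
Qed.

End Sequences.



Section MatrixNorm.
Context {R : realType}.
Local Open Scope complex_scope.
Local Notation C := (Num.NumField.sort (R[i] : numFieldType)).

Definition mn n (h : 'rV[C]_n) : R := cRe (`|h| : C).

Lemma mnE n (h : 'rV[C]_n) : (`|h| : C) = (mn h)%:C.
Proof.
have := normr_ge0 h; rewrite lecE /= => /andP[/eqP E _].
exact: eqC_ReIm.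
Qed.

Lemma mn_ge0 n (h : 'rV[C]_n) : 0 <= mn h.
Proof. by rewrite -(lecR (R:=R)) -mnE normr_ge0. Qed.

Lemma mn_lt n (h : 'rV[C]_n) (e : R) : 0 < e -> (mn h < e) <-> forall j, nc (h 0 j) < e.
Proof.
move=> e0; have e0' : (0 : C) < e%:C by rewrite ltcR.
rewrite -ltcR -mnE.
have <- : ball (0 : 'rV[C]_n) (e%:C) h = (`|h| < e%:C) :> Prop.
  by rewrite mx_norm_ball /ball_ /= sub0r normrN.
split=> [[_ H] j|H].
  by have := H 0 j; rewrite mxE /ball /= sub0r normrN ncE ltcR.
split=> // i j; rewrite mxE /ball /= sub0r normrN ncE ltcR (ord1 i); exact: H.
Qed.

Lemma mn_ge n (h : 'rV[C]_n) j : nc (h 0 j) <= mn h.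
Proof.
apply/ler_addgt0Pr => e e0; apply/ltW.
by have [/(_ _ j) H _] := @mn_lt n h (mn h + e) (ltr_wpDl (mn_ge0 h) e0); apply: H; rewrite ltrDl.
Qed.

Lemma mn_le n (h : 'rV[C]_n) : mn h <= \sum_j nc (h 0 j).
Proof.
have s0 : 0 <= \sum_j nc (h 0 j) by apply: sumr_ge0 => i _; exact: nc_ge0.
apply/ler_addgt0Pr => e e0; apply/ltW.
apply/(@mn_lt n h _ (ltr_wpDl s0 e0)) => j; apply: (@le_lt_trans _ _ (\sum_j nc (h 0 j))); last by rewrite ltrDl.
by rewrite (bigD1 j) //= lerDl; apply: sumr_ge0 => i _; exact: nc_ge0.
Qed.

Lemma mn_near n (c : 'rV[C]_n) (P : 'rV[C]_n -> Prop) :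
  (\forall c' \near c, P c') <-> exists2 d : R, 0 < d & forall h, mn h < d -> P (c + h).
Proof.
split=> [/nbhs_ballP [e /= e0 H]|[d d0 H]].
  have eE : e = (cRe e)%:C by move: e0; rewrite ltcE /= => /andP[/eqP E _]; exact: eqC_ReIm.
  exists (cRe e) => [|h hd]; first by rewrite -(ltcR (R:=R)) -eE.
  apply: H; rewrite mx_norm_ball /ball_ /= opprD addrA subrr sub0r normrN mnE eE ltcR //.
apply/nbhs_ballP; exists (d%:C) => [|h]; first by rewrite /= ltcR.
rewrite mx_norm_ball /ball_ /= => hd; have -> : h = c + (h - c) by rewrite addrC subrK.
by apply: H; rewrite -(ltcR (R:=R)) -mnE distrC.
Qed.

Lemma diff_epsP n m (f : 'rV[C]_n -> 'rV[C]_m) c : differentiable f c ->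
  exists2 L : 'rV[C]_n -> 'rV[C]_m, linear L & forall e : R, 0 < e -> exists2 d : R, 0 < d &
    forall h, mn h < d -> mn (f (c + h) - f c - L h) <= e * mn h.
Proof.
move=> df; exists ('d f c) => [a x y|e e0]; first by rewrite linearP.
have e0' : (0 : C) < e%:C by rewrite ltcR.
have [_ /eqaddoP /(_ _ e0') /mn_near [d d0 H]] := (diff_locallyP _ _).1 df.
exists d => // h /H; rewrite add0r /= !mnE -rmorphM lecR.
by rewrite [c + h]addrC -addrA -opprD.
Qed.

Lemma lin_differentiable n m (u : 'rV[C]_n -> 'rV[C]_m) c : linear u -> differentiable u c.
Proof.
move=> lu; pose U := HB.pack_for {linear 'rV[C]_n -> 'rV[C]_m} u (GRing.isLinear.Build _ _ _ _ u lu).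
have -> : u = \sum_(j < n) (fun h : 'rV[C]_n => (h 0 j : C) *: u (delta_mx 0 j)).
  apply/funext => h; rewrite fct_sumE.
  rewrite {1}(row_sum_delta h) -[u]/(U : _ -> _) linear_sum; apply: eq_bigr => j _.
  by rewrite linearZ.
apply: differentiable_sum => j; apply: differentiableZl; exact: differentiable_coord.
Qed.

Lemma diffZ_fun n m (a : 'rV[C]_n -> C) (w : 'rV[C]_n -> 'rV[C]_m) c :
  differentiable a c -> differentiable w c -> differentiable (fun x => a x *: w x) c.
Proof.
move=> da dw.
have -> : (fun x => a x *: w x) = \sum_(j < m) (fun h : 'rV[C]_n => (a h * w h 0 j : C) *: delta_mx 0 j).
  apply/funext => h; rewrite fct_sumE {1}(row_sum_delta (w h)) scaler_sumr.
  by apply: eq_bigr => j _; rewrite scalerA.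
apply: differentiable_sum => j; apply: differentiableZl; apply: differentiableM => //.
apply: (differentiable_comp (f := w) (g := fun h : 'rV[C]_m => h 0 j)) => //; exact: differentiable_coord.
Qed.
End MatrixNorm.


Section VectorBridge.
Context {R : realType}.
Local Open Scope complex_scope.
Local Notation C := (Num.NumField.sort (R[i] : numFieldType)).

Lemma fin_min n (P : 'I_n -> R -> Prop) : (forall i d d', d' <= d -> P i d -> P i d') ->
  (forall i, exists2 d : R, 0 < d & P i d) -> exists2 d : R, 0 < d & forall i, P i d.
Proof.
move=> anti H; have /choice [d dP] : forall i, exists d : R, 0 < d /\ P i d.
  by move=> i; have [d d0 Pd] := H i; exists d.
have s0 : 0 <= \sum_j (d j)^-1 by apply: sumr_ge0 => j _; rewrite invr_ge0 ltW //; have [] := dP j.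
exists (1 + \sum_j (d j)^-1)^-1 => [|i]; first by rewrite invr_gt0; lra.
have [di Pi] := dP i; apply: anti Pi.
rewrite -[d i]invrK lef_pV2 ?posrE ?invr_gt0 //; last lra.
rewrite (bigD1 i) //= addrA [1 + _]addrC -addrA lerDl.
by apply: addr_ge0 => //; apply: sumr_ge0 => j _; rewrite invr_ge0 ltW //; have [] := dP j.
Qed.

Section OneSpace.
Variable V : vectType R[i].
Implicit Types (u : nat -> V) (F : C -> V).

Lemma crdK : cancel (@crd _ V) (@uncrd _ V).
Proof. exact: passmx.rVofK (vbasisP _). Qed.
Lemma uncrdK : cancel (@uncrd _ V) (@crd _ V).
Proof. exact: passmx.vecofK (vbasisP _). Qed.
Lemma crd_lin : linear (@crd _ V). Proof. exact: passmx.rVof_linear. Qed.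
Lemma uncrd_lin : linear (@uncrd _ V). Proof. exact: passmx.vecof_linear. Qed.

Definition cd (i : 'I_(\dim {:V})) (v : V) : C := coord (vbasis {:V}) i v.
Lemma cdE i v : cd i v = crd v 0 i.
Proof. by rewrite /crd /cd /passmx.rVof mxE. Qed.
Lemma cd_lin i : linear (cd i : V -> R[i]^o).
Proof. by move=> a x y; rewrite /cd linearP. Qed.
Lemma cd_sum (v : V) : v = \sum_i cd i v *: (vbasis {:V})`_i.
Proof. exact: coord_vbasis (memvf _). Qed.
Lemma cd_inj (v w : V) : (forall i, cd i v = cd i w) -> v = w.
Proof. by move=> H; rewrite (cd_sum v) (cd_sum w); apply: eq_bigr => i _; rewrite H. Qed.

Definition vn (v : V) : R := mn (crd v).

Lemma linZ_of (W : lmodType R[i]) (u : V -> W) : linear u -> forall a x, u (a *: x) = a *: u x.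
Proof. by move=> lu a x; have := lu a x 0; have := lu 1 0 0; rewrite !scale1r !addr0 => /eqP; rewrite -subr_eq subrr => /eqP <-; rewrite addr0. Qed.
Lemma lin0_of (W : lmodType R[i]) (u : V -> W) : linear u -> u 0 = 0.
Proof. by move=> lu; have := linZ_of lu 0 0; rewrite !scale0r. Qed.
Lemma linD_of (W : lmodType R[i]) (u : V -> W) : linear u -> {morph u : x y / x + y}.
Proof. by move=> lu x y; have := lu 1 x y; rewrite !scale1r. Qed.
Lemma linN_of (W : lmodType R[i]) (u : V -> W) : linear u -> {morph u : x / - x}.
Proof. by move=> lu x; rewrite -[in LHS]scaleN1r (linZ_of lu) scaleN1r. Qed.
Lemma linB_of (W : lmodType R[i]) (u : V -> W) : linear u -> {morph u : x y / x - y}.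
Proof. by move=> lu x y; rewrite linD_of // linN_of. Qed.
Lemma lin_sum_of (W : lmodType R[i]) (u : V -> W) : linear u ->
  forall (I : Type) (s : seq I) (P : pred I) (F : I -> V), u (\sum_(i <- s | P i) F i) = \sum_(i <- s | P i) u (F i).
Proof.
move=> lu I s P F; elim: s => [|a s IH]; first by rewrite !big_nil lin0_of.
by rewrite !big_cons; case: (P a) => //; rewrite linD_of // IH.
Qed.
Lemma lin_cd (W : lmodType R[i]) (u : V -> W) (v : V) : linear u -> u v = \sum_i cd i v *: u (vbasis {:V})`_i.
Proof. by move=> lu; rewrite {1}(cd_sum v) lin_sum_of //; apply: eq_bigr => i _; rewrite linZ_of. Qed.

Lemma vn_ge0 v : 0 <= vn v. Proof. exact: mn_ge0. Qed.
Lemma vn_ge v i : nc (cd i v) <= vn v.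
Proof. by rewrite cdE; exact: mn_ge. Qed.
Lemma vn_le v : vn v <= \sum_i nc (cd i v).
Proof. by rewrite (eq_bigr (fun i => nc (crd v 0 i))) => [|i _]; rewrite ?cdE //; exact: mn_le. Qed.
Lemma vn_lt v e : 0 < e -> (forall i, nc (cd i v) < e) -> vn v < e.
Proof. by move=> e0 H; apply/(mn_lt _ e0) => j; rewrite -cdE. Qed.
Lemma vnD v w : vn (v + w) <= vn v + vn w.
Proof.
rewrite /vn (linD_of crd_lin).
have E : ((mn (crd v + crd w))%:C : C) <= (mn (crd v) + mn (crd w))%:C.
  by rewrite [X in _ <= X](rmorphD (real_complex R)) /= -!mnE; exact: ler_normD.
by rewrite lecR in E.
Qed.
Lemma vnZ a v : vn (a *: v) = nc a * vn v.
Proof.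
rewrite /vn (linZ_of crd_lin).
have E : (mn (a *: crd v))%:C = (nc a * mn (crd v))%:C :> C.
  by rewrite [RHS](rmorphM (real_complex R)) /= -!mnE; exact: normrZ.
by have := congr1 (@complex.Re R) E.
Qed.
Lemma vn0 : vn 0 = 0. Proof. by rewrite -(scale0r 0) vnZ nc0 mul0r. Qed.
Lemma vn_le_eq0 v : vn v <= 0 -> v = 0.
Proof.
move=> H; apply: cd_inj => i; rewrite (lin0_of (cd_lin i)); apply: ncP => e e0.
by apply: le_trans (vn_ge v i) _; apply: le_trans H (ltW e0).
Qed.
Lemma vnN v : vn (- v) = vn v.
Proof. by rewrite -scaleN1r vnZ ncN nc1 mul1r. Qed.
Lemma lin_bound (phi : V -> R[i]^o) : linear phi -> exists2 M : R, 0 < M & forall v, nc (phi v) <= M * vn v.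
Proof.
move=> lp; exists (1 + \sum_(i < \dim {:V}) nc (phi (vbasis {:V})`_i)).
  by apply: ltr_pwDl => //; apply: sumr_ge0 => i _; exact: nc_ge0.
move=> v; rewrite (lin_cd v lp); apply: le_trans (nc_sum _ _ _) _.
apply: (@le_trans _ _ (\sum_(i < \dim {:V}) nc (phi (vbasis {:V})`_i) * vn v)).
  apply: ler_sum => i _; rewrite ncM mulrC; apply: ler_wpM2l; [exact: nc_ge0|exact: vn_ge].
by rewrite -mulr_suml; apply: ler_wpM2r; rewrite ?vn_ge0 // lerDr.
Qed.
End OneSpace.
End VectorBridge.


Section VectorCalculus.
Context {R : realType}.
Local Open Scope complex_scope.
Local Notation C := (Num.NumField.sort (R[i] : numFieldType)).

Section Limits.
Variable V : vectType R[i].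
Implicit Types (u : nat -> V) (F : R[i] -> V).

Lemma vn_cds (v : V) (e : R) : (forall i, nc (cd i v) <= e) -> vn v <= (\dim {:V})%:R * e.
Proof.
move=> H; apply: le_trans (vn_le v) _; apply: le_trans (ler_sum _ (fun i _ => H i)) _.
by rewrite sumr_const card_ord mulr_natl.
Qed.

Lemma vnearP (x : V) (P : V -> Prop) :
  vnear x P <-> exists2 d : R, 0 < d & forall y, vn y < d -> P (x + y).
Proof.
rewrite /vnear mn_near; split=> -[d d0 H]; exists d => // y yd.
  by have := H (crd y) yd; rewrite -(linD_of (@crd_lin _ V)) crdK.
have : vn (uncrd y) < d by rewrite /vn uncrdK.
by move/H; rewrite (linD_of (V := 'rV[R[i]]_(\dim {:V})) (@uncrd_lin _ V)) crdK.
Qed.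

Lemma C_nearP (z : C) (P : C -> Prop) :
  (\forall w \near z, P w) <-> exists2 d : R, 0 < d & forall h, nc h < d -> P (z + h).
Proof.
split=> [/nbhs_ballP [e /= e0 H]|[d d0 H]].
  have eE : e = (cRe e)%:C by move: e0; rewrite ltcE /= => /andP[/eqP E _]; exact: eqC_ReIm.
  exists (cRe e) => [|h hd]; first by rewrite -(ltcR (R:=R)) -eE.
  by apply: H; rewrite /ball /= opprD addrA subrr sub0r normrN ncE eE ltcR.
apply/nbhs_ballP; exists (d%:C) => [|h]; first by rewrite /= ltcR.
rewrite /ball /= => hd; have -> : h = z + (h - z) by rewrite addrC subrK.
by apply: H; rewrite -(ltcR (R:=R)) -ncE distrC.
Qed.

Lemma vcvgP u l : vcvg u l <->
  forall e : R, 0 < e -> exists N, forall n, (N <= n)%N -> vn (u n - l) <= e.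
Proof.
split=> [/cvgrPdist_le H e e0|H].
  have e0' : (0 : C) < e%:C by rewrite ltcR.
  have [N _ HN] := H _ e0'; exists N => n Nn.
  by have := HN n Nn; rewrite /= distrC -(linB_of (@crd_lin _ V)) mnE lecR.
apply/cvgrPdist_le => e e0.
have eE : e = (cRe e)%:C by move: e0; rewrite ltcE /= => /andP[/eqP E _]; exact: eqC_ReIm.
have e0' : 0 < cRe e by rewrite -(ltcR (R:=R)) -eE.
have [N HN] := H _ e0'; exists N => // n /= Nn.
by rewrite distrC -(linB_of (@crd_lin _ V)) mnE eE lecR; exact: HN.
Qed.

Lemma vcvg_lin u l (phi : V -> R[i]^o) : linear phi -> vcvg u l -> clim (phi \o u) (phi l).
Proof.
move=> lp /vcvgP H e e0; have [M M0 HM] := lin_bound lp.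
have [N HN] := H (e / M) (divr_gt0 e0 M0); exists N => n /HN Hn.
rewrite /= -(linB_of lp); apply: le_trans (HM _) _.
by rewrite mulrC -ler_pdivlMr.
Qed.

Lemma vcvg_cd u l : (forall i, clim (fun n => cd i (u n)) (cd i l)) -> vcvg u l.
Proof.
move=> H; apply/vcvgP => e e0.
have d0 : 0 < (\dim {:V})%:R + 1 :> R by apply: ltr_wpDl.
have /choice [N HN] : forall i : 'I_(\dim {:V}), exists N, forall n, (N <= n)%N ->
    nc (cd i (u n) - cd i l) <= e / ((\dim {:V})%:R + 1).
  by move=> i; apply: H; apply: divr_gt0.
exists (\sum_i N i)%N => n Nn.
have : vn (u n - l) <= (\dim {:V})%:R * (e / ((\dim {:V})%:R + 1)).
  apply: vn_cds => i; rewrite (linB_of (@cd_lin _ V i)); apply: HN; apply: leq_trans Nn.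
  by rewrite (bigD1 i) //= leq_addr.
move/le_trans; apply; rewrite mulrCA -[X in _ <= X]mulr1; apply: ler_wpM2l; first exact: ltW.
by rewrite ler_pdivrMr // mul1r lerDl.
Qed.

Lemma vcvg_unique u l l' : vcvg u l -> vcvg u l' -> l = l'.
Proof.
move=> h h'; apply: cd_inj => i.
exact: clim_unique (vcvg_lin (@cd_lin _ V i) h) (vcvg_lin (@cd_lin _ V i) h').
Qed.

Lemma vlimE u l : vcvg u l -> vlim u = l.
Proof.
move=> h; rewrite /vlim (_ : lim _ = crd l) ?crdK //.
by apply: cvg_lim h.
Qed.

Lemma is_deriv_inP (D : set C) F t v : is_deriv_in D F t v <->
  forall e : R, 0 < e -> exists2 d : R, 0 < d &
   forall s, D s -> nc (s - t) < d -> vn (F s - F t - (s - t) *: v) <= e * nc (s - t).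
Proof.
have key s : s != t -> forall e : R,
  (`|crd v - (s - t)^-1 *: crd (F s - F t)| <= (e%:C : C)) =
  (vn (F s - F t - (s - t) *: v) <= e * nc (s - t)).
  move=> st e; have n0 : 0 < nc (s - t) by rewrite nc_gt0 subr_eq0.
  have -> : F s - F t - (s - t) *: v = (s - t) *: ((s - t)^-1 *: (F s - F t) - v).
    by rewrite scalerBr scalerA divff ?subr_eq0 // scale1r.
  rewrite vnZ mulrC ler_pM2r // distrC -(linZ_of (@crd_lin _ V)) -(linB_of (@crd_lin _ V)).
  by rewrite mnE lecR.
split=> [/cvgrPdist_le H e e0|H].
  have e0' : (0 : C) < e%:C by rewrite ltcR.
  have := H _ e0'; rewrite /within /= /dnbhs /within /= => /C_nearP [d d0 Hd].
  exists d => // s Ds sd; have [->|st] := eqVneq s t.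
    by rewrite !subrr scale0r subrr vn0 nc0 mulr0.
  by have := Hd (s - t) sd; rewrite addrC subrK => /(_ st Ds); rewrite key.
apply/cvgrPdist_le => e e0.
have eE : e = (cRe e)%:C by move: e0; rewrite ltcE /= => /andP[/eqP E _]; exact: eqC_ReIm.
have e0' : 0 < cRe e by rewrite -(ltcR (R:=R)) -eE.
have [d d0 Hd] := H _ e0'.
rewrite /within /= /dnbhs /within /=; apply/C_nearP; exists d => // k kd kt Dk.
by rewrite eE key //; apply: Hd => //; rewrite addrC addKr.
Qed.

End Limits.
End VectorCalculus.


Section Derivatives.
Context {R : realType}.
Local Open Scope complex_scope.
Local Notation C := (Num.NumField.sort (R[i] : numFieldType)).

Lemma lin_vbound (V W : vectType R[i]) (u : V -> W) : linear u ->
  exists2 M : R, 0 < M & forall v, vn (u v) <= M * vn v.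
Proof.
move=> lu; exists (1 + \sum_(i < \dim {:V}) vn (u (vbasis {:V})`_i)).
  by apply: ltr_pwDl => //; apply: sumr_ge0 => i _; exact: vn_ge0.
move=> v; rewrite (lin_cd v lu).
apply: (@le_trans _ _ (\sum_(i < \dim {:V}) vn (u (vbasis {:V})`_i) * vn v)).
  elim/big_rec2: _ => [|i y x _ IH]; first by rewrite vn0.
  apply: le_trans (vnD _ _) _; apply: lerD => //; rewrite vnZ mulrC.
  by apply: ler_wpM2l; [exact: vn_ge0|exact: vn_ge].
by rewrite -mulr_suml; apply: ler_wpM2r; rewrite ?vn_ge0 // lerDr.
Qed.

Definition frechet (V W : vectType R[i]) (F : V -> W) x (L : V -> W) := linear L /\
  forall e : R, 0 < e -> exists2 d : R, 0 < d &
    forall h, vn h < d -> vn (F (x + h) - F x - L h) <= e * vn h.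

Lemma holo_frechet (V W : vectType R[i]) (F : V -> W) x : holo_at F x ->
  exists2 d : R, 0 < d & forall y, vn y < d -> exists L, frechet F (x + y) L.
Proof.
move=> /mn_near [d d0 H]; exists d => // y yd.
have [L lL HL] := diff_epsP (H (crd y) yd).
exists (fun v => uncrd (L (crd v))); split=> [a v w|e e0].
  by rewrite (@crd_lin _ V) lL (@uncrd_lin _ W).
have [d' d'0 H'] := HL e e0; exists d' => // h hd'; rewrite /vn.
rewrite !(linB_of (@crd_lin _ W)) uncrdK.
by have := H' (crd h) hd'; rewrite -!(linD_of (@crd_lin _ V)) !crdK.
Qed.

Lemma frechet_lin (V W : vectType R[i]) (u : V -> W) x : linear u -> frechet u x u.
Proof.
move=> lu; split=> // e e0; exists 1 => // h _.
by rewrite (linD_of lu) addrAC addrK subrr vn0 mulr_ge0 ?vn_ge0 // ltW.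
Qed.

Lemma frechet_cont (V W : vectType R[i]) (F : V -> W) x L : frechet F x L ->
  forall e : R, 0 < e -> exists2 d : R, 0 < d & forall h, vn h < d -> vn (F (x + h) - F x) <= e.
Proof.
move=> [lL H] e e0; have [M M0 HM] := lin_vbound lL.
have [d d0 Hd] := H 1 ltr01.
have [d' [d'0 dd' dM]] : exists d', [/\ 0 < d', d' <= d & d' * (1 + M) <= e].
  exists (Num.min d (e / (1 + M))); split; first by rewrite lt_min d0 divr_gt0 //; lra.
    by rewrite ge_min lexx.
  by rewrite -ler_pdivlMr; [rewrite ge_min lexx orbT|lra].
exists d' => // h hd'.
have := Hd h (lt_le_trans hd' dd'); have := HM h => h1 h2.
have : vn (F (x + h) - F x) <= vn (F (x + h) - F x - L h) + vn (L h) by rewrite -{1}(subrK (L h) (F (x + h) - F x)) vnD.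
have : vn h * (1 + M) <= e.
  by apply: le_trans dM; apply: ler_wpM2r; [lra|exact: ltW].
by rewrite mul1r in h2; lra.
Qed.

Section Curves.
Variables V W : vectType R[i].

Lemma deriv_near (D : set C) (F G : R[i] -> V) t v (r : R) : 0 < r ->
  (forall s, nc (s - t) < r -> F s = G s) -> is_deriv_in D F t v -> is_deriv_in D G t v.
Proof.
move=> r0 FG /is_deriv_inP H; apply/is_deriv_inP => e e0; have [d d0 Hd] := H e e0.
exists (Num.min d r) => [|s Ds]; first by rewrite lt_min d0.
rewrite lt_min => /andP[sd sr]; rewrite -!FG ?subrr ?nc0 //; exact: Hd.
Qed.

Lemma deriv_chain (D : set C) (F : V -> W) (gam : R[i] -> V) t v L :
  is_deriv_in D gam t v -> frechet F (gam t) L -> is_deriv_in D (F \o gam) t (L v).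
Proof.
move=> /is_deriv_inP H [lL HL]; apply/is_deriv_inP => e e0.
have [M M0 HM] := lin_vbound lL.
have v0 := vn_ge0 v.
pose e1 := e / 2 / (1 + vn v); pose e2 := Num.min 1 (e / 2 / M).
have e10 : 0 < e1 by apply: divr_gt0; [lra|lra].
have e20 : 0 < e2 by rewrite lt_min ltr01 divr_gt0 //; lra.
have [d1 d10 H1] := HL e1 e10; have [d2 d20 H2] := H e2 e20.
exists (Num.min d2 (d1 / (1 + vn v))) => [|s Ds].
  by rewrite lt_min d20 divr_gt0 //; lra.
rewrite lt_min => /andP[sd2 sd1]; have {}H2 := H2 s Ds sd2.
set k := nc (s - t) in sd1 sd2 H2 *; have k0 : 0 <= k by exact: nc_ge0.
set g := gam s - gam t in H2 *.
have gE : gam s = gam t + g by rewrite addrC subrK.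
clearbody g.
have vs : vn g <= k * (1 + vn v).
  have -> : g = (g - (s - t) *: v) + (s - t) *: v by rewrite subrK.
  apply: le_trans (vnD _ _) _; rewrite vnZ.
  have : e2 * k <= k by rewrite -[X in _ <= X]mul1r; apply: ler_wpM2r => //; rewrite ge_min lexx.
  rewrite -/k; lra.
have gd : vn g < d1.
  by apply: le_lt_trans vs _; rewrite -ltr_pdivlMr //; lra.
have {}H1 := H1 g gd.
rewrite /= gE.
have -> : F (gam t + g) - F (gam t) - (s - t) *: L v =
   (F (gam t + g) - F (gam t) - L g) + L (g - (s - t) *: v).
  by rewrite (linB_of lL) (linZ_of lL) addrA subrK.
apply: le_trans (vnD _ _) _.
have h1 : e1 * vn g <= e / 2 * k.
  apply: (@le_trans _ _ (e1 * (k * (1 + vn v)))); first by apply: ler_wpM2l => //; exact: ltW.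
  by rewrite /e1 mulrCA mulrC divfK ?lexx //; apply/eqP; lra.
have h2 : vn (L (g - (s - t) *: v)) <= e / 2 * k.
  apply: le_trans (HM _) _.
  apply: (@le_trans _ _ (M * (e2 * k))); first by apply: ler_wpM2l => //; exact: ltW.
  rewrite mulrA; apply: ler_wpM2r => //; rewrite mulrC -ler_pdivlMr //.
  by rewrite /e2 ge_min lexx orbT.
lra.
Qed.

Lemma deriv_lin (D : set C) (u : V -> W) (gam : R[i] -> V) t v : linear u ->
  is_deriv_in D gam t v -> is_deriv_in D (u \o gam) t (u v).
Proof. by move=> lu H; apply: (deriv_chain H); exact: frechet_lin. Qed.

Lemma derivT_hd (gam : R[i] -> V) t v (phi : V -> R[i]^o) : linear phi ->
  is_deriv_in setT gam t v -> hd (phi \o gam) t (phi v).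
Proof.
move=> lp /is_deriv_inP H e e0; have [M M0 HM] := lin_bound lp.
have [d d0 Hd] := H (e / M) (divr_gt0 e0 M0); exists d => // h hd'.
have := Hd (t + h) I; rewrite addrAC subrr add0r => /(_ hd') h1.
have EZ : phi v * h = phi (h *: v) by rewrite (linZ_of lp) mulrC.
rewrite /= EZ -!(linB_of lp).
apply: le_trans (HM _) _; rewrite mulrC -ler_pdivlMr // mulrAC; exact: h1.
Qed.

Lemma hd_derivT (gam : R[i] -> V) t v :
  (forall i, hd (fun s => cd i (gam s)) t (cd i v)) -> is_deriv_in setT gam t v.
Proof.
move=> H; apply/is_deriv_inP => e e0.
have d1 : 0 < (\dim {:V})%:R + 1 :> R by apply: ltr_wpDl.
have e1 : 0 < e / ((\dim {:V})%:R + 1) by apply: divr_gt0.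
have [||d d0 Hd] := @fin_min R _ (fun i d => forall h, nc h < d ->
   nc (cd i (gam (t + h)) - cd i (gam t) - h * cd i v) <= e / ((\dim {:V})%:R + 1) * nc h).
- by move=> i d d' dd' Hd h hd'; apply: Hd; exact: lt_le_trans hd' dd'.
- by move=> i; have [d d0 Hd] := H i _ e1; exists d => // h /Hd; rewrite [cd i v * h]mulrC.
exists d => // s _ sd.
apply: le_trans (_ : (\dim {:V})%:R * (e / ((\dim {:V})%:R + 1) * nc (s - t)) <= _).
  apply: vn_cds => i; rewrite !(linB_of (@cd_lin _ V i)) (linZ_of (@cd_lin _ V i)).
  by have := Hd i (s - t) sd; rewrite [t + _]addrC subrK.
rewrite mulrA; apply: ler_wpM2r; first exact: nc_ge0.
by rewrite mulrCA -[X in _ <= X]mulr1; apply: ler_wpM2l; [exact: ltW|rewrite ler_pdivrMr // mul1r lerDl].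
Qed.

Lemma derive1_deriv (F : R[i] -> V) t v : is_deriv_in setT F t v ->
  derive1 (fun s : C => crd (F s)) t = crd v.
Proof.
move=> /is_deriv_inP H; apply: cvg_lim => //; apply/cvgrPdist_le => e e0.
have eE : e = (cRe e)%:C by move: e0; rewrite ltcE /= => /andP[/eqP E _]; exact: eqC_ReIm.
have e0' : 0 < cRe e by rewrite -(ltcR (R:=R)) -eE.
have [d d0 Hd] := H _ e0'.
rewrite /dnbhs /within /=; apply/C_nearP; exists d => // k kd; rewrite add0r => k0.
have n0 : 0 < nc k by rewrite nc_gt0.
have := Hd (k + t) I; rewrite addrK => /(_ kd) h1.
have E : F (k + t) - F t - k *: v = k *: (k^-1 *: (F (k + t) - F t) - v).
  by rewrite scalerBr scalerA divff // scale1r.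
move: h1; rewrite E vnZ mulrC ler_pM2r // => h1.
by rewrite distrC -(linB_of (@crd_lin _ V)) -(linZ_of (@crd_lin _ V)) -(linB_of (@crd_lin _ V)) mnE eE lecR.
Qed.

End Curves.

Lemma dirder_eq (V W : vectType R[i]) (F : V -> W) x v l :
  is_deriv_in setT (fun s => F (x + s *: v)) 0 l -> dirder F x v = l.
Proof. by move=> /derive1_deriv h; rewrite /dirder /vderiven /= h crdK. Qed.

Lemma deriv_line (V W : vectType R[i]) (F : V -> W) x v s L : frechet F (x + s *: v) L ->
  is_deriv_in setT (fun s => F (x + s *: v)) s (L v).
Proof.
move=> H; apply: (@deriv_chain _ _ setT F (fun s => x + s *: v)) H.
apply/is_deriv_inP => e e0; exists 1 => // s' _ _.
rewrite opprD addrACA subrr add0r -scalerBl subrr vn0; apply: mulr_ge0; [exact: ltW|exact: nc_ge0].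
Qed.

Lemma dirder_frechet (V W : vectType R[i]) (F : V -> W) x v L : frechet F x L -> dirder F x v = L v.
Proof. by move=> H; apply: dirder_eq; apply: deriv_line; rewrite scale0r addr0. Qed.

End Derivatives.


Section ScalarTaylor.
Context {R : realType}.
Local Open Scope complex_scope.
Local Notation C := R[i].
Implicit Types (F G : C -> C) (a : nat -> C).

Lemma psum_hol a F (r : R) : 0 < r -> (forall w, nc w < r -> psum a w (F w)) ->
  hol F 0 r /\ tc F 0 = a.
Proof.
move=> r0 H; split=> [z|]; last by apply: (tc_eq r0) => w; rewrite add0r; exact: H.
by rewrite subr0 => /(psum_hd H) [l hl _]; exists l.
Qed.

Lemma psum_peel a z l : z != 0 -> psum a z l -> psum (fun k => a k.+1) z ((l - a 0%N) / z).
Proof.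
move=> z0 H e e0; have nz : 0 < nc z by rewrite nc_gt0.
have [N HN] := H (e * nc z) (mulr_gt0 e0 nz).
exists N => n Nn; have := HN n.+1 (leqW Nn); rewrite big_ord_recl /= expr0 mulr1 => h.
rewrite -(ler_pM2r nz) -ncM; apply: le_trans h; rewrite le_eqVlt; apply/orP; left; apply/eqP; congr nc.
rewrite mulrBl divfK // mulr_suml [\sum_(i < n) _](eq_bigr (fun i : 'I_n => a i.+1 * z ^+ i.+1)).
  by rewrite opprB addrA [a 0%N + _]addrC.
by move=> i _; rewrite exprSr mulrA.
Qed.

Lemma hol_peel F (r : R) : 0 < r -> hol F 0 r -> exists F1, [/\ hol F1 0 r,
  tc F1 0 = (fun k => tc F 0 k.+1) & forall z, nc z < r -> F z = tc F 0 0%N + z * F1 z].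
Proof.
move=> r0 hF; pose F1 z := if z == 0 then tc F 0 1%N else (F z - tc F 0 0%N) / z.
have H w : nc w < r -> psum (fun k => tc F 0 k.+1) w (F1 w).
  move=> wr; rewrite /F1; have [->|w0] := eqVneq w 0; first exact: (psum_at0 (fun k => tc F 0 k.+1)).
  by apply: psum_peel => //; have := tcP hF wr; rewrite add0r.
have [h1 h2] := psum_hol r0 H; exists F1; split => // z zr; rewrite /F1.
have [->|z0] := eqVneq z 0; first by rewrite mul0r addr0 (tc0 r0 hF).
by rewrite mulrC divfK // addrC subrK.
Qed.

Lemma tcM F G (r : R) k : 0 < r -> hol F 0 r -> hol G 0 r ->
  tc (fun z => F z * G z) 0 k = \sum_(i < k.+1) tc F 0 i * tc G 0 (k - i)%N.
Proof.
move=> r0 hF hG; elim: k F hF => [|k IH] F hF.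
  by rewrite big_ord_recl big_ord0 addr0 subnn (tc0 r0 (holM hF hG)) (tc0 r0 hF) (tc0 r0 hG).
have [F1 [h1 t1 E]] := hol_peel r0 hF.
have hz : hol (fun z => z) 0 r by move=> z _; exists 1; exact: hd_id.
rewrite (@tc_ext _ _ (fun z => tc F 0 0%N * G z + z * (F1 z * G z)) _ r r0).
- rewrite (tcD _ r0 (holZ _ hG) (holM hz (holM h1 hG))) (tcZ _ _ r0 hG).
  rewrite (tc_mulX _ r0 (holM h1 hG)) [RHS]big_ord_recl /= subn0 IH //; congr (_ + _).
  by apply: eq_bigr => i _; rewrite t1.
- exact: holM.
- by move=> z; rewrite subr0 => /E ->; rewrite mulrDl mulrA.
Qed.

Lemma tc_shift F c k : tc (fun z => F (c + z)) 0 k = tc F c k.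
Proof.
rewrite /tc; congr (xget _ _ _).
by apply/seteqP; split=> a /= [s s0 H]; exists s => // w /H; rewrite add0r.
Qed.

Lemma tc_iter F c (r : R) k : 0 < r -> hol F c r ->
  k`!%:R * tc F c k = iter k (@dC R) F c.
Proof.
move=> r0; elim: k F => [|k IH] F hF; first by rewrite fact0 mul1r (tc0 r0 hF).
by rewrite iterSr -IH; [rewrite (tc_dC _ r0 hF) factS natrM; ring|exact: hol_dC_hol].
Qed.

(** Values of two holomorphic functions on a punctured disc determine their
    values at the centre. *)
Lemma hol_eq0 F G (r : R) : 0 < r -> hol F 0 r -> hol G 0 r ->
  (forall z, 0 < nc z < r -> F z = G z) -> F 0 = G 0.
Proof.
move=> r0 hF hG E; apply/eqP; rewrite -subr_eq0; apply/eqP; apply: ncP => e e0.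
have [|lF /hd_cont cF] := hF 0; first by rewrite subr0 nc0.
have [|lG /hd_cont cG] := hG 0; first by rewrite subr0 nc0.
have e2 : 0 < e / 2 by lra.
have [d d0 Hd] := cF _ e2; have [d' d'0 Hd'] := cG _ e2.
have [t [t0 t1 t2]] := small2 d0 d'0; have [s [s0 s1 s2]] := small2 r0 t0.
have ns : nc s%:C = s by rewrite ncR ger0_norm // ltW.
have := Hd s%:C; have := Hd' s%:C; rewrite ns add0r => /(_ (lt_trans s2 t2)) h1 /(_ (lt_trans s2 t1)) h2.
have EE : F s%:C = G s%:C by apply: E; rewrite ns s0.
rewrite EE in h2.
have -> : F 0 - G 0 = (G s%:C - G 0) - (G s%:C - F 0) by ring.
by apply: le_trans (ncB _ _) _; lra.
Qed.

(** A pole of order T of F at 0 gives a pole of order T + k of the k-th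
    Taylor coefficient of F, as a function of the centre. *)
Lemma tc_pole F H (r : R) T k : 0 < r -> hol H 0 r ->
  (forall z, 0 < nc z < r -> F z = z ^- T * H z) ->
  exists2 H', hol H' 0 r & forall z, 0 < nc z < r -> tc F z k = z ^- (T + k) * H' z.
Proof.
move=> r0 hH FE.
have key k' : exists2 H', hol H' 0 r & forall z, 0 < nc z < r -> iter k' (@dC R) F z = z ^- (T + k') * H' z.
  elim: k' => [|k' [H' hH' E]]; first by exists H => // z /FE E; rewrite /= E addn0.
  exists (fun z => z * dC H' z + (- (T + k')%:R) * H' z).
    apply: holD; last exact: holZ.
    by apply: holM; [move=> z _; exists 1; exact: hd_id|exact: hol_dC_hol].
  move=> z /andP[z0 zr]; rewrite iterS; apply: dC_eq.
  have zn : z != 0 by rewrite -nc_gt0.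
  have [t [t0 t1 t2]] : exists t : R, [/\ 0 < t, t < nc z & t < r - nc z].
    by apply: small2 => //; lra.
  apply: (@hd_near R (fun w => w ^- (T + k') * H' w) _ z _ t) => //.
    move=> w wt; rewrite E //.
    have := nc_sub_ge z (z - w); have -> : z - (z - w) = w by ring.
    have := ncD z (w - z); have -> : z + (w - z) = w by ring.
    by rewrite [nc (z - w)]ncBC => h1 h2; apply/andP; split; lra.
  have hV := hd_comp (hdX z (T + k')) (hdV (expf_neq0 (T + k') zn)).
  have zr' : nc (z - 0) < r by rewrite subr0.
  have := hdM hV (hol_dC hH' zr'); rewrite /comp; set l := (_ + _) => hl.
  suff -> : z ^- (T + k'.+1) * (z * dC H' z + - (T + k')%:R * H' z) = l by [].
  rewrite /l addnS; case: (T + k')%N => [|n] /=; rewrite ?expr0 ?expr1 ?invr1.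
    by field.
  rewrite !exprS; field; apply/andP; split => //; exact: expf_neq0.
have [H' hH' E] := key k; exists (fun z => (k`!%:R)^-1 * H' z); first exact: holZ.
move=> z zr; have [t [t0 _ tz]] : exists t : R, [/\ 0 < t, t < 1 & (t <= nc z) /\ (t <= r - nc z)].
  move/andP: zr => [z0 zr]; have [||t [h1 h2 h3]] := @small2 R (nc z) (r - nc z); rewrite ?subr_gt0 //.
  have [t' [h4 h5 h6]] := small2 ltr01 h1.
  by exists t'; split => //; split; lra.
have hFz : hol F z t.
  move=> w wt.
  have w1 : 0 < nc w < r.
    have := nc_sub_ge z (z - w); have -> : z - (z - w) = w by ring.
    have := ncD z (w - z); have -> : z + (w - z) = w by ring.
    by rewrite [nc (z - w)]ncBC => h1 h2; apply/andP; split; lra.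
  move/andP: (w1) => [w0 wr]; have wn : w != 0 by rewrite -nc_gt0.
  have [s [s0 s1 s2]] : exists t : R, [/\ 0 < t, t < nc w & t < r - nc w].
    by apply: small2 => //; lra.
  have [|l hl] := hH w; first by rewrite subr0.
  eexists; apply: (@hd_near R (fun w => w ^- T * H w) _ w _ s) => //; last first.
    exact: hdM (hd_comp (hdX w T) (hdV (expf_neq0 T wn))) hl.
  move=> v vs; rewrite FE //.
  have := nc_sub_ge w (w - v); have -> : w - (w - v) = v by ring.
  have := ncD w (v - w); have -> : w + (v - w) = v by ring.
  by rewrite [nc (w - v)]ncBC => h1 h2; apply/andP; split; lra.
have := tc_iter k t0 hFz; rewrite E // => /(congr1 (fun x => (k`!%:R)^-1 * x)).
by rewrite mulKf ?pnatr_eq0 -?lt0n ?fact_gt0 // mulrCA.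
Qed.

End ScalarTaylor.


Section VectorHolomorphy.
Context {R : realType}.
Local Open Scope complex_scope.
Local Notation C := (Num.NumField.sort (R[i] : numFieldType)).

Definition vhol (V : vectType R[i]) (H : R[i] -> V) c (r : R) :=
  forall phi : V -> R[i]^o, linear phi -> hol (phi \o H) c r.

Definition vtc (V : vectType R[i]) (H : R[i] -> V) c k : V :=
  \sum_(i < \dim {:V}) tc (fun z => cd i (H z)) c k *: (vbasis {:V})`_i.

Section Basics.
Variable V : vectType R[i].
Implicit Types (F G H : R[i] -> V).

Lemma hol_sumI (I : Type) (s : seq I) (f : I -> R[i] -> R[i]) c (r : R) k : 0 < r ->
  (forall i, hol (f i) c r) -> hol (fun z => \sum_(i <- s) f i z) c r /\
  tc (fun z => \sum_(i <- s) f i z) c k = \sum_(i <- s) tc (f i) c k.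
Proof.
move=> r0 h; elim: s => [|a s [IH1 IH2]].
  have -> : (fun z => \sum_(i <- [::]) f i z) = fun=> 0 by apply/funext => z; rewrite big_nil.
  split; first by move=> z _; exists 0; exact: hd_cst.
  rewrite big_nil (@tc_eq R _ c (fun=> 0) 1 ltr01) // => w _.
  by apply: clim_ext (@clim_cst R _) => m; rewrite big1 // => i _; rewrite mul0r.
have -> : (fun z => \sum_(i <- a :: s) f i z) = fun z => f a z + \sum_(i <- s) f i z.
  by apply/funext => z; rewrite big_cons.
by split; [exact: holD|rewrite (tcD _ r0) // big_cons IH2].
Qed.

Lemma vhol_cd H c (r : R) : 0 < r -> (forall i, hol (fun z => cd i (H z)) c r) -> vhol H c r.
Proof.
move=> r0 h phi lp.
have -> : phi \o H = fun z => \sum_(i < \dim {:V}) phi (vbasis {:V})`_i * cd i (H z).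
  by apply/funext => z; rewrite /= (lin_cd _ lp); apply: eq_bigr => i _; rewrite mulrC.
by have [] := @hol_sumI _ (index_enum _) (fun (i : 'I_(\dim {:V})) z => phi (vbasis {:V})`_i * cd i (H z)) c r 0 r0 (fun i => holZ _ (h i)).
Qed.

Lemma vtcE H c (r : R) k (phi : V -> R[i]^o) : 0 < r -> vhol H c r -> linear phi ->
  phi (vtc H c k) = tc (phi \o H) c k.
Proof.
move=> r0 h lp.
have -> : phi \o H = fun z => \sum_(i < \dim {:V}) phi (vbasis {:V})`_i * cd i (H z).
  by apply/funext => z; rewrite /= (lin_cd _ lp); apply: eq_bigr => i _; rewrite mulrC.
have hi i : hol (fun z => cd i (H z)) c r by apply: (h (cd i)); exact: cd_lin.
have [_ ->] := @hol_sumI _ (index_enum _) (fun (i : 'I_(\dim {:V})) z => phi (vbasis {:V})`_i * cd i (H z)) c r k r0 (fun i => holZ _ (hi i)).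
rewrite /vtc (lin_sum_of lp); apply: eq_bigr => i _.
by rewrite (linZ_of lp) (tcZ _ _ r0 (hi i)) mulrC.
Qed.

Lemma cd_vtc H c (r : R) k i : 0 < r -> vhol H c r -> cd i (vtc H c k) = tc (fun z => cd i (H z)) c k.
Proof. by move=> r0 h; rewrite (vtcE _ r0 h (@cd_lin _ V i)). Qed.

Lemma vhol_derivT H c (r : R) z : vhol H c r -> nc (z - c) < r ->
  exists l, is_deriv_in setT H z l.
Proof.
move=> h zr; exists (\sum_(i < \dim {:V}) dC (fun z => cd i (H z)) z *: (vbasis {:V})`_i).
apply: hd_derivT => i.
have -> : cd i (\sum_(i < \dim {:V}) dC (fun z => cd i (H z)) z *: (vbasis {:V})`_i) = dC (fun z => cd i (H z)) z.
  by rewrite /cd coord_sum_free //; exact: basis_free (vbasisP _).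
exact: hol_dC (h _ (@cd_lin _ V i)) zr.
Qed.

Lemma derivT_vhol H c (r : R) : (forall z, nc (z - c) < r -> exists l, is_deriv_in setT H z l) -> vhol H c r.
Proof. by move=> h phi lp z /h [l hl]; exists (phi l); exact: derivT_hd. Qed.

Lemma vhol_sub H c d (r s : R) : vhol H c r -> nc (d - c) + s <= r -> vhol H d s.
Proof. by move=> h ds phi lp; apply: hol_sub ds; exact: h. Qed.

Lemma vhol_shift H c (r : R) : vhol H c r -> vhol (fun z => H (c + z)) 0 r.
Proof. by move=> h phi lp; exact: hol_shift (h phi lp). Qed.

Lemma vtc_shift H c k : vtc (fun z => H (c + z)) 0 k = vtc H c k.
Proof. by apply: eq_bigr => i _; congr (_ *: _); exact: (tc_shift (fun z => cd i (H z))). Qed.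

Lemma vhol_near F H c (r : R) : vhol F c r -> (forall w, nc (w - c) < r -> F w = H w) -> vhol H c r.
Proof.
move=> h E phi lp z zr; have [l hl] := h phi lp z zr; exists l.
apply: (@hd_near R (phi \o F) _ z l (r - nc (z - c))) => //; first by rewrite subr_gt0.
move=> w wz; rewrite /= E //; have -> : w - c = (w - z) + (z - c) by ring.
by apply: le_lt_trans (ncD _ _) _; rewrite -ltrBrDr.
Qed.

Lemma vtc_near F H c (r : R) k : 0 < r -> vhol F c r -> (forall w, nc (w - c) < r -> F w = H w) ->
  vtc F c k = vtc H c k.
Proof.
move=> r0 h E; apply: eq_bigr => i _; congr (_ *: _).
by rewrite (tc_ext r0 (h _ (@cd_lin _ V i)) (G := fun z => cd i (H z))) // => w /E E0; rewrite /= E0.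
Qed.

Lemma vholD F G c (r : R) : vhol F c r -> vhol G c r -> vhol (fun z => F z + G z) c r.
Proof.
move=> hF hG phi lp; have -> : phi \o (fun z => F z + G z) = fun z => (phi \o F) z + (phi \o G) z.
  by apply/funext => z; rewrite /= (linD_of lp).
by apply: holD; [exact: hF|exact: hG].
Qed.

Lemma vhol_scale (a : R[i] -> R[i]) F c (r : R) : hol a c r -> vhol F c r -> vhol (fun z => a z *: F z) c r.
Proof.
move=> ha hF phi lp; have -> : phi \o (fun z => a z *: F z) = fun z => a z * (phi \o F) z.
  by apply/funext => z; rewrite /= (linZ_of lp).
by apply: holM => //; exact: hF.
Qed.

Lemma vhol_cst (v : V) c (r : R) : vhol (fun=> v) c r.
Proof. by move=> phi lp z _; exists 0; exact: hd_cst. Qed.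

Lemma vtc0 H c (r : R) : 0 < r -> vhol H c r -> vtc H c 0 = H c.
Proof.
move=> r0 h; apply: cd_inj => i; rewrite (cd_vtc _ _ r0 h).
exact: tc0 r0 (h _ (@cd_lin _ V i)).
Qed.

Lemma vderiven_hol F c (r : R) t k : vhol F c r -> nc (t - c) < r ->
  vderiven k F t = k`!%:R *: vtc F t k.
Proof.
move=> h; pose D k t : V := \sum_(i < \dim {:V}) iter k (@dC R) (fun z => cd i (F z)) t *: (vbasis {:V})`_i.
have hD k' : vhol (D k') c r.
  apply: derivT_vhol => z zr.
  exists (D k'.+1 z); apply: hd_derivT => i.
  rewrite /D [X in hd _ _ X](_ : _ = iter k'.+1 (@dC R) (fun z => cd i (F z)) z); last first.
    by rewrite /cd coord_sum_free //; exact: basis_free (vbasisP _).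
  apply: (@hd_ext R (iter k' (@dC R) (fun z => cd i (F z)))).
    by move=> w; rewrite /cd coord_sum_free //; exact: basis_free (vbasisP _).
  have hi : hol (iter k' (@dC R) (fun z => cd i (F z))) c r.
    by elim: k' => [|m IH]; [apply: (h (cd i)); exact: cd_lin|exact: hol_dC_hol].
  exact: hol_dC hi zr.
have key k' t' : nc (t' - c) < r -> derive1n k' (fun s : C => crd (F s)) t' = crd (D k' t').
  elim: k' t' => [|k' IH] t' tr; first by rewrite /= /D -(cd_sum (F t')).
  rewrite derive1nS.
  have dD : is_deriv_in setT (D k') t' (D k'.+1 t').
    apply: hd_derivT => i.
    rewrite /D [X in hd _ _ X](_ : _ = iter k'.+1 (@dC R) (fun z => cd i (F z)) t'); last first.
      by rewrite /cd coord_sum_free //; exact: basis_free (vbasisP _).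
    apply: (@hd_ext R (iter k' (@dC R) (fun z => cd i (F z)))).
      by move=> w; rewrite /cd coord_sum_free //; exact: basis_free (vbasisP _).
    have hi : hol (iter k' (@dC R) (fun z => cd i (F z))) c r.
      clear IH; elim: k' => [|m IH]; [apply: (h (cd i)); exact: cd_lin|exact: hol_dC_hol].
    exact: hol_dC hi tr.
  pose G (s : R[i]) : V := uncrd (derive1n k' (fun s : C => crd (F s)) s).
  have EG : derive1n k' (fun s : C => crd (F s)) = (fun s : C => crd (G s)).
    by apply/funext => s; rewrite uncrdK.
  rewrite EG; apply: derive1_deriv; rewrite /G; apply: (@deriv_near R V setT (D k') _ t' _ (r - nc (t' - c))) => //; first by rewrite subr_gt0.
  move=> s sr; rewrite IH ?crdK //.
  have -> : s - c = (s - t') + (t' - c) by ring.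
  by apply: le_lt_trans (ncD _ _) _; rewrite -ltrBrDr.
move=> tr; rewrite /vderiven key // crdK /D /vtc scaler_sumr.
apply: eq_bigr => i _; rewrite scalerA; congr (_ *: _).
have r0 : 0 < r - nc (t - c) by rewrite subr_gt0.
rewrite -(tc_iter k r0) //; apply: (@hol_sub R _ c r); last by lra.
by apply: (h (cd i)); exact: cd_lin.
Qed.
End Basics.

Section Two.
Variables V W U : vectType R[i].
Lemma vhol_lin (u : V -> W) (H : R[i] -> V) c (r : R) : linear u -> vhol H c r -> vhol (fun z => u (H z)) c r.
Proof. by move=> lu h phi lp; apply: (h (phi \o u)) => a x y; rewrite /= lu lp. Qed.

Lemma vtc_lin (u : V -> W) (H : R[i] -> V) c (r : R) k : 0 < r -> linear u -> vhol H c r ->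
  vtc (fun z => u (H z)) c k = u (vtc H c k).
Proof.
move=> r0 lu h; apply: cd_inj => i; rewrite (cd_vtc _ _ r0 (vhol_lin lu h)).
have lp : linear (cd i \o u : V -> R[i]^o) by move=> a x y; rewrite /= lu (@cd_lin _ W i).
by have := vtcE k r0 h lp => /= ->.
Qed.

Definition bil (B : V -> W -> U) := (forall x, linear (B x)) /\ (forall y, linear (B^~ y)).

Lemma bilE B : bil B -> forall x y, B x y =
  \sum_(i < \dim {:V}) \sum_(j < \dim {:W}) (cd i x * cd j y) *: B (vbasis {:V})`_i (vbasis {:W})`_j.
Proof.
move=> [b1 b2] x y; rewrite {1}(lin_cd x (b2 y)); apply: eq_bigr => i _.
rewrite {1}(lin_cd y (b1 _)) scaler_sumr; apply: eq_bigr => j _; by rewrite scalerA.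
Qed.

Lemma vhol_bil B (F : R[i] -> V) (G : R[i] -> W) c (r : R) : 0 < r -> bil B -> vhol F c r -> vhol G c r ->
  vhol (fun z => B (F z) (G z)) c r.
Proof.
move=> r0 bB hF hG phi lp.
have -> : phi \o (fun z => B (F z) (G z)) = fun z => \sum_(i < \dim {:V}) \sum_(j < \dim {:W})
    (cd i (F z) * cd j (G z)) * phi (B (vbasis {:V})`_i (vbasis {:W})`_j).
  apply/funext => z; rewrite /= (bilE bB) (lin_sum_of lp); apply: eq_bigr => i _.
  by rewrite (lin_sum_of lp); apply: eq_bigr => j _; rewrite (linZ_of lp).
have hij i j : hol (fun z => (cd i (F z) * cd j (G z)) * phi (B (vbasis {:V})`_i (vbasis {:W})`_j)) c r.
  apply: holM; last by move=> z _; exists 0; exact: hd_cst.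
  by apply: holM; [apply: (hF (cd i)); exact: cd_lin|apply: (hG (cd j)); exact: cd_lin].
have hi i := (@hol_sumI _ (index_enum _) _ c r 0 r0 (hij i)).1.
exact: (@hol_sumI _ (index_enum _) _ c r 0 r0 hi).1.
Qed.

Lemma vtc_bil B (F : R[i] -> V) (G : R[i] -> W) (r : R) k : 0 < r -> bil B -> vhol F 0 r -> vhol G 0 r ->
  vtc (fun z => B (F z) (G z)) 0 k = \sum_(m < k.+1) B (vtc F 0 m) (vtc G 0 (k - m)).
Proof.
move=> r0 bB hF hG; apply: cd_inj => l; have lp := @cd_lin _ U l.
rewrite (cd_vtc _ _ r0 (vhol_bil r0 bB hF hG)).
pose f (i : 'I_(\dim {:V})) (j : 'I_(\dim {:W})) z := (cd i (F z) * cd j (G z)) * cd l (B (vbasis {:V})`_i (vbasis {:W})`_j).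
have hfi i : hol (fun z => cd i (F z)) 0 r by apply: (hF (cd i)); exact: cd_lin.
have hgj j : hol (fun z => cd j (G z)) 0 r by apply: (hG (cd j)); exact: cd_lin.
have hij i j : hol (f i j) 0 r.
  apply: holM; last by move=> z _; exists 0; exact: hd_cst.
  exact: holM.
have -> : (fun z => cd l (B (F z) (G z))) = fun z => \sum_(i < \dim {:V}) \sum_(j < \dim {:W}) f i j z.
  apply/funext => z; rewrite (bilE bB) (lin_sum_of lp); apply: eq_bigr => i _.
  by rewrite (lin_sum_of lp); apply: eq_bigr => j _; rewrite (linZ_of lp).
have hi i := (@hol_sumI _ (index_enum _) _ 0 r 0 r0 (hij i)).1.
rewrite (@hol_sumI _ (index_enum _) _ 0 r k r0 hi).2.
under eq_bigr => i _ do rewrite (@hol_sumI _ (index_enum _) _ 0 r k r0 (hij i)).2.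
have tij i j : tc (f i j) 0 k = \sum_(m < k.+1) (cd i (vtc F 0 m) * cd j (vtc G 0 (k - m))) * cd l (B (vbasis {:V})`_i (vbasis {:W})`_j).
  have -> : f i j = fun z => cd l (B (vbasis {:V})`_i (vbasis {:W})`_j) * (cd i (F z) * cd j (G z)).
    by apply/funext => z; rewrite /f mulrC.
  rewrite (tcZ _ _ r0 (holM (hfi i) (hgj j))) (tcM _ r0 (hfi i) (hgj j)) mulr_sumr.
  by apply: eq_bigr => m _; rewrite (cd_vtc _ _ r0 hF) (cd_vtc _ _ r0 hG) mulrC.
under eq_bigr => i _ do under eq_bigr => j _ do rewrite tij.
rewrite (lin_sum_of lp).
transitivity (\sum_(i < \dim {:V}) \sum_(m < k.+1) \sum_(j < \dim {:W}) (cd i (vtc F 0 m) * cd j (vtc G 0 (k - m))) * cd l (B (vbasis {:V})`_i (vbasis {:W})`_j)).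
  by apply: eq_bigr => i _; rewrite exchange_big.
rewrite exchange_big; apply: eq_bigr => m _.
rewrite (bilE bB) (lin_sum_of lp); apply: eq_bigr => i _.
by rewrite (lin_sum_of lp); apply: eq_bigr => j _; rewrite (linZ_of lp).
Qed.
End Two.

End VectorHolomorphy.


Section LaurentCalculus.
Context {R : realType}.
Local Open Scope complex_scope.
Local Notation C := (Num.NumField.sort (R[i] : numFieldType)).

Lemma annulusP (c : C) : 0 < c -> exists2 r : R, 0 < r & forall z : R[i], (0 < (`|z| : C) < c) = (0 < nc z < r).
Proof.
move=> c0; have cE : c = (cRe c)%:C by move: c0; rewrite ltcE /= => /andP[/eqP E _]; exact: eqC_ReIm.
exists (cRe c) => [|z]; first by rewrite -(ltcR (R:=R)) -cE.
by rewrite ncE {1}cE !ltcR.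
Qed.

Lemma annulusC (r : R) (z : R[i]) : (0 < (`|z| : C) < r%:C) = (0 < nc z < r).
Proof. by rewrite ncE !ltcR. Qed.

Section Coefs.
Variable V : vectType R[i].
Implicit Types (X : int -> V) (a : nat -> V) (H F : R[i] -> V).

(** The series z^-T * sum_k a_k z^k. *)
Definition coefs (T : nat) a : int -> V :=
  fun n => if n + T%:Z is Posz k then a k else 0.

Lemma coefs_at T a k : coefs T a (k%:Z - T%:Z) = a k.
Proof. by rewrite /coefs subrK. Qed.

Lemma coefs_lt T a n : n < - T%:Z -> coefs T a n = 0.
Proof. by rewrite -subr_lt0 opprK /coefs; case: (n + _). Qed.

Lemma coefs_eta T X : (forall n, n < - T%:Z -> X n = 0) -> X = coefs T (fun k => X (k%:Z - T%:Z)).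
Proof.
move=> H; apply/funext => n; rewrite /coefs.
case E: (n + T%:Z) => [k|k]; first by rewrite -[Posz k]E addrK.
by apply: H; rewrite -subr_lt0 opprK E.
Qed.

Lemma lpartial_coefs T a (z : R[i]) N : z != 0 -> (T <= N)%N ->
  lpartial (coefs T a) z N = z ^- T *: \sum_(k < N + T) z ^+ k *: a k.
Proof.
move=> z0 TN; rewrite /lpartial big_split /= addnC big_split_ord /= scalerDr [LHS]addrC; congr (_ + _).
  rewrite -(subnK TN) addnC big_split_ord /= [X in _ + X]big1 ?addr0 => [|i _]; last first.
    by rewrite coefs_lt ?scaler0 // ltrN2 ltz_nat ltnS leq_addr.
  rewrite (reindex_inj rev_ord_inj) scaler_sumr /=; apply: eq_bigr => i _.
  have iT := ltn_ord i.
  have -> : - (T - i.+1).+1%:Z = i%:Z - T%:Z by lia.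
  rewrite coefs_at scalerA; congr (_ *: _).
  have EE : z ^+ T = z ^+ (T - i.+1).+1 * z ^+ i by rewrite -exprD; congr (_ ^+ _); lia.
  by rewrite EE invfM mulfVK // expf_neq0.
rewrite scaler_sumr; apply: eq_bigr => i _.
have -> : i%:Z = (T + i)%N%:Z - T%:Z by lia.
by rewrite coefs_at scalerA exprD mulKf // expf_neq0.
Qed.

Lemma coefs_cvg T a (z : R[i]) l : z != 0 -> (forall i, psum (fun k => cd i (a k)) z (cd i l)) ->
  vcvg (lpartial (coefs T a) z) (z ^- T *: l).
Proof.
move=> z0 H; apply: vcvg_cd => i e e0.
have n0 : 0 < nc (z ^- T) by rewrite nc_gt0 invr_neq0 // expf_neq0.
have [N HN] := H i _ (divr_gt0 e0 n0); exists (maxn N T) => n; rewrite geq_max => /andP[Nn Tn].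
rewrite lpartial_coefs // -(linB_of (@cd_lin _ V i)) -scalerBr (linZ_of (@cd_lin _ V i)) ncM mulrC.
rewrite -ler_pdivlMr // (linB_of (@cd_lin _ V i)) (lin_sum_of (@cd_lin _ V i)).
have := HN (n + T)%N (leq_trans Nn (leq_addr _ _)).
have -> : \sum_(k < n + T) cd i (a k) * z ^+ k = \sum_(k < n + T) cd i (z ^+ k *: a k).
  by apply: eq_bigr => k _; rewrite (linZ_of (@cd_lin _ V i)) mulrC.
by [].
Qed.

Lemma cvg_coefs T a (z : R[i]) l i : z != 0 -> vcvg (lpartial (coefs T a) z) l ->
  psum (fun k => cd i (a k)) z (z ^+ T * cd i l).
Proof.
move=> z0 /(vcvg_lin (@cd_lin _ V i)) H e e0.
have n0 : 0 < nc (z ^+ T) by rewrite nc_gt0 expf_neq0.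
have [N HN] := H _ (divr_gt0 e0 n0); exists (maxn N T + T)%N => n Nn.
have Tn : (T <= n)%N by lia.
have := HN (n - T)%N ltac:(lia).
rewrite /= lpartial_coefs //; last by lia.
rewrite subnK // (linZ_of (@cd_lin _ V i)) ler_pdivlMr // mulrC -ncM mulrBr.
rewrite [z ^+ T * (z ^- T *: _)]mulVKf ?expf_neq0 // (lin_sum_of (@cd_lin _ V i)).
have -> : \sum_(k < n) cd i (a k) * z ^+ k = \sum_(k < n) cd i (z ^+ k *: a k).
  by apply: eq_bigr => k _; rewrite (linZ_of (@cd_lin _ V i)) mulrC.
by [].
Qed.

Lemma vtc_psum H (r : R) z i : vhol H 0 r -> nc z < r -> psum (fun k => cd i (vtc H 0 k)) z (cd i (H z)).
Proof.
move=> h zr; have r0 : 0 < r := le_lt_trans (nc_ge0 z) zr.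
have := tcP (h (cd i) (@cd_lin _ V i)) zr; rewrite add0r /=.
by have -> : (fun k => cd i (vtc H 0 k)) = tc (cd i \o H) 0 by apply/funext => k; rewrite (cd_vtc _ _ r0 h).
Qed.

Lemma coefs_vhol T H (r : R) : 0 < r -> vhol H 0 r ->
  Laurent (coefs T (vtc H 0)) /\
  forall z, 0 < nc z < r -> lsum (coefs T (vtc H 0)) z = z ^- T *: H z.
Proof.
move=> r0 h.
have cv z : 0 < nc z < r -> vcvg (lpartial (coefs T (vtc H 0)) z) (z ^- T *: H z).
  move=> /andP[z0 zr]; apply: coefs_cvg => [|i]; first by rewrite -nc_gt0.
  exact: vtc_psum h zr.
split; last by move=> z /cv /vlimE.
split; first by exists (- T%:Z) => n; exact: coefs_lt.
exists (r%:C) => [|z]; first by rewrite ltcR.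
by rewrite annulusC => /cv Hz; exists (z ^- T *: H z).
Qed.

Definition mer F (T : nat) H (r : R) :=
  [/\ 0 < r, vhol H 0 r & forall z, 0 < nc z < r -> F z = z ^- T *: H z].

Lemma Laurent_mer X : Laurent X -> exists T H (r : R),
  mer (lsum X) T H r /\ X = coefs T (vtc H 0).
Proof.
move=> [[T0 HT] [c c0 Hc]]; have [r r0 rE] := annulusP c0.
pose T := `|T0|%N.
have XE : X = coefs T (fun k => X (k%:Z - T%:Z)).
  by apply: coefs_eta => n nT; apply: HT; rewrite /T in nT; lia.
set a := (fun k => _) in XE.
have Hl z : 0 < nc z < r -> exists l, forall i, psum (fun k => cd i (a k)) z (cd i l).
  move=> zr; have := Hc z; rewrite rE XE => /(_ zr) [l hl].
  exists (z ^+ T *: l) => i; rewrite (linZ_of (@cd_lin _ V i)).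
  by apply: cvg_coefs hl; rewrite -nc_gt0; case/andP: zr.
have /choice [H HH] : forall z, exists l, nc z < r -> forall i, psum (fun k => cd i (a k)) z (cd i l).
  move=> z; have [->|z0] := eqVneq z 0.
    by exists (a 0%N) => _ i; exact: (psum_at0 (fun k => cd i (a k))).
  have [zr|zr] := boolP (nc z < r); last by exists 0.
  by have [|l hl] := Hl z; [rewrite nc_gt0 z0|exists l].
have hi i := psum_hol r0 (fun z zr => HH z zr i).
have hH : vhol H 0 r by apply: vhol_cd => // i; exact: (hi i).1.
have aE : a = vtc H 0.
  by apply/funext => k; apply: cd_inj => i; rewrite (cd_vtc _ _ r0 hH) (hi i).2.
exists T, H, r; split; last by rewrite -aE -XE.
split => // z zr; rewrite XE aE; exact: (coefs_vhol T r0 hH).2.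
Qed.

Lemma mer_widen F T H (r : R) S : mer F T H r -> exists H', mer F (T + S) H' r /\
  forall n, coefs (T + S) (vtc H' 0) n = coefs T (vtc H 0) n.
Proof.
elim: S => [|S IH] h; first by exists H; rewrite addn0.
have [H' [[r0 hH' E] E']] := IH h; exists (fun z => z *: H' z); rewrite addnS.
have hid : hol (fun z : R[i] => z) 0 r by move=> z _; exists 1; exact: hd_id.
have hz : vhol (fun z => z *: H' z) 0 r by exact: vhol_scale.
split=> [|n].
  split => // z zr; rewrite E // scalerA; congr (_ *: _).
  have z0 : z != 0 by rewrite -nc_gt0; case/andP: zr.
  by rewrite exprS invfM mulrAC mulVf // mul1r.
have vE k : vtc (fun z => z *: H' z) 0 k = if k is k'.+1 then vtc H' 0 k' else 0.
  apply: cd_inj => i; rewrite (cd_vtc _ _ r0 hz).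
  have -> : (fun z => cd i (z *: H' z)) = fun z => z * cd i (H' z).
    by apply/funext => z; rewrite (linZ_of (@cd_lin _ V i)).
  rewrite (tc_mulX _ r0 (hH' (cd i) (@cd_lin _ V i))); case: k => [|k].
    by rewrite (lin0_of (@cd_lin _ V i)).
  by rewrite (cd_vtc _ _ r0 hH').
rewrite -E' /coefs.
have -> : n + (T + S).+1%:Z = (n + (T + S)%N%:Z) + 1 by lia.
case: (n + _) => [k|k]; first by rewrite -[Posz k + 1]/(Posz (k + 1)) addn1 vE.
by case: k => [|k] //=; rewrite vE.
Qed.

Lemma mer_uniq F G T T' H H' (r r' : R) : mer F T H r -> mer G T' H' r' ->
  (exists2 s : R, 0 < s & forall z, 0 < nc z < s -> F z = G z) ->
  coefs T (vtc H 0) = coefs T' (vtc H' 0).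
Proof.
move=> hF hG [s s0 E]; apply/funext => n.
have [H1 [[r0 h1 E1] <-]] := mer_widen T' hF; have [H2 [[r0' h2 E2] <-]] := mer_widen T hG.
rewrite addnC; suff -> : vtc H1 0 = vtc H2 0 by [].
have [t0 [t00 tr tr']] := small2 r0 r0'; have [t [t1 t2 t3]] := small2 s0 t00.
have HE z : 0 < nc z < t -> H1 z = H2 z.
  move=> /andP[z0 zt]; have zn : z != 0 by rewrite -nc_gt0.
  have [z1 z2 z3] : [/\ 0 < nc z < r, 0 < nc z < r' & 0 < nc z < s].
    by rewrite !z0; split; apply: (lt_trans zt); lra.
  have := E z z3; rewrite (E1 z z1) (E2 z z2) addnC => /(congr1 ( *:%R (z ^+ (T' + T)))).
  by rewrite !scalerA divff ?expf_neq0 // !scale1r.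
have sub (K : R[i] -> V) q : vhol K 0 q -> t < q -> vhol K 0 t.
  by move=> hK tq; apply: vhol_sub hK _; rewrite subrr nc0 add0r ltW.
have h1' := sub _ _ h1 (lt_trans t3 tr); have h2' := sub _ _ h2 (lt_trans t3 tr').
apply/funext => k; apply: (vtc_near _ t1 h1') => w; rewrite subr0 => wt.
have [->|w0] := eqVneq w 0; last by apply: HE; rewrite nc_gt0 w0.
apply: cd_inj => i.
apply: (@hol_eq0 R (fun z => cd i (H1 z)) (fun z => cd i (H2 z)) t t1 (h1' _ (@cd_lin _ V i)) (h2' _ (@cd_lin _ V i))).
by move=> z /HE ->.
Qed.

Lemma lof_mer F T H (r : R) : mer F T H r -> laurent_of F = coefs T (vtc H 0).
Proof.
move=> h; have [r0 hH E] := h; have [L1 L2] := coefs_vhol T r0 hH.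
rewrite /laurent_of; case: xgetP => [X -> [LX [c c0 Xc]]|].
  have [T' [H' [r' [h' ->]]]] := Laurent_mer LX.
  apply: (mer_uniq h' h); have [s s0 sE] := annulusP c0; exists s => // z zs.
  by apply: Xc; rewrite sE.
move=> /(_ (coefs T (vtc H 0))) []; split => //.
exists (r%:C) => [|z]; first by rewrite ltcR.
by rewrite annulusC => zr; rewrite L2 // E.
Qed.

Definition Mer F := exists T H r, mer F T H r.

Lemma lof_Laurent F : Mer F -> Laurent (laurent_of F).
Proof. by move=> [T [H [r h]]]; rewrite (lof_mer h); case: h => r0 h _; exact: (coefs_vhol T r0 h).1. Qed.

Lemma lsum_lof_mer F T H (r : R) z : mer F T H r -> 0 < nc z < r -> lsum (laurent_of F) z = F z.
Proof. by move=> h zr; rewrite (lof_mer h); case: h => r0 h E; rewrite E // (coefs_vhol T r0 h).2. Qed.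

Lemma lsum_lof F : Mer F -> exists2 r : R, 0 < r & forall z, 0 < nc z < r -> lsum (laurent_of F) z = F z.
Proof. by move=> [T [H [r h]]]; exists r => [|z]; [case: h|exact: lsum_lof_mer h]. Qed.

Lemma lof_near F G : Mer F -> Mer G -> (exists2 s : R, 0 < s & forall z, 0 < nc z < s -> F z = G z) ->
  laurent_of F = laurent_of G.
Proof.
move=> [T [H [r h]]] [T' [H' [r' h']]] E; rewrite (lof_mer h) (lof_mer h'); exact: mer_uniq h h' E.
Qed.

Lemma Mer_near F G : Mer F -> (exists2 s : R, 0 < s & forall z, 0 < nc z < s -> F z = G z) -> Mer G.
Proof.
move=> [T [H [r [r0 h E]]]] [s s0 E']; have [t [t0 t1 t2]] := small2 r0 s0.
exists T, H, t; split => //.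
  by apply: vhol_sub h _; rewrite subrr nc0 add0r ltW.
  move=> z /andP[z0 zt]; rewrite -E' ?E //; apply/andP; split=> //; exact: lt_trans zt _.
Qed.

Lemma Laurent_Mer X : Laurent X -> Mer (lsum X).
Proof. by move=> /Laurent_mer [T [H [r [h _]]]]; exists T, H, r. Qed.

Lemma lof_lsum X : Laurent X -> laurent_of (lsum X) = X.
Proof. by move=> /Laurent_mer [T [H [r [h E]]]]; rewrite (lof_mer h). Qed.

Lemma Laurent_eq X Y : Laurent X -> Laurent Y ->
  (exists2 s : R, 0 < s & forall z, 0 < nc z < s -> lsum X z = lsum Y z) -> X = Y.
Proof.
move=> hX hY E; rewrite -(lof_lsum hX) -(lof_lsum hY); apply: lof_near => //; exact: Laurent_Mer.
Qed.

Lemma Mer_hol H (r : R) : 0 < r -> vhol H 0 r -> Mer H.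
Proof. by move=> r0 h; exists 0%N, H, r; split => // z _; rewrite expr0 invr1 scale1r. Qed.

End Coefs.
End LaurentCalculus.


Section LaurentOperations.
Context {R : realType}.
Local Open Scope complex_scope.
Local Notation C := (Num.NumField.sort (R[i] : numFieldType)).

Lemma mer_shrink (V : vectType R[i]) (F H : R[i] -> V) T (r s : R) :
  mer F T H r -> 0 < s -> s <= r -> mer F T H s.
Proof.
move=> [r0 h E] s0 sr; split => //; first by apply: vhol_sub h _; rewrite subrr nc0 add0r.
by move=> z /andP[z0 zs]; apply: E; rewrite z0 /=; exact: lt_le_trans zs sr.
Qed.

Section One.
Variables V W : vectType R[i].
Implicit Types (F G H : R[i] -> V).

Lemma mer_lin (u : V -> W) F H T (r : R) : linear u -> mer F T H r -> mer (fun z => u (F z)) T (fun z => u (H z)) r.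
Proof. by move=> lu [r0 h E]; split => // [|z zr]; [exact: vhol_lin|rewrite E // (linZ_of lu)]. Qed.

Lemma Mer_lin (u : V -> W) F : linear u -> Mer F -> Mer (fun z => u (F z)).
Proof. by move=> lu [T [H [r h]]]; exists T, (fun z => u (H z)), r; exact: mer_lin. Qed.

Lemma lof_lin (u : V -> W) F n : linear u -> Mer F -> laurent_of (fun z => u (F z)) n = u (laurent_of F n).
Proof.
move=> lu [T [H [r h]]]; rewrite (lof_mer (mer_lin lu h)) (lof_mer h).
by rewrite /coefs; case: (_ + _) => k; [case: h => r0 h _; rewrite (vtc_lin _ r0)|rewrite (lin0_of lu)].
Qed.

Lemma res_lin (u : V -> W) F : linear u -> Mer F -> residue (fun z => u (F z)) = u (residue F).
Proof. exact: lof_lin. Qed.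

Lemma mer2 F G : Mer F -> Mer G -> exists T H K (r : R), mer F T H r /\ mer G T K r.
Proof.
move=> [T [H [r h]]] [T' [H' [r' h']]].
have [H1 [h1 _]] := mer_widen T' h; have [H2 [h2 _]] := mer_widen T h'.
have [t [t0 t1 t2]] : exists t : R, [/\ 0 < t, t < r & t < r'] by apply: small2; [case: h|case: h'].
exists (T + T')%N, H1, H2, t; split; first by apply: mer_shrink h1 _ _ => //; exact: ltW.
by rewrite addnC; apply: mer_shrink h2 _ _ => //; exact: ltW.
Qed.

Lemma vtcD F G c (r : R) k : 0 < r -> vhol F c r -> vhol G c r ->
  vtc (fun z => F z + G z) c k = vtc F c k + vtc G c k.
Proof.
move=> r0 hF hG; apply: cd_inj => i; rewrite (cd_vtc _ _ r0 (vholD hF hG)) (linD_of (@cd_lin _ V i)).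
rewrite (cd_vtc _ _ r0 hF) (cd_vtc _ _ r0 hG).
have -> : (fun z => cd i (F z + G z)) = fun z => cd i (F z) + cd i (G z).
  by apply/funext => z; rewrite (linD_of (@cd_lin _ V i)).
by rewrite (tcD _ r0) //; [apply: (hF (cd i))|apply: (hG (cd i))]; exact: cd_lin.
Qed.

Lemma merD F G H K T (r : R) : mer F T H r -> mer G T K r -> mer (fun z => F z + G z) T (fun z => H z + K z) r.
Proof.
move=> [r0 hH E] [_ hK E']; split => //; first exact: vholD.
by move=> z zr; rewrite E // E' // scalerDr.
Qed.

Lemma MerD F G : Mer F -> Mer G -> Mer (fun z => F z + G z).
Proof. by move=> hF hG; have [T [H [K [r [h h']]]]] := mer2 hF hG; exists T, (fun z => H z + K z), r; exact: merD. Qed.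

Lemma lofD F G n : Mer F -> Mer G -> laurent_of (fun z => F z + G z) n = laurent_of F n + laurent_of G n.
Proof.
move=> hF hG; have [T [H [K [r [h h']]]]] := mer2 hF hG.
rewrite (lof_mer (merD h h')) (lof_mer h) (lof_mer h') /coefs; case: (_ + _) => k; last by rewrite addr0.
by case: h => r0 h _; case: h' => _ h' _; rewrite (vtcD _ r0).
Qed.

Lemma resD F G : Mer F -> Mer G -> residue (fun z => F z + G z) = residue F + residue G.
Proof. exact: lofD. Qed.

Lemma Mer_cst (v : V) : Mer (fun=> v).
Proof. by apply: (@Mer_hol R V (fun=> v) 1); [exact: ltr01|exact: vhol_cst]. Qed.

Lemma Mer_sum (I : Type) (s : seq I) (P : pred I) (f : I -> R[i] -> V) :
  (forall i, Mer (f i)) -> Mer (fun z => \sum_(i <- s | P i) f i z).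
Proof.
move=> h; elim: s => [|a s IH].
  have -> : (fun z => \sum_(i <- [::] | P i) f i z) = fun=> 0 by apply/funext => z; rewrite big_nil.
  exact: Mer_cst.
have -> : (fun z => \sum_(i <- a :: s | P i) f i z) =
    if P a then (fun z => f a z + \sum_(i <- s | P i) f i z) else (fun z => \sum_(i <- s | P i) f i z).
  by apply/funext => z; rewrite big_cons; case: (P a).
by case: (P a) => //; exact: MerD.
Qed.

Lemma vtc_cst0 k : vtc (fun=> 0 : V) 0 k = 0.
Proof.
have z0 : linear (fun _ : V => 0 : V) by move=> a x y; rewrite scaler0 addr0.
by rewrite (@vtc_lin _ _ _ (fun _ : V => 0 : V) (fun=> 0) 0 1 k ltr01 z0 (@vhol_cst R V 0 0 1)).
Qed.

Lemma res_near F G : Mer F -> (exists2 s : R, 0 < s & forall z, 0 < nc z < s -> F z = G z) ->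
  residue F = residue G.
Proof. by move=> hF E; rewrite /residue (lof_near hF (Mer_near hF E) E). Qed.

Lemma mer_Xn F H T (r : R) n : mer F T H r -> mer (fun z => z ^- n *: F z) (n + T) H r.
Proof.
move=> [r0 h E]; split => // z zr; rewrite E // scalerA exprD invfM //.
Qed.

Lemma Mer_Xn F n : Mer F -> Mer (fun z => z ^- n *: F z).
Proof. by move=> [T [H [r h]]]; exists (n + T)%N, H, r; exact: mer_Xn. Qed.

Lemma lof_at F T H (r : R) k : mer F T H r -> laurent_of F (k%:Z - T%:Z) = vtc H 0 k.
Proof. by move=> h; rewrite (lof_mer h) coefs_at. Qed.

Lemma lof_lt F T H (r : R) n : mer F T H r -> n < - T%:Z -> laurent_of F n = 0.
Proof. by move=> h nT; rewrite (lof_mer h) coefs_lt. Qed.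

(** Derivatives along curves of Laurent series are unique. *)
Lemma lderiv_unique (X : R[i] -> int -> V) t Y Y' : Laurent Y -> Laurent Y' ->
  is_lderiv_in (setT : set C) X t Y -> is_lderiv_in (setT : set C) X t Y' -> Y = Y'.
Proof.
move=> LY LY' [c c0 H] [c' c'0 H']; apply: Laurent_eq => //.
have [r r0 rE] := annulusP c0; have [r' r'0 rE'] := annulusP c'0.
have [s [s0 s1 s2]] := small2 r0 r'0; exists s => // z /andP[z0 zs].
have := H z; rewrite rE z0 (lt_trans zs s1) => /(_ isT) h.
have := H' z; rewrite rE' z0 (lt_trans zs s2) => /(_ isT) h'.
apply: cd_inj => i; apply: hd_unique (derivT_hd (@cd_lin _ V i) h) (derivT_hd (@cd_lin _ V i) h').
Qed.

End One.

Section Bil.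
Variables V W U : vectType R[i].
Variable B : V -> W -> U.
Hypothesis bB : bil B.

Lemma mer_bil F H S (G K : R[i] -> W) T (r : R) : mer F S H r -> mer G T K r ->
  mer (fun z => B (F z) (G z)) (S + T) (fun z => B (H z) (K z)) r.
Proof.
move=> [r0 hH E] [_ hK E']; split => //; first exact: vhol_bil.
move=> z zr; rewrite E // E' //; have [b1 b2] := bB.
have EB : B (z ^- S *: H z) (K z) = z ^- S *: B (H z) (K z) := linZ_of (b2 _) _ _.
by rewrite (linZ_of (b1 _)) EB scalerA exprD invfM mulrC.
Qed.

Lemma Mer_bil F (G : R[i] -> W) : Mer F -> Mer G -> Mer (fun z => B (F z) (G z)).
Proof.
move=> [T [H [r h]]] [T' [H' [r' h']]].
have [t [t0 t1 t2]] : exists t : R, [/\ 0 < t, t < r & t < r'] by apply: small2; [case: h|case: h'].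
exists (T + T')%N, (fun z => B (H z) (H' z)), t.
by apply: mer_bil; [apply: mer_shrink h _ _|apply: mer_shrink h' _ _] => //; exact: ltW.
Qed.

Lemma res_bil F H S (G K : R[i] -> W) T (r r' : R) : mer F S H r -> mer G T K r' ->
  residue (fun z => B (F z) (G z)) =
  \sum_(i < S + T) B (laurent_of F (i%:Z - S%:Z)) (laurent_of G (S%:Z - 1 - i%:Z)).
Proof.
move=> h h'.
have [t [t0 t1 t2]] : exists t : R, [/\ 0 < t, t < r & t < r'] by apply: small2; [case: h|case: h'].
have {}h := mer_shrink h t0 (ltW t1); have {}h' := mer_shrink h' t0 (ltW t2).
rewrite /residue (lof_mer (mer_bil h h')); case: (posnP (S + T)) => [E|ST].
  by rewrite coefs_lt ?E // big1 // => i _; have := ltn_ord i; rewrite ?E.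
have -> : -1 = (S + T).-1%:Z - (S + T)%N%:Z by lia.
rewrite coefs_at; case: (h) => _ hH _; case: (h') => _ hK _.
rewrite (vtc_bil _ t0 bB hH hK) prednK //; apply: eq_bigr => i _.
rewrite (lof_at _ h); congr (B _ _); rewrite -(lof_at _ h'); congr (laurent_of _ _).
by have := ltn_ord i; lia.
Qed.

End Bil.
End LaurentOperations.


Section PoleData.
Context {R : realType}.
Local Open Scope complex_scope.
Local Notation C := (Num.NumField.sort (R[i] : numFieldType)).

Lemma eps_diff n m (f : 'rV[C]_n -> 'rV[C]_m) c (L : 'rV[C]_n -> 'rV[C]_m) : linear L ->
  (forall e : R, 0 < e -> exists2 d : R, 0 < d &
    forall h, mn h < d -> mn (f (c + h) - f c - L h) <= e * mn h) -> differentiable f c.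
Proof.
move=> lL H; pose U := HB.pack_for {linear 'rV[C]_n -> 'rV[C]_m} L (GRing.isLinear.Build _ _ _ _ L lL).
have cL : continuous U by move=> x; apply: differentiable_continuous; exact: lin_differentiable.
have E : f \o shift c = cst (f c) + U +o_ (0 : 'rV[C]_n) id.
  apply/eqaddoP => e e0.
  have eE : e = (cRe e)%:C by move: e0; rewrite ltcE /= => /andP[/eqP E _]; exact: eqC_ReIm.
  have e0' : 0 < cRe e by rewrite -(ltcR (R:=R)) -eE.
  have [d d0 Hd] := H _ e0'; apply/mn_near; exists d => // h /Hd; rewrite add0r => hh.
  have -> : (f \o shift c - (cst (f c) + U)) h = f (c + h) - f c - L h.
    by rewrite [c + h]addrC -addrA -opprD.
  by rewrite /= !mnE eE -rmorphM lecR.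
apply/diff_locallyP; have dE := diff_unique cL E.
by rewrite dE; split.
Qed.

Lemma near_diff n m (f g : 'rV[C]_n -> 'rV[C]_m) c (r : R) : 0 < r ->
  (forall h, mn h < r -> f (c + h) = g (c + h)) -> differentiable f c -> differentiable g c.
Proof.
move=> r0 E /diff_epsP [L lL HL]; apply: (eps_diff lL) => e e0.
have [d d0 Hd] := HL e e0; exists (Num.min d r) => [|h]; first by rewrite lt_min d0.
rewrite lt_min => /andP[hd' hr].
have m0 : mn (0 : 'rV[C]_n) < r by apply/(mn_lt _ r0) => j; rewrite mxE nc0.
have := E 0 m0; rewrite !addr0 => <-; rewrite -(E h hr); exact: Hd.
Qed.


Section Pole.
Variables (g : vectType R[i]) (h : {vspace g}).
Local Notation hstar := 'Hom(subvs_of h, (R[i])^o).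
Variable r : hstar -> R[i] -> tensor2 g.
Local Notation PT := (hstar * (R[i])^o)%type.

Lemma prod_bound : exists2 M : R, 0 < M &
  forall (v : hstar) (z : (R[i])^o), vn ((v, z) : PT) <= M * (vn v + nc z).
Proof.
have l1 : linear (fun v : hstar => (v, 0) : PT).
  by move=> a x y; apply/pair_equal_spec; split => //=; rewrite scaler0 addr0.
have l2 : linear (fun z : (R[i])^o => (0, z) : PT).
  by move=> a x y; apply/pair_equal_spec; split => //=; rewrite scaler0 addr0.
have [M M0 HM] := lin_vbound l1.
exists (M + vn ((0, 1) : PT)) => [|v z]; first by rewrite ltr_wpDr // vn_ge0.
have -> : ((v, z) : PT) = (v, 0) + z *: ((0, 1) : PT).
  by apply/pair_equal_spec; split => /=; rewrite ?scaler0 ?addr0 // add0r; exact/esym/mulr1.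
apply: le_trans (vnD _ _) _; rewrite vnZ.
have := HM v; have := vn_ge0 ((0, 1) : PT); have := vn_ge0 v; have := nc_ge0 z.
set a := vn v; set b := vn _; set c := nc z => c0 a0 b0 hM.
have := mulr_ge0 (ltW M0) c0; have := mulr_ge0 b0 a0; rewrite mulrDr !mulrDl [c * _]mulrC; lra.
Qed.

(** The singularity of r along z = 0 is at most a simple pole, uniformly in a
    polydisc around (q, 0). *)
Definition pole q (G : PT -> tensor2 g) (rho : R) :=
  forall (v : hstar) (z : (R[i])^o), vn v < rho -> nc z < rho ->
   [/\ holo_at G (q + v, z), exists L, frechet G (q + v, z) L &
       z != 0 -> r (q + v) z = z^-1 *: G (q + v, z)].

Lemma prod_proj : exists2 M : R, 0 < M & forall y : PT, vn y.1 <= M * vn y /\ nc y.2 <= M * vn y.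
Proof.
have l1 : linear (fun y : PT => y.1) by [].
have l2 : linear (fun y : PT => y.2 : (R[i])^o) by [].
have [M M0 HM] := lin_vbound l1; have [M' M'0 HM'] := lin_bound l2.
exists (M + M') => [|y]; first lra.
have y0 := vn_ge0 y; rewrite mulrDl; split.
  by apply: le_trans (HM y) _; rewrite lerDl mulr_ge0 // ltW.
by apply: le_trans (HM' y) _; rewrite lerDr mulr_ge0 // ltW.
Qed.

Lemma nonpole_data q : nonpole r q -> exists G : PT -> tensor2 g, exists2 rho : R, 0 < rho & pole q G rho.
Proof.
move=> [G [hG /vnearP [d d0 Hd]]]; exists G.
have [M M0 HM] := prod_bound.
have [d1 d10 H1] := holo_frechet hG.
have [d2 d20 H2] : exists2 d : R, 0 < d & forall y, vn y < d -> holo_at G ((q, 0 : (R[i])^o) + y).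
  move: hG => /nbhs_interior /mn_near [d2 d20 H2]; exists d2 => // y yd.
  by rewrite /holo_at (linD_of (@crd_lin _ PT)); exact: H2.
pose t := Num.min d (Num.min d1 d2).
have t0 : 0 < t by rewrite !lt_min d0 d10.
exists (t / (2 * M)) => [|v z vt zt]; first by rewrite divr_gt0 // mulr_gt0.
have : vn ((v, z) : PT) < t.
  apply: le_lt_trans (HM v z) _; move: vt zt; rewrite !ltr_pdivlMr ?mulr_gt0 //.
  move=> h1 h2; rewrite mulrDr; lra.
rewrite !lt_min => /and3P[h0 h1 h2].
have E : ((q + v, z) : PT) = (q, 0 : (R[i])^o) + (v, z).
  by apply/pair_equal_spec; split => //=; rewrite add0r.
split; [by rewrite E; exact: H2|by rewrite E; exact: H1|].
by move=> z0; have := Hd _ h0; rewrite -E; exact.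
Qed.

Lemma pole_small (v : hstar) (z : (R[i])^o) (rho e : R) : vn v < rho -> nc z < rho -> 0 < e ->
  exists2 d : R, 0 < d & forall y : PT, vn y < d -> [/\ vn (v + y.1) < rho, nc (z + y.2) < rho & nc y.2 < e].
Proof.
move=> vr zr e0; have [M M0 HM] := prod_proj.
pose t := Num.min e (Num.min (rho - vn v) (rho - nc z)).
have t0 : 0 < t by rewrite !lt_min e0 !subr_gt0 vr.
exists (t / M) => [|y]; first exact: divr_gt0.
rewrite ltr_pdivlMr // mulrC => yt; have [h1 h2] := HM y.
move: yt; rewrite !lt_min => /and3P[ye yv yz]; split.
- by apply: le_lt_trans (vnD _ _) _; lra.
- by apply: le_lt_trans (ncD _ _) _; lra.
- exact: le_lt_trans h2 ye.
Qed.

Lemma pole_nonpole q (v : hstar) (G : PT -> tensor2 g) (rho : R) : pole q G rho ->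
  vn v < rho -> nonpole r (q + v).
Proof.
move=> H vr; have rho0 : 0 < rho := le_lt_trans (vn_ge0 v) vr.
have z0 : nc 0 < rho by rewrite nc0.
have [hG _ _] := H v 0 vr z0; exists G; split => //; apply/vnearP.
have [d d0 Hd] := pole_small vr z0 ltr01; exists d => // y /Hd [h1 h2 _].
have Ey : (q + v, 0) + y = (q + (v + y.1), y.2) :> PT.
  by apply/pair_equal_spec; split; rewrite /= ?addrA ?add0r.
have h2' : nc y.2 < rho by rewrite -[y.2]add0r.
by rewrite Ey; have [_ _] := H _ _ h1 h2'.
Qed.

Lemma pole_regular q (v : hstar) (z : (R[i])^o) (G : PT -> tensor2 g) (rho : R) : pole q G rho ->
  vn v < rho -> nc z < rho -> z != 0 -> regular r (q + v) z.
Proof.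
move=> H vr zr z0; have nz : 0 < nc z by rewrite nc_gt0.
have [d d0 Hd] := pole_small vr zr nz.
rewrite /regular /holo_at; apply/mn_near; exists d => // k kd.
pose y := uncrd k : PT.
have kE : crd (q + v, z) + k = crd ((q + v, z) + y) by rewrite (linD_of (@crd_lin _ PT)) uncrdK.
rewrite kE; have yd : vn y < d by rewrite /vn uncrdK.
have [h1 h2 h3] := Hd y yd.
have zy0 : z + y.2 != 0.
  by apply/eqP => E; move: h3; rewrite -[y.2](addKr z) E addr0 ncN ltxx.
have xE : (q + v, z) + y = (q + (v + y.1), z + y.2) :> PT by rewrite addrA.
rewrite xE; set x' := (_, _).
have [hG _ _] := H _ _ h1 h2.
have dG : differentiable (fun c : 'rV[C]_(\dim {: PT}) => crd (G (uncrd c))) (crd x').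
  exact: (nbhs_singleton hG).
have dS : differentiable (fun c : 'rV[C]_(\dim {: PT}) => ((uncrd c : PT).2 : C)) (crd x').
  have -> : (fun c : 'rV[C]_(\dim {: PT}) => ((uncrd c : PT).2 : C)) =
     \sum_(j < \dim {: PT}) (fun c : 'rV[C]_(\dim {: PT}) => (c 0 j : C) *: ((uncrd (delta_mx 0 j) : PT).2 : C)).
    apply/funext => c; rewrite fct_sumE {1}(row_sum_delta c).
    rewrite (lin_sum_of (V := 'rV[R[i]]_(\dim {: PT})) (@uncrd_lin _ PT)).
    rewrite (lin_sum_of (V := PT) (u := fun y : PT => y.2)) //; apply: eq_bigr => j _.
    by rewrite (linZ_of (V := 'rV[R[i]]_(\dim {: PT})) (@uncrd_lin _ PT)).
  apply: differentiable_sum => j; apply: differentiableZl; exact: differentiable_coord.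
have dV : differentiable (fun c : 'rV[C]_(\dim {: PT}) => ((uncrd c : PT).2 : C)^-1) (crd x').
  by apply: differentiableV => //; rewrite crdK.
have [d' d'0 Hd'] : exists2 d' : R, 0 < d' & forall y' : PT, vn y' < d' ->
   [/\ vn ((v + y.1) + y'.1) < rho, nc ((z + y.2) + y'.2) < rho & nc y'.2 < nc (z + y.2)].
  by apply: pole_small => //; rewrite nc_gt0.
apply: (near_diff d'0 _ (diffZ_fun dV dG)) => k' k'd.
pose y' := uncrd k' : PT.
have k'E : crd x' + k' = crd (x' + y').
  by clear; clearbody x'; rewrite (linD_of (@crd_lin _ PT) x' y') /y' uncrdK.
have [|h4 h5 h6] := Hd' y'; first by rewrite /vn uncrdK.
rewrite k'E !crdK.
have x'E : x' + y' = (q + ((v + y.1) + y'.1), (z + y.2) + y'.2) :> PT.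
  by apply/pair_equal_spec; split; [exact: (esym (addrA q (v + y.1) y'.1))|].
have zy'0 : (z + y.2) + y'.2 != 0.
  by rewrite addr_eq0; apply/eqP => E; move: h6; rewrite E ncN ltxx.
have [_ _ /(_ zy'0) E] := H _ _ h4 h5.
by rewrite x'E /runc /= E; exact: (esym (linZ_of (@crd_lin _ (tensor2 g)) _ _)).
Qed.
End Pole.
End PoleData.


Section ParametricTaylor.
Context {R : realType}.
Local Open Scope complex_scope.
Local Notation C := (Num.NumField.sort (R[i] : numFieldType)).

Lemma vtc_param (V : vectType R[i]) (F D : R[i] -> R[i] -> V) (sg rho M : R) : 0 < sg -> 0 < rho ->
  (forall s z, nc s < sg -> nc z < rho -> is_deriv_in setT (F^~ z) s (D s z)) ->
  (forall s z, nc s < sg -> nc z < rho -> exists l, is_deriv_in setT (F s) z l) ->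
  (forall s z, nc s < sg -> nc z < rho -> vn (F s z) <= M) ->
  vhol (D 0) 0 rho /\ forall k, is_deriv_in setT (fun s => vtc (F s) 0 k) 0 (vtc (D 0) 0 k).
Proof.
move=> sg0 rho0 h1 h2 HM.
have M0 : 0 <= M by apply: le_trans (vn_ge0 (F 0 0)) (HM _ _ _ _); rewrite nc0.
have key i := @tc_param R (fun s z => cd i (F s z)) sg rho M sg0 rho0 M0.
have key' i : hol (fun z => dC (fun s => cd i (F s z)) 0) 0 rho /\
    forall k, hd (fun s => tc (fun z => cd i (F s z)) 0 k) 0 (tc (fun z => dC (fun s => cd i (F s z)) 0) 0 k).
  apply: key => [z zr s|s hs z|s z hs hz].
  - rewrite subr0 => hs; exists (cd i (D s z)); exact: derivT_hd (@cd_lin _ V i) (h1 s z hs zr).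
  - rewrite subr0 => hz; have [l hl] := h2 s z hs hz; exists (cd i l); exact: derivT_hd (@cd_lin _ V i) hl.
  - by apply: le_trans (vn_ge _ i) _; exact: HM.
have z0 : nc (0 : R[i]) < sg by rewrite nc0.
have E i z : nc z < rho -> dC (fun s => cd i (F s z)) 0 = cd i (D 0 z).
  by move=> hz; apply: dC_eq; exact: derivT_hd (@cd_lin _ V i) (h1 0 z z0 hz).
have hD : vhol (D 0) 0 rho.
  apply: vhol_cd => // i z; rewrite subr0 => hz; have [|l hl] := (key' i).1 z; first by rewrite subr0.
  exists l; apply: (@hd_near R _ _ z l (rho - nc z) _ _ hl); first by rewrite subr_gt0.
  move=> w wz; apply: E; have -> : w = (w - z) + z by ring.
  by apply: le_lt_trans (ncD _ _) _; rewrite -ltrBrDr.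
split=> // k; apply: hd_derivT => i; rewrite (cd_vtc _ _ rho0 hD).
rewrite -(@tc_ext R (fun z => dC (fun s => cd i (F s z)) 0) _ 0 rho rho0 (key' i).1); last first.
  by move=> w; rewrite subr0; exact: E.
apply: (@hd_near R _ _ 0 _ sg sg0 _ ((key' i).2 k)) => s; rewrite subr0 => hs.
rewrite (cd_vtc _ _ rho0) // => phi lp z; rewrite subr0 => hz.
have [l hl] := h2 s z hs hz; exists (phi l); exact: derivT_hd lp hl.
Qed.

(** A function meromorphic at 0 is holomorphic off 0. *)
Lemma mer_vhol (V : vectType R[i]) (F H : R[i] -> V) T (r t : R) c : mer F T H r ->
  0 < t -> t <= nc c -> t <= r - nc c -> vhol F c t.
Proof.
move=> [r0 hH E] t0 tc tr phi lp w wt.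
have far u : nc (u - c) < t -> 0 < nc u < r.
  move=> ut; have := nc_sub_ge c (c - u); have -> : c - (c - u) = u by ring.
  have := ncD c (u - c); have -> : c + (u - c) = u by ring.
  by rewrite [nc (c - u)]ncBC => h1 h2; apply/andP; split; lra.
have /andP[w0 wr] := far w wt; have wn : w != 0 by rewrite -nc_gt0.
have [|l hl] := hH phi lp w; first by rewrite subr0.
eexists; apply: (@hd_near R (fun w => w ^- T * phi (H w)) _ w _ (t - nc (w - c))); first by rewrite subr_gt0.
  move=> v vs; rewrite /= E ?(linZ_of lp) //; apply: far.
  have -> : v - c = (v - w) + (w - c) by ring.
  by apply: le_lt_trans (ncD _ _) _; rewrite -ltrBrDr.
exact: hdM (hd_comp (hdX w T) (hdV (expf_neq0 T wn))) hl.
Qed.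

Lemma frechet_near (V W : vectType R[i]) (F G : V -> W) x L (r : R) : 0 < r ->
  (forall y, vn y < r -> F (x + y) = G (x + y)) -> frechet F x L -> frechet G x L.
Proof.
move=> r0 E [lL H]; split=> // e e0; have [d d0 Hd] := H e e0.
exists (Num.min d r) => [|k]; first by rewrite lt_min d0.
rewrite lt_min => /andP[kd kr]; rewrite -(E k kr).
by have := E 0; rewrite vn0 addr0 => <- //; exact: Hd.
Qed.

Lemma frechet_post (V W U : vectType R[i]) (u : W -> U) (F : V -> W) x L : linear u ->
  frechet F x L -> frechet (fun y => u (F y)) x (fun v => u (L v)).
Proof.
move=> lu [lL H]; split=> [a v w|e e0]; first by rewrite lL lu.
have [M M0 HM] := lin_vbound lu; have [d d0 Hd] := H (e / M) (divr_gt0 e0 M0).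
exists d => // k kd; rewrite -!(linB_of lu); apply: le_trans (HM _) _.
by rewrite mulrC -ler_pdivlMr // mulrAC; exact: Hd.
Qed.

Section RFamily.
Variables (g : vectType R[i]) (h : {vspace g}).
Local Notation hstar := 'Hom(subvs_of h, (R[i])^o).
Variable r : hstar -> R[i] -> tensor2 g.
Local Notation PT := (hstar * (R[i])^o)%type.

Lemma frechet_fst (V W : vectType R[i]) (G : (V * (R[i])^o)%type -> W) q z L : frechet G (q, z) L ->
  frechet (fun q' => G (q', z)) q (fun v => L (v, 0)).
Proof.
have l1 : linear (fun v : V => (v, 0) : (V * (R[i])^o)%type).
  by move=> a x y; apply/pair_equal_spec; split => //=; rewrite scaler0 addr0.
move=> [lL H]; split=> [a v w|e e0]; first by rewrite l1 lL.
have [M M0 HM] := lin_vbound l1; have [d d0 Hd] := H (e / M) (divr_gt0 e0 M0).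
exists (d / M) => [|k]; first exact: divr_gt0.
rewrite ltr_pdivlMr // mulrC => kd.
have := Hd (k, 0) (le_lt_trans (HM k) kd).
have -> : (q, z) + (k, 0) = (q + k, z) :> (V * (R[i])^o)%type.
  by apply/pair_equal_spec; split; rewrite /= ?addr0.
have eM : 0 <= e / M by rewrite divr_ge0 // ltW.
move/le_trans; apply; apply: le_trans (ler_wpM2l eM (HM k)) _.
by rewrite mulrA divfK // lt0r_neq0.
Qed.

(** The derivative of r(., z) at q in the direction v. *)
Definition Dr q v (z : R[i]) : tensor2 g := dirder (r^~ z) q v.

Definition polyb q (G : PT -> tensor2 g) (rho M : R) :=
  [/\ 0 < rho, pole r q G rho &
   forall (v : hstar) (z : (R[i])^o), vn v < rho -> nc z < rho -> vn (G (q + v, z)) <= M].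

Lemma nonpole_polyb q : nonpole r q -> exists G rho M, polyb q G rho M.
Proof.
move=> /nonpole_data [G [rho rho0 H]].
have [z0 z1] : vn (0 : hstar) < rho /\ nc (0 : R[i]) < rho by rewrite vn0 nc0.
have [_ [L /frechet_cont cG] _] := H 0 0 z0 z1.
have [d d0 Hd] := cG 1 ltr01; have [M M0 HM] := @prod_bound R g h.
have dM : 0 < d / (2 * M) by rewrite divr_gt0 // mulr_gt0.
have [t [t0 t1 t2]] := small2 rho0 dM.
exists G, t, (1 + vn (G (q, 0))); split => // v z vt zt.
  by apply: H; [exact: lt_trans vt t1|exact: lt_trans zt t1].
have : vn ((v, z) : PT) < d.
  apply: le_lt_trans (HM v z) _; move: (lt_trans vt t2) (lt_trans zt t2).
  by rewrite !ltr_pdivlMr ?mulr_gt0 // => h1 h2; rewrite mulrDr; lra.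
move/Hd; rewrite addr0.
have -> : (q, 0 : (R[i])^o) + (v, z) = (q + v, z) :> PT by apply/pair_equal_spec; rewrite /= add0r.
move=> h1; rewrite -[G (q + v, z)](subrK (G (q, 0))).
by apply: le_trans (vnD _ _) _; rewrite lerD2r.
Qed.

Section AtPoint.
Variables (q : hstar) (G : PT -> tensor2 g) (rho M : R).
Hypothesis HG : polyb q G rho M.

Lemma rho_gt0 : 0 < rho. Proof. by case: HG. Qed.

Lemma r_mer v : vn v < rho -> mer (r (q + v)) 1 (fun z => G (q + v, z)) rho.
Proof.
move=> vr; have [rho0 HP _] := HG; split => //.
  apply: derivT_vhol => z; rewrite subr0 => zr; have [_ [L hL] _] := HP v z vr zr.
  exists (L (0, 1)).
  have E (s : R[i]) : (q + v, s) = (q + v, 0 : (R[i])^o) + s *: ((0, 1) : PT).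
    by apply/pair_equal_spec; split; rewrite /= ?scaler0 ?addr0 // add0r; exact/esym/mulr1.
  have := @deriv_line R PT (tensor2 g) G (q + v, 0) (0, 1) z L; rewrite -E => /(_ hL).
  by apply: (@deriv_near R _ setT _ _ z _ 1 ltr01) => s _; rewrite -E.
move=> z /andP[z0 zr]; have [_ _ H] := HP v z vr zr.
by rewrite H ?expr1 // -nc_gt0.
Qed.

Lemma r_frechet z : 0 < nc z < rho -> frechet (r^~ z) q (fun v => Dr q v z).
Proof.
move=> /andP[z0 zr]; have [rho0 HP _] := HG.
have zn : z != 0 by rewrite -nc_gt0.
have v0 : vn (0 : hstar) < rho by rewrite vn0.
have [_ [L hL] _] := HP 0 z v0 zr; rewrite addr0 in hL.
have lz : linear (fun T : tensor2 g => z^-1 *: T).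
  by move=> a x y; rewrite scalerDr !scalerA mulrC.
have h1 : frechet (r^~ z) q (fun v => z^-1 *: L (v, 0)).
  apply: (frechet_near rho0 _ (frechet_post lz (frechet_fst hL))) => y yr.
  by have [_ _ H] := HP y z yr zr; rewrite -(H zn).
have -> // : (fun v => Dr q v z) = (fun v => z^-1 *: L (v, 0)).
by apply/funext => v; rewrite /Dr (dirder_frechet _ h1).
Qed.

Lemma Dr_lin z : 0 < nc z < rho -> linear (fun v => Dr q v z).
Proof. by move=> /r_frechet []. Qed.

Definition sgv (v : hstar) : R := rho / (1 + vn v).
Lemma sgvP v : 0 < sgv v /\ forall s, nc s < sgv v -> vn (s *: v) < rho.
Proof.
have v0 := vn_ge0 v; have rho0 := rho_gt0.
split=> [|s]; first by apply: divr_gt0 => //; lra.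
rewrite /sgv ltr_pdivlMr ?vnZ; last lra.
by have := nc_ge0 s; rewrite mulrDr mulr1; lra.
Qed.

(** The derivative along v of the residue-free part z r(q, z). *)
Definition DG v (s z : R[i]) : tensor2 g := dirder (fun q' => G (q', z)) (q + s *: v) v.

Lemma G_deriv v s z : nc s < sgv v -> nc z < rho ->
  is_deriv_in setT (fun s => G (q + s *: v, z)) s (DG v s z).
Proof.
move=> hs hz; have [rho0 HP _] := HG.
have [_ [L /frechet_fst hL] _] := HP (s *: v) z ((sgvP v).2 s hs) hz.
by rewrite /DG (dirder_frechet v hL); exact: (@deriv_line R hstar _ (fun q' => G (q', z)) q v s _ hL).
Qed.

Lemma G_param v : vhol (DG v 0) 0 rho /\
  forall k, is_deriv_in setT (fun s => vtc (fun z => G (q + s *: v, z)) 0 k) 0 (vtc (DG v 0) 0 k).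
Proof.
have [sg0 sgP] := sgvP v.
apply: (@vtc_param _ (fun s z => G (q + s *: v, z)) (DG v) (sgv v) rho M) => //.
- exact: rho_gt0.
- by move=> s z; exact: G_deriv.
- move=> s z /sgP vr zr; have [rho0 HP _] := HG.
  have [_ hh _] := r_mer vr; apply: (vhol_derivT hh); by rewrite subr0.
- by move=> s z /sgP vr zr; have [_ _] := HG; apply.
Qed.

Lemma Dr_mer v : mer (Dr q v) 1 (DG v 0) rho.
Proof.
have [hD _] := G_param v; split => //; first exact: rho_gt0.
move=> z zr; have [z0 hz] := andP zr; have [sg0 sgP] := sgvP v.
have n0 : nc (0 : R[i]) < sgv v by rewrite nc0.
have zn : z != 0 by rewrite -nc_gt0.
have := deriv_lin (u := fun T : tensor2 g => z^-1 *: T) _ (G_deriv n0 hz).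
rewrite expr1 => H; apply: dirder_eq; apply: (deriv_near sg0 _ (H _)) => [s|a x y].
  rewrite subr0 => /sgP vr /=; have [_ HP _] := HG.
  by have [_ _ E] := HP _ z vr hz; rewrite E.
by rewrite scalerDr !scalerA mulrC.
Qed.

Lemma rtc_deriv v c k : 0 < nc c < rho ->
  is_deriv_in setT (fun s => vtc (r (q + s *: v)) c k) 0 (vtc (Dr q v) c k).
Proof.
move=> /andP[c0 cr]; have [rho0 HP HB] := HG; have [sg0 sgP] := sgvP v.
have [t [t0 t1 t2]] : exists t : R, [/\ 0 < t, t <= nc c / 2 & t < rho - nc c].
  have [||t [t0 t1 t2]] := @small2 R (nc c / 2) (rho - nc c); [lra|lra|].
  by exists t; split => //; exact: ltW.
have ct (z : R[i]) : nc z < t -> nc c / 2 <= nc (c + z) /\ nc (c + z) < rho.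
  move=> zt; have := ncD c z; have := nc_sub_ge c (- z); rewrite opprK ncN; lra.
have M0 : 0 <= M.
  by apply: le_trans (vn_ge0 (G (q + 0, 0))) (HB _ _ _ _); rewrite ?vn0 ?nc0.
have tc1 : t <= nc c by lra.
have tc2 : t <= rho - nc c by exact: ltW.
have c2 : 0 < nc c / 2 by lra.
have cpos (z : R[i]) : nc z < t -> 0 < nc (c + z) < rho.
  by move=> /ct [h1 ->]; rewrite (lt_le_trans c2 h1).
pose D s z := (c + z)^-1 *: DG v s (c + z).
have [|||hD HD] := @vtc_param _ (fun s z => r (q + s *: v) (c + z)) D (sgv v) t (M / (nc c / 2)) sg0 t0.
- move=> s z hs hz; have [h1 h2] := ct z hz.
  have nz : c + z != 0 by rewrite -nc_gt0; lra.
  have := deriv_lin (u := fun T : tensor2 g => (c + z)^-1 *: T) _ (G_deriv hs h2).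
  move=> H; have sd : 0 < sgv v - nc s by rewrite subr_gt0.
  apply: (deriv_near sd _ (H _)) => [s'|a x y]; last by rewrite scalerDr !scalerA mulrC.
  move=> hs' /=.
  have /sgP vr : nc s' < sgv v.
    by have -> : s' = (s' - s) + s by [ring]; apply: le_lt_trans (ncD _ _) _; rewrite -ltrBrDr.
  by have [_ _ E] := HP _ _ vr h2; rewrite E.
- move=> s z /sgP vr hz; have [h1 h2] := ct z hz.
  have vh : vhol (fun z => r (q + s *: v) (c + z)) 0 t.
    exact: (vhol_shift (mer_vhol (r_mer vr) t0 tc1 tc2)).
  by apply: (vhol_derivT vh); rewrite subr0.
- move=> s z /sgP vr hz; have [h1 h2] := ct z hz.
  have nz : c + z != 0 by rewrite -nc_gt0; lra.
  have [_ _ E] := HP _ _ vr h2; rewrite E // vnZ ncV mulrC.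
  apply: ler_pM; [exact: vn_ge0|by rewrite invr_ge0 nc_ge0|exact: HB|].
  by rewrite lef_pV2 ?posrE //; lra.
have h0 := HD k.
have E1 : (fun s => vtc (fun z => r (q + s *: v) (c + z)) 0 k) = fun s => vtc (r (q + s *: v)) c k.
  by apply/funext => s; rewrite vtc_shift.
rewrite E1 in h0; rewrite -vtc_shift.
suff -> : vtc (fun z => Dr q v (c + z)) 0 k = vtc (D 0) 0 k by [].
apply: (vtc_near _ t0) => [|z]; last first.
  rewrite subr0 => zt; have [_ _ E] := Dr_mer v.
  by rewrite (E _ (cpos z zt)) expr1.
exact: (vhol_shift (mer_vhol (Dr_mer v) t0 tc1 tc2)).
Qed.
End AtPoint.
End RFamily.
End ParametricTaylor.


Section SmoothFunctions.
Context {R : realType}.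
Local Open Scope complex_scope.
Local Notation C := (Num.NumField.sort (R[i] : numFieldType)).

(** Sequences of at most geometric growth: the coefficients of convergent
    power series. *)
Definition geomb (a : nat -> R[i]) := exists (M K : R), [/\ 0 <= M, 1 <= K & forall k, nc (a k) <= M * K ^+ k].

Lemma geomb_lc a t b : geomb a -> geomb b -> geomb (lc a t b).
Proof.
move=> [M [K [M0 K1 H]]] [M' [K' [M'0 K'1 H']]].
exists (M + nc t * M'), (K + K'); split=> [||k]; [|lra|].
  by apply: addr_ge0 => //; apply: mulr_ge0 => //; exact: nc_ge0.
rewrite /lc; apply: le_trans (ncD _ _) _; rewrite ncM mulrDl; apply: lerD.
  apply: le_trans (H k) _; apply: ler_wpM2l => //; apply: lerXn2r; rewrite ?nnegrE; lra.
rewrite -mulrA; apply: ler_wpM2l; first exact: nc_ge0.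
apply: le_trans (H' k) _; apply: ler_wpM2l => //; apply: lerXn2r; rewrite ?nnegrE; lra.
Qed.

Lemma geomb_bd a : (forall k, nc (a k) <= 1) -> geomb a.
Proof. by move=> H; exists 1, 1; split => // k; rewrite expr1n mulr1. Qed.

Lemma geomb_hol a : geomb a -> exists H (r : R), [/\ 0 < r, hol H 0 r & tc H 0 = a].
Proof.
move=> [M [K [M0 K1 H]]]; have K0 : 0 < K by lra.
have cv w : nc w < K^-1 -> exists l, psum a w l.
  move=> wK; have [|||l hl _] := @clim_abs R (fun k => a k * w ^+ k) M (K * nc w) _ _ M0.
  - by apply: mulr_ge0; [exact: ltW|exact: nc_ge0].
  - by rewrite -ltr_pdivlMl // mulr1.
  - move=> k; rewrite ncM ncX exprMn mulrA; apply: ler_wpM2r => //; apply: exprn_ge0; exact: nc_ge0.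
  by exists l.
have /choice [F HF] : forall w, exists l, nc w < K^-1 -> psum a w l.
  move=> w; have [wK|wK] := boolP (nc w < K^-1); last by exists 0.
  by have [l hl] := cv w wK; exists l.
have i0 : 0 < K^-1 by rewrite invr_gt0.
by have [h1 h2] := psum_hol i0 HF; exists F, K^-1.
Qed.

Lemma hol_geomb H (r : R) : 0 < r -> hol H 0 r -> geomb (tc H 0).
Proof.
move=> r0 hH; have [s0 s1] : 0 < r / 2 /\ r / 2 < r by split; lra.
have [M M0 HM] := hol_bounded hH s0 s1.
exists (2 * M), (1 + (r / 2)^-1); split=> [||k].
- lra.
- by rewrite lerDl invr_ge0 ltW.
have := @tc_bound R H 0 r (r / 2) M hH s0 s1 _ k.
have H1 : (forall w, nc w = r / 2 -> nc (H (0 + w)) <= M).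
  by move=> w ws; apply: HM; rewrite ws.
move=> /(_ H1) h; have p0 : 0 < (r / 2) ^+ k by rewrite exprn_gt0.
rewrite -ler_pdivlMr // in h; apply: le_trans h _; rewrite -exprVn.
apply: ler_wpM2l; first lra.
have i0 : 0 < (r / 2)^-1 by rewrite invr_gt0.
apply: lerXn2r; rewrite ?nnegrE; lra.
Qed.

Section Blocks.
Variable V : vectType R[i].
Local Notation d := (\dim {:V}).

(** A sequence of vectors as one sequence of scalars: the coordinates of the
    k-th vector are the entries of index k d, ..., k d + d - 1. *)
Definition unblock (a : nat -> R[i]) (k : nat) : V := \sum_(i < d) a (k * d + i)%N *: (vbasis {:V})`_i.
Definition block (c : nat -> V) (m : nat) : R[i] :=
  if insub (m %% d)%N is Some i then cd i (c (m %/ d)%N) else 0.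

Lemma cd_unblock a k i : cd i (unblock a k) = a (k * d + i)%N.
Proof. by rewrite /cd coord_sum_free //; exact: basis_free (vbasisP _). Qed.

Lemma block_at c k (i : 'I_d) : block c (k * d + i)%N = cd i (c k).
Proof.
have d0 : (0 < d)%N by apply: leq_ltn_trans (ltn_ord i).
by rewrite /block modnMDl modn_small // divnMDl // divn_small // addn0 valK.
Qed.

Lemma unblockK c : unblock (block c) = c.
Proof. by apply/funext => k; apply: cd_inj => i; rewrite cd_unblock block_at. Qed.

Lemma unblock_lc a t b k : unblock (lc a t b) k = unblock a k + t *: unblock b k.
Proof.
apply: cd_inj => i; rewrite (linD_of (@cd_lin _ V i)) (linZ_of (@cd_lin _ V i)).
by rewrite !cd_unblock.
Qed.

Lemma geomb_unblock a : geomb a -> exists H (r : R), [/\ 0 < r, vhol H 0 r & vtc H 0 = unblock a].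
Proof.
move=> [M [K [M0 K1 Ha]]]; have K0 : 0 < K by lra.
have gi (i : 'I_d) : geomb (fun k => a (k * d + i)%N).
  exists (M * K ^+ i), (K ^+ d); split => [||k]; first by apply: mulr_ge0 => //; apply: exprn_ge0; exact: ltW.
    by rewrite exprn_ege1.
  by rewrite -mulrA -exprM mulnC -exprD addnC.
have /choice [F HF] : forall i : 'I_d, exists F : R[i] -> R[i], exists2 r : R, 0 < r &
   (hol F 0 r /\ tc F 0 = fun k => a (k * d + i)%N).
  by move=> i; have [F [r [r0 h1 h2]]] := geomb_hol (gi i); exists F, r.
have [||r r0 Hr] := @fin_min R d (fun i r => hol (F i) 0 r).
- by move=> i e e' e'e h z ze; apply: h; exact: lt_le_trans ze e'e.
- by move=> i; have [r r0 [h _]] := HF i; exists r.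
pose H z : V := \sum_(i < d) F i z *: (vbasis {:V})`_i.
have cdH i z : cd i (H z) = F i z by rewrite /cd coord_sum_free //; exact: basis_free (vbasisP _).
have hH : vhol H 0 r.
  apply: vhol_cd => // i; have -> : (fun z => cd i (H z)) = F i by apply/funext => z; rewrite cdH.
  exact: Hr.
exists H, r; split => //; apply/funext => k; apply: cd_inj => i.
rewrite (cd_vtc _ _ r0 hH) cd_unblock.
have -> : (fun z => cd i (H z)) = F i by apply/funext => z; rewrite cdH.
by have [_ _ [_ ->]] := HF i.
Qed.

Lemma geomb_block H (r : R) : 0 < r -> vhol H 0 r -> geomb (block (vtc H 0)).
Proof.
move=> r0 hH.
have /choice [M HM] : forall i : 'I_d, exists M : R, exists K : R, [/\ 0 <= M, 1 <= K & forall k, nc (cd i (vtc H 0 k)) <= M * K ^+ k].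
  move=> i; have [M [K HK]] := hol_geomb r0 (hH _ (@cd_lin _ V i)); exists M, K.
  by case: HK => h1 h2 h3; split => // k; rewrite (cd_vtc _ _ r0 hH); exact: h3.
have /choice [K HK] := HM.
have M0 : 0 <= \sum_i M i by apply: sumr_ge0 => i _; case: (HK i).
have K0 : 0 <= \sum_i K i by apply: sumr_ge0 => i _; case: (HK i); lra.
exists (\sum_i M i), (1 + \sum_i K i); split=> [||m] //; first by rewrite lerDl.
rewrite /block; case: insubP => [i _ _|_]; last first.
  by rewrite nc0; apply: mulr_ge0 => //; apply: exprn_ge0; lra.
have [h1 h2 h3] := HK i; apply: le_trans (h3 _) _.
apply: ler_pM => //.
- by apply: exprn_ge0; lra.
- by rewrite (bigD1 i) //= lerDl; apply: sumr_ge0 => j _; case: (HK j).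
apply: (@le_trans _ _ ((1 + \sum_i K i) ^+ (m %/ d))).
  apply: lerXn2r; rewrite ?nnegrE; [lra|lra|].
  rewrite (bigD1 i) //=; have : 0 <= \sum_(j < d | j != i) K j by apply: sumr_ge0 => j _; case: (HK j); lra.
  lra.
by apply: ler_weXn2l; [lra|exact: leq_div].
Qed.
End Blocks.

Lemma sum_blocks (V : zmodType) n m (F : nat -> V) :
  \sum_(k < n * m) F k = \sum_(k < n) \sum_(j < m) F (k * m + j)%N.
Proof.
elim: n => [|n IH]; first by rewrite !big_ord0.
by rewrite mulSnr big_split_ord big_ord_recr IH.
Qed.

Section ChainRule.
Variable g : vectType R[i].
Local Notation "g ^*" := 'Hom(g, (R[i])^o) : type_scope.
Local Notation d := (\dim {:g}).

Lemma hom_bil : bil (fun (xi : g ^*) (x : g) => xi x : (R[i])^o).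
Proof.
split=> [xi a x y|x a xi eta]; first by rewrite linearP.
by rewrite add_lfunE scale_lfunE.
Qed.

Lemma ldiffP (f : (int -> g) -> R[i]) X : lsmooth f -> Laurent X -> is_ldiff f X (ldiff f X).
Proof. by move=> sf LX; rewrite /ldiff; case: xgetP => [xi -> //|]; have [xi h] := sf X LX; move=> /(_ xi). Qed.

Definition ser (a : nat -> R[i]) : int -> g := coefs 1 (unblock g a).

Lemma ser_lc a t b : ser (lc a t b) = fun n => ser a n + t *: ser b n.
Proof.
apply/funext => n; rewrite /ser /coefs; case: (n + _) => k; first exact: unblock_lc.
by rewrite scaler0 addr0.
Qed.

Lemma ser_mer b : geomb b -> exists H (r : R), mer (lsum (ser b)) 1 H r /\ ser b = coefs 1 (vtc H 0).
Proof.
move=> /(geomb_unblock g) [H [r [r0 hH E]]]; exists H, r; rewrite /ser -E; split => //.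
by split => // z zr; rewrite (coefs_vhol 1 r0 hH).2.
Qed.

Lemma ser_Laurent b : geomb b -> Laurent (ser b).
Proof. by move=> /(geomb_unblock g) [H [r [r0 hH E]]]; rewrite /ser -E; exact: (coefs_vhol 1 r0 hH).1. Qed.

Lemma smooth_Cl f : lsmooth f -> Cl geomb (fun a => f (ser a)).
Proof.
move=> sf a ga; have [Lxi Hxi] := ldiffP sf (ser_Laurent ga).
set xi := ldiff f (ser a) in Lxi Hxi.
have [S [A [r [hA xiE]]]] := Laurent_mer Lxi.
pose c m : R[i] := if insub (m %% d)%N is Some j then xi (- (m %/ d)%N%:Z) (vbasis {:g})`_(j : 'I_d) else 0.
exists (S.+1 * d)%N, c => b gb.
have := Hxi _ (ser_Laurent gb) => /hdP H.
have -> : (fun t => f (ser (lc a t b))) = fun t : C => f (fun n => ser a n + t *: ser b n).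
  by apply/funext => t; rewrite ser_lc.
suff <- : lpair xi (ser b) = \sum_(k < S.+1 * d) c k * b k by [].
have [B [r' [hB bE]]] := ser_mer gb.
rewrite /lpair (res_bil hom_bil hA hB) addn1 (sum_blocks S.+1 d (fun k => c k * b k)) (reindex_inj rev_ord_inj) /=.
rewrite (lof_lsum Lxi) (lof_lsum (ser_Laurent gb)); apply: eq_bigr => i _.
have iS := ltn_ord i.
have -> : (S.+1 - i.+1)%N%:Z - S%:Z = - i%:Z by lia.
have -> : S%:Z - 1 - (S.+1 - i.+1)%N%:Z = i%:Z - 1 by lia.
rewrite /ser (coefs_at 1) /unblock linear_sum; apply: eq_bigr => j _.
have d0 : (0 < d)%N by apply: leq_ltn_trans (ltn_ord j).
rewrite linearZ /= /c modnMDl modn_small // divnMDl // divn_small // addn0 valK.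
by rewrite mulrC.
Qed.

(** The chain rule along a curve of series of order at least -1. *)
Lemma smooth_chain f (H : R[i] -> R[i] -> g) (K : R[i] -> g) (sg r r' : R) : lsmooth f ->
  0 < sg -> 0 < r -> 0 < r' ->
  (forall s, nc s < sg -> vhol (H s) 0 r) -> vhol K 0 r' ->
  (forall k, is_deriv_in setT (fun s => vtc (H s) 0 k) 0 (vtc K 0 k)) ->
  hd (fun s => f (coefs 1 (vtc (H s) 0))) 0 (lpair (ldiff f (coefs 1 (vtc (H 0) 0))) (coefs 1 (vtc K 0))).
Proof.
move=> sf sg0 r0 r'0 hH hK HD.
have gK := geomb_block r'0 hK; have gH s : nc s < sg -> geomb (block (vtc (H s) 0)) by move=> /hH; exact: geomb_block.
have n0 : nc (0 : R[i]) < sg by rewrite nc0.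
have hk k : hd (fun s => block (vtc (H s) 0) k) 0 (block (vtc K 0) k).
  rewrite /block; case: insubP => [i _ _|_]; last exact: hd_cst.
  exact: (derivT_hd (@cd_lin _ g i) (HD _)).
have [l h1 h2] := Cl_chain geomb_lc geomb_bd (smooth_Cl sf) sg0 gH gK hk.
have sE c : ser (block c) = coefs 1 c by rewrite /ser unblockK.
have -> : (fun s => f (coefs 1 (vtc (H s) 0))) = fun s => f (ser (block (vtc (H s) 0))).
  by apply/funext => s; rewrite sE.
suff <- : l = lpair (ldiff f (coefs 1 (vtc (H 0) 0))) (coefs 1 (vtc K 0)) by [].
have [Lxi Hxi] := ldiffP sf (ser_Laurent (gH 0 n0)).
have := Hxi _ (ser_Laurent gK) => /hdP h3.
rewrite -!sE; apply: hd_unique h3.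
by apply: hd_ext h1 => t; rewrite ser_lc.
Qed.

End ChainRule.
End SmoothFunctions.


Section FixedRadius.
Context {R : realType}.
Local Open Scope complex_scope.
Local Notation C := (Num.NumField.sort (R[i] : numFieldType)).

Section One.
Variable V : vectType R[i].
Implicit Types (F G : R[i] -> V).

Definition MerR F (r : R) := exists T H, mer F T H r.

Lemma MerR_Mer F r : MerR F r -> Mer F.
Proof. by move=> [T [H h]]; exists T, H, r. Qed.

Lemma MerR_shrink F r s : MerR F r -> 0 < s -> s <= r -> MerR F s.
Proof. by move=> [T [H h]] s0 sr; exists T, H; exact: mer_shrink h s0 sr. Qed.

Lemma Mer_MerR F : Mer F -> exists2 r : R, 0 < r & MerR F r.
Proof. by move=> [T [H [r h]]]; exists r; [case: h|exists T, H]. Qed.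

Lemma MerR_D F G r : MerR F r -> MerR G r -> MerR (fun z => F z + G z) r.
Proof.
move=> [T [H h]] [T' [H' h']]; have [H1 [h1 _]] := mer_widen T' h; have [H2 [h2 _]] := mer_widen T h'.
by rewrite addnC in h2; exists (T + T')%N, (fun z => H1 z + H2 z); exact: merD.
Qed.

Lemma MerR_hol H r : 0 < r -> vhol H 0 r -> MerR H r.
Proof. by move=> r0 h; exists 0%N, H; split => // z _; rewrite expr0 invr1 scale1r. Qed.

Lemma MerR_cst (v : V) r : 0 < r -> MerR (fun=> v) r.
Proof. by move=> r0; apply: MerR_hol => //; exact: vhol_cst. Qed.

Lemma MerR_sum (I : Type) (s : seq I) (f : I -> R[i] -> V) r : 0 < r ->
  (forall i, MerR (f i) r) -> MerR (fun z => \sum_(i <- s) f i z) r.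
Proof.
move=> r0 h; elim: s => [|a s IH].
  have -> : (fun z => \sum_(i <- [::]) f i z) = fun=> 0 by apply/funext => z; rewrite big_nil.
  exact: MerR_cst.
have -> : (fun z => \sum_(i <- a :: s) f i z) = fun z => f a z + \sum_(i <- s) f i z.
  by apply/funext => z; rewrite big_cons.
exact: MerR_D.
Qed.

Lemma MerR_ext F G r : (forall z, 0 < nc z < r -> F z = G z) -> MerR F r -> MerR G r.
Proof. by move=> E [T [H [r0 h E']]]; exists T, H; split => // z zr; rewrite -E // E'. Qed.

Lemma lsum_lofR F r z : MerR F r -> 0 < nc z < r -> lsum (laurent_of F) z = F z.
Proof. by move=> [T [H h]]; exact: lsum_lof_mer h. Qed.

Lemma mer_neg F H T r : mer F T H r -> mer (fun z => F (- z)) T (fun z => (-1) ^+ T *: H (- z)) r.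
Proof.
move=> [r0 h E]; split => // [|z zr].
  apply: vhol_scale; first by move=> z _; exists 0; exact: hd_cst.
  move=> phi lp z; rewrite subr0 => zr; have [|l hl] := h phi lp (- z); first by rewrite subr0 ncN.
  exists (- l); have := @hd_aff R (phi \o H) z l 0 (-1); rewrite add0r !mulN1r => /(_ hl).
  by apply: hd_ext => w; rewrite add0r mulN1r.
rewrite E ?ncN // scalerA; congr (_ *: _).
by rewrite [(- z) ^+ T]exprNn invfM -[((-1) ^+ T)^-1]exprVn invrN1 mulrC.
Qed.

Lemma MerR_neg F r : MerR F r -> MerR (fun z => F (- z)) r.
Proof. by move=> [T [H h]]; exists T, (fun z => (-1) ^+ T *: H (- z)); exact: mer_neg. Qed.

Lemma mer_tcvhol F T H r z : mer F T H r -> 0 < nc z < r -> exists2 t : R, 0 < t & vhol F z t.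
Proof.
move=> h /andP[z0 zr]; exists (Num.min (nc z) (r - nc z)); first by rewrite lt_min z0 subr_gt0.
by apply: (mer_vhol h); rewrite ?lt_min ?z0 ?subr_gt0 ?ge_min ?lexx ?orbT.
Qed.

Lemma MerR_vtc F r k : MerR F r -> MerR (fun z => vtc F z k) r.
Proof.
move=> [T [H h]]; have [r0 hH E] := h.
have /choice [K HK] : forall i : 'I_(\dim {:V}), exists K : R[i] -> R[i],
    hol K 0 r /\ forall z, 0 < nc z < r -> cd i (vtc F z k) = z ^- (T + k) * K z.
  move=> i; have [K hK EK] := @tc_pole R (fun z => cd i (F z)) (fun z => cd i (H z)) r T k r0
     (hH _ (@cd_lin _ V i)) (fun z zr => etrans (congr1 (cd i) (E z zr)) (linZ_of (@cd_lin _ V i) _ _)).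
  exists K; split => // z zr; have [t t0 vt] := mer_tcvhol h zr.
  by rewrite (cd_vtc _ _ t0 vt) EK.
exists (T + k)%N, (fun z => \sum_(i < \dim {:V}) K i z *: (vbasis {:V})`_i).
have cdK i z : cd i (\sum_(i < \dim {:V}) K i z *: (vbasis {:V})`_i) = K i z.
  by rewrite /cd coord_sum_free //; exact: basis_free (vbasisP _).
split => // [|z zr].
  apply: vhol_cd => // i.
  have -> : (fun z => cd i (\sum_(i < \dim {:V}) K i z *: (vbasis {:V})`_i)) = K i by apply/funext => z; rewrite cdK.
  by case: (HK i).
by apply: cd_inj => i; rewrite (linZ_of (@cd_lin _ V i)) cdK; case: (HK i) => _; exact.
Qed.

End One.

Lemma MerR_lin (V W : vectType R[i]) (u : V -> W) F r : linear u -> MerR F r -> MerR (fun z => u (F z)) r.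
Proof. by move=> lu [T [H h]]; exists T, (fun z => u (H z)); exact: mer_lin. Qed.

Lemma MerR_bil (V W U : vectType R[i]) (B : V -> W -> U) F G r : bil B -> MerR F r -> MerR G r ->
  MerR (fun z => B (F z) (G z)) r.
Proof. by move=> bB [T [H h]] [T' [H' h']]; exists (T + T')%N, (fun z => B (H z) (H' z)); exact: mer_bil. Qed.

Section Tensor.
Variable g : vectType R[i].
Local Notation "g ^*" := 'Hom(g, (R[i])^o) : type_scope.
Local Notation e i := (vbasis {:g})`_i.
Local Notation n := (\dim {:g}).

Lemma lift2_lin (V : lmodType R[i]) (F : g -> g -> V) : linear (lift2 F : tensor2 g -> V).
Proof.
move=> a S T; rewrite /lift2 scaler_sumr -big_split; apply: eq_bigr => i _ /=.
rewrite scaler_sumr -big_split; apply: eq_bigr => j _ /=.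
by rewrite !mxE scalerDl scalerA.
Qed.

Lemma lift2_eq (V : lmodType R[i]) (F F' : g -> g -> V) T : (forall i j : 'I_n, F (e i) (e j) = F' (e i) (e j)) -> lift2 F T = lift2 F' T.
Proof. by move=> E; apply: eq_bigr => i _; apply: eq_bigr => j _; rewrite E. Qed.

Lemma lift2_post (V W : lmodType R[i]) (u : V -> W) (F : g -> g -> V) T : linear u ->
  u (lift2 F T) = lift2 (fun a b => u (F a b)) T.
Proof.
move=> lu; have lD : {morph u : x y / x + y} by move=> x y; have := lu 1 x y; rewrite !scale1r.
have l0 : u 0 = 0 by have /(congr1 (fun x => x - u 0)) := lD 0 0; rewrite addr0 addrK subrr.
have lZ a x : u (a *: x) = a *: u x by have := lu a x 0; rewrite l0 !addr0.
rewrite /lift2 (big_morph u lD l0); apply: eq_bigr => i _.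
by rewrite (big_morph u lD l0); apply: eq_bigr => j _; rewrite lZ.
Qed.

Lemma lift2_sumF (V : lmodType R[i]) (F F' : g -> g -> V) a T :
  lift2 (fun x y => a *: F x y + F' x y) T = a *: lift2 F T + lift2 F' T.
Proof.
rewrite /lift2 scaler_sumr -big_split; apply: eq_bigr => i _ /=.
rewrite scaler_sumr -big_split; apply: eq_bigr => j _ /=.
by rewrite scalerDr !scalerA [a * _]mulrC.
Qed.

Lemma contr1_bil : bil (fun (T : tensor2 g) (eta : g ^*) => contr1 T eta).
Proof.
split=> [T a x y|eta]; last exact: lift2_lin.
rewrite /contr1 -lift2_sumF; apply: lift2_eq => i j.
by rewrite add_lfunE scale_lfunE scalerDl scalerA.
Qed.

Lemma contr2_bil : bil (fun (T : tensor2 g) (eta : g ^*) => contr2 T eta).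
Proof.
split=> [T a x y|eta]; last exact: lift2_lin.
rewrite /contr2 -lift2_sumF; apply: lift2_eq => i j.
by rewrite add_lfunE scale_lfunE scalerDl scalerA.
Qed.

(** The non-polar part of the R-operator: contraction of the Taylor
    coefficients of D at -w with the principal part of a. *)
Definition Sop (D : R[i] -> tensor2 g) (S : nat) (a : int -> g ^*) (w : R[i]) : g :=
  \sum_(k < S) contr1 (vtc D (- w) k) (a (- k.+1%:Z)).

Lemma Sop_MerR D S a r : 0 < r -> MerR D r -> MerR (Sop D S a) r.
Proof.
move=> r0 hD.
apply: (@MerR_sum g _ (index_enum _) (fun (k : 'I_S) w => contr1 (vtc D (- w) k) (a (- k.+1%:Z))) r r0) => k.
have := MerR_neg (MerR_vtc k hD).
exact: (@MerR_lin _ _ (fun T : tensor2 g => contr1 T (a (- k.+1%:Z))) _ _ (contr1_bil.2 _)).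
Qed.

End Tensor.
End FixedRadius.


Section Operators.
Context {R : realType}.
Local Open Scope complex_scope.
Local Notation C := (Num.NumField.sort (R[i] : numFieldType)).
Variable g : vectType R[i].
Local Notation "g ^*" := 'Hom(g, (R[i])^o) : type_scope.
Local Notation e i := (vbasis {:g})`_i.
Local Notation n := (\dim {:g}).
Variables (br : g -> g -> g) (form : g -> g -> (R[i])^o).
Hypotheses (Hinv : is_invariant_form br form) (Hnd : nondegenerate_on fullv form).

Lemma form_lin x : linear (form x). Proof. by case: Hinv. Qed.
Lemma form_sym x y : form x y = form y x. Proof. by case: Hinv. Qed.
Lemma form_linl y : linear (form^~ y).
Proof. by move=> a x x'; rewrite /= ![form _ y]form_sym form_lin. Qed.
Lemma form_inj x y : (forall w, form x w = form y w) -> x = y.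
Proof.
move=> H; apply/eqP; rewrite -subr_eq0; apply/eqP; apply: Hnd => [|w _]; first exact: memvf.
by rewrite (linB_of (form_linl w)) H subrr.
Qed.

Local Notation B := (\matrix_(i < n, j < n) form (e i) (e j)).

Lemma gram_unit : B \in unitmx.
Proof.
rewrite -row_free_unit; apply: inj_row_free => v vB.
have E : \sum_(i < n) v 0 i *: e i = 0.
  apply: Hnd => [|y _]; first exact: memvf.
  rewrite (lin_cd y (form_lin _)) big1 // => j _.
  rewrite (lin_sum_of (form_linl _)).
  have := congr1 (fun M : 'rV[R[i]]_n => M 0 j) vB; rewrite !mxE => E.
  rewrite [X in _ *: X](_ : _ = 0) ?scaler0 // -[RHS]E; apply: eq_bigr => i _.
  by rewrite (linZ_of (form_linl _)) !mxE.
apply/rowP => i; rewrite mxE.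
have := congr1 (fun x => cd i x) E; rewrite (lin0_of (@cd_lin _ g i)).
by rewrite /cd coord_sum_free //; exact: basis_free (vbasisP _).
Qed.

Lemma form_casimir xi y : form (contr1 (casimir form) xi) y = xi y.
Proof.
rewrite (lin_cd y (form_lin _)) (lin_cd (u := xi) y) => [|a x w]; last by rewrite linearP.
apply: eq_bigr => k _; congr (_ *: _).
rewrite (lift2_post _ _ (form_linl _)) /lift2.
transitivity (\sum_(i < n) xi (e i) * (1%:M : 'M[R[i]]_n) i k).
  rewrite -(mulVmx gram_unit); apply: eq_bigr => i _.
  rewrite [in RHS]mxE mulr_sumr; apply: eq_bigr => j _.
  by rewrite (linZ_of (form_linl _)) !mxE mulrCA.
rewrite (bigD1 k) //= big1 => [|i ik]; first by rewrite mxE eqxx mulr1 addr0.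
by rewrite mxE (negbTE ik) mulr0.
Qed.

Lemma raiseE xi : raise form xi = contr1 (casimir form) xi.
Proof.
rewrite /raise; case: xgetP => [x -> /= Hx|].
  by apply: form_inj => y; rewrite Hx form_casimir.
by move=> /(_ (contr1 (casimir form) xi)) []; exact: form_casimir.
Qed.

Lemma form_raise xi y : form (raise form xi) y = xi y.
Proof. by rewrite raiseE form_casimir. Qed.

Lemma raise_lin : linear (raise form).
Proof. by move=> a x y; rewrite !raiseE; exact: (contr1_bil g).1. Qed.

Section RFamily.
Variable h : {vspace g}.
Local Notation hstar := 'Hom(subvs_of h, (R[i])^o).
Variable r : hstar -> R[i] -> tensor2 g.
Implicit Types (q v : hstar) (a : int -> g ^*) (x : phase h).

Definition Ropf q S a (z : R[i]) : g := 2^-1 *: raise form (lsum a z) + Sop (r q) S a z.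

Lemma Ropf_MerR q S a (t : R) : 0 < t -> MerR (r q) t -> MerR (lsum a) t -> MerR (Ropf q S a) t.
Proof.
move=> t0 hr ha; apply: MerR_D; last exact: Sop_MerR.
apply: (@MerR_lin _ _ _ (fun xi : g ^* => 2^-1 *: raise form xi)) => // b x y.
by rewrite raise_lin scalerDr !scalerA mulrC.
Qed.

Lemma Rop_eq q S a (t : R) : 0 < t -> MerR (r q) t -> MerR (lsum a) t ->
  (forall m, m < - S%:Z -> a m = 0) -> Rop form r q a = laurent_of (Ropf q S a).
Proof.
move=> t0 hr ha aS; have hM := MerR_Mer (Ropf_MerR S t0 hr ha).
have E : exists2 s : R, 0 < s & forall z, 0 < nc z < s -> Ropf q S a z =
    2^-1 *: raise form (lsum a z) +
    vlim (fun N => \sum_(k < N) (k`!%:R : R[i])^-1 *: contr1 (vderiven k (r q) (- z)) (a (- k.+1%:Z))).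
  exists t => // z zt; rewrite /Ropf; congr (_ + _); apply/esym.
  apply: vlimE; apply/vcvgP => eps e0; exists S => N SN.
  suff -> : \sum_(k < N) (k`!%:R : R[i])^-1 *: contr1 (vderiven k (r q) (- z)) (a (- k.+1%:Z)) = Sop (r q) S a z.
    by rewrite subrr vn0 ltW.
  rewrite /Sop -(subnKC SN) big_split_ord /= [X in _ + X]big1 => [|k _]; last first.
    by rewrite aS ?(lin0_of ((contr1_bil g).1 _)) ?scaler0 // ltrN2 ltz_nat ltnS leq_addr.
  rewrite addr0; apply: eq_bigr => k _; have zt' : 0 < nc (- z) < t by rewrite ncN.
  have [T [H hm]] := hr; have [s s0 vh] := mer_tcvhol hm zt'.
  have zz : nc (- z - - z) < s by rewrite subrr nc0.
  rewrite (vderiven_hol _ vh zz).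
  have cl : contr1 (k`!%:R *: vtc (r q) (- z) k) (a (- k.+1%:Z)) = k`!%:R *: contr1 (vtc (r q) (- z) k) (a (- k.+1%:Z)).
    exact: linZ_of ((contr1_bil g).2 _) _ _.
  by rewrite cl scalerA mulVf ?scale1r // pnatr_eq0 -lt0n fact_gt0.
by rewrite /Rop; apply/esym; apply: lof_near => //; exact: (Mer_near hM).
Qed.

Lemma Rop_sum q S a (t : R) z : 0 < t -> MerR (r q) t -> MerR (lsum a) t ->
  (forall m, m < - S%:Z -> a m = 0) -> 0 < nc z < t -> lsum (Rop form r q a) z = Ropf q S a z.
Proof. by move=> t0 hr ha aS zt; rewrite (Rop_eq t0 hr ha aS) (lsum_lofR (Ropf_MerR S t0 hr ha)). Qed.

Lemma polyb_MerR q G (rho M : R) : polyb r q G rho M -> MerR (r q) rho.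
Proof.
move=> HG; have v0 : vn (0 : hstar) < rho by rewrite vn0; case: HG.
by have := r_mer HG v0; rewrite addr0 => hr; exists 1%N, (fun z => G (q, z)).
Qed.

Lemma dRop_eq q v S a G (rho M : R) : polyb r q G rho M -> Laurent a ->
  (forall m, m < - S%:Z -> a m = 0) -> dRop form r (q, v) a = laurent_of (Sop (Dr r q v) S a).
Proof.
move=> HG La aS; have rho0 := rho_gt0 HG; have [sg0 sgP] := sgvP HG v.
have [ra ra0 ha] := Mer_MerR (Laurent_Mer La).
have [t [t0 t1 t2]] := small2 rho0 ra0.
have hS : MerR (Sop (Dr r q v) S a) rho.
  by apply: Sop_MerR => //; exists 1%N, (DG q G v 0); exact: Dr_mer HG v.
have LS := lof_Laurent (MerR_Mer hS).
have HD : is_lderiv_in (setT : set C) (fun s => Rop form r (q + s *: v) a) 0 (laurent_of (Sop (Dr r q v) S a)).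
  exists (t%:C) => [|z]; first by rewrite ltcR.
  rewrite annulusC => zt; have zr : 0 < nc z < rho by case/andP: zt => ->; move/lt_trans; apply.
  rewrite (lsum_lofR hS zr).
  apply: (@deriv_near R g setT (fun s => Ropf (q + s *: v) S a z) _ 0 _ (sgv rho v) sg0) => [s|].
    rewrite subr0 => /sgP vr; have hr : MerR (r (q + s *: v)) t.
      by apply: (@MerR_shrink _ _ _ rho) => //; [exists 1%N, (fun z => G (q + s *: v, z)); exact: (r_mer HG vr)|exact: ltW].
    have ha' := MerR_shrink ha t0 (ltW t2).
    by rewrite (Rop_sum t0 hr ha' aS zt).
  apply: hd_derivT => i.
  pose u k (T : tensor2 g) : (R[i])^o := cd i (contr1 T (a (- k.+1%:Z))).
  have ul k : linear (u k) by move=> b x y; rewrite /u ((contr1_bil g).2 _) (@cd_lin _ g i).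
  have -> : cd i (Sop (Dr r q v) S a z) = 0 + \sum_(k < S) u k (vtc (Dr r q v) (- z) k).
    by rewrite add0r /Sop (lin_sum_of (@cd_lin _ g i)).
  apply: (@hd_ext R (fun s => cd i (2^-1 *: raise form (lsum a z)) + \sum_(k < S) u k (vtc (r (q + s *: v)) (- z) k))).
    by move=> s; rewrite /Ropf (linD_of (@cd_lin _ g i)) /Sop (lin_sum_of (@cd_lin _ g i)).
  apply: hdD; first exact: hd_cst.
  apply: hd_sum => k _; have zr' : 0 < nc (- z) < rho by rewrite ncN.
  exact: (derivT_hd (ul (nat_of_ord k)) (rtc_deriv HG zr')).
rewrite /dRop; case: xgetP => [Y -> [LY HY]|/(_ (laurent_of (Sop (Dr r q v) S a)))]; last by case.
exact: lderiv_unique LY LS HY HD.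
Qed.

Definition laxf x (z : R[i]) : g := vsval x.1.2 + contr2 (r x.1.1 z) x.2.

Lemma Lmap_mer1 x K (rho : R) : mer (r x.1.1) 1 K rho ->
  mer (laxf x) 1 (fun z => z *: vsval x.1.2 + contr2 (K z) x.2) rho.
Proof.
move=> [rho0 hG E]; split => //.
  apply: vholD; last exact: (vhol_lin ((contr2_bil g).2 x.2) hG).
  by apply: vhol_scale; [move=> z _; exists 1; exact: hd_id|exact: vhol_cst].
move=> z zr; rewrite /laxf E // expr1 scalerDr scalerA mulVf ?scale1r; last first.
  by rewrite -nc_gt0; case/andP: zr.
by congr (_ + _); exact: (linZ_of ((contr2_bil g).2 x.2)).
Qed.

Lemma Lmap_mer x G (rho M : R) : polyb r x.1.1 G rho M ->
  mer (laxf x) 1 (fun z => z *: vsval x.1.2 + contr2 (G (x.1.1, z)) x.2) rho.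
Proof.
move=> HG; have v0 : vn (0 : hstar) < rho by rewrite vn0; case: HG.
by have := r_mer HG v0; rewrite addr0; exact: Lmap_mer1.
Qed.

Lemma Lmap_sum x G (rho M : R) z : polyb r x.1.1 G rho M -> 0 < nc z < rho -> lsum (Lmap r x) z = laxf x z.
Proof. by move=> HG zr; rewrite /Lmap (lsum_lof_mer (Lmap_mer HG)). Qed.

Lemma Lmap_Laurent x G (rho M : R) : polyb r x.1.1 G rho M -> Laurent (Lmap r x).
Proof. by move=> HG; apply: lof_Laurent; eexists; eexists; eexists; exact: (Lmap_mer HG). Qed.

End RFamily.
End Operators.


Section DirectionalDerivatives.
Context {R : realType}.
Local Open Scope complex_scope.
Local Notation C := (Num.NumField.sort (R[i] : numFieldType)).
Variable g : vectType R[i].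
Local Notation "g ^*" := 'Hom(g, (R[i])^o) : type_scope.
Local Notation e i := (vbasis {:g})`_i.
Local Notation n := (\dim {:g}).

Lemma lpair_lof (A : int -> g ^*) F : Laurent A -> Mer F ->
  lpair A (laurent_of F) = residue (fun z => lsum A z (F z) : (R[i])^o).
Proof.
move=> LA hF; apply: res_near.
  apply: (Mer_bil (hom_bil g)); apply: Laurent_Mer => //; exact: lof_Laurent.
by have [r r0 E] := lsum_lof hF; exists r => // z /E ->.
Qed.

Lemma hd_derivK F t l : hd F t l -> is_deriv_in (setT : set C) (F : R[i] -> (R[i])^o) t (l : (R[i])^o).
Proof.
move=> H; apply: hd_derivT => i.
have E (y : (R[i])^o) : cd i y = cd i (1 : (R[i])^o) * y.
  by rewrite mulrC -[RHS](linZ_of (@cd_lin R (R[i])^o i)); congr (cd i _); exact/esym/mulr1.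
by rewrite E; apply: hd_ext (hdZ _ H) => w; exact: (esym (E _)).
Qed.

Lemma Sop_widen D S S' (a : int -> g ^*) w : (S <= S')%N -> (forall m, m < - S%:Z -> a m = 0) ->
  Sop D S' a w = Sop D S a w.
Proof.
move=> SS aS; rewrite /Sop -(subnKC SS) big_split_ord /= [X in _ + X]big1 ?addr0 // => k _.
by rewrite aS ?(lin0_of ((contr1_bil g).1 _)) // ltrN2 ltz_nat ltnS leq_addr.
Qed.

(** For fixed w off the origin, z |-> D(z - w) is holomorphic at 0, so the
    residue only sees the principal part of a. *)
Lemma res_Sop (D : R[i] -> tensor2 g) S (a : int -> g ^*) w (t : R) (b : g ^*) : MerR D t -> Laurent a ->
  (forall m, m < - S%:Z -> a m = 0) -> 0 < nc w < t ->
  Mer (fun z => b (contr1 (D (z - w)) (lsum a z)) : (R[i])^o) /\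
  residue (fun z => b (contr1 (D (z - w)) (lsum a z)) : (R[i])^o) = b (Sop D S a w).
Proof.
move=> [T0 [H0 hD]] La aS wt; have wt' : 0 < nc (- w) < t by rewrite ncN.
have [t' t'0 vh] := mer_tcvhol hD wt'.
have bB : bil (fun (T : tensor2 g) (eta : g ^*) => b (contr1 T eta) : (R[i])^o).
  split=> [T x y z|eta x y z]; first by rewrite ((contr1_bil g).1 T) linearP.
  by rewrite ((contr1_bil g).2 eta) linearP.
have E : (fun z => D (z - w)) = fun z => D (- w + z) by apply/funext => z; rewrite addrC.
have hF : mer (fun z => D (z - w)) 0 (fun z => D (z - w)) t'.
  split => // [|z _]; first by rewrite E; exact: vhol_shift.
  by rewrite expr0 invr1 scale1r.
have [T [H [s [hA aE]]]] := Laurent_mer La.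
split.
  apply: (Mer_bil bB (F := fun z => D (z - w)) (G := lsum a)); last exact: Laurent_Mer.
  by exists 0%N, (fun z => D (z - w)), t'.
rewrite (res_bil bB hF hA) add0n (lof_lsum La).
rewrite -(@Sop_widen D S (S + T)) ?leq_addr // addnC (@Sop_widen D T (T + S)) ?leq_addr //; last first.
  by move=> m mT; rewrite aE coefs_lt.
rewrite /Sop linear_sum; apply: eq_bigr => k _.
rewrite (lof_at _ hF) E vtc_shift; congr (b (contr1 _ (a _))); lia.
Qed.

Section Lax.
Variable h : {vspace g}.
Local Notation hstar := 'Hom(subvs_of h, (R[i])^o).
Variable r : hstar -> R[i] -> tensor2 g.
Variables (f : (int -> g) -> R[i]) (x : phase h) (G : (hstar * (R[i])^o)%type -> tensor2 g) (rho M : R).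
Hypotheses (sf : lsmooth f) (HG : polyb r x.1.1 G rho M).
Local Notation q := x.1.1.
Local Notation p := x.1.2.
Local Notation xi := x.2.
Local Notation A := (ldiff f (Lmap r x)).

Lemma A_Laurent : Laurent A.
Proof. by have [] := ldiffP sf (Lmap_Laurent HG). Qed.

Lemma dirder_affine (u : phase h) (F : R[i] -> g) : Mer F ->
  (forall t : R[i], Lmap r (x + t *: u) = fun m => Lmap r x m + t *: laurent_of F m) ->
  dirder (f \o Lmap r : phase h -> (R[i])^o) x u = residue (fun z => lsum A z (F z) : (R[i])^o).
Proof.
move=> hF E; rewrite -(lpair_lof A_Laurent hF); apply: dirder_eq; apply: hd_derivK.
have [_ H] := ldiffP sf (Lmap_Laurent HG).
have := H _ (lof_Laurent hF) => /hdP; apply: hd_ext => t.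
by rewrite /= E.
Qed.

Lemma Mer_r2 eta : Mer (fun z => contr2 (r q z) eta).
Proof. exact: (Mer_lin ((contr2_bil g).2 eta) (MerR_Mer (polyb_MerR HG))). Qed.

Lemma dirder_p (w : subvs_of h) :
  dirder (f \o Lmap r : phase h -> (R[i])^o) x (0, w, 0) = residue (fun z => lsum A z (vsval w) : (R[i])^o).
Proof.
apply: (dirder_affine (F := fun=> vsval w)) => [|t]; first exact: Mer_cst.
have -> : x + t *: (0, w, 0) = (q, p + t *: w, xi) :> phase h.
  by case: (x) => [[a b] c]; apply/pair_equal_spec; split; [apply/pair_equal_spec; split|]; rewrite /= ?scaler0 ?addr0.
apply/funext => m; rewrite /Lmap /=.
have hL : Mer (fun z => vsval p + contr2 (r q z) xi) by apply: MerD; [exact: Mer_cst|exact: Mer_r2].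
have lt : linear (fun v : g => t *: v) by move=> a u v; rewrite scalerDr !scalerA mulrC.
rewrite -(lof_lin m lt (Mer_cst (vsval w))) -(lofD m hL (Mer_lin lt (Mer_cst (vsval w)))).
congr (laurent_of _ m); apply/funext => z.
by rewrite addrAC.
Qed.

Lemma dirder_xi eta :
  dirder (f \o Lmap r : phase h -> (R[i])^o) x (0, 0, eta) = residue (fun z => lsum A z (contr2 (r q z) eta) : (R[i])^o).
Proof.
apply: (dirder_affine (F := fun z => contr2 (r q z) eta)) => [|t]; first exact: Mer_r2.
have -> : x + t *: (0, 0, eta) = (q, p, xi + t *: eta) :> phase h.
  by case: (x) => [[a b] c]; apply/pair_equal_spec; split; [apply/pair_equal_spec; split|]; rewrite /= ?scaler0 ?addr0.
apply/funext => m; rewrite /Lmap /=.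
have hL : Mer (fun z => vsval p + contr2 (r q z) xi) by apply: MerD; [exact: Mer_cst|exact: Mer_r2].
have lt : linear (fun v : g => t *: v) by move=> a u v; rewrite scalerDr !scalerA mulrC.
rewrite -(lof_lin m lt (Mer_r2 eta)) -(lofD m hL (Mer_lin lt (Mer_r2 eta))).
congr (laurent_of _ m); apply/funext => z; rewrite -addrA; congr (_ + _).
have cl := (contr2_bil g).1 (r q z).
by rewrite (linD_of cl) (linZ_of cl).
Qed.

Lemma Mer_Dr2 v eta : Mer (fun z => contr2 (Dr r q v z) eta).
Proof.
apply: (Mer_lin ((contr2_bil g).2 eta)); exists 1%N, (DG q G v 0), rho; exact: (Dr_mer HG v).
Qed.

(** Along q the whole series varies, and the chain rule for functions that
    are differentiable along lines is needed. *)
Lemma dirder_q v :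
  dirder (f \o Lmap r : phase h -> (R[i])^o) x (v, 0, 0) = residue (fun z => lsum A z (contr2 (Dr r q v z) xi) : (R[i])^o).
Proof.
rewrite -(lpair_lof A_Laurent (Mer_Dr2 v xi)); apply: dirder_eq; apply: hd_derivK.
have [sg0 sgP] := sgvP HG v; have rho0 := rho_gt0 HG.
pose H s z := z *: vsval p + contr2 (G (q + s *: v, z)) xi.
pose K z := contr2 (DG q G v 0 z) xi.
have xs s : x + s *: (v, 0, 0) = (q + s *: v, p, xi) :> phase h.
  by case: (x) => [[a b] c]; apply/pair_equal_spec; split; [apply/pair_equal_spec; split|]; rewrite /= ?scaler0 ?addr0.
have hm s : nc s < sgv rho v -> mer (laxf r (x + s *: (v, 0, 0))) 1 (H s) rho.
  by move=> /sgP vr; rewrite xs; apply: (Lmap_mer1 (x := (q + s *: v, p, xi)) (r_mer HG vr)).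
have LE s : nc s < sgv rho v -> Lmap r (x + s *: (v, 0, 0)) = coefs 1 (vtc (H s) 0).
  by move=> /hm /lof_mer.
have [hDG HD] := G_param HG v.
have c2 := (contr2_bil g).2 xi.
have hK : vhol K 0 rho by exact: vhol_lin.
have KE : laurent_of (fun z => contr2 (Dr r q v z) xi) = coefs 1 (vtc K 0).
  exact: (lof_mer (mer_lin c2 (Dr_mer HG v))).
have n0 : nc (0 : R[i]) < sgv rho v by rewrite nc0.
have L0 : Lmap r x = coefs 1 (vtc (H 0) 0) by rewrite -LE // scale0r addr0.
rewrite KE L0.
apply: (@hd_near R (fun s => f (coefs 1 (vtc (H s) 0))) _ 0 _ (sgv rho v) sg0).
  by move=> s; rewrite subr0 => /LE <-.
apply: (smooth_chain sf sg0 rho0 rho0) => // [s /hm [] //|k].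
have hz : vhol (fun z : R[i] => z *: vsval p) 0 rho.
  by apply: vhol_scale; [move=> z _; exists 1; exact: hd_id|exact: vhol_cst].
rewrite (vtc_lin k rho0 c2 hDG).
apply: (@deriv_near R g setT (fun s => vtc (fun z => z *: vsval p) 0 k + contr2 (vtc (fun z => G (q + s *: v, z)) 0 k) xi) _ 0 _ (sgv rho v) sg0) => [s|].
  rewrite subr0 => /sgP vr; have [_ hG _] := r_mer HG vr.
  by rewrite /H (vtcD k rho0 hz (vhol_lin c2 hG)) (vtc_lin k rho0 c2 hG).
have := deriv_lin c2 (HD k) => /is_deriv_inP D; apply/is_deriv_inP => eps /D [d d0 Hd].
have E (u b c : g) : (u + b) - (u + c) = b - c by rewrite opprD addrACA subrr add0r.
by exists d => // s Ds sd; rewrite E; exact: Hd s Ds sd.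
Qed.

End Lax.
End DirectionalDerivatives.


Section Contraction.
Context {R : realType}.
Local Open Scope complex_scope.
Local Notation C := (Num.NumField.sort (R[i] : numFieldType)).
Variable g : vectType R[i].
Local Notation "g ^*" := 'Hom(g, (R[i])^o) : type_scope.
Local Notation e i := (vbasis {:g})`_i.
Local Notation n := (\dim {:g}).

Lemma hom_linear (A : g ^*) : linear (A : g -> (R[i])^o).
Proof. by move=> a x y; rewrite linearP. Qed.

Lemma homE (A : g ^*) y : A y = \sum_(i < n) (cd i y : R[i]) * (A (e i) : R[i]) :> R[i].
Proof. exact: (lin_cd y (hom_linear A)). Qed.

Lemma linfunE (V W : vectType R[i]) (u : V -> W) x : linear u -> linfun u x = u x.
Proof.
move=> lu; pose U := HB.pack_for {linear V -> W} u (GRing.isLinear.Build _ _ _ _ u lu).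
exact: (lfunE U x).
Qed.

(** Contraction of the three factors with three linear forms. *)
Definition pair3 (A b xi : g ^*) (T : tensor3 g) : R[i] :=
  \sum_(i < n) \sum_(j < n) \sum_(k < n) (T i : 'M[R[i]]_n) j k * ((A (e i) : R[i]) * (b (e j) : R[i]) * (xi (e k) : R[i])).

Lemma pair3_lin A b xi : linear (pair3 A b xi : tensor3 g -> (R[i])^o).
Proof.
move=> a S T.
suff E : pair3 A b xi (a *: S + T) = a * pair3 A b xi S + pair3 A b xi T :> R[i] by exact: E.
rewrite /pair3 mulr_sumr -big_split; apply: eq_bigr => i _ /=.
rewrite mulr_sumr -big_split; apply: eq_bigr => j _ /=.
rewrite mulr_sumr -big_split; apply: eq_bigr => k _ /=.
by rewrite !ffunE !mxE; ring.
Qed.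

Lemma pair3_tens3 A b xi x y w : pair3 A b xi (tens3 x y w) = (A x : R[i]) * (b y : R[i]) * (xi w : R[i]).
Proof.
rewrite (homE A x) (homE b y) (homE xi w) !mulr_suml; apply: eq_bigr => i _.
rewrite -mulrA mulr_suml mulr_sumr; apply: eq_bigr => j _.
rewrite mulrA mulr_sumr; apply: eq_bigr => k _.
by rewrite ffunE !mxE /cd; ring.
Qed.

(** lift2 with scalar values, as a sum in the base field. *)
Definition lsc (F : g -> g -> R[i]) (T : tensor2 g) : R[i] :=
  \sum_(i < n) \sum_(j < n) (T : 'M[R[i]]_n) i j * F (e i) (e j).

Lemma lscE (F : g -> g -> R[i]) T : lift2 (F : g -> g -> (R[i])^o) T = lsc F T.
Proof. by []. Qed.

Lemma lift2_scal (F : g -> g -> R[i]) (a : R[i]) T : lsc (fun x y => F x y * a) T = lsc F T * a.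
Proof.
rewrite /lsc mulr_suml; apply: eq_bigr => i _; rewrite mulr_suml; apply: eq_bigr => j _.
by rewrite mulrA.
Qed.

Lemma lsc_eq (F F' : g -> g -> R[i]) T : (forall i j : 'I_n, F (e i) (e j) = F' (e i) (e j)) -> lsc F T = lsc F' T.
Proof. by move=> E; apply: eq_bigr => i _; apply: eq_bigr => j _; rewrite E. Qed.

Lemma pair3_lift2 A b xi (F : g -> g -> tensor3 g) T : pair3 A b xi (lift2 F T) = lsc (fun x y => pair3 A b xi (F x y)) T.
Proof. exact: (lift2_post F T (pair3_lin A b xi)). Qed.

Lemma hom_lift2 (A : g ^*) (F : g -> g -> g) T : A (lift2 F T) = lsc (fun x y => A (F x y)) T :> R[i].
Proof. exact: (lift2_post F T (hom_linear A)). Qed.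

Lemma hom_contr1 (b eta : g ^*) T : b (contr1 T eta) = lsc (fun x y => (eta x : R[i]) * (b y : R[i])) T :> R[i].
Proof. by rewrite /contr1 hom_lift2; apply: lsc_eq => i j; rewrite linearZ. Qed.

Lemma hom_contr2 (b eta : g ^*) T : b (contr2 T eta) = lsc (fun x y => (eta y : R[i]) * (b x : R[i])) T :> R[i].
Proof. by rewrite /contr2 hom_lift2; apply: lsc_eq => i j; rewrite linearZ. Qed.

Lemma contr1_tens x y (eta : g ^*) : contr1 (tens x y) eta = eta x *: y.
Proof.
rewrite /contr1 /lift2 (homE eta x) scaler_suml; apply: eq_bigr => i _.
rewrite [in RHS](cd_sum y) scaler_sumr; apply: eq_bigr => j _.
by rewrite !mxE !scalerA /cd; congr (_ *: _); ring.
Qed.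

Lemma contr2_tens x y (eta : g ^*) : contr2 (tens x y) eta = eta y *: x.
Proof.
rewrite /contr2 /lift2 (homE eta y) exchange_big scaler_suml; apply: eq_bigr => i _.
rewrite [in RHS](cd_sum x) scaler_sumr; apply: eq_bigr => j _.
by rewrite !mxE !scalerA /cd; congr (_ *: _); ring.
Qed.

Lemma contr2_flip T (eta : g ^*) : contr2 (flip T) eta = contr1 T eta.
Proof.
rewrite /flip (lift2_post _ _ ((contr2_bil g).2 eta)).
by apply: lift2_eq => i j; rewrite contr2_tens.
Qed.

Variable br : g -> g -> g.
Hypothesis Hlie : is_lie_bracket br.

Lemma br_bil : bil br. Proof. by case: Hlie. Qed.
Lemma brxx x : br x x = 0. Proof. by case: Hlie. Qed.
Lemma brC x y : br x y = - br y x.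
Proof.
have D z : br (x + y) z = br x z + br y z := linD_of (br_bil.2 z) x y.
have := brxx (x + y); rewrite (linD_of (br_bil.1 _)) !D !brxx add0r addr0 addrC.
by move=> /eqP; rewrite addr_eq0 => /eqP.
Qed.

Lemma adstarE x xi y : adstar br x xi y = xi (br x y).
Proof.
by rewrite /adstar linfunE // => a u v; rewrite (br_bil.1 x) linearP.
Qed.

Lemma adstar_bil : bil (adstar br).
Proof.
split=> [x a xi eta|xi a x y]; apply/lfunP => v; rewrite !(adstarE, add_lfunE, scale_lfunE) //.
have D : br (a *: x + y) v = a *: br x v + br y v := br_bil.2 v a x y.
by rewrite D linearP.
Qed.

Lemma lift2_br12_23 S T (A b xi : g ^*) :
  pair3 A b xi (br12_23 br S T) = b (br (contr1 S A) (contr2 T xi)).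
Proof.
rewrite /br12_23 pair3_lift2.
have -> : br (contr1 S A) (contr2 T xi) = lift2 (fun x y => (A x : R[i]) *: br y (contr2 T xi)) S.
  have D u := lift2_post (fun x y => (A x : R[i]) *: y) S (br_bil.2 u).
  by rewrite /contr1 D; apply: lift2_eq => i j; exact: (linZ_of (br_bil.2 _)).
rewrite hom_lift2; apply: lsc_eq => i j; rewrite linearZ /=.
rewrite pair3_lift2 /contr2 (lift2_post _ _ (br_bil.1 _)) hom_lift2.
rewrite -[RHS]mulrC -lift2_scal; apply: lsc_eq => k l.
by rewrite pair3_tens3 (linZ_of (br_bil.1 _)) linearZ /= -[_ *: _]/(_ * _ : R[i]); ring.
Qed.

Lemma lift2_br12_13 S T (A b xi : g ^*) :
  pair3 A b xi (br12_13 br S T) = - (b (contr1 S (adstar br (contr2 T xi) A)) : R[i]).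
Proof.
rewrite /br12_13 pair3_lift2 hom_contr1 -mulN1r mulrC -lift2_scal.
apply: lsc_eq => i j; rewrite pair3_lift2 adstarE brC linearN /= mulNr mulrN1 opprK.
rewrite /contr2 (lift2_post _ _ (br_bil.1 _)) hom_lift2 -lift2_scal.
apply: lsc_eq => k l.
by rewrite pair3_tens3 (linZ_of (br_bil.1 _)) linearZ /= -[_ *: _]/(_ * _ : R[i]); ring.
Qed.

Lemma cd_gdual j (y : g) : gdual j y = cd j y :> R[i].
Proof. by rewrite /gdual linfunE // => a u v; rewrite linearP. Qed.

Lemma lift2_br13_23 S T (A b xi : g ^*) :
  pair3 A b xi (br13_23 br S T) = \sum_(j < n) \sum_(k < n)
    (A (contr2 S (gdual j)) : R[i]) * (b (contr2 T (gdual k)) : R[i]) * (xi (br (e j) (e k)) : R[i]).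
Proof.
rewrite /br13_23 pair3_lift2.
transitivity (lsc (fun a b0 => lsc (fun c d => (A a : R[i]) * (b c : R[i]) * (xi (br b0 d) : R[i])) T) S).
  apply: lsc_eq => i j; rewrite pair3_lift2.
  by apply: lsc_eq => k l; rewrite pair3_tens3.
transitivity (\sum_(j < n) \sum_(k < n) lsc (fun a b0 => lsc (fun c d => (cd j b0 * (A a : R[i])) * (cd k d * (b c : R[i])) * (xi (br (e j) (e k)) : R[i])) T) S); last first.
  apply: eq_bigr => j _; apply: eq_bigr => k _.
  rewrite !hom_contr2 -mulrA -lift2_scal; apply: lsc_eq => i l.
  rewrite cd_gdual [RHS]mulrCA -lift2_scal; apply: lsc_eq => i' l'.
  by rewrite cd_gdual; ring.
rewrite /lsc.
under [RHS]eq_bigr => j _ do rewrite exchange_big.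
rewrite [RHS]exchange_big; apply: eq_bigr => i _ /=.
under [RHS]eq_bigr => j _ do rewrite exchange_big.
rewrite [RHS]exchange_big; apply: eq_bigr => l _ /=.
under [RHS]eq_bigr => j _ do rewrite -mulr_sumr exchange_big.
rewrite -mulr_sumr; congr (_ * _).
rewrite [RHS]exchange_big; apply: eq_bigr => i' _ /=.
under [RHS]eq_bigr => j _ do rewrite exchange_big.
rewrite [RHS]exchange_big; apply: eq_bigr => l' _ /=.
under [RHS]eq_bigr => j _ do rewrite -mulr_sumr.
rewrite -mulr_sumr; congr (_ * _).
rewrite (bilE br_bil (e l) (e l')) linear_sum mulr_sumr; apply: eq_bigr => j _.
rewrite linear_sum mulr_sumr; apply: eq_bigr => k _.
by rewrite linearZ /= -[_ *: _]/(_ * _ : R[i]); ring.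
Qed.

End Contraction.


Section KeyIdentity.
Context {R : realType}.
Local Open Scope complex_scope.
Local Notation C := (Num.NumField.sort (R[i] : numFieldType)).
Variable g : vectType R[i].
Local Notation "g ^*" := 'Hom(g, (R[i])^o) : type_scope.
Local Notation e i := (vbasis {:g})`_i.
Local Notation n := (\dim {:g}).
Variables (br : g -> g -> g) (form : g -> g -> (R[i])^o) (h : {vspace g}).
Local Notation hstar := 'Hom(subvs_of h, (R[i])^o).
Variable r : hstar -> R[i] -> tensor2 g.
Hypotheses (Hlie : is_lie_bracket br) (Hr : classical_dynamical_r_matrix br form r).
Variables (q : hstar) (G : (hstar * (R[i])^o)%type -> tensor2 g) (rho M : R).
Hypothesis HG : polyb r q G rho M.

Lemma reg v z : vn v < rho -> 0 < nc z < rho -> regular r (q + v) z.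
Proof. by case: HG => _ HP _ vr /andP[z0 zr]; apply: (pole_regular HP vr zr); rewrite -nc_gt0. Qed.
Lemma reg0 z : 0 < nc z < rho -> regular r q z.
Proof. by move=> /(@reg 0); rewrite addr0; apply; rewrite vn0; case: HG. Qed.
Lemma npl v : vn v < rho -> nonpole r (q + v).
Proof. by case: HG => _ HP _ vr; exact: (pole_nonpole HP vr). Qed.
Lemma npl0 : nonpole r q.
Proof. by have := @npl 0; rewrite addr0; apply; rewrite vn0; case: HG. Qed.

Lemma r_flip v z (xi : g ^*) : vn v < rho -> 0 < nc z < rho ->
  contr2 (r (q + v) z) xi = - contr1 (r (q + v) (- z)) xi.
Proof.
move=> vr zr; have zr' : 0 < nc (- z) < rho by rewrite ncN.
have /eqP := cdr_unitary Hr (npl vr) (reg vr zr) (reg vr zr'); rewrite addr_eq0 => /eqP ->.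
by rewrite (linN_of ((contr2_bil g).2 xi)) contr2_flip.
Qed.

Lemma Dr_flip v z (xi : g ^*) : 0 < nc z < rho ->
  contr1 (Dr r q v (- z)) xi = - contr2 (Dr r q v z) xi.
Proof.
move=> zr; have zr' : 0 < nc (- z) < rho by rewrite ncN.
have [sg0 sgP] := sgvP HG v.
have D y : 0 < nc y < rho -> is_deriv_in (setT : set C) (fun s => r (q + s *: v) y) 0 (Dr r q v y).
  move=> yr; have := r_frechet HG yr => H.
  by have := @deriv_line R _ _ (r^~ y) q v 0 _; rewrite scale0r addr0 => /(_ _ H).
have d2 := deriv_lin ((contr2_bil g).2 xi) (D z zr).
have d1 := deriv_lin ((contr1_bil g).2 xi) (D (- z) zr').
have ln : linear (fun y : g => - y) by move=> a x y; rewrite opprD scalerN.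
have d3 : is_deriv_in (setT : set C) (fun s => contr2 (r (q + s *: v) z) xi) 0 (- contr1 (Dr r q v (- z)) xi).
  apply: (deriv_near sg0 _ (deriv_lin ln d1)) => s; rewrite subr0 => /sgP vr /=.
  by rewrite r_flip.
apply: oppr_inj; rewrite opprK; apply: cd_inj => i.
exact: hd_unique (derivT_hd (@cd_lin _ g i) d3) (derivT_hd (@cd_lin _ g i) d2).
Qed.

(** Weight zero, contracted with a linear form in the first factor. *)
Lemma weight z u (A : g ^*) : 0 < nc z < rho -> u \in h ->
  contr1 (r q z) (adstar br u A) = br (contr1 (r q z) A) u.
Proof.
move=> zr uh; have W := cdr_weight_zero Hr npl0 (reg0 zr) uh.
have := congr1 (fun T => contr1 T A) W; rewrite (lin0_of ((contr1_bil g).2 A)).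
rewrite /ad2 (lift2_post _ _ ((contr1_bil g).2 A)).
rewrite (@lift2_eq _ _ _ _ (fun a b => 1 *: (A (br u a) *: b) + A a *: br u b)); last first.
  by move=> i j; rewrite (linD_of ((contr1_bil g).2 A)) !contr1_tens scale1r.
rewrite lift2_sumF scale1r => /eqP; rewrite addr_eq0 => /eqP E.
transitivity (lift2 (fun a b => A (br u a) *: b) (r q z)).
  by apply: lift2_eq => i j; rewrite adstarE.
rewrite E (brC Hlie); congr (- _); rewrite /contr1 (lift2_post _ _ ((br_bil Hlie).1 u)).
by apply: lift2_eq => i j; rewrite (linZ_of ((br_bil Hlie).1 u)).
Qed.

Lemma istar_sum (xi : g ^*) : istar h xi = \sum_(i < \dim h) xi (vsval (hbas i)) *: hdual i.
Proof.
apply/lfunP => y; rewrite sum_lfunE /istar comp_lfunE.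
have lv : linear (@vsval _ _ h) by move=> a u v; rewrite linearP.
rewrite (linfunE _ lv) [vsval y](coord_vbasis (subvsP y)) linear_sum.
apply: eq_bigr => i _; rewrite linearZ scale_lfunE /=.
have E : hdual i y = coord (vbasis h) i (vsval y) :> R[i].
  by rewrite /hdual linfunE // => a u v; rewrite !linearP.
have -> : vsval (hbas i) = (vbasis h)`_i.
  by rewrite /hbas vsprojK // vbasis_mem // mem_nth // size_tuple.
by rewrite E -[RHS]/(_ * _ : R[i]) mulrC.
Qed.

Lemma Dr_istar (xi : g ^*) z : 0 < nc z < rho ->
  Dr r q (istar h xi) z = \sum_(i < \dim h) xi (vsval (hbas i)) *: Dr r q (hdual i) z.
Proof.
move=> zr; rewrite istar_sum (lin_sum_of (Dr_lin HG zr)).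
by apply: eq_bigr => i _; rewrite (linZ_of (Dr_lin HG zr)).
Qed.

Lemma alt_term hi T1 T2 T3 (A b xi : g ^*) :
  pair3 A b xi (lift2 (fun x y => tens3 hi x y) T1 + lift2 (fun x y => tens3 y hi x) T2 +
    lift2 (fun x y => tens3 x y hi) T3) =
  (b (contr2 T1 xi) : R[i]) * (A hi : R[i]) + (b hi : R[i]) * (A (contr1 T2 xi) : R[i]) +
  (xi hi : R[i]) * (b (contr1 T3 A) : R[i]).
Proof.
have pl := pair3_lin A b xi.
have e1 : lsc (fun x y => pair3 A b xi (tens3 hi x y)) T1 = (b (contr2 T1 xi) : R[i]) * (A hi : R[i]).
  by rewrite hom_contr2 -lift2_scal; apply: lsc_eq => k l; rewrite pair3_tens3; ring.
have e2 : lsc (fun x y => pair3 A b xi (tens3 y hi x)) T2 = (b hi : R[i]) * (A (contr1 T2 xi) : R[i]).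
  by rewrite hom_contr1 mulrC -lift2_scal; apply: lsc_eq => k l; rewrite pair3_tens3; ring.
have e3 : lsc (fun x y => pair3 A b xi (tens3 x y hi)) T3 = (xi hi : R[i]) * (b (contr1 T3 A) : R[i]).
  by rewrite hom_contr1 mulrC -lift2_scal; apply: lsc_eq => k l; rewrite pair3_tens3.
have p1 := etrans (pair3_lift2 A b xi (fun x y => tens3 hi x y) T1) e1.
have p2 := etrans (pair3_lift2 A b xi (fun x y => tens3 y hi x) T2) e2.
have p3 := etrans (pair3_lift2 A b xi (fun x y => tens3 x y hi) T3) e3.
rewrite 2!(linD_of pl).
exact: (f_equal2 (fun u v : R[i] => u + v) (f_equal2 (fun u v : R[i] => u + v) p1 p2) p3).
Qed.

Lemma cdybe_terms z1 z2 z3 z12 z13 z23 z31 :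
  z1 - z2 = z12 -> z1 - z3 = z13 -> z2 - z3 = z23 -> z3 - z1 = z31 ->
  regular r q z12 -> regular r q z13 -> regular r q z23 -> regular r q z31 ->
  \sum_(i < \dim h)
    (lift2 (fun a b => tens3 (vsval (hbas i)) a b) (Dr r q (hdual i) z23) +
     lift2 (fun a b => tens3 b (vsval (hbas i)) a) (Dr r q (hdual i) z31) +
     lift2 (fun a b => tens3 a b (vsval (hbas i))) (Dr r q (hdual i) z12))
  + br12_13 br (r q z12) (r q z13) + br12_23 br (r q z12) (r q z23) + br13_23 br (r q z13) (r q z23) = 0.
Proof. by move=> <- <- <- <- r1 r2 r3 r4; exact: (cdr_CDYBE Hr npl0 r1 r2 r3 r4). Qed.

Lemma combine6 (x0 x1 x2 x3 b5 s2 s3 s4 s5 : R[i]) : x0 + x1 + x2 + x3 = 0 ->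
  x0 = b5 - s2 -> x1 = - s3 -> x2 = s4 -> x3 = - s5 -> b5 - s3 + s4 = s2 + s5.
Proof.
move=> E E0 E1 E2 E3; rewrite {}E0 {}E1 {}E2 {}E3 in E; apply/eqP; rewrite -subr_eq0; apply/eqP; rewrite -[RHS]E; ring.
Qed.

Lemma cdybe_alg (D1 D2 D3 D4 : 'I_(\dim h) -> tensor2 g) (D5 S T U : tensor2 g) (A b xi : g ^*) :
  \sum_(i < \dim h)
    (lift2 (fun a b => tens3 (vsval (hbas i)) a b) (D1 i) +
     lift2 (fun a b => tens3 b (vsval (hbas i)) a) (D2 i) +
     lift2 (fun a b => tens3 a b (vsval (hbas i))) (D3 i))
  + br12_13 br S T + br12_23 br S U + br13_23 br T U = 0 ->
  (forall i, contr1 (D2 i) xi = - contr2 (D4 i) xi) ->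
  D5 = \sum_(i < \dim h) xi (vsval (hbas i)) *: D3 i ->
  (b (contr1 D5 A) : R[i]) - (b (contr1 S (adstar br (contr2 T xi) A)) : R[i])
  + (b (br (contr1 S A) (contr2 U xi)) : R[i])
  = \sum_(i < \dim h)
      ((b (vsval (hbas i)) : R[i]) * (A (contr2 (D4 i) xi) : R[i])
       - (b (contr2 (D1 i) xi) : R[i]) * (A (vsval (hbas i)) : R[i]))
    + \sum_(k < n) \sum_(j < n) (b (contr2 U (gdual k)) : R[i]) * (A (contr2 T (gdual j)) : R[i])
        * (xi (br (e k) (e j)) : R[i]).
Proof.
move=> E H2 ED; have pl := pair3_lin A b xi.
apply: (combine6 (x0 := pair3 A b xi (\sum_(i < \dim h)
    (lift2 (fun a b => tens3 (vsval (hbas i)) a b) (D1 i) +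
     lift2 (fun a b => tens3 b (vsval (hbas i)) a) (D2 i) +
     lift2 (fun a b => tens3 a b (vsval (hbas i))) (D3 i)))) _ _
   (lift2_br12_13 Hlie S T A b xi) (lift2_br12_23 Hlie S U A b xi)
   (etrans (lift2_br13_23 Hlie T U A b xi) _)).
- have := congr1 (pair3 A b xi) E; rewrite (lin0_of pl) 3!(linD_of pl); exact.
- rewrite (lin_sum_of pl).
  have -> : b (contr1 D5 A) = \sum_(i < \dim h) (xi (vsval (hbas i)) : R[i]) * (b (contr1 (D3 i) A) : R[i]) :> R[i].
    rewrite ED (lin_sum_of ((contr1_bil g).2 A)) linear_sum; apply: eq_bigr => i _.
    by rewrite (linZ_of ((contr1_bil g).2 A)) linearZ.
  rewrite -sumrB; apply: eq_bigr => i _; rewrite alt_term H2 linearN /=; ring.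
rewrite exchange_big -sumrN; apply: eq_bigr => k _; rewrite -sumrN; apply: eq_bigr => j _.
by rewrite (brC Hlie (e j)) linearN /=; ring.
Qed.

(** The dynamical Yang-Baxter equation at (z, w, 0), contracted with linear
    forms in the three factors. *)
Lemma cdybe_pair z w (A b xi : g ^*) : 0 < nc w < rho -> 0 < nc z < rho -> 0 < nc (z - w) < rho ->
  (b (contr1 (Dr r q (istar h xi) (z - w)) A) : R[i])
  - (b (contr1 (r q (z - w)) (adstar br (contr2 (r q z) xi) A)) : R[i])
  + (b (br (contr1 (r q (z - w)) A) (contr2 (r q w) xi)) : R[i])
  = \sum_(i < \dim h)
      ((b (vsval (hbas i)) : R[i]) * (A (contr2 (Dr r q (hdual i) z) xi) : R[i])
       - (b (contr2 (Dr r q (hdual i) w) xi) : R[i]) * (A (vsval (hbas i)) : R[i]))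
    + \sum_(k < n) \sum_(j < n) (b (contr2 (r q w) (gdual k)) : R[i]) * (A (contr2 (r q z) (gdual j)) : R[i])
        * (xi (br (e k) (e j)) : R[i]).
Proof.
move=> wr zr zwr; have zr' : 0 < nc (- z) < rho by rewrite ncN.
have := cdybe_terms (erefl (z - w)) (subr0 z) (subr0 w) (sub0r z) (reg0 zwr) (reg0 zr) (reg0 wr) (reg0 zr').
move=> E; exact: (cdybe_alg A b E (fun i => @Dr_flip (hdual i) z xi zr) (Dr_istar xi zwr)).
Qed.

End KeyIdentity.


Section ScalarResidue.
Context {R : realType}.
Local Open Scope complex_scope.

Definition sres (F : R[i] -> R[i]) : R[i] := residue (F : R[i] -> (R[i])^o).
Definition sMer (F : R[i] -> R[i]) := Mer (F : R[i] -> (R[i])^o).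

Lemma sMerD F G : sMer F -> sMer G -> sMer (fun z => F z + G z).
Proof. exact: MerD. Qed.
Lemma sresD F G : sMer F -> sMer G -> sres (fun z => F z + G z) = sres F + sres G.
Proof. exact: resD. Qed.

Lemma scal_lin (c : R[i]) : linear (fun y : (R[i])^o => c * y : (R[i])^o).
Proof.
by move=> a x y; rewrite -[a *: _]/(a * x : R[i]) -[a *: _]/(a * (c * x) : R[i]) mulrDr mulrCA.
Qed.
Lemma sMerZ c F : sMer F -> sMer (fun z => c * F z).
Proof. exact: (Mer_lin (scal_lin c)). Qed.
Lemma sresZ c F : sMer F -> sres (fun z => c * F z) = c * sres F.
Proof. exact: (res_lin (scal_lin c)). Qed.

Lemma sres_sum (I : Type) (s : seq I) (f : I -> R[i] -> R[i]) : (forall i, sMer (f i)) ->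
  sMer (fun z => \sum_(i <- s) f i z) /\ sres (fun z => \sum_(i <- s) f i z) = \sum_(i <- s) sres (f i).
Proof.
move=> h; elim: s => [|a s [IH1 IH2]].
  have -> : (fun z => \sum_(i <- [::]) f i z) = fun z => 0 * 0 by apply/funext => z; rewrite big_nil mul0r.
  have m0 : sMer (fun=> 0) by exact: Mer_cst.
  by split; [exact: sMerZ|rewrite (sresZ _ m0) mul0r big_nil].
have -> : (fun z => \sum_(i <- a :: s) f i z) = fun z => f a z + \sum_(i <- s) f i z.
  by apply/funext => z; rewrite big_cons.
by split; [exact: sMerD|rewrite (sresD (h a) IH1) big_cons IH2].
Qed.

Lemma sres_near F G : sMer F -> (exists2 s : R, 0 < s & forall z, 0 < nc z < s -> F z = G z) -> sres F = sres G.
Proof. exact: res_near. Qed.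

Lemma sres3 f1 f2 f3 x1 x2 x3 : sMer f1 -> sMer f2 -> sMer f3 ->
  sres f1 = x1 -> sres f2 = x2 -> sres f3 = x3 ->
  sMer (fun z => f1 z + ((-1) * f2 z + (-1) * f3 z)) /\
  sres (fun z => f1 z + ((-1) * f2 z + (-1) * f3 z)) = x1 - x2 - x3.
Proof.
move=> m1 m2 m3 <- <- <-; have m2' := sMerZ (-1) m2; have m3' := sMerZ (-1) m3.
split; first exact: sMerD m1 (sMerD m2' m3').
by rewrite (sresD m1 (sMerD m2' m3')) (sresD m2' m3') (sresZ _ m2) (sresZ _ m3) !mulN1r addrA.
Qed.
End ScalarResidue.

Section KeyResidue.
Context {R : realType}.
Local Open Scope complex_scope.
Variable g : vectType R[i].
Local Notation "g ^*" := 'Hom(g, (R[i])^o) : type_scope.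
Local Notation e i := (vbasis {:g})`_i.
Local Notation n := (\dim {:g}).
Variables (br : g -> g -> g) (form : g -> g -> (R[i])^o) (h : {vspace g}).
Local Notation hstar := 'Hom(subvs_of h, (R[i])^o).
Variable r : hstar -> R[i] -> tensor2 g.
Hypotheses (Hlie : is_lie_bracket br) (Hr : classical_dynamical_r_matrix br form r).
Variables (q : hstar) (G : (hstar * (R[i])^o)%type -> tensor2 g) (rho M : R).
Hypothesis HG : polyb r q G rho M.
Variables (A : int -> g ^*) (xi : g ^*).
Hypothesis LA : Laurent A.

Definition dAp (i : 'I_(\dim h)) := sres (fun z => lsum A z (vsval (hbas i))).
Definition dAq (i : 'I_(\dim h)) := sres (fun z => lsum A z (contr2 (Dr r q (hdual i) z) xi)).
Definition dAxi (j : 'I_n) := sres (fun z => lsum A z (contr2 (r q z) (gdual j))).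

Lemma sMer_ev F : Mer F -> sMer (fun z => lsum A z (F z)).
Proof. by move=> hF; apply: (Mer_bil (hom_bil g)) => //; exact: Laurent_Mer. Qed.

Lemma Mer_adr : Mer (fun z => adstar br (contr2 (r q z) xi) (lsum A z)).
Proof.
apply: (Mer_bil (adstar_bil Hlie)); last exact: Laurent_Mer.
exact: (Mer_lin ((contr2_bil g).2 xi) (MerR_Mer (polyb_MerR HG))).
Qed.

Lemma Mer_DrR v : MerR (Dr r q v) rho.
Proof. by exists 1%N, (DG q G v 0); exact: (Dr_mer HG v). Qed.

(** The residue at z = 0 of the dynamical Yang-Baxter equation. *)
Lemma key0 S w (b : g ^*) : 0 < nc w < rho / 2 -> (forall m, m < - S%:Z -> A m = 0) ->
  (forall m, m < - S%:Z -> laurent_of (fun z => adstar br (contr2 (r q z) xi) (lsum A z)) m = 0) ->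
  (b (Sop (Dr r q (istar h xi)) S A w) : R[i])
  - (b (Sop (r q) S (laurent_of (fun z => adstar br (contr2 (r q z) xi) (lsum A z))) w) : R[i])
  + (b (br (Sop (r q) S A w) (contr2 (r q w) xi)) : R[i])
  = \sum_(i < \dim h) ((b (vsval (hbas i)) : R[i]) * dAq i - (b (contr2 (Dr r q (hdual i) w) xi) : R[i]) * dAp i)
    + \sum_(k < n) \sum_(j < n) (b (contr2 (r q w) (gdual k)) : R[i]) * dAxi j * (xi (br (e k) (e j)) : R[i]).
Proof.
move=> /andP[w0 wr2] AS aS; have rho0 := rho_gt0 HG.
have wr : 0 < nc w < rho by rewrite w0 /=; lra.
set a' := laurent_of _ in aS *; have La : Laurent a' by exact: lof_Laurent Mer_adr.
have hr := polyb_MerR HG.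
pose b' := adstar br (contr2 (r q w) xi) b.
have [m1 r1] := res_Sop b (Mer_DrR (istar h xi)) LA AS wr.
have [m2 r2] := res_Sop b hr La aS wr.
have [m3 r3] := res_Sop b' hr LA AS wr.
have b'E y : b' y = - (b (br y (contr2 (r q w) xi)) : R[i]) :> R[i].
  by rewrite adstarE // (brC Hlie) linearN.
pose f1 z : R[i] := b (contr1 (Dr r q (istar h xi) (z - w)) (lsum A z)).
pose f2 z : R[i] := b (contr1 (r q (z - w)) (lsum a' z)).
pose f3 z : R[i] := b' (contr1 (r q (z - w)) (lsum A z)).
pose X (i : 'I_(\dim h)) z : R[i] := lsum A z (contr2 (Dr r q (hdual i) z) xi).
pose Y (i : 'I_(\dim h)) z : R[i] := lsum A z (vsval (hbas i)).
pose Z (j : 'I_n) z : R[i] := lsum A z (contr2 (r q z) (gdual j)).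
have mX i : sMer (X i) by apply: sMer_ev; exact: (Mer_lin ((contr2_bil g).2 xi) (MerR_Mer (Mer_DrR _))).
have mY i : sMer (Y i) by apply: sMer_ev; exact: Mer_cst.
have mZ j : sMer (Z j) by apply: sMer_ev; exact: (Mer_lin ((contr2_bil g).2 _) (MerR_Mer hr)).
pose bh (i : 'I_(\dim h)) : R[i] := b (vsval (hbas i)).
pose c (i : 'I_(\dim h)) : R[i] := b (contr2 (Dr r q (hdual i) w) xi).
pose d (k j : 'I_n) : R[i] := (b (contr2 (r q w) (gdual k)) : R[i]) * (xi (br (e k) (e j)) : R[i]).
pose u (i : 'I_(\dim h)) z := bh i * X i z + (- c i) * Y i z.
have mu i : sMer (u i) by apply: sMerD; apply: sMerZ.
pose v (k : 'I_n) z := \sum_(j < n) d k j * Z j z.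
have mv' (k j : 'I_n) : sMer (fun z => d k j * Z j z) by exact: sMerZ.
have mv k : sMer (v k) by exact: (sres_sum (index_enum _) (mv' k)).1.
have [ms1 rs1] := sres_sum (index_enum 'I_(\dim h)) mu.
have [ms2 rs2] := sres_sum (index_enum 'I_n) mv.
have E : exists2 s : R, 0 < s & forall z, 0 < nc z < s ->
    f1 z + ((-1) * f2 z + (-1) * f3 z) = \sum_(i < \dim h) u i z + \sum_(k < n) v k z.
  have [s1 s10 sE] := lsum_lof Mer_adr.
  have [s2 [s20 s2a s2b]] := small2 s10 w0.
  have rho2 : 0 < rho / 2 by lra.
  have [s [s0 sa sb]] := small2 s20 rho2.
  exists s => // z /andP[z0 zs].
  have zr : 0 < nc z < rho by rewrite z0 /=; lra.
  have zwr : 0 < nc (z - w) < rho.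
    by have := ncB z w; have := nc_sub_ge w z; rewrite [nc (w - z)]ncBC => h1 h2; apply/andP; split; lra.
  have zs1 : 0 < nc z < s1 by rewrite z0 /=; lra.
  have := cdybe_pair Hlie Hr HG (lsum A z) b xi wr zr zwr.
  rewrite /f1 /f2 (sE z zs1) /f3 b'E !mulN1r opprK addrA => ->.
  congr (_ + _); first by apply: eq_bigr => i _; rewrite /u mulNr.
  apply: eq_bigr => k _; apply: eq_bigr => j _; rewrite /d /Z; ring.
have [mf rf] := sres3 (m1 : sMer f1) (m2 : sMer f2) (m3 : sMer f3) r1 r2 r3.
have K := etrans (esym rf) (sres_near mf E); rewrite b'E opprK in K.
apply: (etrans K); clear K; rewrite (sresD ms1 ms2) rs1 rs2.
congr (_ + _).
  apply: eq_bigr => i _; rewrite /u (sresD (sMerZ _ (mX i)) (sMerZ _ (mY i))).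
  by rewrite (sresZ _ (mX i)) (sresZ _ (mY i)) mulNr.
apply: eq_bigr => k _; rewrite (sres_sum (index_enum _) (mv' k)).2; apply: eq_bigr => j _.
by rewrite (sresZ _ (mZ j)) /d -/(Z j) /dAxi -/(Z j); ring.
Qed.

Lemma Sop_congr (D : R[i] -> tensor2 g) S (a a' : int -> g ^*) w : (forall k, a (- k.+1%:Z) = a' (- k.+1%:Z)) ->
  Sop D S a w = Sop D S a' w.
Proof. by move=> E; apply: eq_bigr => k _; rewrite E. Qed.

Lemma SopD (D : R[i] -> tensor2 g) S (a a' : int -> g ^*) w :
  Sop D S (fun m => a m + a' m) w = Sop D S a w + Sop D S a' w.
Proof. by rewrite /Sop -big_split; apply: eq_bigr => k _; rewrite (linD_of ((contr1_bil g).1 _)). Qed.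

Lemma SopN (D : R[i] -> tensor2 g) S (a : int -> g ^*) w t : 0 < t -> vhol D (- w) t ->
  Sop (fun z => - D z) S a w = - Sop D S a w.
Proof.
move=> t0 hD; rewrite /Sop -sumrN; apply: eq_bigr => k _.
have ln : linear (fun T : tensor2 g => - T) by move=> b x y; rewrite opprD scalerN.
by rewrite (vtc_lin k t0 ln hD) (linN_of ((contr1_bil g).2 _)).
Qed.

Lemma Sop_near (D D' : R[i] -> tensor2 g) S (a : int -> g ^*) w (t : R) : 0 < t -> vhol D (- w) t ->
  (forall z, nc (z - - w) < t -> D z = D' z) -> Sop D S a w = Sop D' S a w.
Proof. by move=> t0 hD E; apply: eq_bigr => k _; rewrite (vtc_near k t0 hD E). Qed.

(** Weight zero, for all Taylor coefficients. *)
Lemma Sop_weight S (a : int -> g ^*) u w : 0 < nc w < rho -> u \in h ->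
  Sop (r q) S (fun m => adstar br u (a m)) w = br (Sop (r q) S a w) u.
Proof.
move=> wr uh; rewrite /Sop; apply/esym.
apply: (etrans (lin_sum_of ((br_bil Hlie).2 u) _ _ _)); apply: eq_bigr => k _; apply/esym.
have wr' : 0 < nc (- w) < rho by rewrite ncN.
have [T [H hm]] := polyb_MerR HG; have [t0 t00 vh0] := mer_tcvhol hm wr'.
pose t := Num.min t0 (Num.min (nc w) (rho - nc w)).
have t1 : 0 < t by rewrite !lt_min t00 subr_gt0.
have vh : vhol (r q) (- w) t.
  by apply: vhol_sub vh0 _; rewrite subrr nc0 add0r ge_min lexx.
rewrite -(vtc_lin k t1 ((contr1_bil g).2 _) vh).
have lb : linear (fun T : tensor2 g => br (contr1 T (a (- k.+1%:Z))) u).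
  by move=> c x y; rewrite ((contr1_bil g).2 _); exact: ((br_bil Hlie).2 u).
rewrite -[RHS](vtc_lin k t1 lb vh).
apply: (vtc_near k t1 (vhol_lin ((contr1_bil g).2 _) vh)) => z zt.
apply: (weight Hlie Hr HG) => //.
have : nc (z - - w) < nc w /\ nc (z - - w) < rho - nc w.
  by move: zt; rewrite /t !lt_min => /and3P[_ -> ->].
have := nc_sub_ge (- w) (- w - z); have -> : - w - (- w - z) = z by ring.
have := ncD (- w) (z - - w); have -> : - w + (z - - w) = z by ring.
by rewrite [nc (- w - z)]ncBC ncN => h1 h2 [h3 h4]; apply/andP; split; lra.
Qed.

Lemma Sop_DrN v S w : 0 < nc w < rho -> Sop (Dr r q (- v)) S A w = - Sop (Dr r q v) S A w.
Proof.
move=> wr; have wr' : 0 < nc (- w) < rho by rewrite ncN.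
have [T [H hm]] := Mer_DrR v; have [t0 t00 vh0] := mer_tcvhol hm wr'.
pose t := Num.min t0 (Num.min (nc w) (rho - nc w)).
have t1 : 0 < t by case/andP: wr => w0 w1; rewrite !lt_min t00 w0 subr_gt0.
have vh : vhol (Dr r q v) (- w) t.
  by apply: vhol_sub vh0 _; rewrite subrr nc0 add0r ge_min lexx.
rewrite -(SopN S A t1 vh); apply/esym; apply: (Sop_near _ _ t1).
  by apply: (vhol_lin (u := fun T : tensor2 g => - T)) vh => c x y; rewrite opprD scalerN.
move=> z zt; have zr : 0 < nc z < rho.
  have : nc (z - - w) < nc w /\ nc (z - - w) < rho - nc w.
    by move: zt; rewrite /t !lt_min => /and3P[_ -> ->].
  have := nc_sub_ge (- w) (- w - z); have -> : - w - (- w - z) = z by ring.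
  have := ncD (- w) (z - - w); have -> : - w + (z - - w) = z by ring.
  by rewrite [nc (- w - z)]ncBC ncN => h1 h2 [h3 h4]; apply/andP; split; lra.
by rewrite (linN_of (Dr_lin HG zr)).
Qed.

Lemma combine_key (x1 x2 x3 y sN sL bL : R[i]) : sN = - x1 -> sL = y + x2 -> bL = y + x3 ->
  x1 - x2 + x3 = - sN - sL + bL.
Proof. by move=> -> -> ->; ring. Qed.

Variable p : subvs_of h.
Local Notation Lx z := (vsval p + contr2 (r q z) xi).

(** The contribution of the Hamiltonian vector field to the value at w of the
    Lax operator, paired with b. *)
Lemma key S w (b : g ^*) : 0 < nc w < rho / 2 -> (forall m, m < - S%:Z -> A m = 0) ->
  (forall m, m < - S%:Z -> laurent_of (fun z => adstar br (Lx z) (lsum A z)) m = 0) ->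
  \sum_(i < \dim h) ((b (vsval (hbas i)) : R[i]) * dAq i - (b (contr2 (Dr r q (hdual i) w) xi) : R[i]) * dAp i)
    + \sum_(k < n) \sum_(j < n) (b (contr2 (r q w) (gdual k)) : R[i]) * dAxi j * (xi (br (e k) (e j)) : R[i])
  = - (b (Sop (Dr r q (- istar h xi)) S A w) : R[i])
    - (b (Sop (r q) S (laurent_of (fun z => adstar br (Lx z) (lsum A z))) w) : R[i])
    + (b (br (Sop (r q) S A w) (Lx w)) : R[i]).
Proof.
move=> wr2 AS aS; have rho0 := rho_gt0 HG.
have wr : 0 < nc w < rho by case/andP: wr2 => -> w2 /=; lra.
have mp : Mer (fun z => adstar br (vsval p) (lsum A z)) by apply: (Mer_lin ((adstar_bil Hlie).1 _)); exact: Laurent_Mer.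
have E m : laurent_of (fun z => adstar br (Lx z) (lsum A z)) m =
   adstar br (vsval p) (A m) + laurent_of (fun z => adstar br (contr2 (r q z) xi) (lsum A z)) m.
  have -> : (fun z => adstar br (Lx z) (lsum A z)) = fun z => adstar br (vsval p) (lsum A z) + adstar br (contr2 (r q z) xi) (lsum A z).
    by apply/funext => z; exact: (linD_of ((adstar_bil Hlie).2 _)).
  rewrite (lofD m mp Mer_adr); congr (_ + _).
  by rewrite (lof_lin m ((adstar_bil Hlie).1 _) (Laurent_Mer LA)) (lof_lsum LA).
have aS' m : m < - S%:Z -> laurent_of (fun z => adstar br (contr2 (r q z) xi) (lsum A z)) m = 0.
  by move=> mS; have := aS m mS; rewrite E AS // (lin0_of ((adstar_bil Hlie).1 _)) add0r.
rewrite -(key0 b wr2 AS aS').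
have eN := etrans (congr1 (fun y => b y : R[i]) (Sop_DrN (istar h xi) S wr)) (linearN b _).
have eL : Sop (r q) S (laurent_of (fun z => adstar br (Lx z) (lsum A z))) w =
    br (Sop (r q) S A w) (vsval p) + Sop (r q) S (laurent_of (fun z => adstar br (contr2 (r q z) xi) (lsum A z))) w.
  rewrite (funext E : laurent_of _ = _); apply: (etrans (SopD _ _ _ _ _)); congr (_ + _).
  exact: (Sop_weight _ _ wr (subvsP p)).
have eL' := etrans (congr1 (fun y => b y : R[i]) eL) (linearD b _ _).
have eB := etrans (congr1 (fun y => b y : R[i]) (linD_of ((br_bil Hlie).1 (Sop (r q) S A w)) (vsval p) (contr2 (r q w) xi))) (linearD b _ _).
exact: (combine_key eN eL' eB).
Qed.

End KeyResidue.


Section RestrictedDerivatives.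
Context {R : realType}.
Local Open Scope complex_scope.
Local Notation C := (Num.NumField.sort (R[i] : numFieldType)).

Lemma cderivD (V : vectType R[i]) (D : set C) (F G : R[i] -> V) t v w :
  is_deriv_in D F t v -> is_deriv_in D G t w -> is_deriv_in D (fun s => F s + G s) t (v + w).
Proof.
move=> /is_deriv_inP H /is_deriv_inP H'; apply/is_deriv_inP => e e0.
have e2 : 0 < e / 2 by lra.
have [d d0 Hd] := H _ e2; have [d' d'0 Hd'] := H' _ e2.
exists (Num.min d d') => [|s Ds]; first by rewrite lt_min d0.
rewrite lt_min => /andP[sd sd'].
have -> : F s + G s - (F t + G t) - (s - t) *: (v + w) = (F s - F t - (s - t) *: v) + (G s - G t - (s - t) *: w).
  by rewrite scalerDr !opprD [RHS]addrACA [F s - F t + _]addrACA.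
apply: le_trans (vnD _ _) _.
have := Hd s Ds sd; have := Hd' s Ds sd'; have -> : e * nc (s - t) = e / 2 * nc (s - t) + e / 2 * nc (s - t) by rewrite -mulrDl; congr (_ * _); lra.
by move=> h1 h2; exact: lerD.
Qed.

Lemma deriv_cst (V : vectType R[i]) (D : set C) (v : V) t : is_deriv_in D (fun=> v) t 0.
Proof.
apply/is_deriv_inP => e e0; exists 1 => // s _ _; rewrite scaler0 subrr subr0 vn0.
by apply: mulr_ge0; [exact: ltW|exact: nc_ge0].
Qed.

Lemma deriv_sum (V : vectType R[i]) (D : set C) (I : Type) (s : seq I) (F : I -> R[i] -> V) t (v : I -> V) :
  (forall i, is_deriv_in D (F i) t (v i)) ->
  is_deriv_in D (fun u => \sum_(i <- s) F i u) t (\sum_(i <- s) v i).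
Proof.
move=> h; elim: s => [|a s IH].
  rewrite big_nil; have -> : (fun u => \sum_(i <- [::]) F i u) = fun=> 0 by apply/funext => u; rewrite big_nil.
  exact: deriv_cst.
rewrite big_cons; have -> : (fun u => \sum_(i <- a :: s) F i u) = fun u => F a u + \sum_(i <- s) F i u.
  by apply/funext => u; rewrite big_cons.
exact: (cderivD (h a) IH).
Qed.

Lemma deriv_nearD (V : vectType R[i]) (D : set C) (F G : R[i] -> V) t v (r : R) : 0 < r -> D t ->
  (forall s, D s -> nc (s - t) < r -> F s = G s) -> is_deriv_in D F t v -> is_deriv_in D G t v.
Proof.
move=> r0 Dt FG /is_deriv_inP H; apply/is_deriv_inP => e e0; have [d d0 Hd] := H e e0.
exists (Num.min d r) => [|s Ds]; first by rewrite lt_min d0.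
rewrite lt_min => /andP[sd sr]; rewrite -(FG s Ds sr) -(FG t Dt) ?subrr ?nc0 //; exact: Hd.
Qed.

Lemma deriv_contD (V : vectType R[i]) (D : set C) (F : R[i] -> V) t v : is_deriv_in D F t v ->
  forall e : R, 0 < e -> exists2 d : R, 0 < d & forall s, D s -> nc (s - t) < d -> vn (F s - F t) < e.
Proof.
move=> /is_deriv_inP H e e0; have [d d0 Hd] := H 1 ltr01; have v0 := vn_ge0 v.
exists (Num.min d (e / (1 + vn v))) => [|s Ds].
  by rewrite lt_min d0 divr_gt0 //; lra.
rewrite lt_min => /andP[sd]; rewrite ltr_pdivlMr; last lra.
move=> se; have := Hd s Ds sd.
rewrite -{2}[F s - F t](subrK ((s - t) *: v)) => h1.
apply: le_lt_trans (vnD _ _) _; rewrite vnZ; lra.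
Qed.

Lemma bil_bound (V W U : vectType R[i]) (B : V -> W -> U) : bil B ->
  exists2 M : R, 0 < M & forall x y, vn (B x y) <= M * vn x * vn y.
Proof.
move=> bB; exists (1 + \sum_(i < \dim {:V}) \sum_(j < \dim {:W}) vn (B (vbasis {:V})`_i (vbasis {:W})`_j)).
  by apply: ltr_pwDl => //; apply: sumr_ge0 => i _; apply: sumr_ge0 => j _; exact: vn_ge0.
have vsum (I : Type) (s : seq I) (F : I -> U) : vn (\sum_(i <- s) F i) <= \sum_(i <- s) vn (F i).
  elim: s => [|a s IH]; first by rewrite !big_nil vn0.
  by rewrite !big_cons; apply: le_trans (vnD _ _) _; rewrite lerD2l.
move=> x y; rewrite (bilE bB x y) -mulrA mulrDl.
have xy0 : 0 <= vn x * vn y by apply: mulr_ge0; exact: vn_ge0.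
apply: ler_wpDl; first by rewrite mul1r.
rewrite mulr_suml; apply: le_trans (vsum _ _ _) _; apply: ler_sum => i _.
rewrite mulr_suml; apply: le_trans (vsum _ _ _) _; apply: ler_sum => j _.
rewrite vnZ mulrC ncM; apply: ler_wpM2l; first exact: vn_ge0.
by apply: ler_pM; rewrite ?nc_ge0 ?vn_ge.
Qed.

Lemma deriv_bil (V W U : vectType R[i]) (B : V -> W -> U) (D : set C) F G t v w : bil B ->
  is_deriv_in D F t v -> is_deriv_in D G t w ->
  is_deriv_in D (fun s => B (F s) (G s)) t (B v (G t) + B (F t) w).
Proof.
move=> bB; have [M M0 HM] := bil_bound bB.
have b1 := bB.1; have b2 := bB.2.
move=> hF hG; have /is_deriv_inP HF := hF; have /is_deriv_inP HG := hG.
apply/is_deriv_inP => e e0.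
have v0 := vn_ge0 v; have f0 := vn_ge0 (F t); have g0 := vn_ge0 (G t).
pose e1 := e / 3 / (M * (1 + vn (G t))); pose e2 := e / 3 / (M * (1 + vn v)); pose e3 := e / 3 / (M * (1 + vn (F t))).
have pos a : 0 <= a -> 0 < M * (1 + a) by move=> a0; apply: mulr_gt0 => //; lra.
have e30 : 0 < e / 3 by lra.
have [p1 p2 p3] : [/\ 0 < e1, 0 < e2 & 0 < e3] by split; apply: divr_gt0 => //; exact: pos.
have [d1 d10 H1] := HF e1 p1; have [d2 d20 H2] := deriv_contD hG p2; have [d3 d30 H3] := HG e3 p3.
have [d4 d40 H4] := deriv_contD hG ltr01.
exists (Num.min (Num.min d1 d2) (Num.min d3 d4)) => [|s Ds]; first by rewrite !lt_min d10 d20 d30.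
rewrite !lt_min => /andP[/andP[s1 s2] /andP[s3 s4]].
have {}H1 := H1 s Ds s1; have {}H2 := H2 s Ds s2; have {}H3 := H3 s Ds s3; have {}H4 := H4 s Ds s4.
set k := nc (s - t) in H1 H3 *; have k0 : 0 <= k by exact: nc_ge0.
have E : B (F s) (G s) - B (F t) (G t) - (s - t) *: (B v (G t) + B (F t) w) =
   B (F s - F t - (s - t) *: v) (G s) + (s - t) *: B v (G s - G t) + B (F t) (G s - G t - (s - t) *: w).
  have X1 y : B (F s - F t - (s - t) *: v) y = B (F s) y - B (F t) y - (s - t) *: B v y.
    have a1 := linB_of (b2 y) (F s - F t) ((s - t) *: v); have a2 := linB_of (b2 y) (F s) (F t).
    by have a3 := linZ_of (b2 y) (s - t) v; rewrite /= in a1 a2 a3; rewrite a1 a2 a3.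
  rewrite X1 !(linB_of (b1 _)) (linZ_of (b1 _)) scalerDr scalerBr.
  move: (B (F s) (G s)) (B (F t) (G t)) (B (F t) (G s)) (_ *: B v (G s)) (_ *: B v (G t)) (_ *: B (F t) w) => a b c x y z.
  apply: cd_inj => i; have lc := @cd_lin R U i.
  by rewrite !(linD_of lc, linN_of lc); ring.
rewrite E; apply: le_trans (vnD _ _) _; apply: le_trans (lerD (vnD _ _) (lexx _)) _.
have h1 : vn (B (F s - F t - (s - t) *: v) (G s)) <= e / 3 * k.
  apply: le_trans (HM _ _) _.
  have gs : vn (G s) <= 1 + vn (G t).
    by rewrite -{1}[G s](subrK (G t)); apply: le_trans (vnD _ _) _; rewrite lerD2r ltW.
  apply: (@le_trans _ _ (M * (e1 * k) * (1 + vn (G t)))).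
    apply: ler_pM => //; [apply: mulr_ge0; [exact: ltW|exact: vn_ge0]|exact: vn_ge0|].
    by apply: ler_wpM2l => //; exact: ltW.
  have -> : M * (e1 * k) * (1 + vn (G t)) = e1 * (M * (1 + vn (G t))) * k by ring.
  by rewrite /e1 divfK ?lexx // lt0r_neq0 // pos.
have h2 : vn ((s - t) *: B v (G s - G t)) <= e / 3 * k.
  rewrite vnZ -/k mulrC; apply: ler_wpM2r => //; apply: le_trans (HM _ _) _.
  apply: (@le_trans _ _ (M * (1 + vn v) * e2)).
    apply: ler_pM => //; [apply: mulr_ge0; [exact: ltW|exact: vn_ge0]|exact: vn_ge0| |exact: ltW].
    by apply: ler_wpM2l; [exact: ltW|lra].
  by rewrite /e2 mulrC divfK ?lexx // lt0r_neq0 // pos.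
have h3 : vn (B (F t) (G s - G t - (s - t) *: w)) <= e / 3 * k.
  apply: le_trans (HM _ _) _.
  apply: (@le_trans _ _ (M * (1 + vn (F t)) * (e3 * k))).
    apply: ler_pM => //; [apply: mulr_ge0; [exact: ltW|exact: vn_ge0]|exact: vn_ge0|].
    by apply: ler_wpM2l; [exact: ltW|lra].
  by rewrite mulrA; apply: ler_wpM2r => //; rewrite /e3 mulrC divfK ?lexx // lt0r_neq0 // pos.
lra.
Qed.

Lemma lin_holo (V W : vectType R[i]) (u : V -> W) x : linear u -> holo_at u x.
Proof.
move=> lu; apply/mn_near; exists 1 => // k _.
apply: lin_differentiable => a c c'.
by rewrite (@uncrd_lin _ V) lu (@crd_lin _ W).
Qed.

Lemma deriv_cds (V : vectType R[i]) (D : set C) (F : R[i] -> V) t v :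
  (forall i, is_deriv_in D (fun s => cd i (F s) : (R[i])^o) t (cd i v : (R[i])^o)) -> is_deriv_in D F t v.
Proof.
move=> H; rewrite (cd_sum v).
have -> : F = fun s => \sum_(i < \dim {:V}) cd i (F s) *: (vbasis {:V})`_i by apply/funext => s; exact: cd_sum.
apply: (deriv_sum (F := fun (i : 'I_(\dim {:V})) s => cd i (F s) *: (vbasis {:V})`_i)) => i.
apply: (deriv_lin (u := fun y : (R[i])^o => y *: (vbasis {:V})`_i) _ (H i)).
by move=> a x y; rewrite scalerDl scalerA.
Qed.

End RestrictedDerivatives.


Section LaxEquation.
Context {R : realType}.
Local Open Scope complex_scope.
Local Notation C := (Num.NumField.sort (R[i] : numFieldType)).
Variable g : vectType R[i].
Local Notation "g ^*" := 'Hom(g, (R[i])^o) : type_scope.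
Local Notation e i := (vbasis {:g})`_i.
Local Notation n := (\dim {:g}).
Variables (br : g -> g -> g) (form : g -> g -> (R[i])^o) (h : {vspace g}).
Local Notation hstar := 'Hom(subvs_of h, (R[i])^o).
Variable r : hstar -> R[i] -> tensor2 g.
Hypotheses (Hlie : is_lie_bracket br) (Hinv : is_invariant_form br form)
  (Hnd : nondegenerate_on fullv form) (Hr : classical_dynamical_r_matrix br form r).
Variables (f : (int -> g) -> R[i]) (x : phase h) (G : (hstar * (R[i])^o)%type -> tensor2 g) (rho M : R).
Hypotheses (sf : lsmooth f) (HG : polyb r x.1.1 G rho M).
Local Notation q := x.1.1.
Local Notation p := x.1.2.
Local Notation xi := x.2.
Local Notation A := (ldiff f (Lmap r x)).
Local Notation H := (f \o Lmap r : phase h -> (R[i])^o).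

Lemma LA : Laurent A. Proof. exact: A_Laurent sf HG. Qed.

Lemma raise_ad A0 y : adstar br y A0 = 0 -> br (raise form A0) y = 0.
Proof.
move=> E; rewrite (brC Hlie); apply: (form_inj Hinv Hnd) => w.
rewrite (linN_of (form_linl Hinv w)) (lin0_of (form_linl Hinv w)).
have [_ _ I] := Hinv; have /eqP := I y (raise form A0) w; rewrite addr_eq0 => /eqP ->.
by rewrite (form_raise Hinv Hnd) -(adstarE Hlie) E zero_lfunE !oppr0.
Qed.

Lemma Mer_ad : Mer (fun z => adstar br (laxf r x z) (lsum A z)).
Proof.
apply: (Mer_bil (adstar_bil Hlie)); last exact: (Laurent_Mer LA).
by eexists; eexists; eexists; exact: (Lmap_mer HG).
Qed.

Lemma ladstarE : ladstar br (Lmap r x) A = laurent_of (fun z => adstar br (laxf r x z) (lsum A z)).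
Proof.
apply/esym; apply: lof_near; first exact: Mer_ad.
  apply: (Mer_bil (adstar_bil Hlie)); last exact: (Laurent_Mer LA).
  exact: (Laurent_Mer (Lmap_Laurent HG)).
by exists rho => [|z zr]; [exact: rho_gt0 HG|rewrite (Lmap_sum HG zr)].
Qed.

(** The Hamiltonian vector at x, read off from the bracket. *)
Definition hamv : phase h :=
  \sum_(i < \dim h) (dAq r q A xi i *: ((0, hbas i, 0) : phase h) - dAp A i *: ((hdual i, 0, 0) : phase h))
  + \sum_(i < n) \sum_(j < n) (dAxi r q A j * (xi (br (e i) (e j)) : R[i])) *: ((0, 0, gdual i) : phase h).

Lemma aux2 (a u a' u' : R[i]) : u' = u -> a' = a -> a * u = u' * a'.
Proof. by move=> -> ->; rewrite mulrC. Qed.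
Lemma aux3 (a y u a' u' : R[i]) : u' = u -> a' = a -> (a * y) * u = u' * a' * y.
Proof. by move=> -> ->; rewrite mulrC mulrA. Qed.

Lemma hamv_lin (u : phase h -> (R[i])^o) : linear u -> u hamv = pbracket br u H x.
Proof.
move=> lu; have du v : dirder u x v = u v := dirder_frechet v (frechet_lin x lu).
rewrite /hamv (linD_of lu) !(lin_sum_of lu) /pbracket; congr (_ + _).
  apply: eq_bigr => i _; apply: (etrans (linB_of lu _ _)).
  exact: (f_equal2 (fun s t : R[i] => s - t)
    (etrans (linZ_of lu _ _) (aux2 (du (0, hbas i, 0)) (dirder_q sf HG (hdual i))))
    (etrans (linZ_of lu _ _) (aux2 (du (hdual i, 0, 0)) (dirder_p sf HG (hbas i))))).
apply: eq_bigr => i _; rewrite (lin_sum_of lu); apply: eq_bigr => j _.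
apply: (etrans (linZ_of lu _ _)).
exact: (aux3 _ (du (0, 0, gdual i)) (dirder_xi sf HG (gdual j))).
Qed.

Definition dlax (w : R[i]) (v : phase h) : g :=
  vsval v.1.2 + (contr2 (Dr r q v.1.1 w) xi + contr2 (r q w) v.2).

Lemma dlax_lin w : 0 < nc w < rho -> linear (dlax w).
Proof.
move=> wr a u v; rewrite /dlax.
have l1 := Dr_lin HG wr; have c1 := (contr2_bil g).1; have c2 := (contr2_bil g).2.
have -> : Dr r q (a *: u + v).1.1 w = a *: Dr r q u.1.1 w + Dr r q v.1.1 w := l1 a u.1.1 v.1.1.
have -> : contr2 (r q w) (a *: u + v).2 = a *: contr2 (r q w) u.2 + contr2 (r q w) v.2 := c1 (r q w) a u.2 v.2.
have -> : contr2 (a *: Dr r q u.1.1 w + Dr r q v.1.1 w) xi = a *: contr2 (Dr r q u.1.1 w) xi + contr2 (Dr r q v.1.1 w) xi := c2 xi a _ _.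
have -> : vsval (a *: u + v).1.2 = a *: vsval u.1.2 + vsval v.1.2 by [].
rewrite !scalerDr [RHS]addrACA; congr (_ + _); exact: addrACA.
Qed.

Lemma dlax_hamv S w : 0 < nc w < rho / 2 -> (forall m, m < - S%:Z -> A m = 0) ->
  (forall m, m < - S%:Z -> ladstar br (Lmap r x) A m = 0) ->
  dlax w hamv = - Sop (Dr r q (- istar h xi)) S A w - Sop (r q) S (ladstar br (Lmap r x) A) w
    + br (Sop (r q) S A w) (laxf r x w).
Proof.
move=> wr2 AS aS; have rho0 := rho_gt0 HG.
have wr : 0 < nc w < rho by case/andP: wr2 => -> w2 /=; lra.
have ll := dlax_lin wr.
apply: cd_inj => i; pose b : g ^* := linfun (cd i : g -> (R[i])^o).
have bE y : cd i y = b y by rewrite /b linfunE //; exact: cd_lin.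
have bR s1 s2 s3 : b (- s1 - s2 + s3) = - (b s1 : R[i]) - (b s2 : R[i]) + (b s3 : R[i]) :> R[i].
  by rewrite linearD linearB linearN.
have aS' m : m < - S%:Z -> laurent_of (fun z => adstar br (vsval p + contr2 (r q z) xi) (lsum A z)) m = 0.
  by move=> /aS; rewrite ladstarE.
rewrite ladstarE !bE; apply: (etrans _ (esym (bR _ _ _))).
apply: (etrans _ (key Hlie Hr HG LA b wr2 AS aS')).
have lb : linear (b : g -> (R[i])^o) := hom_linear b.
have d1 k : dlax w (0, hbas k, 0) = vsval (hbas k).
  by rewrite /dlax /= (lin0_of (Dr_lin HG wr)) (lin0_of ((contr2_bil g).2 xi)) (lin0_of ((contr2_bil g).1 _)) !addr0.
have d2 k : dlax w (hdual k, 0, 0) = contr2 (Dr r q (hdual k) w) xi.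
  by rewrite /dlax /= (lin0_of ((contr2_bil g).1 _)) addr0 add0r.
have d3 k : dlax w (0, 0, gdual k) = contr2 (r q w) (gdual k).
  by rewrite /dlax /= (lin0_of (Dr_lin HG wr)) (lin0_of ((contr2_bil g).2 xi)) !add0r.
pose u (v : phase h) : (R[i])^o := b (dlax w v).
have lu : linear u by move=> a v v'; rewrite /u ll lb.
have d1' k : u (0, hbas k, 0) = b (vsval (hbas k)) := congr1 b (d1 k).
have d2' k : u (hdual k, 0, 0) = b (contr2 (Dr r q (hdual k) w) xi) := congr1 b (d2 k).
have d3' k : u (0, 0, gdual k) = b (contr2 (r q w) (gdual k)) := congr1 b (d3 k).
rewrite -[b (dlax w hamv)]/(u hamv); clearbody u.
rewrite /hamv (linD_of lu) !(lin_sum_of lu); congr (_ + _).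
  apply: eq_bigr => k _; apply: (etrans (linB_of lu _ _)).
  exact: (f_equal2 (fun s t : R[i] => s - t)
    (etrans (linZ_of lu _ _) (aux2 (esym (d1' k)) erefl)) (etrans (linZ_of lu _ _) (aux2 (esym (d2' k)) erefl))).
apply: eq_bigr => k _; rewrite (lin_sum_of lu); apply: eq_bigr => j _.
apply: (etrans (linZ_of lu _ _)); exact: (aux3 _ (esym (d3' k)) erefl).
Qed.

End LaxEquation.


Section PartTwo.
Context {R : realType}.
Local Open Scope complex_scope.
Local Notation C := (Num.NumField.sort (R[i] : numFieldType)).
Variable g : vectType R[i].
Local Notation "g ^*" := 'Hom(g, (R[i])^o) : type_scope.
Variables (br : g -> g -> g) (form : g -> g -> (R[i])^o) (h : {vspace g}).
Local Notation hstar := 'Hom(subvs_of h, (R[i])^o).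
Variable r : hstar -> R[i] -> tensor2 g.
Hypotheses (Hlie : is_lie_bracket br) (Hinv : is_invariant_form br form)
  (Hnd : nondegenerate_on fullv form) (Hr : classical_dynamical_r_matrix br form r).

Lemma lof0 (V : vectType R[i]) : laurent_of (fun=> 0 : V) = fun=> 0.
Proof.
have z0 : linear (fun _ : V => 0 : V) by move=> a x y; rewrite scaler0 addr0.
by apply/funext => m; rewrite (lof_lin m z0 (Mer_cst (0 : V))).
Qed.

Lemma Sop0 (D : R[i] -> tensor2 g) S w : Sop D S (fun=> 0) w = 0.
Proof. by rewrite /Sop big1 // => k _; rewrite (lin0_of ((contr1_bil g).1 _)). Qed.

(** The right-hand side of the Lax equation as a function of z. *)
Lemma laxrhs x (A : int -> g ^*) S G (rho M : R) : polyb r x.1.1 G rho M -> Laurent A ->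
  (forall m, m < - S%:Z -> A m = 0) ->
  exists2 t : R, 0 < t & t <= rho / 2 /\ forall z, 0 < nc z < t ->
   lsum (lbr br (Rop form r x.1.1 A) (Lmap r x) - dRop form r (x.1.1, - istar h x.2) A) z
   = br (Ropf form r x.1.1 S A z) (laxf r x z) - Sop (Dr r x.1.1 (- istar h x.2)) S A z.
Proof.
move=> HG LA AS; have rho0 := rho_gt0 HG.
have [ra ra0 ha] := Mer_MerR (Laurent_Mer LA).
have r2 : 0 < rho / 2 by lra.
have [t [t0 t1 t2]] := small2 r2 ra0.
have tr : t <= rho by lra.
have hr : MerR (r x.1.1) t := MerR_shrink (polyb_MerR HG) t0 tr.
have ha' := MerR_shrink ha t0 (ltW t2).
have mR := Ropf_MerR Hinv Hnd S t0 hr ha'.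
have mL : MerR (laxf r x) t.
  by apply: (@MerR_shrink _ _ _ rho) => //; eexists; eexists; exact: (Lmap_mer HG).
have mF1 := MerR_bil (br_bil Hlie) mR mL.
have mF2 : MerR (Sop (Dr r x.1.1 (- istar h x.2)) S A) t.
  by apply: Sop_MerR => //; exact: (MerR_shrink (Mer_DrR HG _) t0 tr).
have E1 : lbr br (Rop form r x.1.1 A) (Lmap r x) = laurent_of (fun z => br (Ropf form r x.1.1 S A z) (laxf r x z)).
  apply/esym; apply: lof_near.
  - exact: MerR_Mer mF1.
  - apply: (Mer_bil (br_bil Hlie)); apply: Laurent_Mer.
      by rewrite (Rop_eq Hinv Hnd t0 hr ha' AS); exact: lof_Laurent (MerR_Mer mR).
    exact: Lmap_Laurent HG.
  exists t => // z zt; rewrite (Rop_sum Hinv Hnd t0 hr ha' AS zt) (Lmap_sum HG) //.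
  by case/andP: zt => -> zt /=; exact: lt_le_trans zt tr.
have ln : linear (fun y : g => - y) by move=> a u v; rewrite opprD scalerN.
have mN := MerR_lin ln mF2.
have E : lbr br (Rop form r x.1.1 A) (Lmap r x) - dRop form r (x.1.1, - istar h x.2) A =
   laurent_of (fun z => br (Ropf form r x.1.1 S A z) (laxf r x z) + - Sop (Dr r x.1.1 (- istar h x.2)) S A z).
  apply/funext => m; rewrite (lofD m (MerR_Mer mF1) (MerR_Mer mN)) (lof_lin m ln (MerR_Mer mF2)).
  by rewrite -E1 -(dRop_eq Hinv Hnd _ HG LA AS).
exists t => //; split; first exact: ltW.
move=> z zt; rewrite E; exact: (lsum_lofR (MerR_D mF1 mN) zt).
Qed.

Theorem part2 (f : (int -> g) -> R[i]) : ad_invariant br f ->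
  forall (D : set R[i]) (phi : R[i] -> phase h),
   hamiltonian_flow br (nonpole_phase r) (f \o Lmap r) D phi ->
   forall t, D t ->
   let L := Lmap r (phi t) in
   let df := ldiff f L in
   is_lderiv_in D (fun s => Lmap r (phi s)) t
     (lbr br (Rop form r (mproj (phi t)) df) L - dRop form r (tau (phi t)) df).
Proof.
move=> [sf finv] D phi Hflow t Dt L df.
have [npt Hd] := Hflow t Dt.
set x := phi t in L df npt Hd *.
have [G [rho [M HG]]] := nonpole_polyb npt.
have rho0 := rho_gt0 HG.
have LAd : Laurent df := LA sf HG.
have [S [HA [ra [hA dfE]]]] := Laurent_mer LAd.
have AS m : m < - S%:Z -> df m = 0 by move=> mS; rewrite dfE coefs_lt.
have lad0 : ladstar br L df = fun=> 0 by apply: finv; exact: Lmap_Laurent HG.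
have [t1 t10 [t1r Y]] := laxrhs HG LAd AS.
have Dphi : is_deriv_in (D : set C) phi t (hamv br r f x).
  apply: deriv_cds => i.
  have lc := @cd_lin R (phase h) i.
  have := Hd (cd i : phase h -> (R[i])^o) (fun y _ => lin_holo y lc).
  by rewrite -(hamv_lin br sf HG lc).
have Mad := Mer_ad Hlie sf HG.
have [r0 r00 Hr0] := lsum_lof Mad.
have [r1 r10 Hr1] := lsum_lof (Mer_cst (0 : 'Hom(g, (R[i])^o))).
have zero z : 0 < nc z < r0 -> 0 < nc z < r1 -> adstar br (laxf r x z) (lsum df z) = 0.
  move=> z0 z1; rewrite -(Hr0 z z0) -(ladstarE Hlie sf HG) -/L -/df lad0 -lof0; exact: Hr1.
have [c1 [c10 c11 c12]] := small2 t10 r00; have [c [c0 ca cb]] := small2 c10 r10.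
exists (c%:C); first by rewrite ltcR.
move=> z; rewrite annulusC => /andP[z0 zc].
have zt1 : 0 < nc z < t1 by rewrite z0 /= (lt_trans zc (lt_trans ca c11)).
have zr0 : 0 < nc z < r0 by rewrite z0 /= (lt_trans zc (lt_trans ca c12)).
have zr1 : 0 < nc z < r1 by rewrite z0 /= (lt_trans zc cb).
have z2 : 0 < nc z < rho / 2 by case/andP: zt1 => _ zt1; rewrite z0 /= (lt_le_trans zt1 t1r).
have zr : 0 < nc z < rho by rewrite z0 /=; case/andP: z2 => _ z2; lra.
have lq : linear (fun v : phase h => v.1.1) by [].
have lp : linear (fun v : phase h => vsval v.1.2) by move=> a u v.
have lx : linear (fun v : phase h => v.2) by [].
have dq := deriv_lin lq Dphi; have dp := deriv_lin lp Dphi; have dx := deriv_lin lx Dphi.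
have dr' : is_deriv_in (D : set C) (fun s => r (phi s).1.1 z) t (Dr r x.1.1 (hamv br r f x).1.1 z).
  exact: (deriv_chain dq (r_frechet HG zr)).
have dL := cderivD dp (deriv_bil (contr2_bil g) dr' dx).
have [d d0 Hdd] := deriv_contD dq rho0.
apply: (@deriv_nearD _ _ _ (fun s => laxf r (phi s) z) _ _ _ d d0 Dt) => [s Ds sd|].
  have vr := Hdd s Ds sd.
  have qE : (phi s).1.1 = x.1.1 + ((phi s).1.1 - x.1.1) by rewrite addrC subrK.
  have := r_mer HG vr; rewrite /= -qE => hm.
  by rewrite (lsum_lof_mer (Lmap_mer1 hm) zr).
have aS m : m < - S%:Z -> ladstar br (Lmap r x) (ldiff f (Lmap r x)) m = 0 by rewrite lad0.
have K := dlax_hamv Hlie Hr sf HG z2 AS aS.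
have EY : lsum (lbr br (Rop form r (mproj x) df) L - dRop form r (tau x) df) z = dlax r x z (hamv br r f x).
  rewrite (Y z zt1) K lad0 Sop0 subr0 addrC; congr (_ + _).
  rewrite /Ropf; apply: (etrans (linD_of ((br_bil Hlie).2 (laxf r x z)) _ _)).
  rewrite (linZ_of ((br_bil Hlie).2 (laxf r x z))) (raise_ad Hlie Hinv Hnd (zero z zr0 zr1)).
  by rewrite scaler0 add0r.
rewrite EY; exact: dL.
Qed.

End PartTwo.


Section TaylorOfTaylor.
Context {R : realType}.
Local Open Scope complex_scope.
Implicit Types (F : R[i] -> R[i]).

Lemma tc_inv (c : R[i]) k : c != 0 -> tc (fun z => z^-1) c k = (-1) ^+ k * c ^- k.+1.
Proof.
move=> c0; rewrite -tc_shift; have ncpos : 0 < nc c by rewrite nc_gt0.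
have hF : hol (fun z => (c + z)^-1) 0 (nc c).
  move=> z; rewrite subr0 => zc; have cz : c + z != 0.
    by rewrite -nc_gt0; have := nc_sub_ge c (- z); rewrite opprK ncN; lra.
  eexists; have := @hd_aff R (fun w => w^-1) z _ c 1; rewrite mul1r => /(_ _ (hdV cz)).
  by apply: hd_ext => w; rewrite mul1r.
have hid : hol (fun z : R[i] => z) 0 (nc c) by move=> z _; exists 1; exact: hd_id.
have E k' : c * tc (fun z => (c + z)^-1) 0 k' + (if k' is k''.+1 then tc (fun z => (c + z)^-1) 0 k'' else 0) = (k' == 0%N)%:R.
  rewrite -(tcZ _ _ ncpos hF) -(tc_mulX _ ncpos hF) -(tcD _ ncpos (holZ _ hF) (holM hid hF)).
  rewrite (tc_eq (a := fun k => (k == 0%N)%:R) ncpos) // => w wc; rewrite add0r.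
  have cw : c + w != 0.
    by rewrite -nc_gt0; have := nc_sub_ge c (- w); rewrite opprK ncN; lra.
  rewrite -mulrDl divff // => e e0; exists 1%N => [[//|m]] _.
  rewrite big_ord_recl big1 => [|i _]; last by rewrite /= mul0r.
  by rewrite eqxx mul1r expr0 addr0 subrr nc0 ltW.
elim: k => [|k IH].
  by have := E 0%N; rewrite addr0 expr0 mul1r expr1 => /(congr1 (fun x => c^-1 * x)); rewrite mulKf // mulr1.
have := E k.+1; rewrite IH => /eqP; rewrite addr_eq0 => /eqP /(congr1 (fun x => c^-1 * x)).
rewrite mulKf // => ->; rewrite [in RHS]exprS [c ^+ k.+2]exprS invfM; ring.
Qed.

Definition tcc m k : R[i] := (m + k)`!%:R / (m`!%:R * k`!%:R).

Lemma tcc_sym m k : tcc m k = tcc k m.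
Proof. by rewrite /tcc addnC mulrC [k`!%:R * _]mulrC mulrC. Qed.

Lemma hol_iter F c (r : R) k : hol F c r -> hol (iter k (@dC R) F) c r.
Proof. by move=> h; elim: k => //= k IH; exact: hol_dC_hol. Qed.

(** Taylor coefficients at 0 of a Taylor coefficient, as a function of the
    centre. *)
Lemma tc_tc F (r : R) k m : 0 < r -> hol F 0 r ->
  hol (fun w => tc F w k) 0 r /\ tc (fun w => tc F w k) 0 m = tcc m k * tc F 0 (m + k).
Proof.
move=> r0 hF.
have f0 j : (j`!%:R : R[i]) != 0 by rewrite pnatr_eq0 -lt0n fact_gt0.
have hI := hol_iter k hF.
have E w : nc (w - 0) < r -> (k`!%:R)^-1 * iter k (@dC R) F w = tc F w k.
  rewrite subr0 => wr; have rw : 0 < r - nc w by rewrite subr_gt0.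
  rewrite -(tc_iter k rw) ?mulKf //; apply: hol_sub hF _; rewrite subr0; lra.
split.
  move=> z zr; have [l hl] := holZ (k`!%:R)^-1 hI zr; exists l.
  apply: (@hd_near R (fun w => (k`!%:R)^-1 * iter k (@dC R) F w) _ z l (r - nc (z - 0))) => //; first by rewrite subr_gt0.
  move=> w wz; apply: E; have -> : w - 0 = (w - z) + (z - 0) by ring.
  by apply: le_lt_trans (ncD _ _) _; rewrite -ltrBrDr.
rewrite -(tc_ext r0 (holZ _ hI) E) (tcZ _ _ r0 hI).
have T : m`!%:R * tc (iter k (@dC R) F) 0 m = (m + k)`!%:R * tc F 0 (m + k).
  by rewrite (tc_iter m r0 hI) -iterD (tc_iter _ r0 hF).
have -> : tc (iter k (@dC R) F) 0 m = (m`!%:R)^-1 * ((m + k)`!%:R * tc F 0 (m + k)) by rewrite -T mulKf.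
by rewrite /tcc; field; rewrite !f0.
Qed.

Lemma tc_neg F (r : R) m : 0 < r -> hol F 0 r -> hol (fun w => F (- w)) 0 r /\ tc (fun w => F (- w)) 0 m = (-1) ^+ m * tc F 0 m.
Proof.
move=> r0 hF; split.
  move=> z; rewrite subr0 => zr; have [|l hl] := hF (- z); first by rewrite subr0 ncN.
  exists (- l); have := @hd_aff R F z l 0 (-1); rewrite add0r !mulN1r => /(_ hl).
  by apply: hd_ext => w; rewrite add0r mulN1r.
rewrite (tc_eq (a := fun m => (-1) ^+ m * tc F 0 m) r0) // => w wr; rewrite add0r.
have wr' : nc (- w) < r by rewrite ncN.
have := tcP hF wr'; rewrite add0r; apply: clim_ext => N; apply: eq_bigr => j _.
by rewrite [(- w) ^+ j]exprNn; ring.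
Qed.

End TaylorOfTaylor.


Section Skew.
Context {R : realType}.
Local Open Scope complex_scope.
Variable g : vectType R[i].
Local Notation "g ^*" := 'Hom(g, (R[i])^o) : type_scope.
Local Notation e i := (vbasis {:g})`_i.
Local Notation n := (\dim {:g}).

Lemma vhol_peel (V : vectType R[i]) (H : R[i] -> V) (r : R) : 0 < r -> vhol H 0 r ->
  exists2 H1, vhol H1 0 r & forall z, nc z < r -> H z = vtc H 0 0 + z *: H1 z.
Proof.
move=> r0 hH.
have /choice [F HF] : forall i : 'I_(\dim {:V}), exists F : R[i] -> R[i],
    hol F 0 r /\ forall z, nc z < r -> cd i (H z) = tc (fun z => cd i (H z)) 0 0 + z * F z.
  by move=> i; have [F [h1 _ h2]] := hol_peel r0 (hH _ (@cd_lin _ V i)); exists F.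
pose H1 z : V := \sum_(i < \dim {:V}) F i z *: (vbasis {:V})`_i.
have cdH i z : cd i (H1 z) = F i z by rewrite /cd coord_sum_free //; exact: basis_free (vbasisP _).
exists H1 => [|z zr].
  apply: vhol_cd => // i; have -> : (fun z => cd i (H1 z)) = F i by apply/funext => z; rewrite cdH.
  by case: (HF i).
apply: cd_inj => i; have lc := @cd_lin R V i; rewrite (linD_of lc) (linZ_of lc) cdH (cd_vtc _ _ r0 hH).
by case: (HF i) => _; apply.
Qed.

Lemma hom_swap (a b : g ^*) T : a (contr2 T b) = b (contr1 T a) :> R[i].
Proof. by rewrite hom_contr1 hom_contr2; apply: lsc_eq => i j; rewrite mulrC. Qed.

(** Pairing with a holomorphic function only sees the principal part. *)
Lemma res_hol (B : int -> g ^*) H S (s : R) (K : R[i] -> g) (t : R) : mer (lsum B) S H s -> 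
  (forall m, m < - S%:Z -> B m = 0) -> Laurent B -> 0 < t -> vhol K 0 t ->
  sMer (fun z => lsum B z (K z)) /\
  sres (fun z => lsum B z (K z)) = \sum_(m < S) (B (- m.+1%:Z) (vtc K 0 m) : R[i]).
Proof.
move=> hB BS LB t0 hK; have mK : mer K 0 K t.
  by split => // z _; rewrite expr0 invr1 scale1r.
split; first by apply: (Mer_bil (hom_bil g)); [exact: Laurent_Mer|exists 0%N, K, t].
rewrite /sres (res_bil (hom_bil g) hB mK) addn0 (reindex_inj rev_ord_inj) /=; apply: eq_bigr => m _.
have mS := ltn_ord m; rewrite (lof_lsum LB).
have -> : (S - m.+1)%N%:Z - S%:Z = - m.+1%:Z by lia.
have -> : S%:Z - 1 - (S - m.+1)%N%:Z = m%:Z - 0%N%:Z by lia.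
by rewrite (lof_at _ mK).
Qed.

Lemma res_Xn (B : int -> g ^*) k y : Laurent B ->
  sMer (fun z => z ^- k.+1 * (lsum B z y : R[i])) /\
  sres (fun z => z ^- k.+1 * (lsum B z y : R[i])) = B k%:Z y.
Proof.
move=> LB; have [T [H [s [hB BE]]]] := Laurent_mer LB.
have ly : linear (fun b : g ^* => b y : (R[i])^o) := (hom_bil g).2 y.
have hX := mer_Xn k.+1 (mer_lin ly hB).
split; first by exists (k.+1 + T)%N, (fun z => H z y), s.
have E : sres (fun z => z ^- k.+1 * (lsum B z y : R[i])) = coefs (k.+1 + T) (vtc (fun z => H z y : (R[i])^o) 0) (-1).
  by rewrite -(lof_mer hX).
rewrite E; have -> : (-1 : int) = (k + T)%N%:Z - (k.+1 + T)%N%:Z by lia.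
case: hB => s0 hH _; rewrite coefs_at (vtc_lin _ s0 ly hH) BE.
by have -> : k%:Z = (k + T)%N%:Z - T%:Z by [lia]; rewrite coefs_at.
Qed.

Variables (br : g -> g -> g) (form : g -> g -> (R[i])^o) (h : {vspace g}).
Local Notation hstar := 'Hom(subvs_of h, (R[i])^o).
Variable r : hstar -> R[i] -> tensor2 g.
Hypotheses (Hlie : is_lie_bracket br) (Hinv : is_invariant_form br form)
  (Hnd : nondegenerate_on fullv form) (Hr : classical_dynamical_r_matrix br form r).
Variables (q : hstar) (G : (hstar * (R[i])^o)%type -> tensor2 g) (rho M : R).
Hypothesis HG : polyb r q G rho M.

Lemma raise_sym (a b : g ^*) : a (raise form b) = b (raise form a) :> R[i].
Proof. by rewrite -!(form_raise Hinv Hnd) (form_sym Hinv). Qed.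

(** r = Omega / z + t(z). *)
Lemma r_regular_part : exists2 t, vhol t 0 rho &
  forall z, 0 < nc z < rho -> r q z = z^-1 *: casimir form + t z.
Proof.
have rho0 := rho_gt0 HG; have v0 : vn (0 : hstar) < rho by rewrite vn0.
have := r_mer HG v0; rewrite addr0 => hm; have [_ hG E] := hm.
have [t ht tE] := vhol_peel rho0 hG; exists t => // z /andP[z0 zr].
have O : vtc (fun z => G (q, z)) 0 0 = casimir form.
  rewrite -(cdr_residue Hr (npl0 HG)) /residue (lof_mer hm).
  by have -> : (-1 : int) = 0%N%:Z - 1%N%:Z by [lia]; rewrite coefs_at.
rewrite E ?z0 // tE // O scalerDr scalerA expr1 mulVf ?scale1r //.
by rewrite -nc_gt0.
Qed.

Section Pair.
Variable t : R[i] -> tensor2 g.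
Hypotheses (ht : vhol t 0 rho) (rt : forall z, 0 < nc z < rho -> r q z = z^-1 *: casimir form + t z).

Lemma t_flip (a b : g ^*) j : b (contr1 (vtc t 0 j) a) = - ((-1) ^+ j * (a (contr1 (vtc t 0 j) b) : R[i])) :> R[i].
Proof.
have rho0 := rho_gt0 HG.
pose u (a b : g ^*) (T : tensor2 g) : (R[i])^o := b (contr1 T a).
have lu a0 b0 : linear (u a0 b0) by move=> c x y; rewrite /u ((contr1_bil g).2 a0) linearP.
have hu a0 b0 : hol (fun z => u a0 b0 (t z)) 0 rho := ht (lu a0 b0).
have ut a0 b0 : u a0 b0 (vtc t 0 j) = tc (fun z => u a0 b0 (t z)) 0 j := vtcE j rho0 ht (lu a0 b0).
have E z : 0 < nc z < rho -> u a b (t z) = (-1) * u b a (t (- z)).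
  move=> zr; have zr' : 0 < nc (- z) < rho by rewrite ncN.
  have v0 : vn (0 : hstar) < rho by rewrite vn0.
  have := r_flip Hr HG b v0 zr; rewrite addr0 => /(congr1 (fun y => a y : R[i])).
  rewrite linearN /= hom_swap (rt zr) (rt zr').
  have D c T (x y : 'Hom(g, (R[i])^o)) : y (contr1 (c *: casimir form + T) x) = c * (y (raise form x) : R[i]) + u x y T :> R[i].
    by rewrite ((contr1_bil g).2 x) linearP -(raiseE Hinv Hnd).
  rewrite !D (raise_sym b a) invrN => F.
  by apply: (addrI (z^-1 * (a (raise form b) : R[i]))); rewrite F; ring.
have [hn tn] := tc_neg j rho0 (hu b a).
have E0 w : nc (w - 0) < rho -> u a b (t w) = (-1) * u b a (t (- w)).
  rewrite subr0 => wr; have [->|w0] := eqVneq w 0; last by apply: E; rewrite nc_gt0 w0.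
  exact: (hol_eq0 (F := fun w => u a b (t w)) (G := fun w => (-1) * u b a (t (- w))) rho0 (hu a b) (holZ (-1) hn)).
have := congr1 (fun s => s j) (tc_ext rho0 (hu a b) E0).
rewrite /= (tcZ _ _ rho0 hn) tn -!ut /u => ->; ring.
Qed.

(** Residue pairing with the non-polar part of the R-operator. *)
Lemma res_SopB (A B : int -> g ^*) S HB (sB : R) : Laurent A -> Laurent B -> mer (lsum B) S HB sB ->
  (forall m, m < - S%:Z -> B m = 0) ->
  sres (fun w => lsum B w (Sop (r q) S A w)) =
  \sum_(k < S) (- (B k%:Z (raise form (A (- k.+1%:Z))) : R[i])
    + \sum_(m < S) (-1) ^+ m * @tcc R m k * (B (- m.+1%:Z) (contr1 (vtc t 0 (m + k)) (A (- k.+1%:Z))) : R[i])).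
Proof.
move=> LA LB hB BS; have rho0 := rho_gt0 HG.
pose f k w : R[i] := (-1) * (w ^- k.+1 * (lsum B w (raise form (A (- k.+1%:Z))) : R[i])).
pose K k w := contr1 (vtc t (- w) k) (A (- k.+1%:Z)).
have hK k : vhol (K k) 0 rho /\ forall m, vtc (K k) 0 m = ((-1) ^+ m * @tcc R m k) *: contr1 (vtc t 0 (m + k)) (A (- k.+1%:Z)).
  have hi (i : 'I_(\dim {: tensor2 g})) : hol (fun z => cd i (t z)) 0 rho := ht (@cd_lin R (tensor2 g) i).
  have Ei (i : 'I_(\dim {: tensor2 g})) w : nc (w - 0) < rho -> tc (fun z => cd i (t z)) (- w) k = cd i (vtc t (- w) k).
    rewrite subr0 => wr; have rw : 0 < rho - nc w by rewrite subr_gt0.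
    rewrite (cd_vtc _ _ rw) //; apply: vhol_sub ht _; rewrite subr0 ncN; lra.
  have hv : vhol (fun w => vtc t (- w) k) 0 rho.
    apply: vhol_cd => // i; have [h1 _] := tc_tc k 0 rho0 (hi i); have [h2 _] := tc_neg 0 rho0 h1.
    move=> z zr; have [l hl] := h2 z zr; exists l.
    apply: (@hd_near R (fun w => tc (fun z => cd i (t z)) (- w) k) _ z l (rho - nc (z - 0))) => //; first by rewrite subr_gt0.
    move=> w wz; apply: Ei; have -> : w - 0 = (w - z) + (z - 0) by ring.
    by apply: le_lt_trans (ncD _ _) _; rewrite -ltrBrDr.
  have cl := (contr1_bil g).2 (A (- k.+1%:Z)).
  split=> [|m]; first exact: (vhol_lin cl hv).
  rewrite /K (vtc_lin m rho0 cl hv) -(linZ_of cl); congr contr1; apply: cd_inj => i.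
  apply: (etrans (cd_vtc _ _ rho0 hv)).
  apply: (etrans _ (esym (etrans (linZ_of (@cd_lin R (tensor2 g) i) _ _) (congr1 _ (cd_vtc _ _ rho0 ht))))).
  have [h1 h1'] := tc_tc k m rho0 (hi i); have [h2 h2'] := tc_neg m rho0 h1.
  by rewrite -(tc_ext rho0 h2 (@Ei i)) h2' h1' mulrA.
have fk k : sMer (f k) /\ sres (f k) = - (B k%:Z (raise form (A (- k.+1%:Z))) : R[i]).
  have [m1 r1] := res_Xn k (raise form (A (- k.+1%:Z))) LB.
  by split; [exact: sMerZ|rewrite (sresZ _ m1) r1 mulN1r].
have gk k : sMer (fun w => lsum B w (K k w)) /\ sres (fun w => lsum B w (K k w)) =
    \sum_(m < S) (-1) ^+ m * @tcc R m k * (B (- m.+1%:Z) (contr1 (vtc t 0 (m + k)) (A (- k.+1%:Z))) : R[i]).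
  have [m1 r1] := res_hol hB BS LB rho0 (hK k).1.
  split=> //; rewrite r1; apply: eq_bigr => m _; rewrite (hK k).2 linearZ; done.
have mk (k : 'I_S) : sMer (fun w => f k w + (lsum B w (K k w) : R[i])) := sMerD (fk k).1 (gk k).1.
have [ms rs] := sres_sum (index_enum 'I_S) mk.
have E : exists2 s : R, 0 < s & forall w, 0 < nc w < s ->
    \sum_(k < S) (f k w + (lsum B w (K k w) : R[i])) = lsum B w (Sop (r q) S A w).
  exists rho => // w wr; have wr' : 0 < nc (- w) < rho by rewrite ncN.
  rewrite /Sop linear_sum; apply: eq_bigr => k _.
  have w0 : - w != 0 by rewrite -nc_gt0; case/andP: wr'.
  pose s := Num.min (nc w) (rho - nc w).
  have s0 : 0 < s by case/andP: wr => h1 h2; rewrite lt_min h1 subr_gt0.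
  have far z : nc (z - - w) < s -> 0 < nc z < rho.
    rewrite lt_min => /andP[h3 h4].
    have := nc_sub_ge (- w) (- w - z); have -> : - w - (- w - z) = z by ring.
    have := ncD (- w) (z - - w); have -> : - w + (z - - w) = z by ring.
    by rewrite [nc (- w - z)]ncBC ncN => h1 h2; apply/andP; split; lra.
  have hinv : hol (fun z => z^-1 : R[i]) (- w) s.
    move=> z zs; have /andP[z0 _] := far z zs; eexists; apply: hdV.
    by rewrite -nc_gt0.
  have ht' : vhol t (- w) s by apply: vhol_sub ht _; rewrite subr0 ncN; move: (ge_min (rho - nc w) (nc w) (rho - nc w)); rewrite lexx orbT -/s; lra.
  have hO : vhol (fun z => z^-1 *: casimir form) (- w) s by apply: vhol_scale => //; exact: vhol_cst.
  have vO : vtc (fun z => z^-1 *: casimir form) (- w) k = ((-1) ^+ k * (- w) ^- k.+1) *: casimir form.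
    apply: cd_inj => i; have lc := @cd_lin R (tensor2 g) i.
    rewrite (cd_vtc _ _ s0 hO) (linZ_of lc) -(tc_inv k w0).
    have -> : (fun z => cd i (z^-1 *: casimir form)) = fun z => cd i (casimir form) * z^-1.
      by apply/funext => z; rewrite (linZ_of lc) mulrC.
    by rewrite (tcZ _ _ s0 hinv) mulrC.
  have vr : vtc (r q) (- w) k = ((-1) ^+ k * (- w) ^- k.+1) *: casimir form + vtc t (- w) k.
    rewrite -vO -(vtcD k s0 hO ht'); apply/esym; apply: (vtc_near k s0 (vholD hO ht')) => z zs.
    by rewrite rt //; exact: far.
  rewrite vr ((contr1_bil g).2 _) linearP -(raiseE Hinv Hnd); congr (_ + _).
  rewrite /f -[RHS]/(_ * _ : R[i]) mulrA; congr (_ * _).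
  rewrite [(- w) ^+ k.+1]exprNn invfM -[((-1) ^+ k.+1)^-1]exprVn invrN1 mulrA; congr (_ * _).
  by rewrite exprS mulrCA -expr2 -exprM mulnC exprM sqrrN expr1n expr1n mulr1.
rewrite -(sres_near ms E) rs; apply: eq_bigr => k _.
by rewrite (sresD (fk k).1 (gk k).1) (fk k).2 (gk k).2.
Qed.
End Pair.

(** The R-operator is skew-symmetric for the residue pairing, up to the
    pairing itself, by unitarity of r. *)
Lemma Sop_skew (A B : int -> g ^*) S HA HB (sA sB : R) : Laurent A -> Laurent B ->
  mer (lsum A) S HA sA -> mer (lsum B) S HB sB ->
  (forall m, m < - S%:Z -> A m = 0) -> (forall m, m < - S%:Z -> B m = 0) ->
  sres (fun w => lsum B w (Sop (r q) S A w)) + sres (fun w => lsum A w (Sop (r q) S B w))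
  = - sres (fun w => lsum B w (raise form (lsum A w))).
Proof.
move=> LA LB hA hB AS BS; have [t ht rt] := r_regular_part.
rewrite (res_SopB ht rt LA LB hB BS) (res_SopB ht rt LB LA hA AS) !big_split /=.
have rl := raise_lin Hinv Hnd.
have -> : sres (fun w => lsum B w (raise form (lsum A w))) =
   \sum_(k < S) (B k%:Z (raise form (A (- k.+1%:Z))) : R[i]) + \sum_(k < S) (A k%:Z (raise form (B (- k.+1%:Z))) : R[i]).
  rewrite /sres (res_bil (hom_bil g) hB (mer_lin rl hA)) big_split_ord /= addrC; congr (_ + _).
    apply: eq_bigr => k _; rewrite (lof_lsum LB) (lof_lin _ rl (Laurent_Mer LA)) (lof_lsum LA).
    by congr ((B _ : g ^*) (raise form (A _)) : R[i]); lia.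
  rewrite (reindex_inj rev_ord_inj) /=; apply: eq_bigr => k _; have kS := ltn_ord k.
  rewrite (lof_lsum LB) (lof_lin _ rl (Laurent_Mer LA)) (lof_lsum LA) raise_sym.
  have -> : (S - k.+1)%N%:Z - S%:Z = - k.+1%:Z by lia.
  by have -> : S%:Z - 1 - (S - k.+1)%N%:Z = k%:Z by lia.
rewrite addrACA opprD -!sumrN; set X := (X in _ + X = _).
suff -> : X = 0 by rewrite addr0.
rewrite /X [X in _ + X]exchange_big -big_split big1 // => k _ /=.
rewrite -big_split big1 // => m _ /=.
rewrite (t_flip ht rt (A (- k.+1%:Z)) (B (- m.+1%:Z)) (m + k)) [(k + m)%N]addnC (@tcc_sym R k m).
rewrite exprD; have s1 : ((-1) ^+ m * (-1) ^+ m : R[i]) = 1 by rewrite -expr2 -exprM mulnC exprM sqrrN expr1n expr1n.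
set s := (-1) ^+ m in s1 *; set s' := (-1) ^+ k; set c := @tcc R m k; set y := (A _ _ : R[i]).
have -> : s * c * - (s * s' * y) + s' * c * y = (1 - s * s) * (s' * c * y) by ring.
by rewrite s1 subrr mul0r.
Qed.

End Skew.


Section PartOne.
Context {R : realType}.
Local Open Scope complex_scope.
Variable g : vectType R[i].
Local Notation "g ^*" := 'Hom(g, (R[i])^o) : type_scope.
Local Notation e i := (vbasis {:g})`_i.
Local Notation n := (\dim {:g}).
Variables (br : g -> g -> g) (form : g -> g -> (R[i])^o) (h : {vspace g}).
Local Notation hstar := 'Hom(subvs_of h, (R[i])^o).
Variable r : hstar -> R[i] -> tensor2 g.
Hypotheses (Hlie : is_lie_bracket br) (Hinv : is_invariant_form br form)
  (Hnd : nondegenerate_on fullv form) (Hr : classical_dynamical_r_matrix br form r).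

Lemma raise_br (a b : g ^*) l : b (br (raise form a) l) = - (a (br (raise form b) l) : R[i]) :> R[i].
Proof.
have [_ _ I] := Hinv; have := I l (raise form b) (raise form a).
rewrite -(form_raise Hinv Hnd b) -(form_raise Hinv Hnd a) (brC Hlie (raise form a) l) (brC Hlie (raise form b) l).
rewrite !(linN_of (form_lin Hinv _)) [form (raise form a) _](form_sym Hinv).
by move=> /eqP; rewrite addr_eq0 => /eqP ->; rewrite !opprK.
Qed.

(** The invariance of the form turns the half-Casimir parts of the two
    R-operators into one term. *)
Lemma ad_pointwise (a b : g ^*) l u v :
  ((- adstar br (2^-1 *: raise form a + u) b + adstar br (2^-1 *: raise form b + v) a) l : R[i]) =
  (-1) * (adstar br l a (raise form b) : R[i]) + ((-1) * (adstar br l a v : R[i]) + (-1) * (b (br u l) : R[i])).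
Proof.
rewrite add_lfunE opp_lfunE !(adstarE Hlie).
have D c1 y1 y2 : br (c1 *: y1 + y2) l = c1 *: br y1 l + br y2 l := (br_bil Hlie).2 l c1 y1 y2.
have P (c : g ^*) c1 y1 y2 : c (br (c1 *: y1 + y2) l) = c1 * (c (br y1 l) : R[i]) + (c (br y2 l) : R[i]) :> R[i].
  by rewrite D linearP.
rewrite !P (brC Hlie l (raise form b)) (brC Hlie l v) !linearN /= raise_br.
set y := (a (br (raise form b) l) : R[i]); set y2 := (a (br v l) : R[i]); set y3 := (b (br u l) : R[i]).
by field.
Qed.

Lemma anti_sum (I J : finType) (a a' b b' : I -> R[i]) (c c' : J -> R[i]) (y : J -> J -> R[i]) :
  (forall i j, y i j = - y j i) ->
  \sum_i (a i * b' i - b i * a' i) + \sum_i \sum_j c i * c' j * y i j =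
  - (\sum_i (a' i * b i - b' i * a i) + \sum_i \sum_j c' i * c j * y i j).
Proof.
move=> anti; rewrite opprD -sumrN; congr (_ + _); first by apply: eq_bigr => i _; ring.
rewrite exchange_big -sumrN; apply: eq_bigr => i _; rewrite -sumrN; apply: eq_bigr => j _.
by rewrite anti; ring.
Qed.

Lemma bracket_congr (I J : finType) (a a' b b' u v : I -> R[i]) (c c' w : J -> R[i]) (y : J -> J -> R[i]) :
  (forall i, a i = a' i) -> (forall i, b i = b' i) -> (forall j, c j = c' j) ->
  \sum_i (a i * u i - b i * v i) + \sum_i \sum_j c i * w j * y i j =
  \sum_i (a' i * u i - b' i * v i) + \sum_i \sum_j c' i * w j * y i j.
Proof.
move=> ha hb hc; congr (_ + _); first by apply: eq_bigr => i _; rewrite ha hb.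
by apply: eq_bigr => i _; apply: eq_bigr => j _; rewrite hc.
Qed.

Lemma pbracket_anti (F H : phase h -> (R[i])^o) x : pbracket br F H x = - pbracket br H F x.
Proof.
apply: (anti_sum (fun i => dirder F x (0, hbas i, 0)) (fun i => dirder H x (0, hbas i, 0))
  (fun i => dirder F x (hdual i, 0, 0)) (fun i => dirder H x (hdual i, 0, 0))
  (fun i => dirder F x (0, 0, gdual i)) (fun i => dirder H x (0, 0, gdual i))
  (y := fun i j => x.2 (br (e i) (e j)))) => i j.
by rewrite (brC Hlie) linearN.
Qed.

Variables (f1 f2 : (int -> g) -> R[i]) (x : phase h) (G : (hstar * (R[i])^o)%type -> tensor2 g) (rho M : R).
Hypotheses (sf1 : lsmooth f1) (sf2 : lsmooth f2) (HG : polyb r x.1.1 G rho M).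
Local Notation q := x.1.1.
Local Notation A := (ldiff f1 (Lmap r x)).
Local Notation B := (ldiff f2 (Lmap r x)).
Local Notation lad := (ladstar br (Lmap r x) A).

Let LB : Laurent B := LA sf2 HG.

Lemma Mer_dlax v : Mer (dlax r x ^~ v).
Proof.
apply: MerD; first exact: Mer_cst.
by apply: MerD; [exact: (Mer_Dr2 HG)|exact: (Mer_r2 HG)].
Qed.

(** The differential at x of the composite of f2 with the Lax operator. *)
Definition dpull v : (R[i])^o := sres (fun w => lsum B w (dlax r x w v)).

Lemma sMerB F : Mer F -> sMer (fun w => lsum B w (F w)).
Proof. by move=> hF; apply: (Mer_bil (hom_bil g)) => //; exact: Laurent_Mer. Qed.

Lemma dpull_lin : linear dpull.
Proof.
move=> a u v; have m1 := sMerB (Mer_dlax u); have m2 := sMerB (Mer_dlax v).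
have E : dpull (a *: u + v) = a * (dpull u : R[i]) + (dpull v : R[i]) :> R[i].
  rewrite /dpull -(sresZ a m1) -(sresD (sMerZ a m1) m2).
  apply: (sres_near (sMerB (Mer_dlax _))); exists rho => [|w wr]; first exact: rho_gt0 HG.
  by rewrite (dlax_lin HG wr) linearP.
exact: E.
Qed.

Lemma pbracket_dpull : pbracket br (f2 \o Lmap r : phase h -> (R[i])^o) (f1 \o Lmap r : phase h -> (R[i])^o) x
  = dpull (hamv br r f1 x) :> R[i].
Proof.
rewrite (hamv_lin br sf1 HG dpull_lin) /pbracket.
have rho0 := rho_gt0 HG.
have near F v : Mer F -> (forall w, 0 < nc w < rho -> F w = dlax r x w v) ->
    residue (fun z => lsum B z (F z) : (R[i])^o) = dirder dpull x v.
  move=> hF E; rewrite (dirder_frechet v (frechet_lin x dpull_lin)).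
  by apply: (sres_near (sMerB hF)); exists rho => // w wr; rewrite E.
have dp k : dirder (f2 \o Lmap r : phase h -> (R[i])^o) x (0, hbas k, 0) = dirder dpull x (0, hbas k, 0).
  rewrite (dirder_p sf2 HG); apply: (near (fun=> vsval (hbas k))) => [|w wr]; first exact: Mer_cst.
  by rewrite /dlax /= (lin0_of (Dr_lin HG wr)) (lin0_of ((contr2_bil g).2 _)) (lin0_of ((contr2_bil g).1 _)) !addr0.
have dq k : dirder (f2 \o Lmap r : phase h -> (R[i])^o) x (hdual k, 0, 0) = dirder dpull x (hdual k, 0, 0).
  rewrite (dirder_q sf2 HG); apply: (near (fun z => contr2 (Dr r q (hdual k) z) x.2)) => [|w wr]; first exact: (Mer_Dr2 HG).
  by rewrite /dlax /= (lin0_of ((contr2_bil g).1 _)) addr0 add0r.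
have dx k : dirder (f2 \o Lmap r : phase h -> (R[i])^o) x (0, 0, gdual k) = dirder dpull x (0, 0, gdual k).
  rewrite (dirder_xi sf2 HG); apply: (near (fun z => contr2 (r q z) (gdual k))) => [|w wr]; first exact: (Mer_r2 HG).
  by rewrite /dlax /= (lin0_of (Dr_lin HG wr)) (lin0_of ((contr2_bil g).2 _)) !add0r.
pose F2 := (f2 \o Lmap r : phase h -> (R[i])^o); pose F1 := (f1 \o Lmap r : phase h -> (R[i])^o).
exact: (bracket_congr
  (a := fun i => dirder F2 x (0, hbas i, 0)) (a' := fun i => dirder dpull x (0, hbas i, 0))
  (b := fun i => dirder F2 x (hdual i, 0, 0)) (b' := fun i => dirder dpull x (hdual i, 0, 0))
  (fun i => dirder F1 x (hdual i, 0, 0)) (fun i => dirder F1 x (0, hbas i, 0))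
  (c := fun i => dirder F2 x (0, 0, gdual i)) (c' := fun i => dirder dpull x (0, 0, gdual i))
  (fun i => dirder F1 x (0, 0, gdual i)) (fun i j => x.2 (br (e i) (e j))) dp dq dx).
Qed.

Lemma combine1 (d1 d3 b1 b2 p1 p2 a1 : R[i]) :
  d1 = - p1 - p2 + d3 -> b1 + p2 = - a1 -> b2 = - a1 - b1 - d3 + p1 -> - d1 = b2.
Proof. by move=> -> E ->; rewrite -E; ring. Qed.

Theorem part1 :
   let L := Lmap r x in
   let df1 := ldiff f1 L in
   let df2 := ldiff f2 L in
   let Rm := Rop form r (mproj x) in
   pbracket br (f1 \o Lmap r) (f2 \o Lmap r) x =
     lpair (- ladstar br (Rm df1) df2 + ladstar br (Rm df2) df1) L
     + lpair df2 (dRop form r (tau x) df1).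
Proof.
move=> L df1 df2 Rm.
have rho0 := rho_gt0 HG.
have LA1 : Laurent A := LA sf1 HG.
have Llad : Laurent lad by rewrite (ladstarE Hlie sf1 HG); exact: lof_Laurent (Mer_ad Hlie sf1 HG).
have [T1 [H1 [s1 [hA1 AE]]]] := Laurent_mer LA1; have [T2 [H2 [s2 [hB1 BE]]]] := Laurent_mer LB.
have [T3 [H3 [s3 [hL1 LE]]]] := Laurent_mer Llad.
pose S := (T1 + T2 + T3)%N.
have AS m : m < - S%:Z -> A m = 0 by move=> mS; rewrite AE coefs_lt //; rewrite /S in mS; lia.
have BS m : m < - S%:Z -> B m = 0 by move=> mS; rewrite BE coefs_lt //; rewrite /S in mS; lia.
have lS m : m < - S%:Z -> lad m = 0 by move=> mS; rewrite LE coefs_lt //; rewrite /S in mS; lia.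
have [H2' [hB _]] := mer_widen (T1 + T3) hB1; have [H3' [hL _]] := mer_widen (T1 + T2) hL1.
have E2 : (T2 + (T1 + T3))%N = S by rewrite /S; lia.
have E3 : (T3 + (T1 + T2))%N = S by rewrite /S; lia.
rewrite E2 in hB; rewrite E3 in hL.
have skew := Sop_skew Hinv Hnd Hr HG Llad LB hL hB lS BS.
have [ra ra0 ha] := Mer_MerR (Laurent_Mer LA1); have [rb rb0 hb] := Mer_MerR (Laurent_Mer LB).
have r2 : 0 < rho / 2 by lra.
have [t' [t'0 t'1 t'2]] := small2 r2 ra0; have [t [t0 t1 t2]] := small2 t'0 rb0.
have tr2 : t < rho / 2 := lt_trans t1 t'1.
have tr : t <= rho by lra.
have hr : MerR (r q) t := MerR_shrink (polyb_MerR HG) t0 tr.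
have hA' : MerR (lsum A) t := MerR_shrink ha t0 (ltW (lt_trans t1 t'2)).
have hB' : MerR (lsum B) t := MerR_shrink hb t0 (ltW t2).
have mRA := Ropf_MerR Hinv Hnd S t0 hr hA'; have mRB := Ropf_MerR Hinv Hnd S t0 hr hB'.
have inr w : 0 < nc w < t -> 0 < nc w < rho by case/andP => -> wt /=; exact: lt_le_trans wt tr.
have rl := raise_lin Hinv Hnd.
(* the pieces *)
have mSA : Mer (Sop (r q) S A) := MerR_Mer (Sop_MerR S A t0 hr).
have mSB : Mer (Sop (r q) S B) := MerR_Mer (Sop_MerR S B t0 hr).
have mSl : Mer (Sop (r q) S lad) := MerR_Mer (Sop_MerR S lad t0 hr).
have mSD : Mer (Sop (Dr r q (- istar h x.2)) S A) := MerR_Mer (Sop_MerR S A rho0 (Mer_DrR HG _)).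
have mLx : Mer (laxf r x) by eexists; eexists; eexists; exact: (Lmap_mer HG).
have mbr : Mer (fun w => br (Sop (r q) S A w) (laxf r x w)) := Mer_bil (br_bil Hlie) mSA mLx.
pose p1 := sres (fun w => lsum B w (Sop (Dr r q (- istar h x.2)) S A w)).
pose p2 := sres (fun w => lsum B w (Sop (r q) S lad w)).
pose d3 := sres (fun w => lsum B w (br (Sop (r q) S A w) (laxf r x w))).
pose b1 := sres (fun w => lsum lad w (Sop (r q) S B w)).
pose a1 := sres (fun w => lsum lad w (raise form (lsum B w))).
have sl F : Mer F -> sMer (fun w => lsum lad w (F w)).
  by move=> hF; apply: (Mer_bil (hom_bil g)) => //; exact: Laurent_Mer.
have mrB : Mer (fun w => raise form (lsum B w)) := Mer_lin rl (Laurent_Mer LB).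
have mrl : Mer (fun w => raise form (lsum lad w)) := Mer_lin rl (Laurent_Mer Llad).
have Ed1 : dpull (hamv br r f1 x) = - p1 - p2 + d3 :> R[i].
  have m1 := sMerB mSD; have m2 := sMerB mSl; have m3 := sMerB mbr.
  transitivity (sres (fun w => (-1) * lsum B w (Sop (Dr r q (- istar h x.2)) S A w) + ((-1) * lsum B w (Sop (r q) S lad w) + lsum B w (br (Sop (r q) S A w) (laxf r x w))))).
    apply: (sres_near (sMerB (Mer_dlax _))); exists t => // w wt.
    have w2 : 0 < nc w < rho / 2 by case/andP: wt => -> wt /=; exact: lt_trans wt tr2.
    have lS' m : m < - S%:Z -> ladstar br (Lmap r x) A m = 0 := lS m.
    rewrite (dlax_hamv Hlie Hr sf1 HG w2 AS lS') linearD linearB linearN /=.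
    by rewrite !mulN1r addrA.
  rewrite (sresD (sMerZ (-1) m1) (sMerD (sMerZ (-1) m2) m3)) (sresD (sMerZ (-1) m2) m3).
  by rewrite (sresZ (-1) m1) (sresZ (-1) m2) !mulN1r addrA.
have Ea : sres (fun w => lsum B w (raise form (lsum lad w))) = a1.
  have E0 w : 0 < nc w < 1 -> (lsum B w (raise form (lsum lad w)) : R[i]) = lsum lad w (raise form (lsum B w)).
    by move=> _; apply: (raise_sym Hinv Hnd).
  exact: (sres_near (sMerB mrl) (ex_intro2 _ _ (1 : R) ltr01 E0)).
have Esk : b1 + p2 = - a1 := etrans (addrC b1 p2) (etrans skew (congr1 (fun u : R[i] => - u) Ea)).
have Eq : lpair df2 (dRop form r (tau x) df1) = p1.
  by rewrite (dRop_eq Hinv Hnd _ HG LA1 AS) (lpair_lof LB mSD).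
have mX : Mer (fun w => adstar br (Ropf form r q S A w) (lsum B w)) := Mer_bil (adstar_bil Hlie) (MerR_Mer mRA) (Laurent_Mer LB).
have mY : Mer (fun w => adstar br (Ropf form r q S B w) (lsum A w)) := Mer_bil (adstar_bil Hlie) (MerR_Mer mRB) (Laurent_Mer LA1).
have LRA : Laurent (Rm df1) by rewrite /Rm (Rop_eq Hinv Hnd t0 hr hA' AS); exact: lof_Laurent (MerR_Mer mRA).
have LRB : Laurent (Rm df2) by rewrite /Rm (Rop_eq Hinv Hnd t0 hr hB' BS); exact: lof_Laurent (MerR_Mer mRB).
have EX : ladstar br (Rm df1) df2 = laurent_of (fun w => adstar br (Ropf form r q S A w) (lsum B w)).
  have EX' w : 0 < nc w < t -> adstar br (lsum (Rm df1) w) (lsum B w) = adstar br (Ropf form r q S A w) (lsum B w).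
    move=> wt; exact: (congr1 (fun y => adstar br y (lsum B w)) (Rop_sum Hinv Hnd t0 hr hA' AS wt)).
  exact: (lof_near (Mer_bil (adstar_bil Hlie) (Laurent_Mer LRA) (Laurent_Mer LB)) mX (ex_intro2 _ _ t t0 EX')).
have EY : ladstar br (Rm df2) df1 = laurent_of (fun w => adstar br (Ropf form r q S B w) (lsum A w)).
  have EY' w : 0 < nc w < t -> adstar br (lsum (Rm df2) w) (lsum A w) = adstar br (Ropf form r q S B w) (lsum A w).
    move=> wt; exact: (congr1 (fun y => adstar br y (lsum A w)) (Rop_sum Hinv Hnd t0 hr hB' BS wt)).
  exact: (lof_near (Mer_bil (adstar_bil Hlie) (Laurent_Mer LRB) (Laurent_Mer LA1)) mY (ex_intro2 _ _ t t0 EY')).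
have ln : linear (fun b : 'Hom(g, (R[i])^o) => - b) by move=> a u v; rewrite opprD scalerN.
have mN := Mer_lin ln mX.
have EXY : - ladstar br (Rm df1) df2 + ladstar br (Rm df2) df1 =
   laurent_of (fun w => - adstar br (Ropf form r q S A w) (lsum B w) + adstar br (Ropf form r q S B w) (lsum A w)).
  apply/funext => m; rewrite (lofD m mN mY) (lof_lin m ln mX).
  have EXm := congr1 (fun X : int -> 'Hom(g, (R[i])^o) => X m) EX.
  have EYm := congr1 (fun X : int -> 'Hom(g, (R[i])^o) => X m) EY.
  exact: (f_equal2 (fun u v : 'Hom(g, (R[i])^o) => - u + v) EXm EYm).
have Eb : lpair (- ladstar br (Rm df1) df2 + ladstar br (Rm df2) df1) L = - a1 - b1 - d3.
  rewrite EXY; clear EXY EX EY Eq Ed1 Esk Ea skew.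
  have m1 := sl _ mrB; have m2 := sl _ mSB; have m3 := sMerB mbr.
  transitivity (sres (fun w => (-1) * lsum lad w (raise form (lsum B w)) + ((-1) * lsum lad w (Sop (r q) S B w) + (-1) * lsum B w (br (Sop (r q) S A w) (laxf r x w))))); last first.
    rewrite (sresD (sMerZ (-1) m1) (sMerD (sMerZ (-1) m2) (sMerZ (-1) m3))) (sresD (sMerZ (-1) m2) (sMerZ (-1) m3)).
    by rewrite (sresZ (-1) m1) (sresZ (-1) m2) (sresZ (-1) m3) !mulN1r addrA.
  have [c1 c10 C1] := lsum_lof (MerD mN mY); have [c2 c20 C2] := lsum_lof (Mer_ad Hlie sf1 HG).
  have [c3 [c30 c31 c32]] := small2 c10 c20; have [c [c0 ca cb]] := small2 c30 t0.
  apply: sres_near.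
    apply: (Mer_bil (hom_bil g)); last exact: (Laurent_Mer (Lmap_Laurent HG)).
    by apply: Laurent_Mer; exact: lof_Laurent (MerD mN mY).
  exists c => // w /andP[w0 wc].
  have wt : 0 < nc w < t by rewrite w0 (lt_trans wc cb).
  have w1 : 0 < nc w < c1 by rewrite w0 (lt_trans wc (lt_trans ca c31)).
  have w2 : 0 < nc w < c2 by rewrite w0 (lt_trans wc (lt_trans ca c32)).
  rewrite (C1 w w1) (Lmap_sum HG (inr w wt)) (ladstarE Hlie sf1 HG) (C2 w w2).
  exact: ad_pointwise.
have goal := combine1 (b2 := - a1 - b1 - d3 + p1) Ed1 Esk erefl.
apply: (etrans (pbracket_anti _ _ _)); apply: (etrans (congr1 (fun y : R[i] => - y) pbracket_dpull)).
exact: (etrans goal (f_equal2 (fun y z : R[i] => y + z) (esym Eb) (esym Eq))).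
Qed.

End PartOne.

Theorem theorem4p8 (R : realType) (g : vectType R[i])
    (br : g -> g -> g) (form : g -> g -> (R[i])^o) (h : {vspace g})
    (r : 'Hom(subvs_of h, (R[i])^o) -> R[i] -> tensor2 g) :
  is_lie_bracket br ->
  is_invariant_form br form ->
  nondegenerate_on fullv form ->
  abelian_subalgebra br h ->
  nondegenerate_on h form ->
  classical_dynamical_r_matrix br form r ->
  (forall f1 f2 : (int -> g) -> R[i], lsmooth f1 -> lsmooth f2 ->
   forall x : phase h, nonpole_phase r x ->
   let L := Lmap r x in
   let df1 := ldiff f1 L in
   let df2 := ldiff f2 L in
   let Rm := Rop form r (mproj x) in
   pbracket br (f1 \o Lmap r) (f2 \o Lmap r) x =
     lpair (- ladstar br (Rm df1) df2 + ladstar br (Rm df2) df1) L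
     + lpair df2 (dRop form r (tau x) df1))
  /\
  (forall f : (int -> g) -> R[i], ad_invariant br f ->
   forall (D : set R[i]) (phi : R[i] -> phase h),
   hamiltonian_flow br (nonpole_phase r) (f \o Lmap r) D phi ->
   forall t, D t ->
   let L := Lmap r (phi t) in
   let df := ldiff f L in
   is_lderiv_in D (fun s => Lmap r (phi s)) t
     (lbr br (Rop form r (mproj (phi t)) df) L
      - dRop form r (tau (phi t)) df)).
Proof.
move=> Hlie Hinv Hnd _ _ Hr; split=> [f1 f2 sf1 sf2 x npx|f hf D phi].
  have [G [rho [M HG]]] := nonpole_polyb npx.
  exact: (part1 Hlie Hinv Hnd Hr sf1 sf2 HG).
exact: (part2 Hlie Hinv Hnd Hr hf).
Qed.
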